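(* Let $\Omega$ be a totally convex disc with smooth boundary in a complete Riemannian surface $(M^2,g)$. Assume that every two points of $\partial\Omega$ are joined by a unique geodesic. If $(\Omega,g)$ admits an isometric involution with no fixed boundary points and $$\mathcal{S}(\partial\Omega)=\mathrm{diam}(\partial\Omega),$$ then the involution has a unique fixed point $x_0\in\Omega$, $\mathcal{S}(\partial\Omega)/2$ is not bigger than the injectivity radius of $(M^2,g)$ at $x_0$, and $\Omega$ is the geodesic ball of $(M^2,g)$ of diameter $\mathcal{S}(\partial\Omega)=\mathrm{diam}(\partial\Omega)$ (i.e. of radius $\mathcal{S}(\partial\Omega)/2$) and center $x_0$.
   Context: A subset of a Riemannian manifold is totally convex if every geodesic with extremities in the subset lies entirely in the subset. Let $d$ be the Riemannian distance of $(M^2,g)$; $\mathrm{diam}(\partial\Omega)=\max_{x,y\in\partial\Omega}d(x,y)$. An isometric involution of $(\Omega,g)$ is an isometry $A:(\Omega,g)\to(\Omega,g)$ with $A\circ A=\mathrm{id}$. Width of $\Gamma=\partial\Omega$: a family $\{p_t,q_t\}\subset\Gamma$, $t\in[0,1]$, is a sweepout of $\Gamma$ if (i) $p_0=q_0$, $p_1=q_1$; (ii) $t\mapsto p_t$, $t\mapsto q_t$ are continuous; (iii) $p_t,q_t$ bound a closed arc $C_t\subset\Gamma$ with $t\mapsto C_t$ continuous (distance between arcs = length of symmetric difference), $C_0=\{p_0\}$, $C_1=\Gamma$. $\mathcal{S}(\Gamma)=\inf\max_{t\in[0,1]}d(p_t,q_t)$ over all sweepouts of $\Gamma$. *)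

(* Defs.v *)
From HB Require Import structures.
From mathcomp Require Import all_boot all_order all_algebra.
From mathcomp Require Import all_classical all_reals all_analysis.
Set Implicit Arguments.
Unset Strict Implicit.
Unset Printing Implicit Defensive.
Import Order.TTheory GRing.Theory Num.Theory numFieldNormedType.Exports.
Local Open Scope classical_set_scope.
Local Open Scope ring_scope.

Section SmoothMaps.
Variables (R : realType) (V W : normedModType R).

(* For finite-dimensional [V] and open [U] this is the usual class C^n. *)
Fixpoint Ck (n : nat) (U : set V) (f : V -> W) : Prop :=
  match n with
  | 0 => forall x, U x -> {for x, continuous f}
  | n'.+1 => (forall x, U x -> differentiable f x) /\
             forall v, Ck n' U (fun x => 'D_v f x)
  end.

Definition smooth (U : set V) (f : V -> W) : Prop := forall n, Ck n U f.

End SmoothMaps.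

Definition quad (R : realType) (G : 'M[R]_2) (u v : 'rV[R]_2) : R :=
  (u *m G *m v^T) 0 0.

(* A connected smooth surface without boundary, presented by an atlas, with a
   smooth Riemannian metric given by its coefficient matrices in the charts.
   Outside [dom i] (resp. [cod i]) the values of the total functions
   [chart i] (resp. [param i], [metric i]) are irrelevant. *)
Record riemannian_surface (R : realType) := RiemannianSurface {
  surface :> topologicalType ;
  surface_hausdorff : hausdorff_space surface ;
  surface_second_countable : @second_countable surface ;
  surface_connected : connected [set: surface] ;
  atlas : Type ;
  dom : atlas -> set surface ;
  cod : atlas -> set 'rV[R]_2 ;
  chart : atlas -> surface -> 'rV[R]_2 ;
  param : atlas -> 'rV[R]_2 -> surface ;
  dom_open : forall i, open (dom i) ;
  cod_open : forall i, open (cod i) ;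
  chart_cod : forall i p, dom i p -> cod i (chart i p) ;
  param_dom : forall i x, cod i x -> dom i (param i x) ;
  chartK : forall i p, dom i p -> param i (chart i p) = p ;
  paramK : forall i x, cod i x -> chart i (param i x) = x ;
  chart_continuous : forall i p, dom i p -> {for p, continuous (chart i)} ;
  param_continuous : forall i x, cod i x -> {for x, continuous (param i)} ;
  chart_at : surface -> atlas ;
  chart_atP : forall p, dom (chart_at p) p ;
  transition_smooth : forall i j,
    smooth (chart i @` (dom i `&` dom j)) (chart j \o param i) ;
  metric : atlas -> 'rV[R]_2 -> 'M[R]_2 ;
  metric_smooth : forall i a b, smooth (cod i) (fun x => metric i x a b : R^o) ;
  metric_sym : forall i x, cod i x -> (metric i x)^T = metric i x ;
  metric_posdef : forall i x, cod i x ->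
    forall u, u != 0 -> 0 < quad (metric i x) u u ;
  metric_transition : forall i j p, dom i p -> dom j p -> forall u v,
    quad (metric i (chart i p)) u v =
    quad (metric j (chart j p))
      ('D_u (chart j \o param i) (chart i p))
      ('D_v (chart j \o param i) (chart i p))
}.

Arguments dom {R r}. Arguments cod {R r}. Arguments chart {R r}.
Arguments param {R r}. Arguments chart_at {R r}. Arguments metric {R r}.

Section RiemannianGeometry.
Variables (R : realType) (M : riemannian_surface R).

Definition smooth_to (V : normedModType R) (U : set V) (f : V -> M) : Prop :=
  (forall x, U x -> {for x, continuous f}) /\
  forall i : atlas M, smooth (U `&` f @^-1` dom i) (chart i \o f).

Definition smooth_from (W : normedModType R) (U : set M) (f : M -> W) : Prop :=
  forall i : atlas M, smooth (chart i @` (dom i `&` U)) (f \o param i).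

Definition smooth_map (U : set M) (f : M -> M) : Prop :=
  forall i : atlas M, smooth_to (chart i @` (dom i `&` U)) (f \o param i).

Definition diffeo_onto_image (U : set 'rV[R]_2) (f : 'rV[R]_2 -> M) : Prop :=
  [/\ open U, smooth_to U f, open (f @` U) &
      exists h : M -> 'rV[R]_2,
        (forall v, U v -> h (f v) = v) /\ smooth_from (f @` U) h].

(* Tangent vectors at [p] are represented by their coordinates in the chart
   [chart_at p]. *)
Definition inner (p : M) (u v : 'rV[R]_2) : R :=
  quad (metric (chart_at p) (chart (chart_at p) p)) u v.

Definition velocity (c : R -> M) (t : R) : 'rV[R]_2 :=
  derive1 (chart (chart_at (c t)) \o c) t.

Definition speed (c : R -> M) (t : R) : R :=
  Num.sqrt (inner (c t) (velocity c t) (velocity c t)).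

Definition tangent_map (f : M -> M) (p : M) (u : 'rV[R]_2) : 'rV[R]_2 :=
  'D_u (chart (chart_at (f p)) \o f \o param (chart_at p))
       (chart (chart_at p) p).

(* A curve on a compact interval is smooth when it extends smoothly to a
   neighbourhood of that interval. *)
Definition smooth_segment (c : R -> M) : Prop :=
  exists2 e : R, 0 < e & smooth_to (`]- e, 1 + e[%classic : set R^o) c.

Definition segment_length (c : R -> M) : R :=
  (\int[lebesgue_measure]_(t in `[0, 1]) speed c t)%R.

(* [piecewise_path x y l]: some piecewise smooth curve from [x] to [y] has
   length [l]. *)
Inductive piecewise_path : M -> M -> R -> Prop :=
| path_nil x : piecewise_path x x 0
| path_cons (c : R -> M) y l : smooth_segment c ->
    piecewise_path (c 1) y l ->
    piecewise_path (c 0) y (segment_length c + l).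

Definition rdist (x y : M) : R := inf [set l | piecewise_path x y l].

Definition diam (A : set M) : R :=
  sup [set l | exists x y, [/\ A x, A y & l = rdist x y]].

Definition christoffel (i : atlas M) (x : 'rV[R]_2) (k a b : 'I_2) : R :=
  let dmetric (a b l : 'I_2) : R :=
    'D_(delta_mx 0 a) (fun y => metric i y b l : R^o) x in
  2^-1 * \sum_l invmx (metric i x) k l *
    (dmetric a b l + dmetric b a l - dmetric l a b).

(* Affinely parametrized, possibly constant; [J] is meant to be open. *)
Definition geodesic_on (J : set R) (c : R -> M) : Prop :=
  smooth_to (J : set R^o) c /\
  forall (t : R) (i : atlas M), J t -> dom i (c t) -> forall k : 'I_2,
    let x := chart i \o c in
    (derive1 (derive1 x) t) 0 k +
    \sum_a \sum_b christoffel i (x t) k a b *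
      (derive1 x t) 0 a * (derive1 x t) 0 b = 0.

Definition geodesic_segment (c : R -> M) (x y : M) : Prop :=
  [/\ c 0 = x, c 1 = y &
      exists2 e : R, 0 < e & geodesic_on `]- e, 1 + e[%classic c].

(* As the parameter interval is [0, 1], equality of parametrized geodesics is
   uniqueness up to reparametrization. *)
Definition joined_by_unique_geodesic (x y : M) : Prop :=
  (exists c, geodesic_segment c x y) /\
  forall c1 c2, geodesic_segment c1 x y -> geodesic_segment c2 x y ->
    forall t : R, 0 <= t <= 1 -> c1 t = c2 t.

Definition complete_surface : Prop :=
  forall (p : M) (v : 'rV[R]_2),
    exists c, [/\ geodesic_on setT c, c 0 = p & velocity c 0 = v].

Definition totally_convex (A : set M) : Prop :=
  forall x y c, A x -> A y -> geodesic_segment c x y ->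
    forall t : R, 0 <= t <= 1 -> A (c t).

(* On a complete surface the set below is a singleton, so that the default value
   [p] is not used. *)
Definition exp_map (p : M) (v : 'rV[R]_2) : M :=
  xget p [set q | exists c,
    [/\ geodesic_on setT c, c 0 = p, velocity c 0 = v & c 1 = q]].

Definition injectivity_radius (p : M) : \bar R :=
  ereal_sup [set r%:E | r in [set r : R | 0 < r /\
    diffeo_onto_image [set v | Num.sqrt (inner p v v) < r] (exp_map p)]].

Definition geodesic_ball (p : M) (r : R) : set M :=
  exp_map p @` [set v | Num.sqrt (inner p v v) <= r].

Definition bdry (A : set M) : set M := closure A `\` A°.

(* The image of the Euclidean closed unit disc by a diffeomorphism of a
   neighbourhood of it onto an open set; [bdry A] is the image of the circle. *)
Definition smooth_disc (A : set M) : Prop :=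
  let D := [set v : 'rV[R]_2 | v 0 0 ^+ 2 + v 0 1 ^+ 2 <= 1] in
  exists U f, [/\ diffeo_onto_image U f, D `<=` U & A = f @` D].

(* [A] is a closed set with boundary: maps on it are smooth when they extend
   smoothly near every point.  The differential of the extension at points of a
   smooth disc [A] is determined by the values on [A].  Only the restriction of
   [s] to [A] matters. *)
Definition isometric_involution (A : set M) (s : M -> M) : Prop :=
  [/\ forall x, A x -> A (s x),
      forall x, A x -> s (s x) = x &
      forall x, A x -> exists (U : set M) (f : M -> M),
        [/\ open U, U x, smooth_map U f,
            forall y, U y -> A y -> f y = s y &
            forall y, U y -> A y -> forall u v,
              inner (f y) (tangent_map f y u) (tangent_map f y v) =
              inner y u v]].

Definition circle_param (G : set M) (c : R -> M) : Prop :=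
  [/\ smooth_to ([set: R] : set R^o) c,
      forall t : R, speed c t != 0,
      forall s t : R, c s = c t <-> exists k : int, s - t = k%:~R &
      range c = G].

(* The value of the integral does not depend on [c]. *)
Definition length_in (G A : set M) : R :=
  get [set l : R | exists2 c, circle_param G c &
    l = (\int[lebesgue_measure]_(t in `[0%R, 1%R[ `&` c @^-1` A) speed c t)%R].

(* When [p = q] the arc is either [[set p]] or [G]. *)
Definition closed_arc (G : set M) (p q : M) (C : set M) : Prop :=
  exists (c : R -> M) (a b : R), [/\ circle_param G c, a <= b <= a + 1,
    c a = p, c b = q & C = c @` `[a, b]].

Definition sweepout (G : set M) (p q : R -> M) : Prop :=
  [/\ p 0 = q 0 /\ p 1 = q 1,
      {within `[0, 1], continuous p},
      {within `[0, 1], continuous q} &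
      exists C : R -> set M,
        [/\ forall t : R, 0 <= t <= 1 -> closed_arc G (p t) (q t) (C t),
            forall t : R, 0 <= t <= 1 -> forall e : R, 0 < e ->
              exists2 d : R, 0 < d & forall s : R, 0 <= s <= 1 -> `|s - t| < d ->
                length_in G ((C s `\` C t) `|` (C t `\` C s)) < e,
            C 0 = [set p 0] &
            C 1 = G]].

Definition width (G : set M) : R :=
  inf [set m | exists p q, sweepout G p q /\
    m = sup [set rdist (p t) (q t) | t in `[0, 1]]].

End RiemannianGeometry.

(* Main.v *)
Require Import Defs.
From HB Require Import structures.
From mathcomp Require Import all_boot all_order all_algebra.
From mathcomp Require Import all_classical all_reals all_analysis.
From mathcomp Require Import measurable_realfun zify ring lra.
Set Implicit Arguments.
Unset Strict Implicit.
Unset Printing Implicit Defensive.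
Import Order.TTheory GRing.Theory Num.Theory numFieldNormedType.Exports.
Local Open Scope classical_set_scope.
Local Open Scope ring_scope.

(* Write s for the involution and d for the distance. A boundary point x and s x are joined by a unique geodesic,
   which s reverses and which is minimizing by completeness, so its midpoint is fixed by s. The differential of s
   there reverses the chord; were it a reflection, s would reverse the orientation of the boundary circle and fix a
   boundary point. Hence the midpoint is an isolated fixed point, and since it depends continuously on x it is the
   same point x0 for every chord. Sweeping the boundary from a fixed base point x gives a boundary point y with
   width <= d x y <= d x x0 + d x0 y = (d x (s x) + d y (s y)) / 2 <= diam, so all chords have length
   L = width = diam and the boundary lies at distance L / 2 from x0. The direction at x0 of the chord of x is odd
   under s, so by the intermediate value theorem the chords leave x0 in every direction. Thus every geodesic of
   length L centred at x0 is minimizing, which excludes cut and conjugate points before L / 2 and identifies the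
   disc with the ball. *)

(** * Smooth calculus in coordinates *)

(** The delicate point is the passage from minimizing diameters to the injectivity radius, made here
    without curvature or index form. Two radii meeting before their ends would form a minimizing
    broken geodesic, which [no_corner] forbids; so the exponential map is injective on the open
    ball. A conjugate vector is then impossible because the geodesic flow is an immersion: the
    corresponding variation vanishes with nonzero slope, hence a neighbouring radius truly crosses
    the central one, against injectivity. The regularity of the flow therefore carries the proof;
    differentiability in the initial condition comes from Gronwall estimates alone, higher classes
    from the tangent flow.

    A second obstacle is that [s] is smooth only through local extensions. It is handled through
    distances where possible, and the uniqueness of chords is turned into a metric statement that
    [s] preserves. Finally, arc length in a sweepout refers to an unspecified parametrization of the
    boundary and has to be bounded for all of them. *)

Section EpsilonDifferential.
Variables (R : realType) (V W : normedModType R).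
Implicit Types (f g : V -> W) (x : V).

Lemma differentiable_eps f x : differentiable f x -> forall e, 0 < e ->
  \forall y \near x, `|f y - f x - 'd f x (y - x)| <= e * `|y - x|.
Proof.
move=> df e e0; have := diff_locally df.
move=> /eqaddoP /(_ e e0) /nbhs_ballP [r /= r0 H].
apply/nbhs_ballP; exists r => //= y xy.
have := H (y - x); rewrite -ball_normE /= sub0r normrN.
move: xy; rewrite -ball_normE /= distrC => xy /(_ xy).
by rewrite -![(_ - _ : _ -> _) _]/(_ - _) /= subrK opprD addrA.
Qed.

(** A candidate for the differential, tested by explicit errors, yields differentiability and the
    value of the differential together; later proofs never return to little-o notation. *)
Lemma eps_differentiable f x (L : {linear V -> W}) : continuous L ->
  (forall e, 0 < e -> \forall y \near x, `|f y - f x - L (y - x)| <= e * `|y - x|) ->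
  differentiable f x /\ 'd f x = L :> (V -> W).
Proof.
move=> cL H.
have E : f \o shift x = cst (f x) + L +o_ 0 id.
  apply/eqaddoP => e e0; have /nbhs_ballP [r /= r0 h] := H _ e0.
  apply/nbhs_ballP; exists r => //= y; rewrite -ball_normE /= sub0r normrN => yr.
  have := h (y + x); rewrite -ball_normE /= opprD addrCA subrr addr0 normrN.
  by move=> /(_ yr); rewrite addrK -![(_ - _ : _ -> _) _]/(_ - _) /= opprD addrA.
have dL : 'd f x = L :> (V -> W) by apply: diff_unique.
by split=> //; apply/diff_locallyP; rewrite dL; split.
Qed.

Lemma near_eq_differentiable f g x : (\forall y \near x, f y = g y) ->
  differentiable f x -> differentiable g x.
Proof.
move=> fg df.
have fgx : f x = g x := nbhs_singleton fg.
have := @eps_differentiable g x ('d f x) (diff_continuous df).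
case=> // e e0; near=> y.
have <- : f y = g y by near: y.
by rewrite -fgx; near: y; apply: differentiable_eps.
Unshelve. all: by end_near. Qed.
End EpsilonDifferential.

Section CkBasics.
Variables (R : realType) (V W : normedModType R).
Implicit Types (f g : V -> W) (U : set V).

Lemma sub_Ck n U U' f : U' `<=` U -> Ck n U f -> Ck n U' f.
Proof.
elim: n f => [|n IH] f UU' /=; first by move=> h x /UU'; exact: h.
by move=> [h1 h2]; split=> [x /UU'|v]; [exact: h1 | exact: IH (h2 v)].
Qed.

Lemma Ck_continuous n U f : Ck n U f -> forall x, U x -> {for x, continuous f}.
Proof.
case: n => [//|n] [h _] x Ux; exact/differentiable_continuous/h.
Qed.

Lemma CkS n U f : Ck n.+1 U f -> Ck n U f.
Proof.
elim: n f => [|n IH] f; first by move=> h; exact: Ck_continuous h.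
by move=> [h1 h2]; split=> // v; apply/IH/h2.
Qed.

Lemma eq_Ck n U f g : open U -> (forall x, U x -> f x = g x) -> Ck n U f -> Ck n U g.
Proof.
move=> oU; elim: n f g => [|n IH] f g fg.
  move=> h x Ux; rewrite /prop_for /continuous_at -(fg _ Ux).
  apply: cvg_trans (h x Ux); apply: near_eq_cvg.
  by apply: filterS (open_nbhs_nbhs (conj oU Ux)) => y /fg.
have nfg x : U x -> \forall y \near x, f y = g y.
  by move=> Ux; apply: filterS (open_nbhs_nbhs (conj oU Ux)) => y /fg.
move=> [h1 h2]; split=> [x Ux|v].
  exact: near_eq_differentiable (nfg x Ux) (h1 x Ux).
by apply: IH (h2 v) => x Ux; apply: near_eq_derive; exact: nfg.
Qed.

Lemma sub_smooth U U' f : U' `<=` U -> smooth U f -> smooth U' f.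
Proof. by move=> UU' h n; apply: sub_Ck (h n). Qed.

Lemma eq_smooth U f g : open U -> (forall x, U x -> f x = g x) ->
  smooth U f -> smooth U g.
Proof. by move=> oU fg h n; apply: eq_Ck (h n). Qed.

Lemma smooth_differentiable U f x : smooth U f -> U x -> differentiable f x.
Proof. by move=> /(_ 1%N)[h _] Ux; apply: h. Qed.

Lemma smooth_continuous U f x : smooth U f -> U x -> {for x, continuous f}.
Proof. by move=> h Ux; apply: (Ck_continuous (h 0%N)). Qed.

Lemma smooth_derive U f v : smooth U f -> smooth U ('D_v f).
Proof. by move=> h n; have [_ /(_ v)] := h n.+1. Qed.

Lemma Ck_cst n U (c : W) : Ck n U (cst c : V -> W).
Proof.
elim: n c => [|n IH] c; first by move=> x _; exact: cst_continuous.
split=> [x _|v]; first exact: differentiable_cst.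
rewrite (_ : derive _ ^~ v = cst 0) //.
by apply/funext => x; rewrite derive_cst.
Qed.

Lemma CkD n U f g : open U -> Ck n U f -> Ck n U g -> Ck n U (fun x => f x + g x).
Proof.
move=> oU; elim: n f g => [|n IH] f g.
  by move=> h1 h2 x Ux; apply: cvgD; [exact: h1|exact: h2].
move=> [f1 f2] [g1 g2]; split=> [x Ux|v].
  exact: (differentiableD (f1 x Ux) (g1 x Ux)).
apply: eq_Ck (IH _ _ (f2 v) (g2 v)) => // x Ux.
by rewrite (@deriveD _ _ _ f g) //; apply: diff_derivable; [exact: f1|exact: g1].
Qed.


Lemma CkN n U f : open U -> Ck n U f -> Ck n U (fun x => - f x).
Proof.
move=> oU; elim: n f => [|n IH] f.
  by move=> h1 x Ux; apply: cvgN; exact: h1.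
move=> [f1 f2]; split=> [x Ux|v]; first exact: (differentiableN (f1 x Ux)).
apply: eq_Ck (IH _ (f2 v)) => // x Ux.
by rewrite (@deriveN _ _ _ f) //; apply: diff_derivable; exact: f1.
Qed.

Lemma Ck_linear n U (L : {linear V -> W}) : continuous L -> Ck n U L.
Proof.
move=> cL; case: n => [|n]; first by move=> x _; exact: cL.
split=> [x _|v]; first exact: linear_differentiable.
rewrite (_ : derive L ^~ v = cst (L v)); first exact: Ck_cst.
apply/funext => x; rewrite deriveE; last exact: linear_differentiable.
by rewrite diff_lin.
Qed.
End CkBasics.

Section CkReal.
Variables (R : realType) (V : normedModType R).
Implicit Types (U : set V).

Lemma CkM n U (f g : V -> R^o) : open U -> Ck n U f -> Ck n U g ->
  Ck n U (fun x => (f x : R) * g x : R^o).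
Proof.
move=> oU; elim: n f g => [|n IH] f g.
  by move=> h1 h2 x Ux; apply: cvgM; [exact: h1|exact: h2].
move=> fS gS; have [f1 f2] := fS; have [g1 g2] := gS.
split=> [x Ux|v]; first exact: (differentiableM (f1 x Ux) (g1 x Ux)).
apply: eq_Ck (CkD oU (IH _ _ (CkS fS) (g2 v)) (IH _ _ (CkS gS) (f2 v))) => // x Ux.
by rewrite (@deriveM _ _ f g) //; apply: diff_derivable; [exact: f1|exact: g1].
Qed.

Lemma Ck_sum (W : normedModType R) n U (I : Type) (r : seq I) (P : pred I) (f : I -> V -> W) :
  open U -> (forall i, P i -> Ck n U (f i)) -> Ck n U (fun x => \sum_(i <- r | P i) f i x).
Proof.
move=> oU h; elim: r => [|i r IH].
  by under eq_fun do rewrite big_nil; exact: Ck_cst.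
under eq_fun do rewrite big_cons.
case Pi : (P i) => //; by apply: CkD => //; exact: h.
Qed.

Lemma CkV n U (f : V -> R^o) : open U -> (forall x, U x -> f x != 0) -> Ck n U f ->
  Ck n U (fun x => (f x : R)^-1 : R^o).
Proof.
move=> oU f0; elim: n => [|n IH].
  by move=> h x Ux; apply: cvgV; [exact: f0|exact: h].
move=> fS; have [f1 f2] := fS.
split=> [x Ux|v]; first exact: (differentiableV (f1 x Ux) (f0 x Ux)).
have iS := IH (CkS fS).
apply: eq_Ck (CkN oU (CkM oU (CkM oU iS iS) (f2 v))) => // x Ux.
rewrite (@deriveV _ _ f) //; [|exact: f0|apply: diff_derivable; exact: f1].
by rewrite expr2 invfM scaleNr.
Qed.

Lemma differentiable_mxP (n m : nat) (f : V -> 'M[R]_(m, n)) x :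
  differentiable f x <-> forall i j, differentiable (fun y => f y i j : R^o) x.
Proof.
split=> [df i j|df].
  exact: (differentiable_comp df (differentiable_coord _ i j)).
rewrite (_ : f = fun y => \sum_i \sum_j (f y i j) *: delta_mx i j); last first.
  by apply/funext => y; exact: matrix_sum_delta.
have dsum k (h : 'I_k -> V -> 'M[R]_(m, n)) : (forall i, differentiable (h i) x) ->
  differentiable (fun y => \sum_i h i y) x.
  move=> hd; rewrite (_ : (fun _ => _) = \sum_i h i); first exact: differentiable_sum.
  by apply/funext => y; rewrite fct_sumE.
apply: (dsum _) => i; apply: (dsum _) => j.
exact: (differentiableZl _ (df i j)).
Qed.

Lemma continuous_mxP (n m : nat) (f : V -> 'M[R]_(m, n)) x :
  {for x, continuous f} <-> forall i j, {for x, continuous (fun y => f y i j : R^o)}.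
Proof.
split=> [cf i j|cf].
  exact: (@continuous_comp _ _ _ f (fun N : 'M[R]_(m,n) => N i j : R^o) x cf (@coord_continuous _ _ _ i j (f x))).
apply/cvgrPdist_le => e e0; near=> y.
rewrite [leLHS]/Num.Def.normr/= mx_normrE (bigmax_le _ (ltW e0))//= => i _.
rewrite !mxE; move: i; near: y; apply: filter_forall => /= -[i j] /=.
by have /cvgrPdist_le := cf i j; exact.
Unshelve. all: by end_near. Qed.

Lemma Ck_mxP k (n m : nat) U (f : V -> 'M[R]_(m, n)) : open U ->
  Ck k U f <-> forall i j, Ck k U (fun y => f y i j : R^o).
Proof.
move=> oU; elim: k f => [|k IH] f.
  by split=> [h i j x Ux|h x Ux]; [move/continuous_mxP: (h x Ux); exact|apply/continuous_mxP => i j; exact: h].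
have De x v : differentiable f x -> forall i j, 'D_v f x i j = 'D_v (fun y => f y i j : R^o) x.
  by move=> df i j; rewrite derive_mx ?mxE //; exact: diff_derivable.
split=> [[h1 h2] i j|h].
  split=> [x Ux|v]; first exact: (differentiable_mxP f x).1 (h1 x Ux) i j.
  apply: eq_Ck ((IH _).1 (h2 v) i j) => // x Ux.
  by rewrite De //; exact: h1.
have h1 x : U x -> differentiable f x.
  by move=> Ux; apply/differentiable_mxP => i j; have [+ _] := h i j; exact.
split=> // v; apply/IH => i j; have [_ /(_ v)] := h i j.
by apply: eq_Ck => // x Ux; rewrite De //; exact: h1.
Qed.
End CkReal.

Section CkComp.
Variables (R : realType).

Lemma derive_rV (W : normedModType R) m (g : 'rV[R]_m -> W) y w :
  differentiable g y -> 'D_w g y = \sum_j w 0 j *: 'D_(delta_mx 0 j) g y.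
Proof.
move=> dg; rewrite deriveE // [in LHS](row_sum_delta w) linear_sum.
by apply: eq_bigr => j _; rewrite linearZ /= deriveE.
Qed.

Lemma derive_comp (V V' W : normedModType R) (f : V -> V') (g : V' -> W) x v :
  differentiable f x -> differentiable g (f x) ->
  'D_v (g \o f) x = 'D_('D_v f x) g (f x).
Proof.
move=> df dg; rewrite !deriveE //; last exact: differentiable_comp.
by rewrite diff_comp.
Qed.

(** The chain rule is expanded along the coordinates of the intermediate space: the derivative of
    the composite becomes a sum of products of maps of one class less, and the induction closes. *)
Lemma Ck_comp_scalar (V : normedModType R) m n U U' (f : V -> 'rV[R]_m) (g : 'rV[R]_m -> R^o) :
  open U -> (forall x, U x -> U' (f x)) -> Ck n U f -> Ck n U' g -> Ck n U (g \o f).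
Proof.
move=> oU fU; elim: n g => [|n IH] g.
  by move=> h1 h2 x Ux; apply: continuous_comp; [exact: h1|apply: h2; exact: fU].
move=> fS gS; have [f1 f2] := fS; have [g1 g2] := gS.
split=> [x Ux|v].
  by apply: differentiable_comp; [exact: f1|apply: g1; exact: fU].
apply: (@eq_Ck _ _ _ n U (fun x => \sum_j (('D_v f x) 0 j : R) * ('D_(delta_mx 0 j) g (f x)) : R^o)) => //.
  move=> x Ux; rewrite (@derive_comp _ _ _ f g); [|exact: f1|by apply: g1; exact: fU].
  by rewrite [RHS]derive_rV //; apply: g1; exact: fU.
apply: Ck_sum => // j _; apply: CkM => //.
  exact: (Ck_mxP _ _ oU).1 (f2 v) 0 j.
exact: (IH _ (CkS fS) (g2 _)).
Qed.

Lemma Ck_comp (V : normedModType R) m n k l U U' (f : V -> 'rV[R]_m) (g : 'rV[R]_m -> 'M[R]_(k, l)) :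
  open U -> open U' -> (forall x, U x -> U' (f x)) -> Ck n U f -> Ck n U' g -> Ck n U (g \o f).
Proof.
move=> oU oU' fU fS gS; apply/Ck_mxP => // i j.
by apply: (@Ck_comp_scalar V m n U U' f (fun y => g y i j)) => //; exact: ((Ck_mxP _ _ oU').1 gS i j).
Qed.

Lemma smooth_comp (V : normedModType R) m k l U U' (f : V -> 'rV[R]_m) (g : 'rV[R]_m -> 'M[R]_(k, l)) :
  open U -> open U' -> (forall x, U x -> U' (f x)) -> smooth U f -> smooth U' g -> smooth U (g \o f).
Proof. by move=> oU oU' fU fS gS n; apply: Ck_comp fU (fS n) (gS n). Qed.

(** For affine inner maps the derivative is again a composite of the same form, so no coordinates
    are needed on the intermediate space. This covers changes of time on the real line. *)
Lemma Ck_comp_affine (V V' W : normedModType R) n U U' (L : {linear V -> V'}) (b : V') (g : V' -> W) :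
  continuous L -> open U -> (forall x, U x -> U' (L x + b)) -> Ck n U' g -> Ck n U (fun x => g (L x + b)).
Proof.
move=> cL oU LU.
have dA x : differentiable (fun x => L x + b) x.
  exact: (differentiableD (linear_differentiable x cL) (differentiable_cst b x)).
have DA x v : 'D_v (fun x => L x + b) x = L v.
  rewrite (@deriveD _ _ _ L (cst b)) ?derive_cst ?addr0 ?deriveE ?diff_lin //.
    exact: linear_differentiable.
  by apply: diff_derivable; exact: linear_differentiable.
elim: n g => [|n IH] g.
  move=> h x Ux; apply: (@continuous_comp _ _ _ (fun x => L x + b) g).
    exact: differentiable_continuous.
  exact/h/LU.
move=> [g1 g2]; split=> [x Ux|v].
  exact: (differentiable_comp (dA x) (g1 _ (LU _ Ux))).
apply: eq_Ck (IH _ (g2 (L v))) => // x Ux.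
rewrite (@derive_comp _ _ _ (fun x => L x + b) g) ?DA //; exact/g1/LU.
Qed.

(** A point and a tangent vector are packed into one row of length m + m; linearity in the vector
    reduces joint smoothness to that of the partial derivatives. Needed for the tangent system of a
    differential equation and for changes of chart on velocities. *)
Lemma smooth_joint_derive m k l U (g : 'rV[R]_m -> 'M[R]_(k, l)) :
  open U -> smooth U g ->
  smooth ((@lsubmx R 1 m m) @^-1` U) (fun z : 'rV[R]_(m + m) => 'D_(rsubmx z) g (lsubmx z)).
Proof.
move=> oU gS n.
have cl : continuous (lsubmx : 'rV[R]_(m + m) -> _).
  by move=> z; exact/differentiable_continuous/differentiable_lsubmx.
have cr : continuous (rsubmx : 'rV[R]_(m + m) -> _).
  by move=> z; exact/differentiable_continuous/differentiable_rsubmx.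
have oU2 : open ((@lsubmx R 1 m m) @^-1` U) by apply: open_comp => // z _; exact: cl.
apply: (@eq_Ck _ _ _ n _ (fun z : 'rV[R]_(m + m) =>
   \sum_j (rsubmx z) 0 j *: 'D_(delta_mx 0 j) g (lsubmx z))) => //.
  by move=> z Uz; rewrite [RHS]derive_rV //; exact: smooth_differentiable gS _.
apply: Ck_sum => // j _; apply/Ck_mxP => // a b.
under eq_fun do rewrite mxE.
apply: CkM => //.
  apply: ((Ck_mxP _ _ oU2).1 _ 0 j); exact: (Ck_linear _ _ cr).
apply: ((Ck_mxP _ _ oU2).1 _ a b).
have lS : Ck n (lsubmx @^-1` U) (lsubmx : 'rV[R]_(m + m) -> 'rV[R]_m) by exact: (Ck_linear n _ cl).
have dS := smooth_derive (delta_mx 0 j) gS n.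
have UU : forall z : 'rV[R]_(m+m), (lsubmx @^-1` U) z -> U (lsubmx z) by [].
exact: (Ck_comp oU2 oU UU lS dS).
Qed.

Lemma smooth_mxP (V : normedModType R) (n m : nat) U (f : V -> 'M[R]_(m, n)) : open U ->
  smooth U f <-> forall i j, smooth U (fun y => f y i j : R^o).
Proof.
by move=> oU; split=> [h i j k|h k]; [exact: (Ck_mxP _ _ oU).1 (h k) i j|apply/Ck_mxP => // i j; exact: h].
Qed.

Lemma smooth_row_mx (V : normedModType R) m1 m2 U (f : V -> 'rV[R]_m1) (g : V -> 'rV[R]_m2) :
  open U -> smooth U f -> smooth U g -> smooth U (fun x => row_mx (f x) (g x)).
Proof.
move=> oU fS gS; apply/smooth_mxP => // i j.
under eq_fun do rewrite mxE.
by case: split_ordP => k _; [exact: (smooth_mxP _ oU).1 fS i k|exact: (smooth_mxP _ oU).1 gS i k].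
Qed.

Lemma smooth_linear (V W : normedModType R) U (L : {linear V -> W}) :
  continuous L -> smooth U L.
Proof. by move=> cL n; exact: Ck_linear. Qed.
End CkComp.

Section Matrices.
Variables (R : realType) (m n : nat).
Implicit Types M : 'M[R]_(m, n).

Lemma mx_coord_le M i j : `|M i j| <= `|M|.
Proof.
rewrite [leRHS]/Num.Def.normr/= mx_normrE.
exact: (le_bigmax _ (fun x : 'I_m * 'I_n => `|M x.1 x.2|) (i, j)).
Qed.

Lemma mx_norm_le M e : 0 <= e -> (forall i j, `|M i j| <= e) -> `|M| <= e.
Proof.
by move=> e0 h; rewrite [leLHS]/Num.Def.normr/= mx_normrE (bigmax_le _ e0).
Qed.
End Matrices.

(** * The continuity method, Gronwall's inequality and strict differentiability *)

Section RealAnalysis.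
Variable R : realType.

Lemma near_normP (V : normedModType R) (P : V -> Prop) x :
  (\forall y \near x, P y) <-> exists2 r : R, 0 < r & forall y, `|y - x| < r -> P y.
Proof.
split=> [/nbhs_ballP [r /= r0 h]|[r r0 h]].
  by exists r => // y yx; apply: h; rewrite -ball_normE /= distrC.
by apply/nbhs_ballP; exists r => // y; rewrite -ball_normE /= distrC => /h.
Qed.

Lemma continuous_near_le (T : topologicalType) (W : normedModType R) (f : T -> W) x (e : R) :
  {for x, continuous f} -> 0 < e -> \forall y \near x, `|f y - f x| <= e.
Proof.
move=> cf e0; have H : \forall z \near f x, `|z - f x| <= e.
  by apply/near_normP; exists e => // z /ltW.
exact: (cf _ H).
Qed.

Lemma near_continuous (T : topologicalType) (W : normedModType R) (f : T -> W) x :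
  (forall e : R, 0 < e -> \forall y \near x, `|f y - f x| <= e) -> {for x, continuous f}.
Proof.
move=> h A /near_normP [r r0 hr].
have r2 : 0 < r / 2 by rewrite divr_gt0.
apply: filterS (h _ r2) => y hy; apply: hr; apply: le_lt_trans hy _.
by rewrite ltr_pdivrMr // ltr_pMr // ltr1n.
Qed.

(** The infimum of the set of failures can neither fail, by the first hypothesis, nor hold, by the
    second. This plays the role of connectedness of the interval in all continuation arguments
    below; the first hypothesis at [t = a] is the base case. *)
Lemma real_induction (a b : R) (P : R -> Prop) :
  (forall t : R, a <= t <= b -> (forall s : R, a <= s < t -> P s) -> P t) ->
  (forall t : R, a <= t < b -> P t -> exists2 d : R, 0 < d & forall s : R, t < s < t + d -> s <= b -> P s) ->
  forall t : R, a <= t <= b -> P t.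
Proof.
move=> hl hr t tab; apply: contrapT => nPt.
pose B := [set t | a <= t <= b /\ ~ P t].
have B0 : B !=set0 by exists t.
have Bl : has_lbound B by exists a => s [/andP[]].
have Bi : has_inf B by [].
have Ps s : a <= s < inf B -> P s.
  move=> /andP[as_ sB]; apply: contrapT => nPs.
  have sb : s <= b.
    by apply: (le_trans (ltW sB)); apply: le_trans (ge_inf Bl (conj tab nPt)) _; case/andP: tab.
  by move: sB; rewrite ltNge => /negP; apply; apply: ge_inf => //; split => //; rewrite as_.
have am : a <= inf B by apply: lb_le_inf => // s [/andP[]].
have mb : inf B <= b by apply: le_trans (ge_inf Bl (conj tab nPt)) _; case/andP: tab.
have Pm : P (inf B) by apply: hl Ps; rewrite am mb.
have [d d0 hd] : exists2 d : R, 0 < d & forall s : R, inf B < s < inf B + d -> s <= b -> P s.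
  move: mb; rewrite le_eqVlt => /orP[/eqP mb|mb]; last by apply: hr => //; rewrite am mb.
  by exists 1 => // s /andP[]; rewrite mb => /lt_geF ->.
have [s [sab nPs] sd] := inf_adherent d0 Bi.
have := ge_inf Bl (conj sab nPs); rewrite le_eqVlt => /orP[/eqP E|ms].
  by apply: nPs; rewrite -E.
by apply: nPs; apply: hd; [rewrite ms sd|case/andP: sab].
Qed.

Lemma is_derive_continuous (V : normedModType R) (f : R -> V) (df : V) (t : R) :
  is_derive t 1 f df -> {for t, continuous f}.
Proof. by move=> [/derivable1_diffP d _]; exact: differentiable_continuous. Qed.

Lemma within_continuous (V : topologicalType) (f : R -> V) (a b : R) :
  (forall t : R, a <= t <= b -> {for t, continuous f}) -> {within `[a, b], continuous f}.
Proof.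
move=> h; apply: continuous_in_subspaceT => t.
by rewrite inE /= in_itv /= => /h.
Qed.

Lemma derive_le (f df g dg : R -> R) (a b : R) : a <= b ->
  (forall t : R, a <= t <= b -> is_derive t 1 f (df t)) ->
  (forall t : R, a <= t <= b -> is_derive t 1 g (dg t)) ->
  (forall t : R, a < t < b -> df t <= dg t) -> f b - f a <= g b - g a.
Proof.
move=> ab hf hg h.
have hd t : a <= t <= b -> is_derive t 1 (f - g) (df t - dg t).
  by move=> tab; have := hf t tab; have := hg t tab => ? ?; exact: is_deriveB.
suff : (f - g) b <= (f - g) a by rewrite /= -![(_ - _ : _ -> _) _]/(_ - _); lra.
apply: (@ler0_derive1_nincr R (f - g) a b) => //.
- move=> x; rewrite in_itv /= => /andP[/ltW ax /ltW xb].
  by have [] := hd x; rewrite ?ax.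
- move=> x; rewrite in_itv /= => xab.
  have /hd [_] : a <= x <= b by move: xab => /andP[/ltW -> /ltW ->].
  by rewrite derive1E => ->; rewrite subr_le0 h.
- by apply: within_continuous => t tab; exact: is_derive_continuous (hd t tab).
Qed.

Lemma is_derive_mxP (V : normedModType R) m n (M : V -> 'M[R]_(m, n)) x v (D : 'M[R]_(m, n)) :
  is_derive x v M D <-> forall i j, is_derive x v (fun y => M y i j : R^o) (D i j).
Proof.
split=> [[d e] i j|h].
  by apply: DeriveDef; [exact: (derivable_mxP M x v).1 d i j|rewrite -e derive_mx // mxE].
have d : derivable M x v by apply: (derivable_mxP M x v).2 => i j; case: (h i j).
apply: DeriveDef => //; rewrite derive_mx //; apply/matrixP => i j; rewrite mxE.
by case: (h i j).
Qed.

Lemma is_derive_comp (V W : normedModType R) (c : R -> V) (dc : V) (F : V -> W) (t : R) :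
  is_derive t 1 c dc -> differentiable F (c t) -> is_derive t 1 (F \o c) ('D_dc F (c t)).
Proof.
move=> [d e] dF.
have dc' : differentiable c t by exact/derivable1_diffP.
apply: DeriveDef; first by apply: diff_derivable; exact: differentiable_comp.
by rewrite derive_comp // e.
Qed.

Lemma is_derive_congr (V W : normedModType R) (f g : V -> W) x v (df dg : W) :
  is_derive x v f df -> f =1 g -> df = dg -> is_derive x v g dg.
Proof. by move=> h /funext <- <-. Qed.

(** The maximum norm is not differentiable, so the estimate is made on the sum of squares [u]: the
    function [u t * expR (- A * t) - B * t] does not increase. The constant [C] depends on [n], [K]
    and [T] only, which allows its use for whole families of curves. *)
Lemma gronwall n (K T : R) : 0 <= K -> 0 <= T -> exists2 C : R, 0 <= C &
  forall (w dw : R -> 'rV[R]_n) (c T' : R), 0 <= c -> 0 <= T' <= T ->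
  (forall t : R, 0 <= t <= T' -> is_derive t 1 w (dw t)) ->
  (forall t : R, 0 <= t <= T' -> `|dw t| <= K * `|w t| + c) ->
  `|w T'| <= C * (`|w 0| + c).
Proof.
move=> K0 T0; pose A : R := 2 * n%:R * (K + 1).
have A0 : 0 <= A by rewrite /A !mulr_ge0 // addr_ge0.
pose X := 2 * n%:R * (1 + T) * expR (A * T).
have X0 : 0 <= X by rewrite /X !mulr_ge0 ?expR_ge0 // addr_ge0.
exists (1 + X) => [|w dw c T' c0 /andP[T'0 T'T] hw hdw]; first by rewrite addr_ge0.
pose u t := \sum_i (w t 0 i) ^+ 2.
have wu t : `|w t| ^+ 2 <= u t.
  have [->|] := eqVneq (w t) 0.
    by rewrite normr0 expr0n /= sumr_ge0 // => i _; exact: sqr_ge0.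
  rewrite -normr_eq0 => /mx_norm_neq0 [[i0 i] /= Ei]; rewrite {i0}(ord1 i0) in Ei.
  have {}Ei : `|w t| = `|w t 0 i| := Ei.
  by rewrite Ei real_normK ?num_real // /u (bigD1 i) //= lerDl sumr_ge0 // => j _; exact: sqr_ge0.
have un t : u t <= n%:R * `|w t| ^+ 2.
  rewrite /u; apply: (@le_trans _ _ (\sum_(i < n) `|w t| ^+ 2)); last first.
    by rewrite sumr_const card_ord mulr_natl.
  apply: ler_sum => i _; rewrite -real_normK ?num_real // lerXn2r ?nnegrE //.
  exact: mx_coord_le.
have hu t : 0 <= t <= T' -> is_derive t 1 u (\sum_i 2 * w t 0 i * dw t 0 i).
  move=> tT; have /is_derive_mxP h := hw t tT.
  rewrite (_ : u = \sum_i (fun t => w t 0 i ^+ 2)); last by apply/funext => s; rewrite fct_sumE.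
  apply: is_derive_sum => i; have hi := h 0 i.
  have h2 := @is_deriveX _ _ (fun t => w t 0 i) 2 t 1 _ hi.
  by apply: is_derive_eq; rewrite expr1.
have hu' t : 0 <= t <= T' -> \sum_i 2 * w t 0 i * dw t 0 i <= A * u t + 2 * n%:R * c ^+ 2.
  move=> tT; apply: (@le_trans _ _ (\sum_(i < n) 2 * `|w t| * (K * `|w t| + c))).
    apply: ler_sum => i _; apply: le_trans (ler_norm _) _; rewrite !normrM ger0_norm //.
    apply: ler_pM => //.
      by rewrite ler_pM2l // mx_coord_le.
    exact: le_trans (mx_coord_le _ _ _) (hdw t tT).
  rewrite sumr_const card_ord -[leLHS]mulr_natr.
  have h1 : 2 * `|w t| * (K * `|w t| + c) <= 2 * (K + 1) * `|w t| ^+ 2 + 2 * c ^+ 2.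
    by have := normr_ge0 (w t); nra.
  have h2 := wu t.
  have h3 : 2 * `|w t| * (K * `|w t| + c) <= 2 * (K + 1) * u t + 2 * c ^+ 2 by nra.
  have := ler_wpM2r (ler0n R n) h3; rewrite /A; nra.
pose B : R := 2 * n%:R * c ^+ 2.
pose v (t : R) := u t * expR (- A * t) - B * t.
have hv : v T' - v 0 <= 0 - 0.
  apply: (@derive_le v (fun t => (\sum_i 2 * w t 0 i * dw t 0 i) * expR (- A * t)
     + u t * (- A * expR (- A * t)) - B) (fun=> 0) (fun=> 0)) => //.
  - move=> t /hu du.
    have dl (k : R) : is_derive t 1 (fun t : R => k * t) k.
      by apply: is_derive_eq; rewrite /= scaler1.
    have de : is_derive t 1 (fun t => expR (- A * t)) (- A * expR (- A * t)).
      have := is_derive1_comp (is_derive_expR (- A * t)) (dl (- A)).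
      by rewrite mulrC.
    have dm := is_deriveM du de.
    apply: (is_derive_congr (is_deriveB dm (dl B))) => //.
    by rewrite /GRing.scale /=; ring.
  - move=> t /andP[/ltW t0 /ltW tT]; have {}t0 : 0 <= t <= T' by rewrite t0 tT.
    have := hu' t t0; rewrite -/B => h.
    have e0 := expR_ge0 (- A * t).
    have e1 : expR (- A * t) <= 1 by rewrite expR_le1 mulNr oppr_le0 mulr_ge0 //; case/andP: t0.
    have B0 : 0 <= B by rewrite /B !mulr_ge0.
    by nra.
have hT : u T' <= X * (`|w 0| + c) ^+ 2.
  have E1 : u T' = u T' * expR (- A * T') * expR (A * T').
    by rewrite -mulrA -expRD mulNr addNr expR0 mulr1.
  have v0 : v 0 = u 0 by rewrite /v !mulr0 expR0 mulr1 subr0.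
  have h1 : u T' * expR (- A * T') <= u 0 + B * T' by move: hv; rewrite v0 /v; lra.
  have h2 : expR (A * T') <= expR (A * T) by rewrite ler_expR ler_wpM2l.
  have h3 := un 0.
  have w0 := normr_ge0 (w 0).
  have B0 : 0 <= B by rewrite /B !mulr_ge0.
  have u0 : 0 <= u 0 by apply: sumr_ge0 => i _; exact: sqr_ge0.
  rewrite E1; apply: (@le_trans _ _ ((u 0 + B * T') * expR (A * T'))).
    by rewrite ler_wpM2r ?expR_ge0.
  apply: (@le_trans _ _ ((u 0 + B * T') * expR (A * T))).
    by rewrite ler_wpM2l // addr_ge0 // mulr_ge0.
  rewrite /X [leRHS]mulrAC ler_wpM2r ?expR_ge0 //.
  have h4 : B * T' <= 2 * n%:R * T * (`|w 0| + c) ^+ 2.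
    rewrite /B [leRHS]mulrAC; apply: ler_pM => //; rewrite ler_wpM2l ?mulr_ge0 //.
    by rewrite lerXn2r ?nnegrE ?addr_ge0 // lerDr.
  have h5 : n%:R * `|w 0| ^+ 2 <= 2 * n%:R * (`|w 0| + c) ^+ 2.
    have h6 : `|w 0| ^+ 2 <= 2 * (`|w 0| + c) ^+ 2 by nra.
    by have := ler_wpM2l (ler0n R n) h6; lra.
  by have := lerD (le_trans h3 h5) h4; lra.
have := le_trans (wu T') hT.
have : X * (`|w 0| + c) ^+ 2 <= ((1 + X) * (`|w 0| + c)) ^+ 2.
  by rewrite exprMn ler_wpM2r ?sqr_ge0 //; nra.
move=> h1 h2; have := le_trans h2 h1.
by rewrite ler_pXn2r ?nnegrE // mulr_ge0 // addr_ge0.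
Qed.

(** Continuity of finitely many partial derivatives gives continuity of the differential in operator
    norm, uniformly over all directions. *)
Lemma derive_operator_continuous m n U (F : 'rV[R]_m -> 'rV[R]_n) a e :
  open U -> Ck 1 U F -> U a -> 0 < e ->
  exists2 r : R, 0 < r & forall z, `|z - a| < r -> U z /\ forall w, `|'D_w F z - 'D_w F a| <= e * `|w|.
Proof.
move=> oU [dF cF] Ua e0.
have e1 : 0 < e / m.+1%:R by rewrite divr_gt0.
have H : \forall z \near a, U z /\ forall j : 'I_m,
    `|'D_(delta_mx 0 j) F z - 'D_(delta_mx 0 j) F a| <= e / m.+1%:R.
  near=> z; split; first by near: z; exact: open_nbhs_nbhs.
  move=> j; move: j; near: z; apply: filter_forall => j.
  exact: continuous_near_le (cF (delta_mx 0 j) a Ua) e1.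
have /nbhs_ballP [r /= r0 hr] := H; exists r => // z za.
have [|Uz hz] := hr z; first by rewrite -ball_normE /= distrC.
split=> // w; rewrite !derive_rV; [|exact: dF|exact: dF].
rewrite -sumrB; apply: le_trans (ler_norm_sum _ _ _) _.
apply: (@le_trans _ _ (\sum_(j < m) `|w| * (e / m.+1%:R))).
  apply: ler_sum => j _; rewrite -scalerBr normrZ ler_pM // ?mx_coord_le //.
rewrite sumr_const card_ord -[leLHS]mulr_natl mulrCA mulrC ler_wpM2r //.
by rewrite mulrCA ger_pMr // ler_pdivrMr // mul1r ler_nat.
Unshelve. all: by end_near. Qed.

(** The mean value theorem is applied, coordinate by coordinate, to [F] minus its differential at
    [a] along the segment from [x] to [y]. Unlike plain differentiability, the estimate compares two
    arbitrary points near [a]. *)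
Lemma strict_differentiability m n U (F : 'rV[R]_m -> 'rV[R]_n) a e :
  open U -> Ck 1 U F -> U a -> 0 < e ->
  exists2 r : R, 0 < r & forall x y, `|x - a| < r -> `|y - a| < r ->
    U x /\ `|F y - F x - 'D_(y - x) F a| <= e * `|y - x|.
Proof.
move=> oU FS Ua e0; have [r r0 hr] := derive_operator_continuous oU FS Ua e0.
exists r => // x y xr yr; split; first by have [] := hr _ xr.
have dF z : U z -> differentiable F z by case: FS => + _; exact.
apply: mx_norm_le => [|i j]; first by rewrite mulr_ge0 // ltW.
rewrite (ord1 i).
pose c (t : R) := x + t *: (y - x).
have hc (t : R) : 0 <= t <= 1 -> `|c t - a| < r.
  move=> /andP[t0 t1].
  have -> : c t - a = (1 - t) *: (x - a) + t *: (y - a).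
    by apply/rowP => k; rewrite /c !mxE; ring.
  apply: le_lt_trans (ler_normD _ _) _; rewrite !normrZ.
  rewrite (ger0_norm t0) (@ger0_norm _ (1 - t)) ?subr_ge0 //.
  by move: xr yr; case: (leP `|x - a| `|y - a|) => h h1 h2; nra.
have dc (t : R) : is_derive t 1 c (y - x).
  apply/is_derive_mxP => i' j'; rewrite /c.
  under eq_fun do rewrite !mxE.
  by apply: is_derive_eq; rewrite /GRing.scale /= !mxE; ring.
pose phi (t : R) := F (c t) 0 j - t * 'D_(y - x) F a 0 j.
have dphi (t : R) : 0 <= t <= 1 -> is_derive t 1 phi (('D_(y - x) F (c t) - 'D_(y - x) F a) 0 j).
  move=> t01; have [Uc _] := hr _ (hc t t01).
  have /is_derive_mxP /(_ 0 j) h := is_derive_comp (dc t) (dF _ Uc).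
  have h2 : is_derive t 1 (fun t : R => t * 'D_(y - x) F a 0 j) ('D_(y - x) F a 0 j).
    by apply: is_derive_eq; rewrite /GRing.scale /=; ring.
  by apply: (is_derive_congr (is_deriveB h h2)) => //; rewrite !mxE.
have [t t01] : exists2 t, t \in `]0, 1[%R & phi 1 - phi 0 = (('D_(y - x) F (c t) - 'D_(y - x) F a) 0 j) * (1 - 0).
  apply: (@MVT R phi) => // [t|].
    by rewrite in_itv /= => /andP[/ltW t0 /ltW t1]; apply: dphi; rewrite t0.
  by apply: within_continuous => t t01; exact: is_derive_continuous (dphi t t01).
have c0 : c 0 = x by rewrite /c scale0r addr0.
have c1 : c 1 = y by rewrite /c scale1r addrC subrK.
rewrite subr0 mulr1 /phi c0 c1 => E.
have -> : (F y - F x - 'D_(y - x) F a) 0 j = ('D_(y - x) F (c t) - 'D_(y - x) F a) 0 j.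
  by rewrite -E !mxE; ring.
apply: le_trans (mx_coord_le _ _ _) _.
have [|_ +] := hr (c t); last exact.
by apply: hc; move: t01; rewrite in_itv /= => /andP[/ltW -> /ltW ->].
Qed.
End RealAnalysis.

(** * Ordinary differential equations *)

Section SegmentUniform.
Variable R : realType.

(** Compactness of the interval, in the form: a local choice of scale near each time can be replaced
    by one scale for all times. *)
Lemma segment_uniform (a b : R) (P : R -> R -> Prop) :
  (forall t0 : R, a <= t0 <= b -> exists2 d0 : R, 0 < d0 &
     \forall t \near t0, forall d, 0 < d < d0 -> P d t) ->
  exists2 d : R, 0 < d & forall t : R, a <= t <= b -> P d t.
Proof.
move=> H; have := (compact_near_coveringP _).1 (@segment_compact R a b).
move=> /(_ R (0 : R)^'+ P _) [].
  move=> t0 /=; rewrite in_itv /= => /H [d0 d00 hn].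
  exists ([set t | forall d, 0 < d < d0 -> P d t], [set d | 0 < d < d0]) => /=.
    split=> //; near=> d; apply/andP; split; near: d; first exact: nbhs_right_gt.
    exact: nbhs_right_lt.
  by move=> [t d] /= [h1 /h1].
move=> r /= r0 hr; exists (r / 2); first by rewrite divr_gt0.
move=> t tab; apply: (hr (r / 2)) => //=.
- by rewrite sub0r normrN gtr0_norm ?divr_gt0 // ltr_pdivrMr // ltr_pMr // ltr1n.
- by rewrite divr_gt0.
Unshelve. all: by end_near. Qed.

Lemma limit_le (u : R -> R) (a t e : R) : a < t -> {for t, continuous u} ->
  (forall s : R, a <= s < t -> u s <= e) -> u t <= e.
Proof.
move=> t0 cu h; rewrite leNgt; apply/negP => et.
have d0 : 0 < (u t - e) / 2 by rewrite divr_gt0 // subr_gt0.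
have /near_normP [r r0 hr] := continuous_near_le cu d0.
pose s := Num.max a (t - r / 2).
have st : s < t by rewrite gt_max t0 /= ltrBlDr ltrDl divr_gt0.
have as_ : a <= s by rewrite le_max lexx.
have := h s; rewrite as_ st => /(_ isT) us.
have := hr s; rewrite ler_norml => /(_ _) /andP[].
  rewrite ltr_norml; apply/andP; split; last by lra.
  have : t - r / 2 <= s by rewrite le_max lexx orbT.
  by lra.
by lra.
Qed.

Lemma vector_mvt n (f df : R -> 'rV[R]_n) (a b B : R) : a <= b ->
  (forall t : R, a <= t <= b -> is_derive t 1 f (df t)) ->
  (forall t : R, a <= t <= b -> `|df t| <= B) -> `|f b - f a| <= B * (b - a).
Proof.
move=> ab hf hB.
have B0 : 0 <= B by apply: le_trans (normr_ge0 (df a)) (hB a _); rewrite lexx.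
apply: mx_norm_le => [|i j]; first by rewrite mulr_ge0 // subr_ge0.
have dB (k t : R) : is_derive t 1 (fun t => k * t) k.
  by apply: is_derive_eq; rewrite /GRing.scale /=; ring.
have hij (t : R) : a <= t <= b -> is_derive t 1 (fun t => f t i j) (df t i j).
  by move=> /hf /is_derive_mxP.
have hb (t : R) : a < t < b -> `|df t i j| <= B.
  move=> /andP[/ltW at_ /ltW tb]; apply: le_trans (mx_coord_le _ _ _) (hB _ _).
  by rewrite at_.
rewrite !mxE ler_norml; apply/andP; split.
  have := @derive_le _ (fun t => - B * t) (fun=> - B) (fun t => f t i j) (fun t => df t i j) a b ab (fun t _ => dB (- B) t) hij.
  have h (t : R) : a < t < b -> - B <= df t i j by move=> /hb; rewrite ler_norml => /andP[].
  by move=> /(_ h); lra.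
have := @derive_le _ (fun t => f t i j) (fun t => df t i j) (fun t => B * t) (fun=> B) a b ab hij (fun t _ => dB B t).
have h (t : R) : a < t < b -> df t i j <= B by move=> /hb; rewrite ler_norml => /andP[].
by move=> /(_ h); lra.
Qed.
End SegmentUniform.

Section Solutions.
Variables (R : realType) (n : nat) (W : set 'rV[R]_n) (F : 'rV[R]_n -> 'rV[R]_n).
Hypotheses (oW : open W) (FS : Ck 1 W F).
Implicit Types (x y : R -> 'rV[R]_n) (T a b : R).

(** Curves are total functions and the derivative is two-sided even at the end points; the solutions
    that occur are restrictions of curves living on a larger interval. *)
Definition solution a b x := forall t : R, a <= t <= b -> W (x t) /\ is_derive t 1 x (F (x t)).

Lemma solution_continuous a b x : solution a b x -> forall t : R, a <= t <= b -> {for t, continuous x}.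
Proof. by move=> h t /h [_]; exact: is_derive_continuous. Qed.

Let dF z : W z -> differentiable F z. Proof. by case: FS => + _; exact. Qed.

Lemma solution_near a b x t0 : solution a b x -> a <= t0 <= b -> forall r, 0 < r ->
  \forall t \near t0, `|x t - x t0| < r.
Proof.
move=> xS t0ab r r0; have r2 : 0 < r / 2 by rewrite divr_gt0.
apply: filterS (continuous_near_le (solution_continuous xS t0ab) r2) => t /= h.
by apply: le_lt_trans h _; lra.
Qed.

Lemma solution_derive_bound a b x : solution a b x ->
  exists2 K : R, 0 <= K & forall t : R, a <= t <= b -> forall w, `|'D_w F (x t)| <= K * `|w|.
Proof.
(* The bound is written as an inverse so that the small uniform constant provided by compactness
   yields a large one. *)
move=> xS; have [] := @segment_uniform R a b (fun d t => forall w, `|'D_w F (x t)| <= d^-1 * `|w|).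
  move=> t0 t0ab; have [Wx _] := xS t0 t0ab.
  have [r r0 hr] := derive_operator_continuous oW FS Wx ltr01.
  have [k k0 hk] := linear_lipschitz (diff_continuous (dF Wx)).
  exists (k + 1)^-1; first by rewrite invr_gt0 addr_gt0.
  near=> t => d /andP[d0 dk] w.
  have [|_ h] := hr (x t); first by near: t; apply: solution_near xS _ _ _.
  have h1 := hk w; rewrite -deriveE in h1; last exact: dF.
  have : `|'D_w F (x t)| <= (k + 1) * `|w|.
    rewrite -(subrK ('D_w F (x t0)) ('D_w F (x t))); apply: le_trans (ler_normD _ _) _.
    by have := h w; lra.
  move/le_trans; apply; rewrite ler_wpM2r //.
  by rewrite -[leLHS]invrK lef_pV2 ?posrE ?invr_gt0 ?addr_gt0 // ltW.
by move=> d d0 h; exists d^-1 => //; rewrite invr_ge0 ltW.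
Unshelve. all: by end_near. Qed.

(** First-order Taylor expansion with an error uniform along the whole trajectory, on a tube of
    constant width that stays in the domain. *)
Lemma solution_taylor a b x e : solution a b x -> 0 < e ->
  exists2 d : R, 0 < d & forall t : R, a <= t <= b -> forall z, `|z - x t| < d ->
    W z /\ `|F z - F (x t) - 'D_(z - x t) F (x t)| <= e * `|z - x t|.
Proof.
move=> xS e0; apply: segment_uniform => t0 t0ab; have [Wx _] := xS t0 t0ab.
have e2 : 0 < e / 2 by rewrite divr_gt0.
have [r r0 hr] := derive_operator_continuous oW FS Wx e2.
have [r' r'0 hr'] := strict_differentiability oW FS Wx e2.
have rr0 : 0 < Num.min r r' / 2 by rewrite divr_gt0 // lt_min r0.
exists (Num.min r r' / 2) => //.
near=> t => d /andP[d0 dr] z zx.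
have xt : `|x t - x t0| < Num.min r r' / 2 by near: t; apply: solution_near xS _ _ _.
have zt : `|z - x t0| < Num.min r r'.
  by rewrite -(subrK (x t) z) -addrA; apply: le_lt_trans (ler_normD _ _) _; lra.
have {}xt : `|x t - x t0| < Num.min r r' by lra.
move: zt xt; rewrite !lt_min => /andP[z1 z2] /andP[x1 x2].
have [_ h1] := hr' _ _ x2 z2; have [_ h2] := hr _ x1; have [Wz _] := hr' z z z2 z2.
split=> //.
have -> : F z - F (x t) - 'D_(z - x t) F (x t) = F z - F (x t) - 'D_(z - x t) F (x t0)
   - ('D_(z - x t) F (x t) - 'D_(z - x t) F (x t0)).
  by rewrite opprB addrA subrK.
by apply: le_trans (ler_normB _ _) _; have := h2 (z - x t); lra.
Unshelve. all: by end_near. Qed.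

Lemma derive_sumr m (z : 'rV[R]_n) k (a : 'I_k -> R) (w : 'I_k -> 'rV[R]_n) (G : 'rV[R]_n -> 'rV[R]_m) :
  differentiable G z -> 'D_(\sum_i a i *: w i) G z = \sum_i a i *: 'D_(w i) G z.
Proof.
move=> dG; rewrite deriveE // linear_sum; apply: eq_bigr => i _.
by rewrite linearZ /= deriveE.
Qed.

(** The predicate [I] says that the competing curve [y] still makes sense at a given time; for
    geodesics it will mean that the curve has not left the chart. As long as [y] remains in a tube
    around [x], Gronwall's inequality keeps it well inside, so [y] stays in the compact tube [K]
    and, by the closing condition on [I], never leaves. The constants do not depend on [y]. *)
Lemma solution_confinement T x : 0 <= T -> solution 0 T x ->
  exists (e C : R) (K : set 'rV[R]_n), [/\ 0 < e, 0 <= C, compact K, K `<=` W &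
    forall y (I : R -> Prop), I 0 -> C * `|y 0 - x 0| < e ->
    (forall t : R, 0 <= t <= T -> I t -> W (y t) /\ is_derive t 1 y (F (y t))) ->
    (forall t : R, 0 <= t < T -> I t -> \forall s \near t, I s) ->
    (forall t : R, 0 < t <= T -> (forall s : R, 0 <= s < t -> I s /\ K (y s)) -> I t) ->
    forall t : R, 0 <= t <= T -> I t /\ `|y t - x t| <= C * `|y 0 - x 0| ].
Proof.
move=> T0 xS; have [k k0 hk] := solution_derive_bound xS.
have [d d0 hd] := solution_taylor xS ltr01.
have [C C0 hC] := @gronwall R n (k + 1) T (addr_ge0 k0 ler01) T0.
pose e := d / 2; have e0 : 0 < e by rewrite divr_gt0.
pose K := [set z | exists2 t, 0 <= t <= T & `|z - x t| <= e].
exists e, (C + 1), K; split=> //; first by rewrite addr_ge0.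
- pose B := [set v : 'rV[R]_n | `|v| <= e].
  have cB : compact B.
    apply: bounded_closed_compact.
      by exists e; split; [exact: num_real|move=> M eM v /= h; apply: le_trans h (ltW eM)].
    rewrite (_ : B = Num.Def.normr @^-1` [set t | t <= e]) //.
    by apply: closed_comp => [? _|]; [exact: norm_continuous|exact: closed_le].
  pose f (p : R * 'rV[R]_n) := x p.1 + p.2.
  have -> : K = f @` (`[0, T] `*` B).
    apply/seteqP; split=> [z [t t0T zt]|z [[t v] /= [+ vB] <-]].
      exists (t, z - x t) => /=; last by rewrite /f /= addrC subrK.
      by split => //=; rewrite in_itv.
    rewrite in_itv /= => t0T; exists t => //; by rewrite /f /= addrC addKr.
  apply: continuous_compact; last first.
    by apply: compact_setX => //; exact: segment_compact.
  apply: continuous_in_subspaceT => -[t v]; rewrite inE /= => -[+ _] /=.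
  rewrite in_itv /= => t0T; apply: (@cvgD _ 'rV[R]_n _ _ _ (fun p : R * 'rV[R]_n => x p.1) snd).
    apply: (@continuous_comp _ _ _ (fst : R * 'rV[R]_n -> R) x (t, v)); first exact: cvg_fst.
    exact: solution_continuous xS _ t0T.
  exact: cvg_snd.
- move=> z [t t0T zt]; have [] := hd t t0T z; last by [].
  by apply: le_lt_trans zt _; rewrite /e; lra.
move=> y I I0 ye yS Io Ic.
have G t : 0 <= t <= T -> (forall s : R, 0 <= s <= t -> I s /\ `|y s - x s| < d) ->
    `|y t - x t| <= C * `|y 0 - x 0|.
  move=> t0T h.
  have := hC (y \- x) (fun s => F (y s) - F (x s)) 0 t (lexx 0) t0T; rewrite addr0; apply.
    move=> s s0t; have s0T : 0 <= s <= T by move: s0t t0T; lra.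
    have [Is _] := h s s0t; have [_ dy] := yS s s0T Is; have [_ dx] := xS s s0T.
    exact: is_deriveB.
  move=> s s0t; have s0T : 0 <= s <= T by move: s0t t0T; lra.
  have [Is ds] := h s s0t; have [_ h1] := hd s s0T _ ds; have h2 := hk s s0T (y s - x s).
  rewrite addr0 -(subrK ('D_(y s - x s) F (x s)) (F (y s) - F (x s))).
  by apply: le_trans (ler_normD _ _) _ => /=; lra.
have y0 := normr_ge0 (y 0 - x 0).
have Q : forall t : R, 0 <= t <= T -> I t /\ `|y t - x t| < e.
  apply: real_induction => t t0T.
    move=> h; move: (t0T) => /andP[]; rewrite le_eqVlt => /orP[/eqP <- _|t0 tT].
      by split=> //; apply: le_lt_trans ye; rewrite ler_peMl // lerDr.
    have It : I t.
      apply: Ic; rewrite ?t0 // => s s0t; have [Is ds] := h s s0t; split=> //.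
      by exists s; [move: s0t tT; lra|exact: ltW].
    have ct : {for t, continuous (fun s => `|y s - x s|)}.
      apply: (@continuous_comp _ _ _ (fun s => y s - x s) Num.Def.normr); last exact: norm_continuous.
      apply: cvgB; last exact: solution_continuous xS _ t0T.
      by have [_ /is_derive_continuous] := yS t t0T It.
    have yte : `|y t - x t| <= e by apply: (limit_le t0 ct) => s /h [_ /ltW].
    split=> //; apply: le_lt_trans ye; rewrite mulrDl mul1r; apply: ler_wpDr => //; apply: G => // s /andP[s0].
    rewrite le_eqVlt => /orP[/eqP ->|st]; first by split=> //; rewrite /e in yte; lra.
    have [|Is ds] := h s; first by rewrite s0.
    by split=> //; rewrite /e in ds; lra.
  move=> [It yt]; have t0T' : 0 <= t <= T by move: t0T; lra.
  have ct : {for t, continuous (fun s => y s - x s)}.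
    apply: cvgB; last exact: solution_continuous xS _ t0T'.
    by have [_ /is_derive_continuous] := yS t t0T' It.
  have e1 : 0 < (e - `|y t - x t|) / 2 by rewrite divr_gt0 // subr_gt0.
  have H : \forall s \near t, I s /\ `|(y s - x s) - (y t - x t)| <= (e - `|y t - x t|) / 2.
    exact: (filterI (Io _ t0T It) (continuous_near_le ct e1)).
  have /near_normP [r r0 hr] := H; exists r => // s /andP[ts sr] sT.
  have [|Is hs] := hr s; first by rewrite gtr0_norm ?subr_gt0 //; lra.
  split=> //; rewrite -(subrK (y t - x t) (y s - x s)); apply: le_lt_trans (ler_normD _ _) _; lra.
move=> t t0T; have [It _] := Q t t0T; split=> //.
rewrite mulrDl mul1r; apply: ler_wpDr => //; apply: G => // s s0t.
have [|Is ds] := Q s; first by move: s0t t0T; lra.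
by split=> //; rewrite /e in ds; lra.
Qed.

(** A linear combination of deviations satisfies the linearized equation up to a second-order Taylor
    error. If it vanishes at time 0, Gronwall's inequality leaves only that error. Dependence on the
    initial condition is thus seen to be linear to first order without solving the linearized
    equation. *)
Lemma solution_combination T x C : 0 <= T -> 0 <= C -> solution 0 T x -> forall e : R, 0 < e ->
  exists2 d : R, 0 < d & forall k (a : 'I_k -> R) (y : 'I_k -> R -> 'rV[R]_n),
    (forall i, solution 0 T (y i)) -> (forall i, `|y i 0 - x 0| < d) ->
    (forall i t, 0 <= t <= T -> `|y i t - x t| <= C * `|y i 0 - x 0|) ->
    \sum_i a i *: (y i 0 - x 0) = 0 ->
    forall t : R, 0 <= t <= T ->
    `|\sum_i a i *: (y i t - x t)| <= e * \sum_i `|a i| * `|y i 0 - x 0|.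
Proof.
move=> T0 C0 xS e e0; have [k k0 hk] := solution_derive_bound xS.
have [G G0 hG] := @gronwall R n k T k0 T0.
(* The Taylor error is multiplied by the Lipschitz constant [C] of the flow and then by the Gronwall
   constant [G]. *)
pose e' := e / ((C + 1) * (G + 1)).
have CG : 0 < (C + 1) * (G + 1) by rewrite mulr_gt0 ?ltr_wpDl.
have e'0 : 0 < e' by rewrite divr_gt0.
have [d d0 hd] := solution_taylor xS e'0.
exists (d / (C + 1)); first by rewrite divr_gt0 ?ltr_wpDl.
move=> m a y yS yd yC ya t t0T.
pose S := \sum_i `|a i| * `|y i 0 - x 0|.
have S0 : 0 <= S by apply: sumr_ge0 => i _; rewrite mulr_ge0.
have := hG (fun t => \sum_i a i *: (y i t - x t)) (fun t => \sum_i a i *: (F (y i t) - F (x t)))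
  (e' * C * S) t; rewrite ya normr0 add0r => /(_ _ t0T) h.
apply: le_trans (h _ _ _) _.
- by apply: mulr_ge0 => //; apply: mulr_ge0 => //; exact: ltW.
- move=> s s0t; have s0T : 0 <= s <= T by move: s0t t0T; lra.
  rewrite (_ : (fun _ => _) = \sum_i (fun t => a i *: (y i t - x t))); last first.
    by apply/funext => r; rewrite fct_sumE.
  apply: is_derive_sum => i; apply: is_deriveZ.
  have [_ dy] := yS i s s0T; have [_ dx] := xS s s0T; exact: is_deriveB.
- move=> s s0t; have s0T : 0 <= s <= T by move: s0t t0T; lra.
  have [Wx _] := xS s s0T.
  have -> : \sum_i a i *: (F (y i s) - F (x s)) =
    \sum_i a i *: (F (y i s) - F (x s) - 'D_(y i s - x s) F (x s)) + 'D_(\sum_i a i *: (y i s - x s)) F (x s).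
    rewrite derive_sumr; last exact: dF.
    by rewrite -big_split /=; apply: eq_bigr => i _; rewrite -scalerDr subrK.
  apply: le_trans (ler_normD _ _) _; rewrite addrC; apply: lerD; first exact: hk.
  apply: le_trans (ler_norm_sum _ _ _) _; rewrite /S mulr_sumr; apply: ler_sum => i _.
  rewrite normrZ mulrCA ler_wpM2l //.
  have yc := yC i s s0T.
  have [|_ h1] := hd s s0T (y i s).
    apply: le_lt_trans yc _; apply: (@le_lt_trans _ _ ((C + 1) * `|y i 0 - x 0|)).
      by rewrite ler_wpM2r // lerDl.
    by rewrite mulrC -ltr_pdivlMr ?ltr_wpDl.
  by have := ler_wpM2l (ltW e'0) yc; lra.
rewrite -/S mulrA ler_wpM2r //.
have E : e' * ((C + 1) * (G + 1)) = e by rewrite /e' divfK ?gt_eqF.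
have h2 : G * C <= (C + 1) * (G + 1) by nra.
by have := ler_wpM2l (ltW e'0) h2; lra.
Qed.
End Solutions.

(** * Smooth dependence on initial conditions *)

Section ApproximatelyLinear.
Variables (R : realType).

Lemma rV_linear_continuous m (V : normedModType R) (L : {linear 'rV[R]_m -> V}) : continuous L.
Proof.
move=> x; rewrite (_ : (L : _ -> _) = fun u : 'rV[R]_m => \sum_j u 0 j *: L (delta_mx 0 j)); last first.
  apply/funext => u; rewrite [in LHS](row_sum_delta u) linear_sum.
  by apply: eq_bigr => j _; rewrite linearZ.
have h j : Ck 0 setT (fun u : 'rV[R]_m => u 0 j *: L (delta_mx 0 j)).
  move=> y _; apply: (@continuous_comp _ _ _ (fun u : 'rV[R]_m => u 0 j : R^o) (fun t : R^o => (t : R) *: L (delta_mx 0 j))).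
    exact: (@coord_continuous _ _ _ 0 j y).
  exact: scalel_continuous.
have H := @Ck_sum R 'rV[R]_m V 0 setT 'I_m (index_enum _) xpredT _ openT (fun j _ => h j).
exact: (H x).
Qed.

Lemma derivable_eps (V W : normedModType R) (g : V -> W) z v (e : R) :
  derivable g z v -> 0 < e ->
  \forall h \near (0 : R)^', `|h^-1 *: (g (h *: v + z) - g z) - 'D_v g z| <= e.
Proof. by move=> dg e0; move/cvgrPdistC_le : dg => /(_ e e0); exact. Qed.

(** No candidate for the differential is required: combinations of two points show that difference
    quotients along an axis are Cauchy, and combinations of m + 1 points then compare a general
    increment with the axis increments. *)
Lemma approximately_linear_differentiable m n (g : 'rV[R]_m -> 'rV[R]_n) z0 :
  (forall e : R, 0 < e -> exists2 d : R, 0 < d & forall k (a : 'I_k -> R) (u : 'I_k -> 'rV[R]_m),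
     (forall i, `|u i - z0| < d) -> \sum_i a i *: (u i - z0) = 0 ->
     `|\sum_i a i *: (g (u i) - g z0)| <= e * \sum_i `|a i| * `|u i - z0|) ->
  differentiable g z0.
Proof.
move=> H.
have nd (h : R) (j : 'I_m) : `|h *: delta_mx 0 j : 'rV[R]_m| <= `|h|.
  apply: mx_norm_le => // i k; rewrite !mxE normrM ler_piMr //.
  by case: eqP; case: eqP; rewrite ?normr1 ?normr0.
have ax (h : R) (j : 'I_m) : h *: delta_mx 0 j + z0 - z0 = h *: delta_mx 0 j.
  by rewrite addrK.
have der (j : 'I_m) : derivable g z0 (delta_mx 0 j).
  apply: cauchy_cvg; apply: cauchy_exP => e e0.
  have e3 : 0 < e / 3 by rewrite divr_gt0.
  have [d d0 hd] := H _ e3.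
  pose q (h : R) := h^-1 *: (g (h *: delta_mx 0 j + z0) - g z0).
  pose k := d / 2; have k0 : 0 < k by rewrite divr_gt0.
  exists (q k); suff : \forall h \near (0 : R)^', ball (q k) e (q h) by [].
  near=> h; rewrite -ball_normE /=.
  have h0 : h != 0 by near: h; exact: nbhs_dnbhs_neq.
  have hlt : `|h| < d by near: h; exact: dnbhs0_lt.
  (* These coefficients annihilate the two increments [k] and [h] along axis [j]; the resulting
     combination of values is the difference of the two difference quotients. *)
  pose a (i : 'I_2) : R := if i == 0 then k^-1 else - h^-1.
  pose u (i : 'I_2) : 'rV[R]_m := if i == 0 then k *: delta_mx 0 j + z0 else h *: delta_mx 0 j + z0.
  have := hd 2%N a u; rewrite !big_ord_recl !big_ord0 !addr0 /a /u /= !ax.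
  rewrite !scalerA mulVf ?gt_eqF // mulNr mulVf // scale1r scaleN1r subrr.
  move=> /(_ _ erefl) -h1.
  rewrite /q -[X in _ - X]/(_) -scaleNr.
  apply: le_lt_trans (h1 _) _.
    move=> i; case: ifP => _; rewrite ax; apply: le_lt_trans (nd _ _) _ => //.
    by rewrite gtr0_norm // /k; lra.
  rewrite normrN !normfV.
  have hk (t : R) : t != 0 -> `|t|^-1 * `|t *: delta_mx 0 j : 'rV[R]_m| <= 1.
    by move=> t0; rewrite ler_pdivrMl ?normr_gt0 // mulr1.
  have h2 := hk k (lt0r_neq0 k0); have h3 := hk h h0.
  by nra.
pose A : 'M[R]_(m, n) := \matrix_(j, i) ('D_(delta_mx 0 j) g z0) 0 i.
pose L : {linear 'rV[R]_m -> 'rV[R]_n} := mulmxr A.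
have LE u : L u = \sum_j u 0 j *: 'D_(delta_mx 0 j) g z0.
  apply/rowP => i; rewrite mxE summxE; apply: eq_bigr => j _; by rewrite !mxE.
have [] // := @eps_differentiable _ _ _ g z0 L (@rV_linear_continuous _ _ L).
move=> e e0; pose e' := e / (1 + 2 * m%:R).
have e'0 : 0 < e' by rewrite divr_gt0 // ltr_pwDl // mulr_ge0.
have [d d0 hd] := H _ e'0.
apply/near_normP; exists d => // u ud.
have [h [h0 hlt hh]] : exists h : R, [/\ h != 0, `|h| < d &
   forall j : 'I_m, `|h^-1 *: (g (h *: delta_mx 0 j + z0) - g z0) - 'D_(delta_mx 0 j) g z0| <= e'].
  apply: (@filter_ex _ (0 : R)^'); near=> h; split.
  - near: h; exact: nbhs_dnbhs_neq.
  - near: h; exact: dnbhs0_lt.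
  - near: h; apply: filter_forall => j; exact: derivable_eps.
pose v := u - z0.
(* Index 0 carries the increment [v] itself; the others carry a common small step [h] along each
   axis, weighted so that the total increment vanishes. *)
pose a (i : 'I_m.+1) : R := if unlift ord0 i is Some j then - v 0 j / h else 1.
pose w (i : 'I_m.+1) : 'rV[R]_m := if unlift ord0 i is Some j then h *: delta_mx 0 j + z0 else u.
have := hd m.+1 a w; rewrite !big_ord_recl /a /w !unlift_none scale1r normr1 mul1r.
under eq_bigr do rewrite liftK ax scalerA divfK // scaleNr.
under [X in `|_ + X|]eq_bigr do rewrite liftK -scalerA scaleNr.
under [X in _ -> _ <= e' * (_ + X)]eq_bigr do rewrite liftK ax.
rewrite !sumrN -row_sum_delta subrr => /(_ _ erefl) h1.
rewrite scale1r in h1.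
rewrite (_ : g u - g z0 - L (u - z0) =
  (g u - g z0 - \sum_j v 0 j *: (h^-1 *: (g (h *: delta_mx 0 j + z0) - g z0)))
  + \sum_j v 0 j *: (h^-1 *: (g (h *: delta_mx 0 j + z0) - g z0) - 'D_(delta_mx 0 j) g z0)); last first.
  under [X in _ = _ + X]eq_bigr do rewrite scalerBr.
  by rewrite sumrB addrA subrK LE.
apply: le_trans (ler_normD _ _) _.
have s1 : \sum_j `|- v 0 j / h| * `|h *: delta_mx 0 j : 'rV[R]_m| <= m%:R * `|v|.
  apply: (@le_trans _ _ (\sum_(j < m) `|v|)); last by rewrite sumr_const card_ord mulr_natl.
  apply: ler_sum => j _; rewrite normrM normrN normfV -mulrA.
  apply: (@le_trans _ _ (`|v 0 j| * 1)); last by rewrite mulr1 mx_coord_le.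
  by rewrite ler_wpM2l // ler_pdivrMl ?normr_gt0 // mulr1.
have s2 : `|\sum_j v 0 j *: (h^-1 *: (g (h *: delta_mx 0 j + z0) - g z0) - 'D_(delta_mx 0 j) g z0)| <= m%:R * (`|v| * e').
  apply: le_trans (ler_norm_sum _ _ _) _.
  apply: (@le_trans _ _ (\sum_(j < m) `|v| * e')); last by rewrite sumr_const card_ord mulr_natl.
  by apply: ler_sum => j _; rewrite normrZ ler_pM // mx_coord_le.
have s3 : `|g u - g z0 - \sum_j v 0 j *: (h^-1 *: (g (h *: delta_mx 0 j + z0) - g z0))| <= e' * (`|v| + m%:R * `|v|).
  apply: le_trans (h1 _) _; last by rewrite ler_pM2l // lerD2l.
  move=> i; case: (unlift _ _) => [j|//]; rewrite ax; exact: le_lt_trans (nd _ _) _.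
have E : e' * (1 + 2 * m%:R) = e by rewrite /e' divfK // gt_eqF // ltr_pwDl // mulr_ge0.
by rewrite -E -/v; lra.
Unshelve. all: by end_near. Qed.
End ApproximatelyLinear.

Lemma le_dist_approx (R : realType) (V : normedModType R) (x y x' y' : V) (B e : R) :
  `|x' - y'| <= B -> `|x' - x| <= e / 2 -> `|y' - y| <= e / 2 -> `|x - y| <= B + e.
Proof.
move=> h1 h2 h3.
have -> : x - y = (x - x') + (x' - y') + (y' - y) by rewrite !addrA !subrK.
apply: le_trans (ler_normD _ _) _; apply: le_trans (lerD (ler_normD _ _) (lexx _)) _.
by rewrite (distrC x); lra.
Qed.

Lemma near_dist_le (R : realType) (t d : R) : 0 < d -> \forall s \near t, `|s - t| <= d.
Proof. by move=> d0; apply: (@continuous_near_le _ _ R^o id t d) => //; exact: cvg_id. Qed.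

Lemma is_derive_scalel (R : realType) (V : normedModType R) (w : V) (u : R) :
  is_derive u 1 (fun s : R => s *: w) w.
Proof.
apply: DeriveDef; first by apply: diff_derivable.
by rewrite deriveE // diff_val scale1r.
Qed.

Lemma subrACAB (V : zmodType) (a b c d : V) : a - b - (c - d) = (a - c) - (b - d).
Proof. by rewrite !opprB addrACA [RHS]addrACA [- b - c]addrC. Qed.

Lemma product_half_bound (R : realType) (e' x B e : R) : 0 < e' -> x <= B ->
  e' * (2 * (B + 1)) = e -> e' * x <= e / 2.
Proof. by move=> ? ? <-; nra. Qed.

Lemma product_half_bound' (R : realType) (x y K B e : R) : 0 <= K -> 0 <= B -> 0 <= x ->
  x <= e / (2 * (K + 1) * (B + 1)) -> y <= B * x -> K * y <= e / 2.
Proof.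
move=> K0 B0 x0; rewrite ler_pdivlMr ?mulr_gt0 // ?ltr_wpDl // => h1 h2.
have h3 := ler_wpM2l K0 h2; nra.
Qed.

Lemma combine_error_bounds (R : realType) (A D K q e' c e : R) :
  A <= e' * c -> D <= K * q -> K * q <= K * e' -> e' * (c + K + 1) = e -> 0 < e' ->
  A + D <= e.
Proof. by move=> ? ? ? <- ?; lra. Qed.

(** * Differentiability of flows in the initial condition *)

Section Flows.
Variables (R : realType).

(** Only an assignment of a solution to each initial value, with no continuity in [z] and no group
    law: both the regularity proved below and the use with geodesics start from this. *)
Definition flow n (W : set 'rV[R]_n) (F : 'rV[R]_n -> 'rV[R]_n) (N : set 'rV[R]_n)
    (al be : R) (phi : 'rV[R]_n -> R -> 'rV[R]_n) :=
  forall z, N z -> phi z 0 = z /\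
    forall t : R, al < t < be -> W (phi z t) /\ is_derive t 1 (phi z) (F (phi z t)).

Lemma derive_dirB (V W : normedModType R) (f : V -> W) x u v : differentiable f x ->
  'D_(u - v) f x = 'D_u f x - 'D_v f x.
Proof. by move=> df; rewrite !deriveE // linearB. Qed.

Lemma derive_dirZ (V W : normedModType R) (f : V -> W) x (a : R) v : differentiable f x ->
  'D_(a *: v) f x = a *: 'D_v f x.
Proof. by move=> df; rewrite !deriveE // linearZ. Qed.

Lemma derive_dirD (V W : normedModType R) (f : V -> W) x u v : differentiable f x ->
  'D_(u + v) f x = 'D_u f x + 'D_v f x.
Proof. by move=> df; rewrite !deriveE // linearD. Qed.

Lemma eps_is_derive (V : normedModType R) (f : R -> V) (t : R) D :
  (forall e : R, 0 < e -> \forall s \near t, `|f s - f t - (s - t) *: D| <= e * `|s - t|) ->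
  is_derive t 1 f D.
Proof.
move=> h.
have L : linear (fun s : R => s *: D) by move=> a u v; rewrite scalerDl -scalerA.
pose LM := GRing.isLinear.Build _ _ _ _ _ L.
pose L' : {linear R -> V} := HB.pack (fun s : R => s *: D) LM.
have cL : continuous L' by exact: scalel_continuous.
have [d dE] := eps_differentiable cL h.
apply: DeriveDef; first exact: diff_derivable.
by rewrite deriveE // dE /= scale1r.
Qed.

Lemma vector_mvt_abs n (f df : R -> 'rV[R]_n) (a b B : R) :
  (forall t : R, a <= t <= b -> is_derive t 1 f (df t)) ->
  (forall t : R, a <= t <= b -> `|df t| <= B) ->
  forall s t, a <= s <= b -> a <= t <= b -> `|f s - f t| <= B * `|s - t|.
Proof.
move=> hf hB.
suff H s t : a <= s <= b -> a <= t <= b -> s <= t -> `|f s - f t| <= B * `|s - t|.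
  move=> s t sab tab; case: (leP s t) => st; first exact: H.
  by rewrite distrC (distrC s); apply: H => //; exact: ltW.
move=> sab tab st; rewrite distrC (distrC s) (@ger0_norm _ (t - s)) ?subr_ge0 //.
apply: (@vector_mvt _ _ f df) => // r rst; [apply: hf|apply: hB]; move: rst sab tab; lra.
Qed.

Lemma is_derive_opp (V : normedModType R) (f : R -> V) (t : R) D :
  is_derive (- t) 1 f D -> is_derive t 1 (fun s => f (- s)) (- D).
Proof.
move=> h; have df : differentiable f (- t) by apply/derivable1_diffP; case: h.
have dn : is_derive t (1 : R) (fun s : R => - s) (- 1) by apply: is_deriveN.
apply: (is_derive_congr (is_derive_comp dn df)) => //.
by rewrite deriveE // linearN /= -deriveE //; case: h => _ ->.
Qed.

Section OneFlow.
Variables (n : nat) (W : set 'rV[R]_n) (F : 'rV[R]_n -> 'rV[R]_n).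
Variables (N : set 'rV[R]_n) (al be : R) (phi : 'rV[R]_n -> R -> 'rV[R]_n).
Hypotheses (oW : open W) (FS : Ck 1 W F) (oN : open N) (fl : flow W F N al be phi).

Lemma flow_combination_forward (T : R) z0 : al < 0 -> 0 <= T < be -> N z0 -> exists C : R, 0 <= C /\
  forall e : R, 0 < e -> exists2 d : R, 0 < d & (forall u, `|u - z0| < d -> N u /\
       forall t : R, 0 <= t <= T -> `|phi u t - phi z0 t| <= C * `|u - z0|) /\
    forall k (a : 'I_k -> R) (u : 'I_k -> 'rV[R]_n),
     (forall i, `|u i - z0| < d) -> \sum_i a i *: (u i - z0) = 0 ->
     forall t : R, 0 <= t <= T ->
     `|\sum_i a i *: (phi (u i) t - phi z0 t)| <= e * \sum_i `|a i| * `|u i - z0|.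
Proof.
move=> al0 /andP[T0 Tb] Nz0.
have sol z : N z -> solution W F 0 T (phi z).
  by move=> /fl [_ h] t tT; apply: h; move: tT; lra.
have [e1 [C [K [e10 C0 _ _ HK]]]] := solution_confinement oW FS T0 (sol _ Nz0).
have [r r0 hr] := (near_normP _ _).1 (open_nbhs_nbhs (conj oN Nz0)).
have Lip u : N u -> C * `|u - z0| < e1 -> forall t : R, 0 <= t <= T -> `|phi u t - phi z0 t| <= C * `|u - z0|.
  move=> Nu ue t tT; have := HK (phi u) (fun=> True) I.
  rewrite (fl Nu).1 (fl Nz0).1 => /(_ ue) HK'.
  apply: (HK' _ _ _ t tT).2 => // [s sT _|s _ _]; [exact: sol|exact: filterT].
exists C; split=> // e e0.
have [d d0 hd] := solution_combination oW FS T0 C0 (sol _ Nz0) e0.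
pose d' := Num.min d (Num.min r (e1 / (C + 1))).
have C1 : 0 < C + 1 by rewrite ltr_wpDl.
have d'0 : 0 < d' by rewrite !lt_min d0 r0 divr_gt0.
have D u : `|u - z0| < d' -> [/\ `|u - z0| < d, N u & C * `|u - z0| < e1].
  rewrite !lt_min => /and3P[ud /hr Nu]; rewrite ltr_pdivlMr // => ue; split=> //.
  by have := normr_ge0 (u - z0); lra.
exists d' => //; split=> [u /D [_ Nu ue]|k a u ud ua t tT]; first by split=> //; exact: Lip.
have E i : phi (u i) 0 = u i by have [_ Nu _] := D _ (ud i); exact: (fl Nu).1.
have E0 : phi z0 0 = z0 := (fl Nz0).1.
apply: le_trans (hd k a (fun i => phi (u i)) _ _ _ _ t tT) _.
- by move=> i; have [_ Nu _] := D _ (ud i); exact: sol.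
- by move=> i; rewrite E E0; have [] := D _ (ud i).
- by move=> i s sT; rewrite E E0; have [_ Nu ue] := D _ (ud i); exact: Lip.
- by rewrite -[RHS]ua; apply: eq_bigr => i _; rewrite E E0.
by rewrite ler_pM2l // E0; apply: ler_sum => i _; rewrite E.
Qed.
End OneFlow.

Lemma flow_opp n (W : set 'rV[R]_n) F N al be phi : flow W F N al be phi ->
  flow W (fun z => - F z) N (- be) (- al) (fun z t => phi z (- t)).
Proof.
move=> fl z Nz; rewrite oppr0; have [-> h] := fl z Nz; split=> // t tab.
have [|Wz dz] := h (- t); first by lra.
split=> //; exact: is_derive_opp.
Qed.

Section OneFlow2.
Variables (n : nat) (W : set 'rV[R]_n) (F : 'rV[R]_n -> 'rV[R]_n).
Variables (N : set 'rV[R]_n) (al be : R) (phi : 'rV[R]_n -> R -> 'rV[R]_n).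
Hypotheses (oW : open W) (FS : Ck 1 W F) (oN : open N) (fl : flow W F N al be phi).

Lemma flow_combination (a b : R) z0 : al < 0 -> 0 < be -> al < a <= 0 -> 0 <= b < be -> N z0 -> exists C : R, 0 <= C /\
  forall e : R, 0 < e -> exists2 d : R, 0 < d & (forall u, `|u - z0| < d -> N u /\
       forall t : R, a <= t <= b -> `|phi u t - phi z0 t| <= C * `|u - z0|) /\
    forall k (c : 'I_k -> R) (u : 'I_k -> 'rV[R]_n),
     (forall i, `|u i - z0| < d) -> \sum_i c i *: (u i - z0) = 0 ->
     forall t : R, a <= t <= b ->
     `|\sum_i c i *: (phi (u i) t - phi z0 t)| <= e * \sum_i `|c i| * `|u i - z0|.
Proof.
move=> al0 be0 ha hb Nz0; have [C [C0 HC]] := flow_combination_forward oW FS oN fl al0 hb Nz0.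
have ha' : 0 <= - a < - al by lra.
have nb : - be < 0 by lra.
have [C' [C'0 HC']] := flow_combination_forward oW (CkN oW FS) oN (flow_opp fl) nb ha' Nz0.
exists (Num.max C C'); split=> [|e e0]; first by rewrite le_max C0.
have [d d0 [h1 h2]] := HC e e0; have [d' d'0 [h1' h2']] := HC' e e0.
exists (Num.min d d'); first by rewrite lt_min d0.
split=> [u|k c u ud uc t tab].
  rewrite lt_min => /andP[/h1 [Nu u1] /h1' [_ u2]]; split=> // t tab.
  case: (leP 0 t) => t0.
    have tb : 0 <= t <= b by lra.
    by apply: le_trans (u1 t tb) _; rewrite ler_wpM2r // le_max lexx.
  have ta : 0 <= - t <= - a by lra.
  have := u2 _ ta; rewrite !opprK => h; apply: le_trans h _.
  by rewrite ler_wpM2r // le_max lexx orbT.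
have ud1 i : `|u i - z0| < d by have := ud i; rewrite lt_min => /andP[].
have ud2 i : `|u i - z0| < d' by have := ud i; rewrite lt_min => /andP[].
case: (leP 0 t) => t0; first by apply: h2 => //; lra.
have ta : 0 <= - t <= - a by lra.
by have := h2' k c u ud2 uc _ ta; rewrite opprK.
Qed.

Lemma flow_differentiable z (t : R) : al < 0 -> 0 < be -> N z -> al < t < be -> differentiable (phi ^~ t) z.
Proof.
move=> al0 be0 Nz tab; apply: approximately_linear_differentiable => e e0.
have h1 : al < Num.min 0 t <= 0 by rewrite lt_min ge_min lexx; move: tab; lra.
have h2 : 0 <= Num.max 0 t < be by rewrite gt_max le_max lexx; move: tab; lra.
have [C [_ /(_ e e0) [d d0 [_ h]]]] := flow_combination al0 be0 h1 h2 Nz.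
exists d => // k a u ud ua; apply: h => //.
by rewrite ge_min le_max lexx !orbT.
Qed.

(** Exchange of the two derivatives. The difference quotients [q h] tend to [J] and their time
    derivatives [p h] tend to [G], both uniformly on a compact interval around [t]; since [G] is
    continuous at [t], the mean value inequality for [q h] passes to the limit and gives the
    derivative of [J]. *)
Lemma flow_derive z v (t : R) : al < 0 -> 0 < be -> N z -> al < t < be ->
  is_derive t 1 (fun s => 'D_v (phi ^~ s) z) ('D_('D_v (phi ^~ t) z) F (phi z t)).
Proof.
move=> al0 be0 Nz tab.
pose a := Num.min (al / 2) ((al + t) / 2); pose b := Num.max (be / 2) ((be + t) / 2).
have ha : al < a <= 0 by rewrite lt_min ge_min; move: tab; lra.
have hb : 0 <= b < be by rewrite gt_max le_max; move: tab; lra.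
have hat : a < t by rewrite gt_min; move: tab; lra.
have hbt : t < b by rewrite lt_max; move: tab; lra.
have [C [C0 HC]] := flow_combination al0 be0 ha hb Nz.
have sol u : N u -> solution W F a b (phi u).
  by move=> /fl [_ h] s sab; apply: h; move: sab ha hb; lra.
have [K K0 hK] := solution_derive_bound oW FS (sol _ Nz).
pose J s := 'D_v (phi ^~ s) z.
pose q h s := h^-1 *: (phi (h *: v + z) s - phi z s).
have dJ s : a <= s <= b -> derivable (phi ^~ s) z v.
  by move=> sab; apply: diff_derivable; apply: flow_differentiable => //; move: sab ha hb; lra.
pose V := `|v| + 1.
have V0 : 0 < V by rewrite ltr_wpDl.
have vV : `|v| <= V by rewrite /V lerDl.
have hv (h d : R) : `|h| < d / V -> `|h *: v + z - z| < d.
  rewrite ltr_pdivlMr // => hd; rewrite addrK normrZ; apply: le_lt_trans hd.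
  by rewrite ler_wpM2l.
have qJ e : 0 < e -> exists2 d : R, 0 < d & forall h : R, h != 0 -> `|h| < d ->
     forall s : R, a <= s <= b -> `|q h s - J s| <= e.
  move=> e0; pose e' := e / (2 * V + 1).
  have V1 : 0 < 2 * V + 1 by rewrite addr_gt0 // mulr_gt0.
  have e'0 : 0 < e' by rewrite divr_gt0.
  have [d d0 [_ hd]] := HC e' e'0.
  exists (d / V) => [|h h0 hlt s sab]; first by rewrite divr_gt0.
  have [k [k0 klt kJ]] : exists k : R, [/\ k != 0, `|k| < d / V & `|q k s - J s| <= e'].
    apply: (@filter_ex _ (0 : R)^'); near=> k; split.
    - near: k; exact: nbhs_dnbhs_neq.
    - near: k; apply: dnbhs0_lt; by rewrite divr_gt0.
    - near: k; exact: (derivable_eps (dJ s sab) e'0).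
  (* The quotient at step [h] is compared with one at an auxiliary step [k], chosen close to the
     limit at the given time; the comparison error does not depend on [k] nor on time, whence
     uniformity. *)
  pose c (i : 'I_2) : R := if i == 0 then h^-1 else - k^-1.
  pose u (i : 'I_2) : 'rV[R]_n := if i == 0 then h *: v + z else k *: v + z.
  have := hd 2%N c u; rewrite !big_ord_recl !big_ord0 !addr0 /c /u /= !addrK.
  rewrite !scalerA mulVf // mulNr mulVf // scale1r scaleN1r subrr => /(_ _ erefl s sab).
  rewrite !big_ord_recl !big_ord0 !addr0 /= => h1.
  rewrite -(subrK (q k s) (q h s)) -addrA; apply: le_trans (ler_normD _ _) _.
  have {}h1 : `|q h s - q k s| <= e' * (`|v| + `|v|).
    rewrite /q -[X in _ - X]/(_) -scaleNr; apply: le_trans (h1 _) _.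
      by move=> i; case: ifP => _; exact: hv.
    by rewrite normrN !normfV !normrZ !mulrA !mulVf ?normr_eq0 // !mul1r.
  have E : e' * (2 * V + 1) = e by rewrite /e' divfK // gt_eqF.
  by rewrite -E; have := ler_wpM2l (ltW e'0) vV; lra.
pose G s := 'D_(J s) F (phi z s).
pose p h s := h^-1 *: (F (phi (h *: v + z) s) - F (phi z s)).
have dq h s : N (h *: v + z) -> a <= s <= b -> is_derive s 1 (q h) (p h s).
  move=> Nh sab; apply: is_deriveZ; apply: is_deriveB.
    by have [] := sol _ Nh s sab.
  by have [] := sol _ Nz s sab.
have dF y : W y -> differentiable F y by case: FS => + _; exact.
have pG e : 0 < e -> exists2 d : R, 0 < d & forall h : R, h != 0 -> `|h| < d -> N (h *: v + z) /\
     forall s : R, a <= s <= b -> `|p h s - G s| <= e.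
  move=> e0; pose e' := e / (C * V + K + 1).
  have V1 : 0 < C * V + K + 1 by rewrite ltr_wpDl // addr_ge0 // mulr_ge0 // ltW.
  have e'0 : 0 < e' by rewrite divr_gt0.
  have [d d0 hd] := solution_taylor oW FS (sol _ Nz) e'0.
  have [d1 d10 hd1] := qJ e' e'0.
  have [d2 d20 [hd2 _]] := HC 1 ltr01.
  have C1 : 0 < C + 1 by rewrite ltr_wpDl.
  exists (Num.min d1 (Num.min (d2 / V) (d / (C + 1) / V))).
    by rewrite !lt_min d10 !divr_gt0.
  move=> h h0; rewrite !lt_min => /and3P[hlt1 /hv hlt2 /hv hlt].
  have [Nh Lh] := hd2 _ hlt2; split=> // s sab.
  have xh := Lh s sab; have [Wx _] := sol _ Nz s sab.
  have [|_ ht] := hd s sab (phi (h *: v + z) s).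
    apply: le_lt_trans xh _; move: hlt; rewrite ltr_pdivlMr // => hlt.
    by have := normr_ge0 (h *: v + z - z); lra.
  have -> : p h s - G s = h^-1 *: (F (phi (h *: v + z) s) - F (phi z s)
       - 'D_(phi (h *: v + z) s - phi z s) F (phi z s)) + 'D_(q h s - J s) F (phi z s).
    rewrite /p /G /q [X in _ = _ + X]derive_dirB; last exact: dF.
    rewrite derive_dirZ; last exact: dF.
    by rewrite [in RHS]scalerBr addrA subrK.
  apply: le_trans (ler_normD _ _) _; rewrite normrZ normfV.
  have h1 := hK s sab (q h s - J s); have h2 := hd1 h h0 hlt1 s sab.
  have h3 : `|h|^-1 * `|F (phi (h *: v + z) s) - F (phi z s) - 'D_(phi (h *: v + z) s - phi z s) F (phi z s)| <= e' * (C * V).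
    rewrite ler_pdivrMl ?normr_gt0 //; apply: le_trans ht _.
    apply: (@le_trans _ _ (e' * (C * `|h *: v + z - z|))); first by rewrite ler_pM2l.
    have h5 := ler_wpM2l C0 vV; have h6 : 0 <= e' * `|h| by rewrite mulr_ge0 // ltW.
    by rewrite addrK normrZ; have := ler_wpM2l h6 h5; lra.
  have E : e' * (C * V + K + 1) = e by rewrite /e' divfK // gt_eqF.
  exact: combine_error_bounds h3 h1 (ler_wpM2l K0 h2) E e'0.
pose B0 := C * V + 1.
have JB s : a <= s <= b -> `|J s| <= B0.
  move=> sab; have [d d0 hd] := qJ 1 ltr01; have [d2 d20 [hd2 _]] := HC 1 ltr01.
  pose h := Num.min d (d2 / V) / 2.
  have dd0 : 0 < Num.min d (d2 / V) by rewrite lt_min d0 divr_gt0.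
  have h0 : 0 < h by rewrite divr_gt0.
  have : `|h| < Num.min d (d2 / V) by rewrite gtr0_norm // /h; lra.
  rewrite lt_min => /andP[h1 /hv h2].
  have := hd h (lt0r_neq0 h0) h1 s sab; have [_ /(_ s sab) h3] := hd2 _ h2 => h4.
  rewrite -(subrK (q h s) (J s)); apply: le_trans (ler_normD _ _) _; rewrite distrC.
  have : `|q h s| <= C * V.
    rewrite normrZ normfV ler_pdivrMl ?normr_gt0 ?gt_eqF //; apply: le_trans h3 _.
    by rewrite addrK normrZ mulrCA ler_wpM2l // ler_wpM2l.
  by rewrite /B0; lra.
have B00 : 0 <= B0 by rewrite addr_ge0 // mulr_ge0 // ltW.
pose B1 := K * B0 + 1.
have B10 : 0 <= B1 by rewrite addr_ge0 // mulr_ge0.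
have GB s : a <= s <= b -> `|G s| <= K * B0.
  by move=> sab; apply: le_trans (hK s sab _) _; rewrite ler_wpM2l // JB.
have tab' : a <= t <= b by rewrite !ltW.
have small d1 d2 : 0 < d1 -> 0 < d2 -> exists h : R, [/\ h != 0, `|h| < d1 & `|h| < d2].
  move=> d10 d20; have m0 : 0 < Num.min d1 d2 by rewrite lt_min d10.
  exists (Num.min d1 d2 / 2); rewrite gt_eqF ?divr_gt0 //.
  rewrite gtr0_norm ?divr_gt0 //.
  have m1 : Num.min d1 d2 <= d1 by rewrite ge_min lexx.
  have m2 : Num.min d1 d2 <= d2 by rewrite ge_min lexx orbT.
  by split => //; lra.
have JL s : a <= s <= b -> `|J s - J t| <= B1 * `|s - t|.
  move=> sab; apply/ler_addgt0Pr => e e0; have e2 : 0 < e / 2 by rewrite divr_gt0.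
  have [d1 d10 hd1] := qJ _ e2; have [d2 d20 hd2] := pG 1 ltr01.
  have [h [h0 h1 h2]] := small _ _ d10 d20; have [Nh hp] := hd2 h h0 h2.
  have pb r : a <= r <= b -> `|p h r| <= B1.
    move=> rab; rewrite -(subrK (G r) (p h r)); apply: le_trans (ler_normD _ _) _.
    by rewrite /B1 addrC lerD // ?hp // GB.
  have := vector_mvt_abs (fun r rab => dq h r Nh rab) pb sab tab'.
  have := hd1 h h0 h1 s sab; have := hd1 h h0 h1 t tab' => qt qs m.
  exact: le_dist_approx m qs qt.
have Gc e : 0 < e -> \forall s \near t, `|G s - G t| <= e.
  move=> e0; pose e' := e / (2 * (B0 + 1)).
  have B01 : 0 < 2 * (B0 + 1) by rewrite mulr_gt0 // ltr_wpDl.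
  have e'0 : 0 < e' by rewrite divr_gt0.
  have [Wx _] := sol _ Nz t tab'.
  have [r r0 hr] := derive_operator_continuous oW FS Wx e'0.
  have d0 : 0 < e / (2 * (K + 1) * (B1 + 1)) by rewrite divr_gt0 // mulr_gt0 ?mulr_gt0 // ltr_wpDl.
  near=> s.
  have sab : a <= s <= b.
    rewrite !ltW //; near: s; [exact: lt_nbhsl|exact: lt_nbhsr].
  have [|_ h1] := hr (phi z s); first by near: s; exact: solution_near (sol _ Nz) tab' _ r0.
  have st : `|s - t| <= e / (2 * (K + 1) * (B1 + 1)).
    near: s; exact: near_dist_le d0.
  have -> : G s - G t = ('D_(J s) F (phi z s) - 'D_(J s) F (phi z t)) + 'D_(J s - J t) F (phi z t).
    by rewrite derive_dirB; [rewrite addrA subrK|exact: dF].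
  apply: le_trans (ler_normD _ _) _.
  have E : e' * (2 * (B0 + 1)) = e by rewrite /e' divfK // gt_eqF.
  rewrite (splitr e); apply: lerD.
    exact: le_trans (h1 _) (product_half_bound e'0 (JB s sab) E).
  exact: le_trans (hK t tab' _) (product_half_bound' K0 B10 (normr_ge0 _) st (JL s sab)).
apply: eps_is_derive => e e0.
have e2 : 0 < e / 2 by rewrite divr_gt0.
have /near_normP [r r0 hr] := Gc _ e2.
pose r' := Num.min (r / 2) (Num.min (t - a) (b - t)).
have r'0 : 0 < r' by rewrite !lt_min divr_gt0 //= !subr_gt0 hat.
have /andP[r'r /andP[r'a r'b]] : (r' <= r / 2) && ((r' <= t - a) && (r' <= b - t)).
  by rewrite -!le_min lexx.
apply/near_normP; exists r' => // s /ltW sr.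
have rr u : t - r' <= u <= t + r' -> (a <= u <= b) /\ `|G u - G t| <= e / 2.
  by move=> ur; split; [lra|apply: hr; rewrite ltr_norml; lra].
apply/ler_addgt0Pr => e' e'0; have e'2 : 0 < e' / 2 by rewrite divr_gt0.
have [d1 d10 hd1] := qJ _ e'2; have [d2 d20 hd2] := pG _ e2.
have [h [h0 h1 h2]] := small _ _ d10 d20; have [Nh hp] := hd2 h h0 h2.
have sr' : t - r' <= s <= t + r' by move: sr; rewrite ler_norml; lra.
have tr' : t - r' <= t <= t + r' by rewrite gerBl lerDl (ltW r'0).
have dqG u : t - r' <= u <= t + r' -> is_derive u 1 (fun u => q h u - u *: G t) (p h u - G t).
  move=> /rr [uab _]; apply: is_deriveB; first exact: dq.
  exact: is_derive_scalel.
have pb u : t - r' <= u <= t + r' -> `|p h u - G t| <= e.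
  move=> /rr [uab Gu]; rewrite -(subrK (G u) (p h u)) -addrA; apply: le_trans (ler_normD _ _) _.
  rewrite (splitr e); exact: lerD (hp u uab) Gu.
have m := vector_mvt_abs dqG pb sr' tr'.
have qs := hd1 h h0 h1 s (rr s sr').1; have qt := hd1 h h0 h1 t tab'.
rewrite -/(J s) -/(J t) -/(G t).
have -> : J s - J t - (s - t) *: G t = (J s - s *: G t) - (J t - t *: G t).
  by rewrite scalerBl subrACAB.
apply: (le_dist_approx m); rewrite subrACAB subrr subr0; [exact: qs|exact: qt].
Unshelve. all: by end_near. Qed.
End OneFlow2.

Lemma row_mx_linear n : exists L : {linear 'rV[R]_n -> 'rV[R]_(n + n)}, forall z, L z = row_mx z 0.
Proof.
exists (mulmxr (row_mx 1%:M 0)) => z.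
by rewrite /= mul_mx_row mulmx1 mulmx0.
Qed.

Lemma open_lsubmx n (W : set 'rV[R]_n) : open W -> open ((@lsubmx R 1 n n) @^-1` W).
Proof.
move=> oW; apply: open_comp => // z _.
exact/differentiable_continuous/differentiable_lsubmx.
Qed.

(** The tangent flow, pairing a trajectory with the derivative of the flow along it, is again a
    flow, for the tangent vector field. *)
Lemma flow_double n (W : set 'rV[R]_n) F N al be phi : open W -> smooth W F -> open N ->
  al < 0 -> 0 < be -> flow W F N al be phi ->
  flow (lsubmx @^-1` W) (fun z => row_mx (F (lsubmx z)) ('D_(rsubmx z) F (lsubmx z)))
    (lsubmx @^-1` N) al be
    (fun z t => row_mx (phi (lsubmx z) t) ('D_(rsubmx z) (phi ^~ t) (lsubmx z))).
Proof.
move=> oW FS oN al0 be0 fl z Nz; split.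
  rewrite (fl _ Nz).1 -[RHS]hsubmxK; congr row_mx.
  transitivity ('D_(rsubmx z) id (lsubmx z)); last by rewrite derive_id.
  apply: near_eq_derive; apply: filterS (open_nbhs_nbhs (conj oN Nz)) => y Ny.
  by rewrite (fl _ Ny).1.
move=> t tab; have [Wp dp] := (fl _ Nz).2 t tab.
rewrite /= row_mxKl row_mxKr; split=> //.
have dD := flow_derive oW (FS 1%N) oN fl (rsubmx z) al0 be0 Nz tab.
apply/is_derive_mxP => i j; rewrite mxE; case: split_ordP => k ->.
  move/is_derive_mxP : dp => /(_ i k) h; apply: (is_derive_congr h) => // s.
  by rewrite row_mxEl.
move/is_derive_mxP : dD => /(_ i k) h; apply: (is_derive_congr h) => // s.
by rewrite row_mxEr.
Qed.

(** Induction on the class, for all systems at once: a directional derivative of the flow is a block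
    of the tangent flow, to which the induction hypothesis applies in twice the dimension. *)
Theorem flow_smooth n (W : set 'rV[R]_n) F N al be phi : open W -> smooth W F -> open N ->
  al < 0 -> 0 < be -> flow W F N al be phi ->
  forall t : R, al < t < be -> smooth N (phi ^~ t).
Proof.
move=> oW FS oN al0 be0 fl t tab k.
elim: k n W F N phi oW FS oN fl => [|k IH] n W F N phi oW FS oN fl.
  by move=> z Nz; apply: differentiable_continuous; exact: (flow_differentiable oW (FS 1%N) oN fl al0 be0 Nz tab).
have dphi z : N z -> differentiable (phi ^~ t) z.
  by move=> Nz; exact: (flow_differentiable oW (FS 1%N) oN fl al0 be0 Nz tab).
split=> // v.
have [L LE] := @row_mx_linear n.
have F2S : smooth (lsubmx @^-1` W) (fun z : 'rV[R]_(n + n) => row_mx (F (lsubmx z)) ('D_(rsubmx z) F (lsubmx z))).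
  apply: smooth_row_mx; first exact: open_lsubmx.
    apply: (@smooth_comp _ _ _ _ _ _ W (fun z : 'rV[R]_(n+n) => lsubmx z)) => //; first exact: open_lsubmx.
    by move=> m; apply: Ck_linear; exact: rV_linear_continuous.
  exact: smooth_joint_derive.
have := IH _ _ _ _ _ (open_lsubmx oW) F2S (open_lsubmx oN) (flow_double oW FS oN al0 be0 fl).
move=> h.
have h2 := Ck_comp_affine (@rV_linear_continuous _ _ _ L) oN _ h.
have {h2}h2 : Ck k N (fun x => (fun z : 'rV[R]_(n+n) => row_mx (phi (lsubmx z) t) ('D_(rsubmx z) (phi ^~ t) (lsubmx z))) (L x + row_mx 0 v)).
  by apply: h2 => x Nx; rewrite /= LE add_row_mx addr0 row_mxKl.
apply/Ck_mxP => // i j; have := (Ck_mxP _ _ oN).1 h2 i (rshift n j).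
apply: eq_Ck => // x Nx; rewrite row_mxEr LE add_row_mx addr0 add0r row_mxKl row_mxKr.
by [].
Qed.
End Flows.

(** * The inverse function theorem *)

Section MatrixSmooth.
Variables (R : realType) (V : normedModType R).
Implicit Types (U : set V).

Lemma Ck_prod n U (I : Type) (r : seq I) (P : pred I) (f : I -> V -> R^o) :
  open U -> (forall i, P i -> Ck n U (f i)) -> Ck n U (fun x => \prod_(i <- r | P i) (f i x : R) : R^o).
Proof.
move=> oU h; elim: r => [|i r IH].
  by under eq_fun do rewrite big_nil; exact: Ck_cst.
under eq_fun do rewrite big_cons.
by case Pi : (P i) => //; apply: CkM => //; exact: h.
Qed.

Lemma Ck_det k n U (M : V -> 'M[R]_n) : open U ->
  (forall i j, Ck k U (fun x => M x i j : R^o)) -> Ck k U (fun x => \det (M x) : R^o).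
Proof.
move=> oU h; apply: Ck_sum => // s _; apply: CkM => //; first exact: Ck_cst.
exact: Ck_prod.
Qed.

Lemma Ck_invmx k n U (M : V -> 'M[R]_n) : open U ->
  (forall i j, Ck k U (fun x => M x i j : R^o)) -> (forall x, U x -> M x \in unitmx) ->
  forall i j, Ck k U (fun x => invmx (M x) i j : R^o).
Proof.
move=> oU h uM i j.
apply: (@eq_Ck _ _ _ k U (fun x => (\det (M x))^-1 * \adj (M x) i j : R^o)) => //.
  by move=> x Ux; rewrite /invmx (uM _ Ux) [RHS]mxE.
apply: CkM => //.
  apply: CkV => //; last exact: Ck_det.
  by move=> x /uM; rewrite unitmxE unitfE.
under eq_fun do rewrite mxE.
apply: CkM => //; first exact: Ck_cst.
apply: Ck_det => // a b; under eq_fun do rewrite !mxE.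
exact: h.
Qed.
End MatrixSmooth.

Section InverseFunction.
Variables (R : realType) (n : nat).
Implicit Types (k : 'rV[R]_n -> 'rV[R]_n) (U : set 'rV[R]_n).

Lemma jacobianE k a i j : differentiable k a ->
  jacobian k a i j = ('D_(delta_mx 0 i) k a) 0 j.
Proof. by move=> dk; rewrite deriveEjacobian // -rowE [RHS]mxE. Qed.

Lemma jacobian_unit k a : differentiable k a ->
  (forall w, 'D_w k a = 0 -> w = 0) -> jacobian k a \in unitmx.
Proof.
move=> dk h; rewrite -row_free_unit -kermx_eq0; apply/eqP/row_matrixP => i.
rewrite row0; apply: h; rewrite deriveEjacobian //; apply/sub_kermxP; exact: row_sub.
Qed.

(** With [c] a bound for the inverse differential at [a], a perturbation of size [1 / (2 * c)] costs
    at most a factor 2; this holds both for differentials at nearby points and for increments of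
    [k]. *)
Lemma inverse_estimate k U a : open U -> Ck 1 U k -> U a ->
  (forall w, 'D_w k a = 0 -> w = 0) ->
  exists b r : R, [/\ 0 < b, 0 < r, forall x, `|x - a| < r -> U x,
    forall x w, `|x - a| < r -> `|w| <= b * `|'D_w k x| &
    forall x y, `|x - a| < r -> `|y - a| < r -> `|y - x| <= b * `|k y - k x| ].
Proof.
move=> oU kS Ua hk.
have dk z : U z -> differentiable k z by case: kS => + _; exact.
have uJ := jacobian_unit (dk _ Ua) hk.
have [c c0 hc] := linear_lipschitz (@rV_linear_continuous R n _ (mulmxr (invmx (jacobian k a)))).
have cE w : `|w| <= c * `|'D_w k a|.
  by have := hc ('D_w k a); rewrite /= deriveEjacobian ?mulmxK //; exact: dk.
pose e := (2 * c)^-1; have e0 : 0 < e by rewrite invr_gt0 mulr_gt0.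
have ce : c * e = 2^-1 by rewrite /e invfM mulrCA mulfV ?gt_eqF // mulr1.
have [r r0 hr] := derive_operator_continuous oU kS Ua e0.
have [r' r'0 hr'] := strict_differentiability oU kS Ua e0.
have half (x y z : R) : x <= c * y -> y <= e * x + z -> x <= (2 * c) * z.
  move=> h1 h2; have h3 := ler_wpM2l (ltW c0) h2.
  by rewrite mulrDr mulrA ce in h3; lra.
exists (2 * c), (Num.min r r'); split=> [||x|x w|x y].
- by rewrite mulr_gt0.
- by rewrite lt_min r0.
- by rewrite lt_min => /andP[/hr []].
- rewrite lt_min => /andP[/hr [_ /(_ w) h] _]; apply: half (cE w) _.
  rewrite -[X in `|X|](subrK ('D_w k x)); apply: le_trans (ler_normD _ _) _.
  by rewrite distrC lerD2r.
rewrite !lt_min => /andP[_ x2] /andP[_ y2]; have [_ h] := hr' _ _ x2 y2.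
apply: half (cE _) _; rewrite -[X in `|X|](subrK (k y - k x)); apply: le_trans (ler_normD _ _) _.
by rewrite distrC lerD2r.
Qed.

(** A preimage of [y] is found by minimizing the squared Euclidean distance [g] from [k x] to [y] on
    a closed ball. The minimum is not on the sphere, where [k] is far from [y], and a critical point
    of [g] with invertible differential is a zero. *)
Lemma local_surjectivity k U a : open U -> Ck 1 U k -> U a ->
  (forall w, 'D_w k a = 0 -> w = 0) -> forall e : R, 0 < e ->
  exists2 d : R, 0 < d & forall y, `|y - k a| < d -> exists x, [/\ U x, `|x - a| < e & k x = y].
Proof.
move=> oU kS Ua hk e e0.
have dk z : U z -> differentiable k z by case: kS => + _; exact.
have [b [r [b0 r0 hU hw hxy]]] := inverse_estimate oU kS Ua hk.
pose p := Num.min (r / 2) (e / 2).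
have p0 : 0 < p by rewrite lt_min !divr_gt0.
have pr : p < r by rewrite gt_min; apply/orP; left; lra.
have pe : p < e by rewrite gt_min; apply/orP; right; lra.
(* On the sphere [k] is at distance at least [d * n.+2%:R] from [k a], hence more than [d * n.+1%:R]
   from [y], while [g a <= n%:R * d ^+ 2]; the factor absorbs the gap between maximum and Euclidean
   norms. *)
pose d := p / (b * n.+2%:R).
have d0 : 0 < d by rewrite divr_gt0 // mulr_gt0.
exists d => // y yd.
pose g x := \sum_i (k x 0 i - y 0 i) ^+ 2.
pose A := [set x : 'rV[R]_n | `|x - a| <= p].
have UA x : A x -> U x by move=> xA; apply: hU; exact: le_lt_trans xA pr.
have Aa : A a by rewrite /A /= subrr normr0 ltW.
have cA : compact A.
  apply: bounded_closed_compact.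
    exists (`|a| + p); split; [exact: num_real|move=> M eM v].
    rewrite /A /= => h; rewrite -(subrK a v); apply: le_trans (ler_normD _ _) _; lra.
  rewrite (_ : A = (fun x => `|x - a|) @^-1` [set t | t <= p]) //.
  apply: closed_comp => [x _|]; last exact: closed_le.
  apply: (@near_continuous _ _ R^o) => e1 e10; apply/near_normP; exists e1 => // z zx.
  by apply: le_trans (ler_dist_dist _ _) _; rewrite opprB addrA subrK; exact: ltW.
have dg x : U x -> forall w, is_derive x w g (\sum_i 2 * (k x 0 i - y 0 i) * 'D_w k x 0 i).
  move=> Ux w; rewrite (_ : g = \sum_i (fun x => (k x 0 i - y 0 i) ^+ 2)); last first.
    by apply/funext => z; rewrite fct_sumE.
  apply: is_derive_sum => i.
  have /is_derive_mxP /(_ 0 i) h1 : is_derive x w k ('D_w k x).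
    by apply: DeriveDef => //; apply: diff_derivable; exact: dk.
  have h2 := is_deriveB h1 (is_derive_cst (y 0 i : R^o) x w).
  have h3 := @is_deriveX _ _ (fun x => k x 0 i - y 0 i) 2 x w _ h2.
  by apply: (is_derive_congr h3) => //; rewrite subr0 expr1.
have gC : Ck 1 U (g : _ -> R^o).
  apply: Ck_sum => // i _.
  have h : Ck 1 U (fun x => k x 0 i - y 0 i : R^o).
    by apply: (CkD oU); [exact: ((Ck_mxP _ _ oU).1 kS 0 i)|exact: Ck_cst].
  by apply: eq_Ck (CkM oU h h) => // z _; rewrite expr2.
have cg : {within A, continuous g}.
  by apply: continuous_in_subspaceT => x; rewrite inE => /UA Ux; exact: (Ck_continuous gC).
have [x0 Ax0 hmin] := @EVT_min_rV R n g A (ex_intro _ a Aa) cA cg.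
rewrite inE in Ax0.
have gn x : `|k x - y| ^+ 2 <= g x.
  have [->|] := eqVneq (k x - y) 0.
    by rewrite normr0 expr0n /= sumr_ge0 // => i _; exact: sqr_ge0.
  rewrite -normr_eq0 => /mx_norm_neq0 [[i0 i] /= Ei]; rewrite {i0}(ord1 i0) in Ei.
  have {}Ei : `|k x - y| = `|k x 0 i - y 0 i| by rewrite [LHS]Ei !mxE.
  rewrite Ei real_normK ?num_real // /g (bigD1 i) //= lerDl sumr_ge0 // => j _; exact: sqr_ge0.
have ga : g a <= n%:R * d ^+ 2.
  apply: (@le_trans _ _ (\sum_(i < n) d ^+ 2)); last by rewrite sumr_const card_ord mulr_natl.
  apply: ler_sum => i _; rewrite -real_normK ?num_real //.
  have h : `|k a 0 i - y 0 i| <= d.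
    apply: le_trans (ltW yd); rewrite distrC.
    by have := mx_coord_le (y - k a) 0 i; rewrite !mxE.
  by apply: lerXn2r => //; rewrite nnegrE ltW.
have x0p : `|x0 - a| < p.
  rewrite lt_neqAle Ax0 andbT; apply/eqP => E.
  have h1 : p <= b * `|k x0 - k a|.
    by rewrite -E; apply: hxy; rewrite ?subrr ?normr0 // E.
  have h2 : d * n.+2%:R <= `|k x0 - k a|.
    by rewrite -(ler_pM2l b0) mulrCA /d divfK // gt_eqF // mulr_gt0.
  have h3 : d * n.+1%:R < `|k x0 - y|.
    have : `|k x0 - k a| <= `|k x0 - y| + `|y - k a|.
      by rewrite -{1}(subrK y (k x0)) -addrA; exact: ler_normD.
    move: h2 yd; rewrite -[n.+2]addn1 natrD mulrDr mulr1; lra.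
  have h4 : (d * n.+1%:R) ^+ 2 < `|k x0 - y| ^+ 2.
    by rewrite ltr_pXn2r ?nnegrE // mulr_ge0 // ltW.
  have h5 : g x0 <= g a by apply: hmin; rewrite inE.
  have h6 : n%:R * d ^+ 2 <= (d * n.+1%:R) ^+ 2.
    by rewrite -natr1; have := ler0n R n; move: (n%:R) (sqr_ge0 d) => N; nra.
  by have := gn x0; lra.
exists x0; split; [exact: UA|by lra|].
apply/eqP; rewrite -subr_eq0; apply/eqP.
have Ux0 := UA _ Ax0.
have uJ : jacobian k x0 \in unitmx.
  apply: jacobian_unit; first exact: dk.
  move=> w w0; have := hw x0 w; rewrite w0 normr0 mulr0.
  by rewrite (lt_trans x0p pr) => /(_ isT); rewrite normr_le0 => /eqP.
(* Along this direction the derivative of [g] at the minimum equals [2 * g x0], so it vanishes only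
   with [g x0]. *)
pose w := (k x0 - y) *m invmx (jacobian k x0).
have wE : 'D_w k x0 = k x0 - y by rewrite deriveEjacobian ?mulmxKV //; exact: dk.
have D0 : 'D_w g x0 = 0.
  pose c (t : R) := x0 + t *: w.
  have c0 : c 0 = x0 by rewrite /c scale0r addr0.
  have dc (t : R) : is_derive t 1 c w.
    have h := is_deriveD (is_derive_cst x0 t 1) (is_derive_scalel w t).
    by apply: (is_derive_congr h); rewrite ?add0r.
  pose q := (p - `|x0 - a|) / (`|w| + 1).
  have w1 : 0 < `|w| + 1 by rewrite ltr_wpDl.
  have q0 : 0 < q by rewrite divr_gt0 // subr_gt0.
  have cA' (t : R) : t \in `]- q, q[ -> A (c t).
    rewrite in_itv /= -ltr_norml => tq; rewrite /A /= /c addrAC; apply: le_trans (ler_normD _ _) _.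
    have : `|t| * (`|w| + 1) <= p - `|x0 - a| by rewrite -ler_pdivlMr // ltW.
    by rewrite normrZ; have := normr_ge0 t; lra.
  have dgx x : U x -> differentiable (g : _ -> R^o) x.
    by move=> Ux; case: gC => + _; exact.
  have dgc (t : R) : t \in `]- q, q[ -> is_derive t 1 (g \o c) ('D_w g (c t)).
    by move=> /cA' /UA Uc; apply: is_derive_comp => //; exact: dgx.
  have := @derive1_at_min R (g \o c) (- q) q 0; rewrite in_itv /= oppr_lt0 q0 => H.
  have [|t tq|//|t tq|_] := H; first by lra.
  - by have [] := dgc t tq.
  - by rewrite /= c0; apply: hmin; rewrite inE; exact: cA'.
  have [|_ +] := dgc 0; first by rewrite in_itv /= oppr_lt0 q0.
  by rewrite c0 => -> .
move: D0; have [_ ->] := dg x0 Ux0 w; rewrite wE => h.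
have h' : 2 * g x0 = 0.
  rewrite -[RHS]h mulr_sumr; apply: eq_bigr => i _; by rewrite !mxE expr2 mulrA.
have g0 : g x0 = 0 by move/eqP : h'; rewrite mulf_eq0 pnatr_eq0 => /eqP.
apply/eqP; rewrite -normr_eq0 -sqrf_eq0 eq_le sqr_ge0 andbT -g0; exact: gn.
Qed.

(** Global injectivity is contained in the given left inverse [g], so only openness and regularity
    are at stake. The differential of [g] is the inverse Jacobian matrix taken at [g y]; it has the
    class of [g], which raises the class by one. *)
Theorem inverse_function_smooth k U (g : 'rV[R]_n -> 'rV[R]_n) : open U -> smooth U k ->
  (forall x w, U x -> 'D_w k x = 0 -> w = 0) -> (forall x, U x -> g (k x) = x) ->
  open (k @` U) /\ smooth (k @` U) g.
Proof.
move=> oU kS hk gk.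
have dk z : U z -> differentiable k z by move=> Uz; exact: smooth_differentiable kS Uz.
have img x : U x -> forall e : R, 0 < e -> exists2 d : R, 0 < d &
    forall y, `|y - k x| < d -> (k @` U) y /\ `|g y - x| < e.
  move=> Ux e e0; have [d d0 hd] := local_surjectivity oU (kS 1%N) Ux (hk x ^~ Ux) e0.
  by exists d => // y /hd [z [Uz zx <-]]; split; [exists z|rewrite gk].
have oV : open (k @` U).
  rewrite openE => _ [x Ux <-].
  suff : \forall y \near k x, (k @` U) y by [].
  apply/near_normP.
  by have [d d0 hd] := img x Ux 1 ltr01; exists d => // y /hd [].
have Vg y : (k @` U) y -> U (g y) /\ k (g y) = y by move=> [x Ux <-]; rewrite gk.
have uJ x : U x -> jacobian k x \in unitmx.
  by move=> Ux; apply: jacobian_unit => [|w]; [exact: dk|exact: hk].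
have dg y : (k @` U) y -> differentiable g y /\
    'd g y = mulmxr (invmx (jacobian k (g y))) :> ('rV[R]_n -> 'rV[R]_n).
  move=> [x Ux <-]; rewrite gk //; apply: eps_differentiable; first exact: rV_linear_continuous.
  have [b [r [b0 r0 hU hw hxy]]] := inverse_estimate oU (kS 1%N) Ux (hk x ^~ Ux).
  have [c c0 hc] := linear_lipschitz (@rV_linear_continuous R n _ (mulmxr (invmx (jacobian k x)))).
  move=> e e0; pose e' := e / (c * b).
  have e'0 : 0 < e' by rewrite divr_gt0 // mulr_gt0.
  have [r' r'0 hr'] := strict_differentiability oU (kS 1%N) Ux e'0.
  have rr0 : 0 < Num.min r r' by rewrite lt_min r0.
  have [d d0 hd] := img x Ux _ rr0.
  apply/near_normP; exists d => // {}y /hd [/Vg [Ugy ky]]; rewrite lt_min (gk _ Ux) => /andP[gr gr'].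
  have xr : `|x - x| < r by rewrite subrr normr0.
  have xr' : `|x - x| < r' by rewrite subrr normr0.
  have h1 := hxy x (g y) xr gr; have [_ h2] := hr' x (g y) xr' gr'; rewrite ky in h1 h2.
  have -> : g y - x - mulmxr (invmx (jacobian k x)) (y - k x) =
     - mulmxr (invmx (jacobian k x)) (y - k x - 'D_(g y - x) k x).
    have E1 : 'D_(g y - x) k x *m invmx (jacobian k x) = g y - x.
      by rewrite deriveEjacobian; [rewrite mulmxK // uJ|exact: dk].
    by rewrite /= [in RHS]mulmxBl E1 opprB.
  rewrite normrN; apply: le_trans (hc _) _.
  have E : e' * (c * b) = e by rewrite /e' divfK // gt_eqF // mulr_gt0.
  rewrite -E; have h3 := ler_wpM2l (ltW e'0) h1; have h4 := le_trans h2 h3.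
  by have := ler_wpM2l (ltW c0) h4; lra.
split=> //; elim=> [|m IH].
  by move=> y Vy; apply: differentiable_continuous; exact: (dg y Vy).1.
split=> [y Vy|v]; first exact: (dg y Vy).1.
apply: (@eq_Ck _ _ _ m _ (fun y => v *m invmx (jacobian k (g y)))) => //.
  by move=> y Vy; have [d dE] := dg y Vy; rewrite deriveE // dE.
apply/Ck_mxP => // i j; under eq_fun do rewrite mxE.
apply: Ck_sum => // l _; apply: CkM => //; first exact: Ck_cst.
apply: Ck_invmx => // [a b|y /Vg [Ugy _]]; last exact: uJ.
apply: (@eq_Ck _ _ _ m _ ((fun x => ('D_(delta_mx 0 a) k x) 0 b : R^o) \o g)) => //.
  by move=> y /Vg [Ugy _]; rewrite jacobianE //; exact: dk.
apply: (@Ck_comp_scalar _ _ _ _ _ U) => // [y /Vg [] //|].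
exact: ((Ck_mxP _ _ oU).1 (smooth_derive (delta_mx 0 a) kS m) 0 b).
Qed.
End InverseFunction.

(** * Geodesics in charts *)

Section Charts.
Variables (R : realType) (M : riemannian_surface R).
Implicit Types (i j : atlas M) (c : R -> M) (p : M) (t : R).

Lemma chart_image_open i (A : set M) : open A -> A `<=` dom i -> open (chart i @` A).
Proof.
move=> oA Ai; have -> : chart i @` A = cod i `&` param i @^-1` A.
  apply/seteqP; split=> [_ [p Ap <-]|x [cx Ax]].
    by split; [apply: chart_cod; exact: Ai|rewrite /preimage /= chartK //; exact: Ai].
  by exists (param i x) => //; rewrite paramK.
rewrite openE => x [cx Ax]; apply: filterI.
  by apply: open_nbhs_nbhs; split=> //; exact: cod_open.
exact: (param_continuous cx (open_nbhs_nbhs (conj oA Ax))).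
Qed.

Definition transition i j := chart j \o param i.

Lemma transitionE i j p : dom i p -> transition i j (chart i p) = chart j p.
Proof. by move=> ip; rewrite /transition /= chartK. Qed.

Lemma transition_dom_open i j : open (chart i @` (dom i `&` dom j)).
Proof. by apply: chart_image_open => [|p []//]; apply: openI; exact: dom_open. Qed.

Lemma transition_differentiable i j p : dom i p -> dom j p ->
  differentiable (transition i j) (chart i p).
Proof.
by move=> ip jp; apply: (smooth_differentiable (@transition_smooth _ _ i j)); exists p.
Qed.

Lemma near_dom c t i : {for t, continuous c} -> dom i (c t) -> \forall s \near t, dom i (c s).
Proof. by move=> cc ic; apply: (cc _ (open_nbhs_nbhs (conj (@dom_open _ _ i) ic))). Qed.

Lemma curve_transition c t i j u : {for t, continuous c} -> dom i (c t) -> dom j (c t) ->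
  is_derive t 1 (chart i \o c) u -> is_derive t 1 (chart j \o c) ('D_u (transition i j) (chart i (c t))).
Proof.
move=> cc ic jc dc.
have := is_derive_comp dc (transition_differentiable ic jc).
apply: near_eq_is_derive; apply: filterS (near_dom cc ic) => s ics.
by rewrite /= transitionE.
Qed.

Lemma transition_derive_inv i j p u : dom i p -> dom j p ->
  'D_('D_u (transition i j) (chart i p)) (transition j i) (chart j p) = u.
Proof.
move=> ip jp.
rewrite -(transitionE j ip) -derive_comp; [|exact: transition_differentiable|by rewrite transitionE //; exact: transition_differentiable].
transitivity ('D_u id (chart i p)); last by rewrite derive_id.
apply: near_eq_derive.
have h : (chart i @` (dom i `&` dom j)) (chart i p) by exists p.
apply: filterS (open_nbhs_nbhs (conj (@transition_dom_open i j) h)) => _ [q [iq jq] <-] /=.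
by rewrite (transitionE j iq) transitionE.
Qed.

(** Velocity read in a fixed chart. [velocity] uses the chart attached to the current point, which
    may jump along the curve, and so cannot be differentiated. *)
Definition vel i c t := derive1 (chart i \o c) t.
Definition state i c t : 'rV[R]_(2 + 2) := row_mx (chart i (c t)) (vel i c t).

(** The pointwise regularity under which velocities change by the differential of the transition map
    and speed is independent of the chart. *)
Definition curve_regular c t := {for t, continuous c} /\ forall i, dom i (c t) -> derivable (chart i \o c) t 1.

Lemma regular_derive c t i : curve_regular c t -> dom i (c t) ->
  is_derive t 1 (chart i \o c) (vel i c t).
Proof. by move=> [_ h] /h d; apply: DeriveDef; [exact: d|exact/esym/derive1E]. Qed.

Lemma smooth_to_regular (J : set R^o) c t : smooth_to J c -> J t -> curve_regular c t.
Proof.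
move=> [h1 h2] Jt; split; first exact: h1.
move=> i ic; apply: diff_derivable; apply: (smooth_differentiable (h2 i)); by split.
Qed.

Lemma vel_transition c t i j : curve_regular c t -> dom i (c t) -> dom j (c t) ->
  vel j c t = 'D_(vel i c t) (transition i j) (chart i (c t)).
Proof.
move=> rc ic jc; have [_ <-] := curve_transition rc.1 ic jc (regular_derive rc ic).
by rewrite /vel derive1E.
Qed.

Lemma velocityE c t : velocity c t = vel (chart_at (c t)) c t. Proof. by []. Qed.

Lemma quad_vel_transition c t i j : curve_regular c t -> dom i (c t) -> dom j (c t) ->
  quad (metric j (chart j (c t))) (vel j c t) (vel j c t) =
  quad (metric i (chart i (c t))) (vel i c t) (vel i c t).
Proof.
move=> rc ic jc; rewrite (vel_transition rc ic jc).
by rewrite [RHS](metric_transition ic jc).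
Qed.

Lemma speedE c t i : curve_regular c t -> dom i (c t) ->
  speed c t = Num.sqrt (quad (metric i (chart i (c t))) (vel i c t) (vel i c t)).
Proof.
move=> rc ic; rewrite /speed /inner velocityE (quad_vel_transition rc ic) //.
exact: chart_atP.
Qed.
End Charts.

Section Spray.
Variables (R : realType) (M : riemannian_surface R).
Implicit Types (i j : atlas M).

Lemma quadE (G : 'M[R]_2) u v : quad G u v = \sum_a \sum_b u 0 a * G a b * v 0 b.
Proof.
rewrite /quad mxE exchange_big /=; apply: eq_bigr => b _.
by rewrite !mxE mulr_suml; apply: eq_bigr => a _.
Qed.

Lemma metric_unit i x : cod i x -> metric i x \in unitmx.
Proof.
move=> ix; rewrite -row_free_unit -kermx_eq0; apply/eqP/row_matrixP => k; rewrite row0.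
apply/eqP; apply/negPn/negP => u0.
have := metric_posdef ix u0; rewrite /quad.
have -> : row k (kermx (metric i x)) *m metric i x = 0 by apply/sub_kermxP; exact: row_sub.
by rewrite mul0mx mxE ltxx.
Qed.

Lemma christoffel_smooth i k a b : smooth (cod i) (fun x => christoffel i x k a b : R^o).
Proof.
have oc := @cod_open _ _ i.
have dm a' b' l n : Ck n (cod i) (fun x => 'D_(delta_mx 0 a') (fun y => metric i y b' l : R^o) x : R^o).
  exact: (smooth_derive (delta_mx 0 a') (@metric_smooth _ _ i b' l) n).
move=> n; rewrite /christoffel; apply: (CkM oc); first exact: Ck_cst.
apply: (@Ck_sum _ _ R^o _ _ _ _ _ _ oc) => l _; apply: (CkM oc).
  apply: Ck_invmx => // [a' b'|]; first exact: metric_smooth.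
  exact: metric_unit.
apply: (CkD oc); first by apply: (CkD oc); exact: dm.
by apply: (CkN oc); exact: dm.
Qed.

Definition spray i (z : 'rV[R]_(2 + 2)) : 'rV[R]_(2 + 2) :=
  row_mx (rsubmx z) (\row_k - \sum_a \sum_b christoffel i (lsubmx z) k a b *
     (rsubmx z) 0 a * (rsubmx z) 0 b).

Definition spray_dom i : set 'rV[R]_(2 + 2) := (@lsubmx R 1 2 2) @^-1` cod i.

Lemma spray_dom_open i : open (spray_dom i).
Proof. exact/open_lsubmx/cod_open. Qed.

Lemma spray_smooth i : smooth (spray_dom i) (spray i).
Proof.
have od := @spray_dom_open i.
have lS : smooth (spray_dom i) (fun z : 'rV[R]_(2+2) => lsubmx z : 'rV[R]_2).
  by move=> n; apply: Ck_linear; exact: rV_linear_continuous.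
have rS : smooth (spray_dom i) (fun z : 'rV[R]_(2+2) => rsubmx z : 'rV[R]_2).
  by move=> n; apply: Ck_linear; exact: rV_linear_continuous.
apply: smooth_row_mx => //.
move=> n; apply/Ck_mxP => // a k.
apply: (@eq_Ck _ _ _ n _ (fun z => - \sum_a \sum_b christoffel i (lsubmx z) k a b *
     (rsubmx z) 0 a * (rsubmx z) 0 b : R^o)) => // [z _|]; first by rewrite mxE.
apply: (CkN od); apply: (@Ck_sum _ _ R^o _ _ _ _ _ _ od) => b _; apply: (@Ck_sum _ _ R^o _ _ _ _ _ _ od) => d _.
apply: (CkM od); last exact: ((Ck_mxP _ _ od).1 (rS n) 0 d).
apply: (CkM od); last exact: ((Ck_mxP _ _ od).1 (rS n) 0 b).
have UU z : spray_dom i z -> cod i (lsubmx z) by [].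
exact: (Ck_comp_scalar od UU (lS n) (@christoffel_smooth i k b d n)).
Qed.

Definition geodesic (c : R -> M) := geodesic_on setT c.

Lemma geodesic_regular c t : geodesic c -> curve_regular c t.
Proof. by move=> [cS _]; exact: smooth_to_regular cS I. Qed.

Lemma vel_derive (J : set R) c t i : open (J : set R^o) -> geodesic_on J c -> J t -> dom i (c t) ->
  is_derive t 1 (vel i c) (\row_k - \sum_a \sum_b christoffel i (chart i (c t)) k a b *
     (vel i c t) 0 a * (vel i c t) 0 b).
Proof.
move=> oJ [[cC cS] cE] Jt ic.
have S2 := (cS i) 2%N.
have /= [_ /(_ 1) [+ _]] := S2 => /(_ t (conj Jt ic)) d.
have d1 : differentiable (vel i c) t.
  have -> : vel i c = 'D_1 (chart i \o c) by apply/funext => s; exact: derive1E.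
  exact: d.
apply: DeriveDef; first by apply: diff_derivable.
apply/rowP => k; rewrite mxE; have := cE t i Jt ic k.
by rewrite /= -derive1E => /eqP; rewrite addr_eq0 => /eqP ->.
Qed.

Lemma state_derive c t i : geodesic c -> dom i (c t) ->
  spray_dom i (state i c t) /\ is_derive t 1 (state i c) (spray i (state i c t)).
Proof.
move=> gc ic; split; first by rewrite /spray_dom /= /state row_mxKl; exact: chart_cod.
have d1 := regular_derive (geodesic_regular t gc) ic.
have d2 := vel_derive openT gc I ic.
apply/is_derive_mxP => a b; rewrite /spray /state row_mxKl row_mxKr mxE; case: split_ordP => k ->.
  move/is_derive_mxP : d1 => /(_ a k) h; apply: (is_derive_congr h) => // s.
  by rewrite row_mxEl.
move/is_derive_mxP : d2 => /(_ a k) h; apply: (is_derive_congr h) => // s.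
by rewrite row_mxEr.
Qed.
End Spray.

Lemma near_realP (R : realType) (P : R -> Prop) (t : R) :
  (\forall s \near t, P s) -> exists2 r : R, 0 < r & forall s, `|s - t| < r -> P s.
Proof. by move=> /(@near_normP R R^o). Qed.

Lemma hausdorff_limit (R : realType) (T : topologicalType) (c1 c2 : R -> T) (a t : R) :
  hausdorff_space T -> a < t -> {for t, continuous c1} -> {for t, continuous c2} ->
  (forall s, a <= s < t -> c1 s = c2 s) -> c1 t = c2 t.
Proof.
move=> hT at_ h1 h2 e; apply: hT => A B nA nB.
have : \forall s \near t, A (c1 s) /\ B (c2 s) by apply: filterI; [exact: h1|exact: h2].
move=> /near_realP [r r0 hr]; pose s := Num.max a (t - r / 2).
have st : s < t by rewrite gt_max at_ /= ltrBlDr ltrDl divr_gt0.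
have as_ : a <= s by rewrite le_max lexx.
have [|As Bs] := hr s; last by exists (c1 s); split=> //; rewrite e // as_.
have : t - r / 2 <= s by rewrite le_max lexx orbT.
by move=> h; rewrite /= ltr0_norm ?subr_lt0 // opprB; lra.
Qed.

Lemma solution_unique (R : realType) n (W : set 'rV[R]_n) (F : 'rV[R]_n -> 'rV[R]_n) T (x y : R -> 'rV[R]_n) :
  open W -> Ck 1 W F -> 0 <= T -> solution W F 0 T x -> solution W F 0 T y -> x 0 = y 0 ->
  forall t : R, 0 <= t <= T -> y t = x t.
Proof.
move=> oW FS T0 xS yS xy t tT.
have [e [C [K [e0 C0 _ _ H]]]] := solution_confinement oW FS T0 xS.
have := H y (fun=> True) I; rewrite xy subrr normr0 mulr0 => /(_ e0) h.
have [] := h _ _ _ t tT => // [s sT _|s _ _|_]; [exact: yS|exact: filterT|].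
by rewrite normr_le0 subr_eq0 => /eqP.
Qed.

Section Geodesics.
Variables (R : realType) (M : riemannian_surface R).
Implicit Types (i j : atlas M) (c : R -> M) (p : M) (t : R).

Lemma is_derive_affine (V : normedModType R) (f : R -> V) (a b t : R) D :
  is_derive (a * t + b) 1 f D -> is_derive t 1 (fun s => f (a * s + b)) (a *: D).
Proof.
move=> h; have df : differentiable f (a * t + b) by apply/derivable1_diffP; case: h.
have da : is_derive t (1 : R) (fun s : R => a * s + b) a.
  by apply: is_derive_eq; rewrite /GRing.scale /=; ring.
have E : 'D_a f (a * t + b) = a *: D.
  by have := derive_dirZ a (1 : R) df; rewrite /GRing.scale /= mulr1 => ->; case: h => _ ->.
by rewrite -E; exact: is_derive_comp da df.
Qed.

Lemma smooth_to_dom_open (V : normedModType R) (J : set V) (f : V -> M) i :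
  open J -> smooth_to J f -> open (J `&` f @^-1` dom i).
Proof.
move=> oJ [fc _]; rewrite openE => x [Jx ix]; apply: filterI.
  exact: open_nbhs_nbhs.
exact: (fc x Jx _ (open_nbhs_nbhs (conj (@dom_open _ _ i) ix))).
Qed.

Lemma smooth_to_affine (J : set R^o) c (a b : R) : open J -> smooth_to J c ->
  smooth_to ([set t | J (a * t + b)] : set R^o) (fun t => c (a * t + b)).
Proof.
move=> oJ cS; have [cc cs] := cS.
have cA (t : R^o) : {for t, continuous (fun t : R^o => a * t + b : R^o)}.
  by apply: cvgD; [apply: cvgMl_tmp; exact: cvg_id|exact: cvg_cst].
split=> [t Jt|i n].
  apply: (@continuous_comp _ _ _ (fun t : R^o => a * t + b : R^o) c); first exact: cA.
  exact: cc.
pose L : {linear R^o -> R^o} := *:%R a.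
have cL : continuous L by exact: scaler_continuous.
apply: (@Ck_comp_affine _ _ _ _ n _ (J `&` c @^-1` dom i) L b (chart i \o c) cL) => //.
  have oU := smooth_to_dom_open i oJ cS.
  exact: (@open_comp _ _ (fun t : R^o => a * t + b : R^o) _ (fun t _ => cA t) oU).
exact: cs.
Qed.

Lemma vel_affine c (a b t : R) i : curve_regular c (a * t + b) -> dom i (c (a * t + b)) ->
  vel i (fun s => c (a * s + b)) t = a *: vel i c (a * t + b).
Proof.
move=> rc ic; have [_ ] := is_derive_affine (regular_derive rc ic).
by rewrite -derive1E.
Qed.

Lemma geodesic_affine c (a b : R) : geodesic c -> geodesic (fun t => c (a * t + b)).
Proof.
move=> gc; split=> [|t i _ ic k /=].
  by have := smooth_to_affine a b openT gc.1; rewrite (_ : [set t | _] = setT) //; apply/seteqP; split.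
have gr s := geodesic_regular s gc.
have d2 := is_derive_affine (vel_derive openT gc I ic).
have dv : is_derive t 1 (vel i (fun s => c (a * s + b))) (a *: (a *: (\row_k
      - (\sum_a0 \sum_b0 christoffel i (chart i (c (a * t + b))) k a0 b0 *
      (vel i c (a * t + b)) 0 a0 * (vel i c (a * t + b)) 0 b0)))).
  have := is_deriveZ a d2; apply: near_eq_is_derive.
  have cA : {for t, continuous (fun s => c (a * s + b))}.
    apply: (@continuous_comp _ _ _ (fun s : R => a * s + b) c); last exact: (gr _).1.
    by apply: cvgD; [apply: cvgMl_tmp; exact: cvg_id|exact: cvg_cst].
  apply: filterS (near_dom cA ic) => s ics; rewrite vel_affine //; exact: gr.
have [_] := dv; rewrite -derive1E -/(vel _ _ _) => E.
rewrite -[X in X + _]/((derive1 (vel i (fun s => c (a * s + b))) t) 0 k) E.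
rewrite -!/(vel i (fun s => c (a * s + b)) t) vel_affine //.
rewrite !mxE mulrA mulrN addrC; apply/eqP; rewrite subr_eq0; apply/eqP.
rewrite mulr_sumr; apply: eq_bigr => a0 _; rewrite mulr_sumr; apply: eq_bigr => b0 _.
by rewrite !mxE; ring.
Qed.

Lemma vel_eq c1 c2 t i j : curve_regular c1 t -> curve_regular c2 t -> c1 t = c2 t ->
  dom i (c1 t) -> dom j (c1 t) -> vel i c1 t = vel i c2 t -> vel j c1 t = vel j c2 t.
Proof.
move=> r1 r2 e i1 j1 ve; have i2 := i1; have j2 := j1; rewrite e in i2 j2.
by rewrite (vel_transition r1 i1 j1) (vel_transition r2 i2 j2) ve e.
Qed.

Lemma state_eq c1 c2 t1 t2 i : state i c1 t1 = state i c2 t2 ->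
  chart i (c1 t1) = chart i (c2 t2) /\ vel i c1 t1 = vel i c2 t2.
Proof. by move=> /eq_row_mx. Qed.

(** Continuation in time of the agreement of positions and of velocities in every chart. At a limit
    time, positions agree because the surface is Hausdorff and states by continuity in one chart;
    past it, uniqueness for the differential equation in that chart applies. *)
Lemma geodesic_unique_forward c1 c2 i : geodesic c1 -> geodesic c2 -> c1 0 = c2 0 ->
  dom i (c1 0) -> vel i c1 0 = vel i c2 0 -> forall t, 0 <= t -> c1 t = c2 t.
Proof.
move=> g1 g2 e0 i0 v0 T T0.
have r1 s := geodesic_regular s g1; have r2 s := geodesic_regular s g2.
suff : forall t, 0 <= t <= T -> c1 t = c2 t /\ forall j, dom j (c1 t) -> vel j c1 t = vel j c2 t.
  by move=> /(_ T); rewrite T0 lexx => /(_ isT) [].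
have nd j t : dom j (c1 t) -> c1 t = c2 t ->
    exists2 r : R, 0 < r & forall s, `|s - t| < r -> dom j (c1 s) /\ dom j (c2 s).
  move=> j1 e; have j2 := j1; rewrite e in j2.
  by apply: near_realP; apply: filterI; [exact: near_dom (r1 t).1 j1|exact: near_dom (r2 t).1 j2].
apply: real_induction => t.
  move=> /andP[]; rewrite le_eqVlt => /orP[/eqP <- _ _|t0 tT H].
    by split=> [|j j0]; [exact: e0|exact: (vel_eq (r1 _) (r2 _) e0 i0 j0 v0)].
  have ct : c1 t = c2 t.
    by apply: (hausdorff_limit (@surface_hausdorff _ M) t0 (r1 t).1 (r2 t).1) => s /H [].
  split=> [|j j1]; first exact: ct.
  have j2 := j1; rewrite ct in j2.
  have [_ d1] := state_derive g1 j1; have [_ d2] := state_derive g2 j2.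
  have [r rr0 hr] := nd j t j1 ct.
  have s12 : state j c1 t = state j c2 t.
    pose a := Num.max 0 (t - r / 2).
    have at_ : a < t by rewrite gt_max t0 /= ltrBlDr ltrDl divr_gt0.
    have a0 : 0 <= a by rewrite le_max lexx.
    have ar : t - r / 2 <= a by rewrite le_max lexx orbT.
    apply: (hausdorff_limit _ at_ (is_derive_continuous d1) (is_derive_continuous d2)).
      exact: norm_hausdorff.
    move=> s /andP[as_ st]; have [|es vs] := H s; first by rewrite st andbT; lra.
    have [|js1 js2] := hr s; first by rewrite /= ltr0_norm ?subr_lt0 // opprB; lra.
    by rewrite /state es vs.
  by have [] := state_eq s12.
move=> tT [ct vt]; set j := chart_at (c1 t).
have j1 : dom j (c1 t) := chart_atP _.
have [r rr0 hr] := nd j t j1 ct.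
exists (r / 2); first by rewrite divr_gt0.
have sol c : geodesic c -> (forall s, `|s - t| < r -> dom j (c s)) ->
    solution (spray_dom j) (@spray _ M j) 0 (r / 2) (fun s => state j c (1 * s + t)).
  move=> gc hc s sr; have jc : dom j (c (1 * s + t)).
    by apply: hc; rewrite mul1r addrK ger0_norm; lra.
  have [W d] := state_derive gc jc; split; first exact: W.
  by have := is_derive_affine d; rewrite scale1r.
have r20 : 0 <= r / 2 by rewrite divr_ge0 // ltW.
move=> s /andP[ts str] sT.
have sr : `|s - t| < r by rewrite gtr0_norm ?subr_gt0 //; lra.
have [js1 js2] := hr s sr.
have st : 0 <= s - t <= r / 2 by lra.
have E := solution_unique (@spray_dom_open _ _ j) (@spray_smooth _ _ j 1%N) r20
   (sol c1 g1 (fun s h => (hr s h).1)) (sol c2 g2 (fun s h => (hr s h).2)).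
have {}E := E _ (s - t) st; rewrite !mulr0 !add0r !mul1r subrK in E.
have {E} sE : state j c2 s = state j c1 s by apply: E; rewrite /state ct vt.
have [cE vE] := state_eq sE.
have cs : c1 s = c2 s by rewrite -(chartK js1) -(chartK js2) cE.
split=> [|k ks]; first exact: cs.
exact: (vel_eq (r1 _) (r2 _) cs js1 ks (esym vE)).
Qed.
End Geodesics.

(** * The geodesic flow *)

Local Opaque derive derive1.

Section GeodesicFlow.
Variables (R : realType) (M : riemannian_surface R).
Hypothesis mc : complete_surface M.
Implicit Types (i j : atlas M) (c : R -> M) (p : M) (t : R).

Lemma geodesic_unique c1 c2 t0 i : geodesic c1 -> geodesic c2 -> c1 t0 = c2 t0 ->
  dom i (c1 t0) -> vel i c1 t0 = vel i c2 t0 -> forall t, c1 t = c2 t.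
Proof.
move=> g1 g2 e0 i0 v0 t.
(* With [a] equal to 1 or -1, the reparametrization by [a * s + t0] reduces both directions of time
   to the forward case. *)
suff H a : 0 <= a * (t - t0) -> a * a = 1 -> c1 t = c2 t.
  case: (leP 0 (t - t0)) => h; first by apply: (H 1); rewrite mul1r.
  by apply: (H (-1)); [rewrite mulN1r oppr_ge0 ltW|rewrite mulrNN mulr1].
move=> ta aa.
have E c : c t = (fun s => c (a * s + t0)) (a * (t - t0)) by rewrite /= mulrA aa mul1r subrK.
rewrite (E c1) (E c2).
have i0' : dom i (c1 (a * 0 + t0)) by rewrite mulr0 add0r.
have i0'' : dom i (c2 (a * 0 + t0)) by rewrite mulr0 add0r -e0.
apply: (@geodesic_unique_forward _ _ (fun s => c1 (a * s + t0)) (fun s => c2 (a * s + t0)) i _ _ _ _ _ _ ta).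
- exact: geodesic_affine.
- exact: geodesic_affine.
- by rewrite mulr0 add0r.
- exact: i0'.
rewrite (vel_affine (geodesic_regular _ g1) i0') (vel_affine (geodesic_regular _ g2) i0'').
by rewrite mulr0 add0r v0.
Qed.

Lemma geodesic_exists i z : spray_dom i z -> exists c, [/\ geodesic c, dom i (c 0) & state i c 0 = z].
Proof.
move=> iz; set p := param i (lsubmx z).
have ip : dom i p by exact: param_dom.
have xp : chart i p = lsubmx z by exact: paramK.
set j := chart_at p; have jp : dom j p := chart_atP p.
have [c [gc c0 vc]] := mc p ('D_(rsubmx z) (transition i j) (chart i p)).
have ic : dom i (c 0) by rewrite c0.
have jc : dom j (c 0) by rewrite c0.
exists c; split=> //.
rewrite /state -[RHS]hsubmxK c0 xp; congr row_mx.
rewrite (vel_transition (geodesic_regular 0 gc) jc ic).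
have -> : vel j c 0 = 'D_(rsubmx z) (transition i j) (chart i p) by rewrite -vc velocityE c0.
rewrite c0; exact: transition_derive_inv.
Qed.

(** The complete geodesic whose state in chart [i] at time 0 is [z]; it may leave the chart later.
    The constant curve is a default for [z] outside the phase space of the chart. *)
Definition geo i (z : 'rV[R]_(2 + 2)) : R -> M :=
  if pselect (spray_dom i z) is left H then sval (cid (geodesic_exists H)) else fun=> param i (lsubmx z).

Lemma geoP i z : spray_dom i z -> [/\ geodesic (geo i z), dom i (geo i z 0) & state i (geo i z) 0 = z].
Proof. by rewrite /geo; case: pselect => // H _; case: cid. Qed.

Lemma state_spray_dom c t i : dom i (c t) -> spray_dom i (state i c t).
Proof. by move=> ic; rewrite /spray_dom /= /state row_mxKl; exact: chart_cod. Qed.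

Lemma geo_state c t0 t i : geodesic c -> dom i (c t0) -> geo i (state i c t0) t = c (t + t0).
Proof.
move=> gc ic; have [g1 i1 s1] := geoP (state_spray_dom ic).
have := @geodesic_unique (geo i (state i c t0)) (fun s => c (1 * s + t0)) 0 i g1 (geodesic_affine 1 t0 gc).
rewrite mulr0 add0r => H.
have [cE vE] := eq_row_mx s1.
have ic' : dom i (c (1 * 0 + t0)) by rewrite mulr0 add0r.
have e0 : geo i (state i c t0) 0 = c (1 * 0 + t0).
  by rewrite -(chartK i1) mulr0 add0r -(chartK ic) cE.
have ev : vel i (geo i (state i c t0)) 0 = vel i (fun s => c (1 * s + t0)) 0.
  by rewrite (vel_affine (geodesic_regular _ gc) ic') scale1r mulr0 add0r.
by rewrite mulr0 add0r in e0; rewrite (H e0 i1 ev) mul1r.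
Qed.

Definition rev (z : 'rV[R]_(2 + 2)) : 'rV[R]_(2 + 2) := row_mx (lsubmx z) (- rsubmx z).

Lemma geo_rev i z t : spray_dom i z -> geo i (rev z) t = geo i z (- t).
Proof.
move=> iz; have [g1 i1 s1] := geoP iz.
have iz' : spray_dom i (rev z) by rewrite /spray_dom /= /rev row_mxKl.
have [g2 i2 s2] := geoP iz'.
have [c1 v1] := eq_row_mx (etrans s1 (esym (hsubmxK z))).
have [c2 v2] := eq_row_mx s2.
have := @geodesic_unique (geo i (rev z)) (fun s => geo i z (-1 * s + 0)) 0 i g2 (geodesic_affine (-1) 0 g1).
rewrite mulr0 add0r => /(_ _ i2) H.
have e0 : geo i (rev z) 0 = geo i z 0 by rewrite -(chartK i1) -(chartK i2) c1 c2.
have ic' : dom i (geo i z (-1 * 0 + 0)) by rewrite mulr0 add0r.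
have ev : vel i (geo i (rev z)) 0 = vel i (fun s => geo i z (-1 * s + 0)) 0.
  by rewrite (vel_affine (geodesic_regular _ g1) ic') mulr0 add0r v1 v2 scaleN1r.
by rewrite (H e0 ev) mulN1r addr0.
Qed.

(** Here the predicate of [solution_confinement] is membership in the chart domain. It is open by
    continuity; its closing condition is the point to prove, since the state is meaningless once the
    curve leaves the domain. *)
Lemma geo_confined i z0 T : 0 <= T -> spray_dom i z0 -> (forall t, 0 <= t <= T -> dom i (geo i z0 t)) ->
  exists2 r : R, 0 < r & forall z, `|z - z0| < r -> spray_dom i z /\
     forall t, 0 <= t <= T -> dom i (geo i z t).
Proof.
move=> T0 iz0 H0.
have [g0 i0 s0] := geoP iz0.
have sol : solution (spray_dom i) (@spray _ M i) 0 T (state i (geo i z0)).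
  by move=> t /H0 it; exact: state_derive.
have [e [C [K [e0 C0 cK KW HC]]]] := solution_confinement (@spray_dom_open _ _ i) (@spray_smooth _ M i 1%N) T0 sol.
have [r r0 hr] := (near_normP _ _).1 (open_nbhs_nbhs (conj (@spray_dom_open _ _ i) iz0)).
have C1 : 0 < C + 1 by rewrite ltr_wpDl.
exists (Num.min r (e / (C + 1))); first by rewrite lt_min r0 divr_gt0.
move=> z; rewrite lt_min => /andP[/hr iz]; rewrite ltr_pdivlMr // => ze.
split=> //; have [g1 i1 s1] := geoP iz.
have gr t := geodesic_regular t g1.
have := HC (state i (geo i z)) (fun t => dom i (geo i z t)) i1.
rewrite s0 s1 => H t tT; apply: (H _ _ _ _ t tT).1.
- by have := normr_ge0 (z - z0); lra.
- by move=> s _ ic; exact: state_derive.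
- by move=> s _ ic; exact: near_dom (gr s).1 ic.
move=> s /andP[s_gt0 sT] hs.
(* The points of the surface under the tube form a compact, hence closed, subset of the chart
   domain. A curve lying in it before time [s] lies in it at time [s]. *)
pose X := param i @` (lsubmx @` K).
have cX : compact X.
  apply: continuous_compact; last first.
    apply: continuous_compact cK; apply: continuous_subspaceT => y.
    exact/differentiable_continuous/differentiable_lsubmx.
  apply: continuous_in_subspaceT => y; rewrite inE => -[w Kw <-].
  apply: param_continuous; exact: KW.
have clX : closed X by apply: compact_closed => //; exact: surface_hausdorff.
suff [y [w Kw <-] <-] : X (geo i z s) by apply: param_dom; exact: KW.
apply: contrapT => nX.
have oX : open (~` X) by exact: closed_openC.
have := (gr s).1 _ (open_nbhs_nbhs (conj oX nX)) => /near_realP [d d0 hd].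
pose u := Num.max 0 (s - d / 2).
have us : u < s by rewrite gt_max s_gt0 /= ltrBlDr ltrDl divr_gt0.
have u0 : 0 <= u by rewrite le_max lexx.
have ud : s - d / 2 <= u by rewrite le_max lexx orbT.
have [|iu Ku] := hs u; first by rewrite u0.
apply: (hd u); first by rewrite ltr0_norm ?subr_lt0 // opprB; lra.
exists (chart i (geo i z u)); last by rewrite chartK.
by exists (state i (geo i z) u) => //; rewrite /state row_mxKl.
Qed.

Lemma open_ball_norm n (a : 'rV[R]_n) r : open [set z : 'rV[R]_n | `|z - a| < r].
Proof.
rewrite openE => z za; suff : \forall y \near z, `|y - a| < r by [].
apply/near_normP; exists (r - `|z - a|); first by rewrite subr_gt0.
move=> y yz; rewrite -(subrK z y) -addrA; apply: le_lt_trans (ler_normD _ _) _; lra.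
Qed.

Lemma rev_continuous : continuous rev.
Proof.
move=> z; have : Ck 0 setT rev; last exact.
apply: (@smooth_row_mx _ _ _ _ setT (@lsubmx R 1 2 2) (fun z => - rsubmx z) openT _ _ 0%N).
  by move=> m; apply: Ck_linear; exact: rV_linear_continuous.
move=> m; apply: (CkN openT); apply: Ck_linear; exact: rV_linear_continuous.
Qed.

(** The margin [d] makes the time interval open around the closed one, as smoothness of flows
    requires; negative times are handled by reversing the velocity. *)
Lemma geo_flow i z0 T : 0 <= T -> spray_dom i z0 -> (forall t, 0 <= t <= T -> dom i (geo i z0 t)) ->
  exists N (d : R), [/\ open N, N z0, 0 < d,
    flow (spray_dom i) (@spray _ M i) N (- d) (T + d) (fun z t => state i (geo i z) t) &
    forall z t, N z -> - d < t < T + d -> dom i (geo i z t)].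
Proof.
move=> T0 iz0 H0; have [g0 i0 s0] := geoP iz0.
have gr t := geodesic_regular t g0.
have iT : dom i (geo i z0 T) by apply: H0; rewrite T0 lexx.
have [d1 d10 h1] := near_realP (near_dom (gr 0).1 i0).
have [d2 d20 h2] := near_realP (near_dom (gr T).1 iT).
pose d := Num.min d1 d2 / 2.
have m0 : 0 < Num.min d1 d2 by rewrite lt_min d10.
have d0 : 0 < d by rewrite divr_gt0.
have [dd1 dd2] : d < d1 /\ d < d2.
  have m1 : Num.min d1 d2 <= d1 by rewrite ge_min lexx.
  have m2 : Num.min d1 d2 <= d2 by rewrite ge_min lexx orbT.
  by rewrite /d; split; lra.
have F1 t : 0 <= t <= T + d -> dom i (geo i z0 t).
  move=> tT; case: (leP t T) => tT'; first by apply: H0; lra.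
  by apply: h2; rewrite gtr0_norm ?subr_gt0 //; lra.
have iz0' : spray_dom i (rev z0) by rewrite /spray_dom /= /rev row_mxKl.
have F2 t : 0 <= t <= d -> dom i (geo i (rev z0) t).
  by move=> td; rewrite geo_rev //; apply: h1; rewrite subr0 normrN ger0_norm; lra.
have Td : 0 <= T + d by lra.
have [r1 r10 H1] := geo_confined Td iz0 F1.
have [r2 r20 H2] := geo_confined (ltW d0) iz0' F2.
exists ([set z | `|z - z0| < r1] `&` rev @^-1` [set z | `|z - rev z0| < r2]), d.
have D z t : ([set z | `|z - z0| < r1] `&` rev @^-1` [set z | `|z - rev z0| < r2]) z ->
    - d < t < T + d -> dom i (geo i z t).
  move=> [/= z1 z2] td; have [iz F3] := H1 z z1; have [_ F4] := H2 _ z2.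
  case: (leP 0 t) => t0; first by apply: F3; lra.
  by rewrite -[t]opprK -geo_rev //; apply: F4; lra.
split=> //.
- apply: openI; first exact: open_ball_norm.
  apply: open_comp; last exact: open_ball_norm.
  by move=> z _; exact: rev_continuous.
- by split; rewrite /= subrr normr0.
- move=> z Nz; have [iz _] := H1 z Nz.1; have [g1 i1 s1] := geoP iz.
  by split=> // t td; apply: state_derive => //; exact: D.
Qed.

Definition state_transition i j (z : 'rV[R]_(2 + 2)) : 'rV[R]_(2 + 2) :=
  row_mx (transition i j (lsubmx z)) ('D_(rsubmx z) (transition i j) (lsubmx z)).

Lemma state_transitionE c t i j : curve_regular c t -> dom i (c t) -> dom j (c t) ->
  state j c t = state_transition i j (state i c t).
Proof.
by move=> rc ic jc; rewrite /state_transition /state row_mxKl row_mxKr (transitionE _ ic) (vel_transition rc ic jc).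
Qed.

Lemma state_transition_smooth i j :
  smooth ((@lsubmx R 1 2 2) @^-1` (chart i @` (dom i `&` dom j))) (state_transition i j).
Proof.
have oD := @transition_dom_open _ _ i j.
have tS := @transition_smooth _ M i j.
apply: smooth_row_mx; [exact: open_lsubmx| |exact: smooth_joint_derive].
have lS : smooth ((@lsubmx R 1 2 2) @^-1` (chart i @` (dom i `&` dom j))) (fun z : 'rV[R]_(2+2) => lsubmx z : 'rV[R]_2).
  by move=> m; apply: Ck_linear; exact: rV_linear_continuous.
have UU z : ((@lsubmx R 1 2 2) @^-1` (chart i @` (dom i `&` dom j))) z -> (chart i @` (dom i `&` dom j)) (lsubmx z) by [].
exact: (smooth_comp (open_lsubmx oD) oD UU lS tS).
Qed.

(** The chart [j] reading the final state is independent of the initial chart, so that it can be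
    exchanged while the geodesic travels. *)
Definition flow_good i z0 t j := exists N, [/\ open N, N z0, N `<=` spray_dom i,
  forall z, N z -> dom j (geo i z t) & smooth N (fun z => state j (geo i z) t)].

Lemma flow_good_chart i z0 t j k : flow_good i z0 t j -> dom k (geo i z0 t) -> flow_good i z0 t k.
Proof.
move=> [N [oN Nz0 Ni Nj NS]] kz0.
have oD := open_lsubmx (@transition_dom_open _ _ j k).
pose S z := state j (geo i z) t.
pose N' := N `&` S @^-1` ((@lsubmx R 1 2 2) @^-1` (chart j @` (dom j `&` dom k))).
have SN z : N z -> lsubmx (S z) = chart j (geo i z t) by move=> Nz; rewrite /S /state row_mxKl.
have oN' : open N'.
  rewrite openE => z [Nz Sz]; apply: filterI; first exact: open_nbhs_nbhs.
  exact: (smooth_continuous NS Nz (open_nbhs_nbhs (conj oD Sz))).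
have N'k z : N' z -> dom k (geo i z t).
  move=> [Nz []] q [jq kq]; rewrite SN // => /(congr1 (param j)).
  by rewrite !chartK //; [move=> <-|exact: Nj].
exists N'; split; first exact: oN'.
- split; first exact: Nz0.
  rewrite /preimage /=; rewrite SN //; exists (geo i z0 t); last by [].
  by split; [exact: Nj|exact: kz0].
- by move=> z [/Ni].
- exact: N'k.
have UU z : N' z -> ((@lsubmx R 1 2 2) @^-1` (chart j @` (dom j `&` dom k))) (S z) by case.
have NS' : smooth N' S by apply: sub_smooth NS => z [].
apply: (eq_smooth oN' _ (smooth_comp oN' oD UU NS' (@state_transition_smooth j k))).
move=> z [Nz Sz]; have [gz _ _] := geoP (Ni _ Nz).
by rewrite /= (state_transitionE (geodesic_regular t gz) (Nj _ Nz)) //; exact: N'k.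
Qed.

Lemma flow_good_step i z0 t T k : 0 <= T -> spray_dom i z0 ->
  (forall s, 0 <= s <= T -> dom k (geo i z0 (s + t))) -> flow_good i z0 t k -> flow_good i z0 (T + t) k.
Proof.
move=> T0 iz0 H [N [oN Nz0 Ni Nk NS]].
have [g0 _ _] := geoP iz0.
have kt0 : dom k (geo i z0 t) := Nk _ Nz0.
pose S z := state k (geo i z) t.
have HT s : 0 <= s <= T -> dom k (geo k (S z0) s) by move=> sT; rewrite geo_state //; exact: H.
have [N2 [d [oN2 N2z d0 fl D]]] := geo_flow T0 (state_spray_dom kt0) HT.
have dT : - d < T < T + d by lra.
have nd : - d < 0 by lra.
have Td : 0 < T + d by lra.
have FS := flow_smooth (@spray_dom_open _ _ k) (@spray_smooth _ M k) oN2 nd Td fl dT.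
pose N' := N `&` S @^-1` N2.
have oN' : open N'.
  rewrite openE => z [Nz Sz]; apply: filterI; first exact: open_nbhs_nbhs.
  exact: (smooth_continuous NS Nz (open_nbhs_nbhs (conj oN2 Sz))).
have E z : N z -> geo k (S z) T = geo i z (T + t).
  by move=> Nz; have [gz _ _] := geoP (Ni _ Nz); rewrite geo_state //; exact: Nk.
exists N'; split; first exact: oN'.
- by split; [exact: Nz0|exact: N2z].
- by move=> z [/Ni].
- by move=> z [Nz Sz]; rewrite -E //; exact: D.
have UU z : N' z -> N2 (S z) by case.
have NS' : smooth N' S by apply: sub_smooth NS => z [].
apply: (eq_smooth oN' _ (smooth_comp oN' oN2 UU NS' FS)).
move=> z [Nz Sz] /=; have [gz _ _] := geoP (Ni _ Nz).
have kz : dom k (geo i z t) := Nk _ Nz.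
have fE : geo k (S z) = fun s => geo i z (1 * s + t).
  by apply/funext => s; rewrite geo_state // mul1r.
rewrite /state fE mul1r; congr row_mx.
rewrite vel_affine ?scale1r ?mul1r //; first exact: geodesic_regular.
by rewrite -E //; exact: D.
Qed.

(** Continuation in time: around every time the central geodesic stays in one chart, where the flow
    is smooth, and composing with it extends the smooth dependence across that interval. *)
Theorem geodesic_flow_smooth i z0 T j : 0 <= T -> spray_dom i z0 -> dom j (geo i z0 T) ->
  flow_good i z0 T j.
Proof.
move=> T0 iz0 jz0; have [g0 i0 s0] := geoP iz0; have gr t := geodesic_regular t g0.
suff H : forall t, 0 <= t <= T -> flow_good i z0 t (chart_at (geo i z0 t)).
  by apply: flow_good_chart jz0; apply: H; rewrite T0 lexx.
have loc t : exists2 r : R, 0 < r & forall s, `|s - t| < r -> dom (chart_at (geo i z0 t)) (geo i z0 s).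
  exact: near_realP (near_dom (gr t).1 (chart_atP _)).
have step s t k : s <= t -> (forall u, s <= u <= t -> dom k (geo i z0 u)) ->
    flow_good i z0 s (chart_at (geo i z0 s)) -> flow_good i z0 t (chart_at (geo i z0 t)).
  move=> st ku gs; have ks : flow_good i z0 s k by apply: flow_good_chart gs _; apply: ku; rewrite lexx.
  apply: (@flow_good_chart _ _ _ k); last exact: chart_atP.
  have := @flow_good_step i z0 s (t - s) k; rewrite subrK; apply=> //; first by rewrite subr_ge0.
  by move=> u ust; apply: ku; lra.
apply: real_induction => t.
  move=> /andP[]; rewrite le_eqVlt => /orP[/eqP <- _ _|t0 tT H].
    apply: (@flow_good_chart _ _ _ i); last exact: chart_atP.
    exists (spray_dom i); split=> //; first exact: spray_dom_open.
      by move=> z /geoP [].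
    apply: (@eq_smooth _ _ _ _ id); [exact: spray_dom_open|by move=> z /geoP [_ _ ->]|].
    have -> : id = (@idfun 'rV[R]_(2 + 2) : {linear 'rV[R]_(2+2) -> 'rV[R]_(2 + 2)}) by [].
    by apply: smooth_linear; exact: rV_linear_continuous.
  have [r r0 hr] := loc t; pose s := Num.max 0 (t - r / 2).
  have st : s < t by rewrite gt_max t0 /= ltrBlDr ltrDl divr_gt0.
  have s0' : 0 <= s by rewrite le_max lexx.
  have sr : t - r / 2 <= s by rewrite le_max lexx orbT.
  apply: (step s t (chart_at (geo i z0 t)) (ltW st)); last by apply: H; rewrite s0'.
  by move=> u ust; apply: hr; rewrite ler0_norm ?opprB; lra.
move=> tT Ht; have [r r0 hr] := loc t; exists r; first exact: r0.
move=> s /andP[ts sr] sT.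
apply: (step t s (chart_at (geo i z0 t)) (ltW ts)) => // u ust.
by apply: hr; rewrite ger0_norm; lra.
Qed.
End GeodesicFlow.

(** * The Riemannian metric *)

Lemma sum2 (V : nmodType) (F : 'I_2 -> V) : \sum_j F j = F 0 + F 1.
Proof. by rewrite !big_ord_recl big_ord0 addr0; congr (_ + F _); exact: val_inj. Qed.

Section Quad.
Variables (R : realType).
Implicit Types (G : 'M[R]_2) (u v w : 'rV[R]_2).

Lemma quadDl G u v w : quad G (u + v) w = quad G u w + quad G v w.
Proof. by rewrite /quad !mulmxDl mxE. Qed.

Lemma quadDr G u v w : quad G w (u + v) = quad G w u + quad G w v.
Proof. by rewrite /quad linearD mulmxDr mxE. Qed.

Lemma quadZl G a u v : quad G (a *: u) v = a * quad G u v.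
Proof. by rewrite /quad -!scalemxAl mxE. Qed.

Lemma quadZr G a u v : quad G u (a *: v) = a * quad G u v.
Proof. by rewrite /quad linearZ -scalemxAr mxE. Qed.

Lemma quadNl G u v : quad G (- u) v = - quad G u v.
Proof. by rewrite -scaleN1r quadZl mulN1r. Qed.

Lemma quadNr G u v : quad G u (- v) = - quad G u v.
Proof. by rewrite -scaleN1r quadZr mulN1r. Qed.

Lemma quad0l G v : quad G 0 v = 0.
Proof. by rewrite -(scale0r 0) quadZl mul0r. Qed.

Lemma quad0r G v : quad G v 0 = 0.
Proof. by rewrite -(scale0r 0) quadZr mul0r. Qed.

Lemma quadC G u v : G^T = G -> quad G u v = quad G v u.
Proof.
move=> sG; rewrite /quad; transitivity ((u *m G *m v^T)^T 0 0); first by rewrite [RHS]mxE.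
by rewrite !trmx_mul trmxK sG mulmxA.
Qed.

Lemma discriminant_le (a b c : R) : 0 <= c -> (forall s, 0 <= a + 2 * b * s + c * s ^+ 2) -> b ^+ 2 <= a * c.
Proof.
move=> c0 H.
move: c0; rewrite le_eqVlt => /orP[/eqP c0|c0].
  subst c; rewrite mulr0; case: (eqVneq b 0) => [->|b0]; first by rewrite expr0n.
  have := H (- (a + 1) / (2 * b)); rewrite mul0r addr0.
  have -> : 2 * b * (- (a + 1) / (2 * b)) = - (a + 1) by field.
  lra.
have := H (- b / c).
have -> : a + 2 * b * (- b / c) + c * (- b / c) ^+ 2 = (a * c - b ^+ 2) / c by field; rewrite gt_eqF.
by rewrite pmulr_lge0 ?invr_gt0 // subr_ge0.
Qed.

Lemma quad_cauchy_schwarz G u v : G^T = G -> (forall w, 0 <= quad G w w) ->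
  quad G u v <= Num.sqrt (quad G u u) * Num.sqrt (quad G v v).
Proof.
move=> sG pG; rewrite -sqrtrM //; apply: le_trans (ler_norm _) _.
rewrite -sqrtr_sqr; apply: ler_wsqrtr; apply: discriminant_le => // s.
have := pG (u + s *: v); rewrite quadDl !quadDr !quadZl !quadZr (quadC v u sG).
congr (0 <= _); ring.
Qed.
End Quad.

Lemma koszul_algebra (R : fieldType) (d : 'I_2 -> 'I_2 -> 'I_2 -> R) (u y : 'rV[R]_2) :
  2 != 0 :> R -> (forall a b c, d a b c = d a c b) ->
  \sum_l (- \sum_a \sum_b (2^-1 * (d a b l + d b a l - d l a b)) * u 0 a * u 0 b) * y 0 l =
  2^-1 * (\sum_a \sum_b u 0 a * (\sum_c y 0 c * d c a b) * u 0 b) -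
  \sum_a \sum_b u 0 a * (\sum_c u 0 c * d c a b) * y 0 b.
Proof.
move=> n2 sd; rewrite !sum2 (sd 0 1 0) (sd 1 1 0).
set a0 := u 0 0; set a1 := u 0 1; set y0 := y 0 0; set y1 := y 0 1.
by field.
Qed.

Section Metric.
Variables (R : realType) (M : riemannian_surface R).
Implicit Types (i j : atlas M) (x u v w y : 'rV[R]_2).

Definition nrm i x u := Num.sqrt (quad (metric i x) u u).

Lemma metric_ge0 i x u : cod i x -> 0 <= quad (metric i x) u u.
Proof.
move=> ix; case: (eqVneq u 0) => [->|u0]; first by rewrite quad0l.
exact/ltW/metric_posdef.
Qed.

Lemma nrm_ge0 i x u : 0 <= nrm i x u. Proof. exact: sqrtr_ge0. Qed.

Lemma nrm_sqr i x u : cod i x -> nrm i x u ^+ 2 = quad (metric i x) u u.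
Proof. by move=> ix; rewrite sqr_sqrtr // metric_ge0. Qed.

Lemma nrm_eq0 i x u : cod i x -> nrm i x u = 0 -> u = 0.
Proof.
move=> ix n0; apply/eqP/negPn/negP => u0; have := metric_posdef ix u0.
by rewrite -nrm_sqr // n0 expr0n ltxx.
Qed.

Lemma nrm_gt0 i x u : cod i x -> u != 0 -> 0 < nrm i x u.
Proof. by move=> ix u0; rewrite sqrtr_gt0; exact: metric_posdef. Qed.

Lemma nrmZ i x a u : nrm i x (a *: u) = `|a| * nrm i x u.
Proof. by rewrite /nrm quadZl quadZr mulrA -expr2 sqrtrM ?sqr_ge0 // sqrtr_sqr. Qed.

Lemma metric_cs i x u v : cod i x -> quad (metric i x) u v <= nrm i x u * nrm i x v.
Proof. move=> ix; exact: (quad_cauchy_schwarz u v (Defs.metric_sym ix) (fun w => metric_ge0 w ix)). Qed.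

Lemma nrmD i x u v : cod i x -> nrm i x (u + v) <= nrm i x u + nrm i x v.
Proof.
move=> ix; rewrite -(@ler_pXn2r _ 2) ?nnegrE ?addr_ge0 ?nrm_ge0 //.
rewrite nrm_sqr // quadDl !quadDr sqrrD !nrm_sqr // (quadC v u (Defs.metric_sym ix)).
have := metric_cs u v ix; rewrite mulr2n; lra.
Qed.

Definition dmetric i x w : 'M[R]_2 := \matrix_(a, b) 'D_w (fun y => metric i y a b : R^o) x.

Lemma quad_derive (V : normedModType R) i (X U W : V -> 'rV[R]_2) (dX dU dW : 'rV[R]_2) (t v : V) :
  cod i (X t) -> differentiable X t -> 'D_v X t = dX -> is_derive t v U dU -> is_derive t v W dW ->
  is_derive t v (fun s => quad (metric i (X s)) (U s) (W s) : R^o)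
    (quad (dmetric i (X t) dX) (U t) (W t) + quad (metric i (X t)) dU (W t) + quad (metric i (X t)) (U t) dW).
Proof.
move=> ix hX <- /is_derive_mxP hU /is_derive_mxP hW.
have hG a b : is_derive t v (fun s => metric i (X s) a b : R^o) (dmetric i (X t) ('D_v X t) a b).
  have dG : differentiable (fun y => metric i y a b : R^o) (X t) := smooth_differentiable (@metric_smooth _ _ i a b) ix.
  apply: DeriveDef; first by apply: diff_derivable; exact: (differentiable_comp hX dG).
  by rewrite mxE; exact: (derive_comp v hX dG).
have h1 a b := is_deriveM (is_deriveM (hU 0 a) (hG a b)) (hW 0 b).
have h2 a := is_derive_sum (h1 a).
have h3 := is_derive_sum h2.
apply: (is_derive_congr h3) => [s|].
  rewrite quadE fct_sumE; apply: eq_bigr => a _; rewrite fct_sumE; by apply: eq_bigr => b _.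
rewrite !quadE -!big_split /=; apply: eq_bigr => a _; rewrite -!big_split /=; apply: eq_bigr => b _.
change (U t 0 a * metric i (X t) a b * dW 0 b +
  W t 0 b * (U t 0 a * dmetric i (X t) ('D_v X t) a b + metric i (X t) a b * dU 0 a) =
  U t 0 a * dmetric i (X t) ('D_v X t) a b * W t 0 b +
  dU 0 a * metric i (X t) a b * W t 0 b + U t 0 a * metric i (X t) a b * dW 0 b).
ring.
Qed.

Definition acc i x u : 'rV[R]_2 := \row_k - \sum_a \sum_b christoffel i x k a b * u 0 a * u 0 b.

Lemma dmetricE i x w a b : cod i x ->
  dmetric i x w a b = \sum_c w 0 c * 'D_(delta_mx 0 c) (fun y => metric i y a b : R^o) x.
Proof.
by move=> ix; rewrite mxE derive_rV //; exact: smooth_differentiable (@metric_smooth _ _ i a b) ix.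
Qed.

Lemma dmetric_sym i x v a b : cod i x ->
  'D_v (fun y => metric i y a b : R^o) x = 'D_v (fun y => metric i y b a : R^o) x.
Proof.
move=> ix; apply: near_eq_derive; apply: filterS (open_nbhs_nbhs (conj (@cod_open _ _ i) ix)) => z iz.
by rewrite -{1}(Defs.metric_sym iz) mxE.
Qed.

Lemma christoffel_lower i x a b l : cod i x ->
  let dm (a b l : 'I_2) : R := 'D_(delta_mx 0 a) (fun y => metric i y b l : R^o) x in
  \sum_k metric i x l k * christoffel i x k a b = 2^-1 * (dm a b l + dm b a l - dm l a b).
Proof.
move=> ix dm; rewrite /christoffel -/dm.
under eq_bigr do rewrite mulrCA mulr_sumr.
rewrite -mulr_sumr exchange_big /=; congr (_ * _).
under eq_bigr do (under eq_bigr do rewrite mulrA; rewrite -mulr_suml).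
have E n : \sum_k metric i x l k * invmx (metric i x) k n = (l == n)%:R.
  by have := mulmxV (metric_unit ix) => /matrixP /(_ l n); rewrite !mxE.
under eq_bigr do rewrite E.
by rewrite (bigD1 l) //= eqxx mul1r big1 ?addr0 // => n /negPf nl; rewrite eq_sym nl mul0r.
Qed.

(** The geodesic acceleration with its index lowered. Conservation of energy and the Gauss lemma
    follow from this identity using only derivatives of the metric, without a covariant
    derivative. *)
Lemma koszul i x u y : cod i x ->
  quad (metric i x) (acc i x u) y = 2^-1 * quad (dmetric i x y) u u - quad (dmetric i x u) u y.
Proof.
move=> ix.
have sG := Defs.metric_sym ix.
have E l : \sum_k (acc i x u) 0 k * metric i x k l = - \sum_a \sum_b (\sum_k metric i x l k * christoffel i x k a b) * u 0 a * u 0 b.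
  under eq_bigr do rewrite mxE mulNr.
  rewrite sumrN; congr (- _).
  under eq_bigr do rewrite mulr_suml.
  rewrite exchange_big /=; apply: eq_bigr => a _.
  under eq_bigr do rewrite mulr_suml.
  rewrite exchange_big /=; apply: eq_bigr => b _.
  rewrite -mulrA mulr_suml; apply: eq_bigr => k _.
  by rewrite -{1}sG mxE; ring.
rewrite quadE exchange_big /=.
under eq_bigr do rewrite -mulr_suml E.
under eq_bigr do (under eq_bigr do (under eq_bigr do rewrite (christoffel_lower _ _ _ ix))).
rewrite !quadE.
under [in RHS]eq_bigr do (under eq_bigr do rewrite (dmetricE _ _ _ ix)).
under [X in _ = _ - X]eq_bigr do (under eq_bigr do rewrite (dmetricE _ _ _ ix)).
have n2 : 2 != 0 :> R by rewrite pnatr_eq0.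
exact: (koszul_algebra u y n2 (fun a b c => dmetric_sym (delta_mx 0 a) b c ix)).
Qed.
End Metric.

(** * Length and distance *)

Section Arclength.
Variables (R : realType) (M : riemannian_surface R).
Implicit Types (i j : atlas M) (c : R -> M) (p : M) (t : R).
Notation mu := (@lebesgue_measure R).

Lemma quad_Ck (V : normedModType R) n (U : set V) i (X A B : V -> 'rV[R]_2) : open U ->
  (forall z, U z -> cod i (X z)) -> Ck n U X -> Ck n U A -> Ck n U B ->
  Ck n U (fun z => quad (metric i (X z)) (A z) (B z) : R^o).
Proof.
move=> oU UX hX hA hB.
apply: (@eq_Ck _ _ _ n U (fun z => \sum_a \sum_b (A z) 0 a * metric i (X z) a b * (B z) 0 b : R^o)) => //.
  by move=> z _; rewrite quadE.
apply: (@Ck_sum _ _ R^o _ _ _ _ _ _ oU) => a _; apply: (@Ck_sum _ _ R^o _ _ _ _ _ _ oU) => b _.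
apply: (CkM oU); last exact: ((Ck_mxP _ _ oU).1 hB 0 b).
apply: (CkM oU); first exact: ((Ck_mxP _ _ oU).1 hA 0 a).
exact: (Ck_comp_scalar oU UX hX (@metric_smooth _ _ i a b n)).
Qed.

Lemma speed_ge0 c t : 0 <= speed c t. Proof. exact: sqrtr_ge0. Qed.

Lemma vel_smooth (J : set R^o) c i : open J -> smooth_to J c -> smooth (J `&` c @^-1` dom i : set R^o) (vel i c).
Proof.
move=> oJ cS; have -> : vel i c = 'D_1 (chart i \o c) by apply/funext => s; exact: derive1E.
by apply: smooth_derive; exact: cS.2.
Qed.

Lemma speed_continuous (J : set R^o) c t : open J -> smooth_to J c -> J t -> {for t, continuous (speed c)}.
Proof.
move=> oJ cS Jt; set i := chart_at (c t).
have oU : open (J `&` c @^-1` dom i : set R^o) by exact: smooth_to_dom_open.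
have Ut : (J `&` c @^-1` dom i) t by split=> //; exact: chart_atP.
have UX z : (J `&` c @^-1` dom i) z -> cod i ((chart i \o c) z) by move=> [_ /chart_cod].
have vS := vel_smooth i oJ cS 0%N.
have := @quad_Ck _ 0 _ i _ _ _ oU UX (cS.2 i 0%N) vS vS t Ut.
move=> /(continuous_comp) /(_ (@sqrt_continuous R _)).
move=> h; have E : \forall s \near t, (Num.sqrt (quad (metric i (chart i (c s))) (vel i c s) (vel i c s)) : R^o) = speed c s.
  apply: filterS (open_nbhs_nbhs (conj oU Ut)) => s [Js is_].
  by rewrite (speedE (smooth_to_regular cS Js) is_).
suff : speed c @ t --> speed c t by [].
rewrite -(nbhs_singleton E); apply: cvg_trans h.
exact: near_eq_cvg E.
Qed.

(** Replaces the length integral by a primitive of the speed, so that lengths are compared by mean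
    value inequalities. The integral starts before 0 to give two-sided derivatives at both end
    points. *)
Lemma arclength c : smooth_segment c -> exists2 F : R -> R,
  (forall t : R, 0 <= t <= 1 -> is_derive t 1 F (speed c t)) & segment_length c = F 1 - F 0.
Proof.
move=> [e e0 cS]; set a := - (e / 2); set u := 1 + e / 2.
have oJ : open (`]- e, 1 + e[%classic : set R^o) by exact: interval_open.
have sC t : a <= t <= u -> {for t, continuous (speed c)}.
  move=> tau; apply: (speed_continuous oJ cS); rewrite /= in_itv /=; rewrite /a /u in tau; lra.
have au : a < u by rewrite /a /u; lra.
have cI : mu.-integrable `[a, u] (EFin \o speed c).
  by apply: continuous_compact_integrable; [exact: segment_compact|exact: within_continuous].
pose F x := (\int[mu]_(t in `[a, x]) speed c t)%R.
have dF t : a < t < u -> is_derive t 1 F (speed c t).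
  move=> /andP[at_ tu]; have [] := @continuous_FTC1_closed R (speed c) a t u tu cI at_ (sC t _).
    by rewrite !ltW.
  by move=> d1 d2; apply: DeriveDef; [exact: d1|rewrite -derive1E; exact: d2].
exists F => [t t01|]; first by apply: dF; rewrite /a /u; lra.
rewrite /segment_length /Rintegral (@continuous_FTC2 R (speed c) F 0 1) //.
- by apply: within_continuous => t t01; apply: sC; rewrite /a /u; lra.
- split.
  + by move=> t; rewrite in_itv /= => t01; have [] := dF t _; first by rewrite /a /u; lra.
  + apply: cvg_at_right_filter; have d := dF 0 _; exact: (is_derive_continuous (d ltac:(rewrite /a /u; lra))).
  + apply: cvg_at_left_filter; have d := dF 1 _; exact: (is_derive_continuous (d ltac:(rewrite /a /u; lra))).
- move=> t; rewrite in_itv /= => t01; rewrite derive1E.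
  by have [] := dF t _; first by rewrite /a /u; lra.
Qed.

Lemma segment_lengthE c F : smooth_segment c ->
  (forall t : R, 0 <= t <= 1 -> is_derive t 1 F (speed c t)) -> segment_length c = F 1 - F 0.
Proof.
move=> cS dF; have [G dG ->] := arclength cS; apply/eqP; rewrite eq_le.
by apply/andP; split; apply: derive_le => //.
Qed.

Lemma smooth_segment_regular c t : smooth_segment c -> 0 <= t <= 1 -> curve_regular c t.
Proof. by move=> [e e0 cS] t01; apply: (smooth_to_regular cS); rewrite /= in_itv /=; lra. Qed.

Lemma curve_regular_affine c a b t : curve_regular c (a * t + b) -> curve_regular (fun s => c (a * s + b)) t.
Proof.
move=> rc; split.
  apply: (@continuous_comp _ _ _ (fun s : R^o => a * s + b : R^o) c); last exact: rc.1.
  by apply: cvgD; [apply: cvgMl_tmp; exact: cvg_id|exact: cvg_cst].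
by move=> i ic; have [] := is_derive_affine (regular_derive rc ic).
Qed.

Lemma speed_affine c a b t : curve_regular c (a * t + b) ->
  speed (fun s => c (a * s + b)) t = `|a| * speed c (a * t + b).
Proof.
move=> rc; set i := chart_at (c (a * t + b)).
have ic : dom i (c (a * t + b)) := chart_atP _.
rewrite (speedE (curve_regular_affine rc) ic) (speedE rc ic) (vel_affine rc ic).
exact: nrmZ.
Qed.

Lemma affine_range (a b x e : R) : 0 < e -> 0 <= b <= 1 -> 0 <= a + b <= 1 -> - e < x < 1 + e ->
  - e < a * x + b < 1 + e.
Proof.
move=> e0 hb hab /andP[x1 x2]; case: (leP 0 a) => a0.
  have h1 : a * - e <= a * x by apply: ler_wpM2l => //; exact: ltW.
  have h2 : a * x <= a * (1 + e) by apply: ler_wpM2l => //; exact: ltW.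
  have h3 : a * e <= 1 * e by apply: ler_wpM2r; [exact: ltW|lra].
  case: (ltgtP a 0) a0 => // [a0 _|-> _]; last by rewrite mul0r; lra.
  have h4 : a * - e < a * x by rewrite ltr_pM2l.
  have h5 : a * x < a * (1 + e) by rewrite ltr_pM2l.
  lra.
have h3 : - a * e <= 1 * e by apply: ler_wpM2r; [exact: ltW|lra].
have h4 : a * x < a * - e by rewrite ltr_nM2l.
have h5 : a * (1 + e) < a * x by rewrite ltr_nM2l.
lra.
Qed.

Lemma segment_affine c (a b : R) : smooth_segment c -> 0 <= b <= 1 -> 0 <= a + b <= 1 ->
  smooth_segment (fun t => c (a * t + b)).
Proof.
move=> [e e0 cS] hb hab.
have oJ : open (`]- e, 1 + e[%classic : set R^o) by exact: interval_open.
have h := smooth_to_affine a b oJ cS.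
have JJ : (`]- e, 1 + e[%classic : set R^o) `<=` [set t | (`]- e, 1 + e[%classic : set R^o) (a * t + b)].
  by move=> x; rewrite /= !in_itv /=; exact: affine_range.
exists e => //; split=> [x /JJ|i]; first exact: h.1.
by apply: sub_smooth (h.2 i) => x [/JJ].
Qed.

Lemma path_along c F (t1 t2 : R) : smooth_segment c -> (forall t : R, 0 <= t <= 1 -> is_derive t 1 F (speed c t)) ->
  0 <= t1 <= 1 -> 0 <= t2 <= 1 -> exists l, [/\ piecewise_path (c t1) (c t2) l,
    t1 <= t2 -> l = F t2 - F t1 & t2 <= t1 -> l = F t1 - F t2].
Proof.
move=> cS dF h1 h2; set a := t2 - t1.
have h2' : 0 <= a + t1 <= 1 by rewrite /a subrK.
have sS := segment_affine cS h1 h2'.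
have rg (s : R) : 0 <= s <= 1 -> 0 <= a * s + t1 <= 1.
  move=> s01; case: (leP 0 a) => a0; rewrite /a in a0 h2' *; nra.
have sp (s : R) : 0 <= s <= 1 -> speed (fun t => c (a * t + t1)) s = `|a| * speed c (a * s + t1).
  by move=> s01; apply: speed_affine; apply: smooth_segment_regular (rg _ s01).
have dG (s : R) : 0 <= s <= 1 -> is_derive s 1 (fun t => F (a * t + t1)) (a * speed c (a * s + t1)).
  by move=> s01; exact: (is_derive_affine (dF _ (rg _ s01))).
exists (segment_length (fun t => c (a * t + t1)) + 0); split.
- have := path_cons sS (path_nil _); rewrite mulr0 add0r mulr1 /a subrK; exact.
- move=> t12.
  have dE (s : R) : 0 <= s <= 1 -> is_derive s 1 (fun t => F (a * t + t1)) (speed (fun t => c (a * t + t1)) s).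
    move=> s01; apply: (is_derive_congr (dG s s01)) => [s'|]; first by [].
    by rewrite (sp s s01) ger0_norm // subr_ge0.
  by rewrite addr0 (segment_lengthE sS dE) mulr0 add0r mulr1 /a subrK.
- move=> t12.
  have dE (s : R) : 0 <= s <= 1 -> is_derive s 1 (fun t => - F (a * t + t1)) (speed (fun t => c (a * t + t1)) s).
    move=> s01; apply: (is_derive_congr (is_deriveN (dG s s01))) => [s'|]; first by [].
    by rewrite (sp s s01) ler0_norm ?mulNr // subr_le0.
  by rewrite addr0 (segment_lengthE sS dE) mulr0 add0r mulr1 /a subrK opprK addrC.
Qed.

Lemma segment_length_ge0 c : smooth_segment c -> 0 <= segment_length c.
Proof.
move=> cS; have [F dF ->] := arclength cS.
have := @derive_le R (cst 0) (cst 0) F (speed c) 0 1 ler01; rewrite subrr; apply=> //.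
by move=> t _; exact: speed_ge0.
Qed.

Lemma path_ge0 (x y : M) l : piecewise_path x y l -> 0 <= l.
Proof. by elim=> // c z l' cS _ IH; apply: addr_ge0 => //; exact: segment_length_ge0. Qed.

Lemma path_cat (x y z : M) l l' : piecewise_path x y l -> piecewise_path y z l' -> piecewise_path x z (l + l').
Proof.
move=> h; elim: h l' => [w l' hw|c w l0 cS h IH l' hw]; first by rewrite add0r.
by rewrite -addrA; apply: path_cons => //; exact: IH.
Qed.

Lemma path_rev (x y : M) l : piecewise_path x y l -> piecewise_path y x l.
Proof.
elim=> [z|c z l0 cS _ IH]; first exact: path_nil.
have [F dF e] := arclength cS.
have i0 : 0 <= (0 : R) <= 1 by rewrite lexx ler01.
have i1 : 0 <= (1 : R) <= 1 by rewrite lexx ler01.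
have [l' [p _ h]] := path_along cS dF i1 i0.
by rewrite addrC; apply: path_cat IH _; rewrite e -(h ler01).
Qed.

Lemma is_derive_eps (V : normedModType R) (f : R -> V) (t : R) D : is_derive t 1 f D ->
  forall e : R, 0 < e -> \forall s \near t, `|f s - f t - (s - t) *: D| <= e * `|s - t|.
Proof.
move=> h e e0; have df : differentiable f t by apply/derivable1_diffP; case: h.
have D1 : 'd f t 1 = D by case: h => _ <-; rewrite deriveE.
apply: filterS (differentiable_eps df e0) => s.
by rewrite -{1}(mulr1 (s - t)) -[(s - t) * 1]/((s - t) *: (1 : R^o)) linearZ D1.
Qed.

Lemma near_realP' (P : R -> Prop) t r : 0 < r -> (forall s, `|s - t| < r -> P s) -> \forall s \near t, P s.
Proof. by move=> r0 h; apply/(@near_normP R R^o); exists r. Qed.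

(** Infinitesimal form of being 1-Lipschitz: an upper bound on forward growth by the speed, and
    lower semicontinuity along the curve. It applies to functions glued from pieces that are not
    differentiable, and is exactly what a continuation argument consumes. *)
Definition forward_lipschitz (f : M -> R) := forall c t, curve_regular c t -> forall e : R, 0 < e ->
  \forall s \near t, (t <= s -> f (c s) <= f (c t) + (speed c t + e) * (s - t)) /\ f (c t) <= f (c s) + e.

(** Real induction on the inequality with a slack [e * t]: semicontinuity closes it at limits, the
    growth bound pushes it forward. *)
Lemma forward_lipschitz_segment f c : forward_lipschitz f -> smooth_segment c ->
  f (c 1) - f (c 0) <= segment_length c.
Proof.
move=> fL cS; have [F dF ->] := arclength cS.
apply/ler_addgt0Pr => e e0.
suff H : forall t : R, 0 <= t <= 1 -> f (c t) - f (c 0) <= F t - F 0 + e * t.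
  by have := H 1; rewrite mulr1 lexx ler01; apply.
apply: real_induction => t t01.
  move=> H; case: (eqVneq t 0) => [->|t0]; first by rewrite mulr0 !subrr addr0.
  have tp : 0 < t by rewrite lt_neqAle eq_sym t0; case/andP: t01.
  apply/ler_addgt0Pr => d d0.
  have d2 : 0 < d / 2 by rewrite divr_gt0.
  have h1 := fL c t (smooth_segment_regular cS t01) _ d2.
  have h2 := continuous_near_le (is_derive_continuous (dF t t01)) d2.
  have /near_realP [r r0 hr] : \forall s \near t, f (c t) <= f (c s) + d / 2 /\ `|F s - F t| <= d / 2.
    by apply: filterI => //; apply: filterS h1 => s [].
  pose s := Num.max 0 (t - r / 2).
  have st : s < t by rewrite gt_max tp /= ltrBlDr ltrDl divr_gt0.
  have s0 : 0 <= s by rewrite le_max lexx.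
  have sr : t - r / 2 <= s by rewrite le_max lexx orbT.
  have [|h3] := hr s; first by rewrite ltr0_norm ?subr_lt0 // opprB; lra.
  rewrite ler_norml => /andP[_ h4].
  have := H s; rewrite s0 st => /(_ isT) h5.
  have : e * s <= e * t by rewrite ler_pM2l // ltW.
  lra.
move=> H; have t01' : 0 <= t <= 1 by case/andP: t01 => -> /ltW ->.
have e2 : 0 < e / 2 by rewrite divr_gt0.
have h1 := fL c t (smooth_segment_regular cS t01') _ e2.
have h2 := is_derive_eps (dF t t01') e2.
have /near_realP [r r0 hr] : \forall s \near t, ((t <= s -> f (c s) <= f (c t) + (speed c t + e / 2) * (s - t)) /\
    f (c t) <= f (c s) + e / 2) /\ `|F s - F t - (s - t) *: speed c t| <= e / 2 * `|s - t| by exact: filterI h1 h2.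
exists r; first exact: r0.
move=> s /andP[ts sr] s1; have [|[/(_ (ltW ts)) h3 _]] := hr s; first by rewrite gtr0_norm ?subr_gt0 //; lra.
have ts' : 0 < s - t by rewrite subr_gt0.
rewrite (gtr0_norm ts') ler_norml /GRing.scale /= => /andP[h4 _].
move: h3 h4 H; set m := s - t; set S := speed c t; move=> h3 h4 H.
have : e * s = e * t + e * m by rewrite /m; ring.
have : (S + e / 2) * m = m * S + e / 2 * m by ring.
lra.
Qed.

Lemma forward_lipschitz_path f (x y : M) l : forward_lipschitz f -> piecewise_path x y l -> f y - f x <= l.
Proof.
move=> fL; elim=> [z|c z l' cS _ IH]; first by rewrite subrr.
have := forward_lipschitz_segment fL cS; lra.
Qed.

Lemma smooth_to_comp (V : normedModType R) m (U : set 'rV[R]_m) (U' : set V) (f : 'rV[R]_m -> M) (g : V -> 'rV[R]_m) :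
  open U -> open U' -> (forall x, U' x -> U (g x)) -> smooth_to U f -> smooth U' g -> smooth_to U' (f \o g).
Proof.
move=> oU oU' UU fS gS; have gc z : U' z -> {for z, continuous g} by move=> Uz; exact: smooth_continuous gS Uz.
have fgc z : U' z -> {for z, continuous (f \o g)}.
  by move=> Uz; apply: continuous_comp; [exact: gc|apply: fS.1; exact: UU].
split=> // i; have oD := smooth_to_dom_open i oU fS.
have oD' : open (U' `&` (f \o g) @^-1` dom i).
  rewrite openE => z [Uz iz]; apply: filterI; first exact: open_nbhs_nbhs.
  exact: (fgc z Uz _ (open_nbhs_nbhs (conj (@dom_open _ _ i) iz))).
have UU' z : (U' `&` (f \o g) @^-1` dom i) z -> (U `&` f @^-1` dom i) (g z).
  by move=> [Uz iz]; split=> //; exact: UU.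
have gS' : smooth (U' `&` (f \o g) @^-1` dom i) g by apply: sub_smooth gS => z [].
exact: (smooth_comp oD' oD UU' gS' (fS.2 i)).
Qed.

Lemma smooth_to_param i : smooth_to (cod i) (param i).
Proof.
split=> [x ix|j]; first exact: param_continuous.
apply: sub_smooth (@transition_smooth _ M i j) => x [ix jx].
by exists (param i x); [split=> //; exact: param_dom|exact: paramK].
Qed.

Lemma quad_normr_le (A : 'M[R]_2) u v : `|quad A u v| <= 4 * `|A| * `|u| * `|v|.
Proof.
have h a b : `|u 0 a * A a b * v 0 b| <= `|u| * `|A| * `|v|.
  by rewrite !normrM !ler_pM ?mulr_ge0 ?mx_coord_le.
rewrite quadE !sum2.
have H (p q r s : R) : `|p + q + (r + s)| <= `|p| + `|q| + (`|r| + `|s|).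
  by apply: le_trans (ler_normD _ _) _; apply: lerD; exact: ler_normD.
apply: le_trans (H _ _ _ _) _.
have := h 0 0; have := h 0 1; have := h 1 0; have := h 1 1.
have -> : 4 * `|A| * `|u| * `|v| = 4 * (`|u| * `|A| * `|v|) by ring.
lra.
Qed.

Lemma sqrt_le_add (p q d : R) : 0 <= q -> 0 <= d -> p <= q + d ^+ 2 -> Num.sqrt p <= Num.sqrt q + d.
Proof.
move=> q0 d0 h; have s0 := sqrtr_ge0 q; rewrite -[leRHS]ger0_norm ?addr_ge0 // -sqrtr_sqr.
apply: ler_wsqrtr; apply: le_trans h _; rewrite sqrrD sqr_sqrtr //.
have : 0 <= Num.sqrt q * d by rewrite mulr_ge0.
rewrite mulr2n; lra.
Qed.

Lemma nrm_near i x (e : R) : cod i x -> 0 < e -> exists2 r : R, 0 < r &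
  forall y, `|y - x| < r -> cod i y /\ forall u, nrm i y u <= nrm i x u + e * `|u| /\ nrm i x u <= nrm i y u + e * `|u|.
Proof.
move=> ix e0; have d0 : 0 < e ^+ 2 / 4 by rewrite divr_gt0 ?exprn_gt0.
have mc : {for x, continuous (metric i)}.
  apply/continuous_mxP => a b; exact: smooth_continuous (@metric_smooth _ _ i a b) ix.
have [r r0 hr] := (near_normP _ _).1 (filterI (open_nbhs_nbhs (conj (@cod_open _ _ i) ix)) (continuous_near_le mc d0)).
exists r => // y /hr[iy hy]; split=> // u.
have hq : `|quad (metric i y - metric i x) u u| <= (e * `|u|) ^+ 2.
  apply: le_trans (quad_normr_le _ _ _) _.
  have -> : (e * `|u|) ^+ 2 = 4 * (e ^+ 2 / 4) * `|u| * `|u| by field.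
  by rewrite !ler_wpM2r // ler_wpM2l.
have E : quad (metric i y - metric i x) u u = quad (metric i y) u u - quad (metric i x) u u.
  by rewrite /quad mulmxBr mulmxBl !mxE.
move: hq; rewrite E ler_norml => /andP[h1 h2].
have eu : 0 <= e * `|u| by rewrite mulr_ge0 // ltW.
split; apply: sqrt_le_add => //; try exact: metric_ge0; lra.
Qed.

Lemma Ck_line (V : normedModType R) n (U : set R^o) (w y : V) : open U -> Ck n U (fun t : R^o => t *: w + y).
Proof.
move=> oU; apply: CkD => //; last exact: Ck_cst.
have lin : linear (fun s : R^o => s *: w) by move=> a u v; rewrite scalerDl -scalerA.
pose LM := GRing.isLinear.Build _ _ _ _ _ lin.
pose L : {linear R^o -> V} := HB.pack (fun s : R^o => s *: w) LM.
have cL : continuous L by exact: scalel_continuous.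
exact: (Ck_linear n U cL).
Qed.

Lemma straight_path i x (e : R) : cod i x -> 0 < e -> exists2 r : R, 0 < r &
  forall y z, `|y - x| < r -> `|z - x| < r -> [/\ cod i y, cod i z & exists2 l,
    piecewise_path (param i y) (param i z) l & l <= nrm i x (z - y) + e * `|z - y|].
Proof.
move=> ix e0; have [r r0 hr] := nrm_near ix e0.
exists (r / 3); first by rewrite divr_gt0.
move=> y z yr zr; set g := fun t : R => t *: (z - y) + y.
have gr t : - (1 / 2) < t < 1 + 1 / 2 -> `|g t - x| < r.
  move=> t01; have -> : g t - x = (1 - t) *: (y - x) + t *: (z - x).
    rewrite /g scalerBl scale1r !scalerBr; apply/rowP => k; rewrite !mxE; ring.
  apply: le_lt_trans (ler_normD _ _) _; rewrite !normrZ.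
  have h1 : `|1 - t| <= 3 / 2 by rewrite ler_norml; lra.
  have h2 : `|t| <= 3 / 2 by rewrite ler_norml; lra.
  have := normr_ge0 (y - x); have := normr_ge0 (z - x).
  have := normr_ge0 t; have := normr_ge0 (1 - t); move: h1 h2 yr zr.
  move: `|1 - t| `|t| `|y - x| `|z - x| => p q a b; nra.
have [r1 r2] : `|y - x| < r /\ `|z - x| < r by split; lra.
have [iy _] := hr y r1; have [iz _] := hr z r2; split=> //.
pose J : set R^o := [set t | - (1/2) < t < 1 + 1/2].
have oJ : open J.
  have -> : J = (`]- (1/2), 1 + 1/2[%classic : set R^o) by apply/seteqP; split=> t; rewrite /= in_itv.
  exact: interval_open.
have gS : smooth (J : set R^o) (g : R^o -> 'rV[R]_2).
  by move=> n; exact: Ck_line.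
have cS : smooth_to J (param i \o g).
  apply: (smooth_to_comp (@cod_open _ _ i) oJ _ (@smooth_to_param i) gS) => t Jt.
  by have [] := hr _ (gr t Jt).
have sS : smooth_segment (param i \o g).
  exists (1/2); first by lra.
  have -> : (`]- (1/2), 1 + 1/2[%classic : set R^o) = J by apply/seteqP; split=> t; rewrite /= in_itv.
  exact: cS.
have g0 : g 0 = y by rewrite /g scale0r add0r.
have g1 : g 1 = z by rewrite /g scale1r subrK.
exists (segment_length (param i \o g) + 0).
  have := path_cons sS (path_nil _); rewrite /= g0 g1; exact.
rewrite addr0; have [F dF ->] := arclength sS.
set B := leRHS.
have := @derive_le R F (speed (param i \o g)) (fun t => B * t) (fun=> B) 0 1 ler01 dF.
rewrite mulr0 mulr1 subr0; apply.
  move=> t _; apply: (is_derive_congr (@is_derive_scalel R R^o B t)) => [s|]; last by [].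
  by rewrite mulrC.
move=> t t01.
have Jt : J t by rewrite /J /=; lra.
have [it h] := hr _ (gr t Jt).
have rt := smooth_to_regular cS Jt.
have idt : dom i ((param i \o g) t) by apply: param_dom.
have vE : vel i (param i \o g) t = z - y.
  have d1 : is_derive t 1 g (z - y).
    have d0 := is_derive_scalel (z - y) t.
    have := @is_deriveD _ _ _ _ (cst y) _ _ _ _ d0 (is_derive_cst _ _ _); rewrite addr0; exact.
  rewrite /vel derive1E; case: d1 => _ <-; apply: near_eq_derive.
  have := open_nbhs_nbhs (conj oJ Jt); apply: filterS => s Js /=; rewrite paramK //.
  by have [] := hr _ (gr s Js).
by rewrite (speedE rt idt) vE /= paramK //; have [] := h (z - y).
Qed.

Lemma near_ball_norm (V : normedModType R) (a : V) (r : R) : 0 < r -> \forall z \near a, `|z - a| < r.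
Proof. by move=> r0; apply/near_normP; exists r. Qed.

Lemma near_path (p : M) : \forall q \near p, exists l, piecewise_path p q l.
Proof.
set i := chart_at p; have ip : dom i p := chart_atP p.
have [r r0 hr] := straight_path (chart_cod ip) ltr01.
have h : \forall q \near p, `|chart i q - chart i p| < r.
  exact: (chart_continuous ip (near_ball_norm (chart i p) r0)).
apply: filterS (filterI (open_nbhs_nbhs (conj (@dom_open _ _ i) ip)) h) => q [iq hq].
have [|_ _ [l hl _]] := hr (chart i p) (chart i q) _ hq; first by rewrite subrr normr0.
by exists l; move: hl; rewrite !chartK.
Qed.

(** The set reachable from [x] is open and closed, hence everything by connectedness. Without this
    the infimum defining [rdist] could be that of an empty set. *)
Lemma path_exists (x y : M) : exists l, piecewise_path x y l.
Proof.
pose A := [set z | exists l, piecewise_path x z l].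
suff AT : A = setT by have : A y by rewrite AT.
have oA : open A.
  rewrite openE => z [l hl]; apply: filterS (near_path z) => w [l' hl'].
  by exists (l + l'); exact: path_cat hl hl'.
have cA : closed A.
  rewrite -openC openE => z nz; apply: filterS (near_path z) => w [l' hl'] [l hl].
  by apply: nz; exists (l + l'); exact: path_cat hl (path_rev hl').
apply: (@surface_connected _ M A); first by exists x, 0; exact: path_nil.
- by exists A => //; rewrite setTI.
- by exists A => //; rewrite setTI.
Qed.

Lemma rdist_le (x y : M) l : piecewise_path x y l -> rdist x y <= l.
Proof. by move=> h; apply: inf_lbound => //; exists 0 => l' /path_ge0. Qed.

Lemma rdist_glb (x y : M) (b : R) : (forall l, piecewise_path x y l -> b <= l) -> b <= rdist x y.
Proof. by move=> h; apply: lb_le_inf; [have [l] := path_exists x y; exists l|move=> l /h]. Qed.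

Lemma rdist_ge0 (x y : M) : 0 <= rdist x y.
Proof. by apply: rdist_glb => l; exact: path_ge0. Qed.

Lemma rdist_sym (x y : M) : rdist x y = rdist y x.
Proof. by apply/eqP; rewrite eq_le; apply/andP; split; apply: rdist_glb => l /path_rev; exact: rdist_le. Qed.

Lemma rdistxx (x : M) : rdist x x = 0.
Proof. by apply/eqP; rewrite eq_le rdist_ge0 andbT; exact/rdist_le/path_nil. Qed.

Lemma rdist_triangle (x y z : M) : rdist x z <= rdist x y + rdist y z.
Proof.
rewrite -lerBlDr; apply: rdist_glb => l hl; rewrite lerBlDr -lerBlDl; apply: rdist_glb => l' hl'.
by rewrite lerBlDl; exact: rdist_le (path_cat hl hl').
Qed.

Lemma forward_lipschitz_rdist f (x y : M) : forward_lipschitz f -> f y - f x <= rdist x y.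
Proof. by move=> fL; apply: rdist_glb => l; exact: forward_lipschitz_path. Qed.

Lemma rdist_chart_le i x (e : R) : cod i x -> 0 < e -> exists2 r : R, 0 < r &
  forall y z, `|y - x| < r -> `|z - x| < r -> [/\ cod i y, cod i z &
    rdist (param i y) (param i z) <= nrm i x (z - y) + e * `|z - y|].
Proof.
move=> ix e0; have [r r0 hr] := straight_path ix e0; exists r => // y z yr zr.
have [iy iz [l hl le]] := hr y z yr zr; split=> //.
exact: le_trans (rdist_le hl) le.
Qed.

Lemma nrm_le i x : exists2 C : R, 0 <= C & forall u, nrm i x u <= C * `|u|.
Proof.
exists (Num.sqrt (4 * `|metric i x|)); first exact: sqrtr_ge0.
move=> u; rewrite /nrm -{1}(normr_id u) -sqrtr_sqr -sqrtrM; last by rewrite mulr_ge0.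
apply: ler_wsqrtr; apply: le_trans (ler_norm _) _; apply: le_trans (quad_normr_le _ _ _) _.
by rewrite expr2 !mulrA.
Qed.

Lemma rdist_curve c t (e : R) : curve_regular c t -> 0 < e ->
  \forall s \near t, rdist (c t) (c s) <= (speed c t + e) * `|s - t|.
Proof.
move=> rc e0; set i := chart_at (c t); have ic : dom i (c t) := chart_atP _.
set x := chart i (c t); set v := vel i c t.
have ix : cod i x by exact: chart_cod.
have [C C0 hC] := nrm_le i x.
have v1 : 0 < `|v| + 1 by have := normr_ge0 v; lra.
pose e1 := e / (2 * (`|v| + 1)); pose e2 := Num.min 1 (e / (2 * (C + 1))).
have e10 : 0 < e1 by rewrite divr_gt0 // mulr_gt0.
have e20 : 0 < e2 by rewrite lt_min ltr01 divr_gt0 // mulr_gt0 //; lra.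
have h1 : e1 * (`|v| + 1) = e / 2 by rewrite /e1; field; rewrite gt_eqF.
have h2 : C * e2 <= e / 2.
  have : e2 <= e / (2 * (C + 1)) by rewrite ge_min lexx orbT.
  have E : (C + 1) * (e / (2 * (C + 1))) = e / 2 by field; rewrite gt_eqF //; lra.
  move=> h; rewrite -E; apply: ler_pM => //; [exact: ltW|lra].
have h3 : e2 <= 1 by rewrite ge_min lexx.
have [r r0 hr] := rdist_chart_le ix e10.
have d1 := regular_derive rc ic.
have n1 := is_derive_eps d1 e20.
have cX := is_derive_continuous d1.
have n2 : \forall s \near t, `|chart i (c s) - x| < r.
  exact: (cX _ (near_ball_norm x r0)).
have n3 := near_dom rc.1 ic.
apply: filterS (filterI n1 (filterI n2 n3)) => s [/= k1 [k2 k3]].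
have [|_ _] := hr x (chart i (c s)) _ k2; first by rewrite subrr normr0.
rewrite /x !chartK // => /le_trans; apply.
rewrite (speedE rc ic) -/x -/v -/(nrm i x v).
set w := chart i (c s) - x; move: k1; rewrite -/w -/x; set h := s - t => k1.
have q1 : nrm i x w <= `|h| * nrm i x v + C * (e2 * `|h|).
  have -> : w = h *: v + (w - h *: v) by rewrite addrC subrK.
  apply: le_trans (nrmD _ _ ix) _; rewrite nrmZ lerD2l; apply: le_trans (hC _) _.
  by rewrite ler_wpM2l.
have q2 : `|w| <= (`|v| + 1) * `|h|.
  have -> : w = h *: v + (w - h *: v) by rewrite addrC subrK.
  apply: le_trans (ler_normD _ _) _; rewrite normrZ mulrDl mul1r mulrC lerD2l.
  apply: le_trans k1 _; rewrite -[leRHS]mul1r; exact: ler_wpM2r.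
have q3 : e1 * `|w| <= e / 2 * `|h|.
  by rewrite -h1 -mulrA ler_wpM2l // ltW.
have q4 : C * (e2 * `|h|) <= e / 2 * `|h| by rewrite mulrA ler_wpM2r.
have -> : (nrm i x v + e) * `|h| = `|h| * nrm i x v + e / 2 * `|h| + e / 2 * `|h| by field.
lra.
Qed.
End Arclength.

(** * The exponential map *)

Section Energy.
Variables (R : realType) (M : riemannian_surface R).
Implicit Types (i j : atlas M) (c : R -> M) (p q : M) (t : R).

Lemma is_derive_near (V W : normedModType R) (f g : V -> W) x v d :
  (\forall y \near x, f y = g y) -> is_derive x v f d -> is_derive x v g d.
Proof.
move=> e [df <-]; apply: DeriveDef; first exact: near_eq_derivable e df.
exact/esym/near_eq_derive.
Qed.

Definition energy c t := inner (c t) (velocity c t) (velocity c t).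

Lemma energyE c t i : curve_regular c t -> dom i (c t) ->
  energy c t = quad (metric i (chart i (c t))) (vel i c t) (vel i c t).
Proof. by move=> rc ic; rewrite /energy /inner velocityE (quad_vel_transition rc ic) //; exact: chart_atP. Qed.

(** Taking the velocity for both arguments in [koszul], the two acceleration terms cancel the
    derivative of the metric. *)
Lemma geodesic_energy c t : geodesic c -> energy c t = energy c 0.
Proof.
move=> gc; have gr s := geodesic_regular s gc.
have d0 (t0 : R) : is_derive t0 1 (energy c) 0.
  set i := chart_at (c t0); have it : dom i (c t0) := chart_atP _.
  have dX := regular_derive (gr t0) it; have dV := vel_derive openT gc I it.
  have hX : differentiable (chart i \o c) t0 by apply/derivable1_diffP; case: dX.
  have eX : 'D_1 (chart i \o c) t0 = vel i c t0 by case: dX.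
  have h := quad_derive (chart_cod it) hX eX dV dV.
  have nE : \forall s \near t0, quad (metric i (chart i (c s))) (vel i c s) (vel i c s) = energy c s.
    by apply: filterS (near_dom (gr t0).1 it) => s is_; rewrite (energyE (gr s) is_).
  apply: (is_derive_near nE); apply: (is_derive_congr h) => [s|]; first by [].
  have K := koszul (vel i c t0) (vel i c t0) (chart_cod it).
  rewrite /= -/(acc i (chart i (c t0)) (vel i c t0)).
  have := quadC (vel i c t0) (acc i (chart i (c t0)) (vel i c t0)) (Defs.metric_sym (chart_cod it)).
  move=> ->; rewrite K; move: (quad (dmetric _ _ _) _ _) => q; lra.
have L (a b : R) : a <= b -> energy c b = energy c a.
  move=> ab; apply/eqP; rewrite -subr_eq0 eq_le.
  have h1 := @derive_le R (energy c) (cst 0) (cst 0) (cst 0) a b ab (fun t _ => d0 t) (fun t _ => is_derive_cst _ _ _) (fun t _ => lexx _).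
  have h2 := @derive_le R (cst 0) (cst 0) (energy c) (cst 0) a b ab (fun t _ => is_derive_cst _ _ _) (fun t _ => d0 t) (fun t _ => lexx _).
  by move: h1 h2; rewrite /cst (subrr 0) => h1 h2; apply/andP; split.
by case: (leP 0 t) => h; [exact: L|apply/esym/L/ltW].
Qed.

Lemma geodesic_speed c t : geodesic c -> speed c t = speed c 0.
Proof. by move=> gc; rewrite /speed -!/(energy c _) geodesic_energy. Qed.

Lemma rdist_geodesic c (a b : R) : geodesic c -> rdist (c a) (c b) <= speed c 0 * `|b - a|.
Proof.
move=> gc; have ga := geodesic_affine (b - a) a gc.
have sS : smooth_segment (fun t => c ((b - a) * t + a)).
  by exists 1 => //; split=> [x _|i]; [exact: ga.1.1|apply: sub_smooth (ga.1.2 i) => x []].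
have dF (t : R) : 0 <= t <= 1 -> is_derive t 1 (fun t : R => t *: (speed c 0 * `|b - a|)) (speed (fun t => c ((b - a) * t + a)) t).
  move=> _; rewrite (speed_affine (geodesic_regular _ gc)) (geodesic_speed _ gc) mulrC.
  exact: (@is_derive_scalel R R^o).
have := path_cons sS (path_nil _); rewrite mulr0 add0r mulr1 subrK => /rdist_le.
by rewrite addr0 (segment_lengthE sS dF) scale0r subr0 scale1r.
Qed.

Lemma nrm_ge i x : cod i x -> exists2 C : R, 0 < C & forall u, `|u| <= C * nrm i x u.
Proof.
(* [w k] represents the [k]-th coordinate form for the metric, so the Cauchy-Schwarz inequality
   bounds each coordinate. *)
move=> ix; pose w (k : 'I_2) : 'rV[R]_2 := delta_mx 0 k *m invmx (metric i x).
exists (1 + nrm i x (w 0) + nrm i x (w 1)).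
  have := nrm_ge0 i x (w 0); have := nrm_ge0 i x (w 1); lra.
have sG := Defs.metric_sym ix.
have H k (u : 'rV[R]_2) : u 0 k <= nrm i x (w k) * nrm i x u.
  have E : quad (metric i x) (w k) u = u 0 k.
    by rewrite /quad /w -[delta_mx 0 k *m _ *m _]mulmxA mulVmx ?metric_unit // mulmx1 -rowE !mxE.
  by rewrite -E; exact: metric_cs.
move=> u; apply: mx_norm_le; first by rewrite mulr_ge0 ?nrm_ge0 //; have := nrm_ge0 i x (w 0); have := nrm_ge0 i x (w 1); lra.
move=> a b; rewrite (ord1 a).
have nN : nrm i x (- u) = nrm i x u by rewrite /nrm quadNl quadNr opprK.
have h1 := H b u; have h2 := H b (- u); rewrite nN mxE in h2.
have n0 := nrm_ge0 i x u; have n1 := nrm_ge0 i x (w 0); have n2 := nrm_ge0 i x (w 1).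
have h3 : nrm i x (w b) <= 1 + nrm i x (w 0) + nrm i x (w 1).
  have [->|->] : b = 0 \/ b = 1 by case: b {H h1 h2} => [[|[|//]] ?]; [left|right]; exact/val_inj.
    lra.
  lra.
have h4 : nrm i x (w b) * nrm i x u <= (1 + nrm i x (w 0) + nrm i x (w 1)) * nrm i x u by rewrite ler_wpM2r.
rewrite ler_norml; lra.
Qed.

Lemma rdist_near p (e : R) : 0 < e -> \forall q \near p, rdist p q < e.
Proof.
move=> e0; set i := chart_at p; have ip : dom i p := chart_atP p.
have [r r0 hr] := rdist_chart_le (chart_cod ip) ltr01.
have [C C0 hC] := nrm_le i (chart i p).
have d0 : 0 < Num.min r (e / (C + 1)) by rewrite lt_min r0 divr_gt0 //; lra.
have N : \forall q \near p, `|chart i q - chart i p| < Num.min r (e / (C + 1)) by exact: (chart_continuous ip (near_ball_norm (chart i p) d0)).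
apply: filterS (filterI (open_nbhs_nbhs (conj (@dom_open _ _ i) ip)) N) => q [iq].
rewrite /= lt_min => /andP[q1 q2].
have [|_ _ ] := hr (chart i p) (chart i q) _ q1; first by rewrite subrr normr0.
rewrite !chartK // => /le_lt_trans; apply.
move: q2; rewrite ltr_pdivlMr; last lra.
have := hC (chart i q - chart i p); lra.
Qed.

Lemma rdist_continuous p q : {for q, continuous (rdist p : M -> R^o)}.
Proof.
apply: near_continuous => e e0; apply: filterS (rdist_near q e0) => y /ltW; apply: le_trans.
have h1 := rdist_triangle p q y; have h2 := rdist_triangle p y q; rewrite (rdist_sym y q) in h2.
by rewrite ler_norml; lra.
Qed.

End Energy.

Section Exp.
Variables (R : realType) (M : riemannian_surface R).
Hypothesis mc : complete_surface M.
Implicit Types (i j : atlas M) (c : R -> M) (p q : M) (t : R).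

(** The whole geodesic rather than its value at time 1: radial, time and scaling arguments all take
    place on this curve. *)
Definition Exp p (v : 'rV[R]_2) : R -> M := geo mc (chart_at p) (row_mx (chart (chart_at p) p) v).
Definition pnorm p v := nrm (chart_at p) (chart (chart_at p) p) v.

Lemma start_dom p v : spray_dom (chart_at p) (row_mx (chart (chart_at p) p) v).
Proof. by rewrite /spray_dom /= row_mxKl; exact/chart_cod/chart_atP. Qed.

Lemma ExpP p v : [/\ geodesic (Exp p v), Exp p v 0 = p & velocity (Exp p v) 0 = v].
Proof.
have [g1 i1 s1] := geoP mc (start_dom p v); have [x1 v1] := eq_row_mx s1.
have e : Exp p v 0 = p by rewrite /Exp -(chartK i1) x1 chartK //; exact: chart_atP.
by split; [exact: g1|exact: e|rewrite velocityE e; exact: v1].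
Qed.

Lemma geodesic_ExpE c t0 t : geodesic c -> c (t + t0) = Exp (c t0) (velocity c t0) t.
Proof. by move=> gc; rewrite /Exp -(geo_state mc t gc (chart_atP _)). Qed.

Lemma Exp_scale p (a : R) v t : Exp p (a *: v) t = Exp p v (a * t).
Proof.
have [g0 e0 v0] := ExpP p v.
have rc := geodesic_regular (a * 0 + 0) g0.
have ga := geodesic_affine a 0 g0.
have := geodesic_ExpE 0 t ga; rewrite !addr0 mulr0 e0 => ->; congr (Exp p _ t).
rewrite velocityE /= mulr0 add0r e0.
have h : dom (chart_at p) (Exp p v (a * 0 + 0)) by rewrite mulr0 add0r e0; exact: chart_atP.
have ve := v0; rewrite velocityE e0 in ve.
by rewrite (vel_affine rc h) mulr0 add0r ve.
Qed.

Lemma exp_mapE p v : exp_map p v = Exp p v 1.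
Proof.
have [g0 e0 v0] := ExpP p v.
rewrite /exp_map; apply: xget_unique; first by exists (Exp p v).
move=> q [c [gc <- <- <-]]; have := geodesic_ExpE 0 1 gc; rewrite addr0; exact.
Qed.

Lemma Exp_speed p v t : speed (Exp p v) t = pnorm p v.
Proof.
have [g0 e0 v0] := ExpP p v; rewrite (geodesic_speed _ g0) (speedE (geodesic_regular 0 g0) (i := chart_at p)) e0.
  by have ve := v0; rewrite velocityE e0 in ve; rewrite ve.
exact: chart_atP.
Qed.

Lemma rdist_Exp p v (a b : R) : rdist (Exp p v a) (Exp p v b) <= pnorm p v * `|b - a|.
Proof. by have [g0 _ _] := ExpP p v; rewrite -(Exp_speed p v 0); exact: rdist_geodesic. Qed.
End Exp.

(** * The Gauss lemma *)

Section BlockDerivatives.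
Variables (R : realType) (V : normedModType R) (m n : nat).

Lemma is_derive_lsubmx (f : V -> 'rV[R]_(m + n)) x v d : is_derive x v f d ->
  is_derive x v (fun y => lsubmx (f y)) (lsubmx d).
Proof.
move=> /is_derive_mxP h; apply/is_derive_mxP => a k; rewrite mxE.
by apply: (is_derive_congr (h a (lshift n k))) => // y; rewrite mxE.
Qed.

Lemma is_derive_rsubmx (f : V -> 'rV[R]_(m + n)) x v d : is_derive x v f d ->
  is_derive x v (fun y => rsubmx (f y)) (rsubmx d).
Proof.
move=> /is_derive_mxP h; apply/is_derive_mxP => a k; rewrite mxE.
by apply: (is_derive_congr (h a (rshift m k))) => // y; rewrite mxE.
Qed.

Lemma is_derive_row_mxr (a : 'rV[R]_m) (f : V -> 'rV[R]_n) x v d : is_derive x v f d ->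
  is_derive x v (fun y => row_mx a (f y)) (row_mx 0 d).
Proof.
move=> /is_derive_mxP h; apply/is_derive_mxP => b k; rewrite mxE; case: split_ordP => l ->.
  rewrite mxE; apply: (is_derive_congr (is_derive_cst (a b l : R^o) x v)) => // y.
  by rewrite row_mxEl.
by apply: (is_derive_congr (h b l)) => // y; rewrite row_mxEr.
Qed.
End BlockDerivatives.

Lemma smooth_id (R : realType) (V : normedModType R) (U : set V) : smooth U (id : V -> V).
Proof.
pose L := (@idfun V : {linear V -> V}).
have cL : continuous L by move=> z; exact: cvg_id.
by move=> n; exact: (Ck_linear n U cL).
Qed.

Lemma gauss_arith (R : realFieldType) (a b c Q : R) : b + 2 * c = 2 * Q -> a + (2^-1 * b - a) + c = Q.
Proof. by move=> h; lra. Qed.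

Section Gauss.
Variables (R : realType) (M : riemannian_surface R).
Hypothesis mc : complete_surface M.
Implicit Types (i j : atlas M) (c : R -> M) (q : M) (t : R).
Notation Exp := (Exp mc).

Lemma Exp0 p t : Exp p 0 t = p.
Proof.
rewrite -(scale0r (0 : 'rV[R]_2)) Exp_scale mul0r.
by have [_ -> _] := ExpP mc p 0.
Qed.

Section Flow.
Variables (i : atlas M) (N : set 'rV[R]_(2 + 2)) (al be : R).
Hypothesis oN : open N.
Let phi := fun z t => state i (geo mc i z) t.

Lemma flow_variation z w t : flow (spray_dom i) (@spray _ M i) N al be phi -> al < 0 -> 0 < be ->
  N z -> al < t < be ->
  is_derive t 1 (fun s => lsubmx ('D_w (phi ^~ s) z) : 'rV[R]_2) (rsubmx ('D_w (phi ^~ t) z)).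
Proof.
move=> fl al0 be0 Nz tab.
have dZ := flow_derive (@spray_dom_open _ _ i) (@spray_smooth _ M i 1%N) oN fl w al0 be0 Nz tab.
have W := ((fl z Nz).2 t tab).1.
have dF := smooth_differentiable (@spray_smooth _ M i) W.
have dF' : is_derive (phi z t) ('D_w (phi ^~ t) z) (@spray _ M i) ('D_('D_w (phi ^~ t) z) (@spray _ M i) (phi z t)).
  by apply: DeriveDef => //; exact: diff_derivable.
apply: (is_derive_congr (is_derive_lsubmx dZ)) => //.
have := is_derive_lsubmx dF'; have := is_derive_rsubmx (is_derive_id (phi z t) ('D_w (phi ^~ t) z)).
have e3 : (fun y => lsubmx (@spray _ M i y) : 'rV[R]_2) = (fun y => rsubmx y) by apply/funext => y; rewrite /spray row_mxKl.
move=> [_ e1] [_ e2]; apply: (etrans (esym e2)); apply: etrans e1; rewrite e3; reflexivity.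
Qed.

(** Derivative of the conservation of energy with respect to the initial state. *)
Lemma flow_energy_variation z w t : flow (spray_dom i) (@spray _ M i) N al be phi -> al < 0 -> 0 < be ->
  (forall z t, N z -> al < t < be -> dom i (geo mc i z t)) -> N `<=` spray_dom i ->
  N z -> al < t < be ->
  quad (dmetric i (lsubmx (phi z t)) (lsubmx ('D_w (phi ^~ t) z))) (rsubmx (phi z t)) (rsubmx (phi z t)) +
  2 * quad (metric i (lsubmx (phi z t))) (rsubmx ('D_w (phi ^~ t) z)) (rsubmx (phi z t)) =
  quad (dmetric i (lsubmx z) (lsubmx w)) (rsubmx z) (rsubmx z) + 2 * quad (metric i (lsubmx z)) (rsubmx w) (rsubmx z).
Proof.
move=> fl al0 be0 D Nd Nz tab.
have dp := flow_differentiable (@spray_dom_open _ _ i) (@spray_smooth _ M i 1%N) oN fl al0 be0 Nz tab.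
have dp' : is_derive z w (phi ^~ t) ('D_w (phi ^~ t) z).
  by apply: DeriveDef => //; exact: diff_derivable.
have W z' : N z' -> cod i (lsubmx (phi z' t)) by move=> Nz'; exact: ((fl z' Nz').2 t tab).1.
have W0 z' : N z' -> cod i (lsubmx z') by move=> /Nd.
have dX : differentiable (fun y => lsubmx (phi y t) : 'rV[R]_2) z.
  exact: (differentiable_comp dp (differentiable_lsubmx _)).
have dX0 : differentiable (fun y : 'rV[R]_(2 + 2) => lsubmx y : 'rV[R]_2) z by exact: differentiable_lsubmx.
have [_ eX] := is_derive_lsubmx dp'.
have [_ eX0] := is_derive_lsubmx (is_derive_id z w).
have dV := is_derive_rsubmx dp'; have dV0 := is_derive_rsubmx (is_derive_id z w).
have [_ h1] := @quad_derive _ M _ i (fun y => lsubmx (phi y t)) (fun y => rsubmx (phi y t)) (fun y => rsubmx (phi y t)) _ _ _ z w (W z Nz) dX eX dV dV.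
have [_ h2] := @quad_derive _ M _ i (fun y => lsubmx y) (fun y => rsubmx y) (fun y => rsubmx y) _ _ _ z w (W0 z Nz) dX0 eX0 dV0 dV0.
have E : 'D_w (fun s => quad (metric i (lsubmx (phi s t))) (rsubmx (phi s t)) (rsubmx (phi s t)) : R^o) z =
         'D_w (fun s => quad (metric i (lsubmx s)) (rsubmx s) (rsubmx s) : R^o) z.
  apply: near_eq_derive; apply: filterS (open_nbhs_nbhs (conj oN Nz)) => y Ny.
  have [g1 i1 s1] := geoP mc (Nd y Ny); have [x0 v0] := eq_row_mx (etrans s1 (esym (hsubmxK y))).
  rewrite /phi /state row_mxKl row_mxKr -(energyE (geodesic_regular t g1) (D y t Ny tab)) (geodesic_energy t g1).
  by rewrite (energyE (geodesic_regular 0 g1) i1) x0 v0.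
rewrite h1 h2 in E.
rewrite (quadC (rsubmx (phi z t)) (rsubmx ('D_w (phi ^~ t) z)) (Defs.metric_sym (W z Nz))) in E.
rewrite (quadC (rsubmx z) (rsubmx w) (Defs.metric_sym (W0 z Nz))) in E.
by rewrite !mulr2n !mulrDl !mul1r !addrA.
Qed.

(** The inner product of the velocity with the variation field has constant derivative: by [koszul]
    its derivative is half the variation of energy, which is conserved. It vanishes at time 0 as the
    starting point is fixed. *)
Lemma gauss_variation z w T : flow (spray_dom i) (@spray _ M i) N al be phi -> al < 0 -> 0 < be ->
  (forall z t, N z -> al < t < be -> dom i (geo mc i z t)) -> N `<=` spray_dom i ->
  N z -> 0 <= T < be -> lsubmx w = 0 ->
  quad (metric i (lsubmx (phi z T))) (rsubmx (phi z T)) (lsubmx ('D_w (phi ^~ T) z)) =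
  T * quad (metric i (lsubmx z)) (rsubmx z) (rsubmx w).
Proof.
move=> fl al0 be0 D Nd Nz T0 w0.
have [g1 i1 s1] := geoP mc (Nd z Nz).
set Q := quad (metric i (lsubmx z)) (rsubmx z) (rsubmx w).
pose H t := quad (metric i (lsubmx (phi z t))) (rsubmx (phi z t)) (lsubmx ('D_w (phi ^~ t) z)).
have dH (t : R) : 0 <= t <= T -> is_derive t 1 (H : R -> R^o) Q.
  move=> tT; have tab : al < t < be by lra.
  have ic := D z t Nz tab; have ix := chart_cod ic.
  have rc := geodesic_regular t g1.
  have dX := regular_derive rc ic; have dV := vel_derive openT g1 I ic.
  have hX : differentiable (chart i \o geo mc i z) t by apply/derivable1_diffP; case: dX.
  have eX : 'D_1 (chart i \o geo mc i z) t = vel i (geo mc i z) t by case: dX.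
  have dY := flow_variation w fl al0 be0 Nz tab.
  have h := quad_derive ix hX eX dV dY.
  have K := koszul (vel i (geo mc i z) t) (lsubmx ('D_w (phi ^~ t) z)) ix.
  have Ev := flow_energy_variation w fl al0 be0 D Nd Nz tab.
  have Pl : lsubmx (phi z t) = chart i (geo mc i z t) by rewrite /phi /state row_mxKl.
  have Pr : rsubmx (phi z t) = vel i (geo mc i z) t by rewrite /phi /state row_mxKr.
  rewrite Pl Pr w0 in Ev.
  have d0 : quad (dmetric i (lsubmx z) 0) (rsubmx z) (rsubmx z) = 0.
    rewrite (_ : dmetric i (lsubmx z) 0 = 0) /quad ?mulmx0 ?mul0mx ?mxE //.
    by apply/matrixP => a b; rewrite !mxE derive0.
  rewrite d0 add0r in Ev.
  rewrite (quadC _ (rsubmx z) (Defs.metric_sym (Nd z Nz))) -/Q in Ev.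
  apply: (is_derive_congr h) => [s|]; first by rewrite /H /phi /state row_mxKl row_mxKr.
  rewrite /= -/(acc i (chart i (geo mc i z t)) (vel i (geo mc i z) t)) K.
  rewrite (quadC (vel i (geo mc i z) t) (rsubmx _) (Defs.metric_sym ix)).
  exact: (gauss_arith _ Ev).
have T1 : 0 <= T by case/andP: T0.
have hQ (t : R) : is_derive t 1 (fun t => t *: (Q : R^o)) Q by exact: is_derive_scalel.
have h1 := @derive_le R H (cst Q) (fun t => t *: (Q : R^o)) (cst Q) 0 T T1 dH (fun t _ => hQ t) (fun _ _ => lexx _).
have h2 := @derive_le R (fun t => t *: (Q : R^o)) (cst Q) H (cst Q) 0 T T1 (fun t _ => hQ t) dH (fun _ _ => lexx _).
have H0 : H 0 = 0.
  have e0 : 'D_w (phi ^~ 0) z = w.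
    have [_ e] := is_derive_id z w; apply: etrans e; apply: near_eq_derive.
    by apply: filterS (open_nbhs_nbhs (conj oN Nz)) => y /fl [].
  by rewrite /H e0 w0 quad0r.
apply/eqP; rewrite eq_le -/(H T); move: h1 h2; rewrite H0 scale0r !subr0 /GRing.scale /= => h1 h2.
by apply/andP; split.
Qed.
End Flow.

Section NormalFlow.
Variable p : M.
Let i := chart_at p.
Let x := chart i p.

(** The neighbourhood of the zero vector is that of the constant geodesic, so everything up to time
    1 happens in the chart at [p]. The last clause is the Gauss lemma. *)
Lemma exp_chart : exists U : set 'rV[R]_2, [/\ open U, U 0, forall v, U v -> dom i (Exp p v 1),
  smooth U (fun v => chart i (Exp p v 1)) &
  forall v h, U v -> quad (metric i (chart i (Exp p v 1))) (vel i (Exp p v) 1) ('D_h (fun v => chart i (Exp p v 1)) v) =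
    quad (metric i x) v h].
Proof.
pose st (v : 'rV[R]_2) : 'rV[R]_(2 + 2) := row_mx x v.
have H0 t : 0 <= t <= 1 -> dom i (geo mc i (st 0) t).
  by move=> _; rewrite -/(Exp p 0 t) Exp0; exact: chart_atP.
have [N [d [oN N0 d0 fl D]]] := geo_flow ler01 (start_dom p 0) H0.
have d0' : - d < 0 by lra.
have d1 : 0 < 1 + d by lra.
have dT : - d < 1 < 1 + d by lra.
have Nd : N `<=` spray_dom i.
  by move=> z Nz; have [_ /(_ 0)] := fl z Nz; rewrite d0' d1 => /(_ isT) []; have [-> _] := fl z Nz.
have stS : smooth setT st.
  by apply: smooth_row_mx; [exact: openT|move=> n; exact: Ck_cst|exact: smooth_id].
have oU : open (st @^-1` N).
  by apply: open_comp => // v _; exact: (smooth_continuous stS I).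
have FS := flow_smooth (@spray_dom_open _ _ i) (@spray_smooth _ M i) oN d0' d1 fl dT.
have UU v : (st @^-1` N) v -> N (st v) by [].
have ES1 : smooth (st @^-1` N) ((fun z => state i (geo mc i z) 1) \o st).
  by apply: (smooth_comp oU oN UU) FS; apply: sub_smooth stS.
have lS : smooth setT (fun z : 'rV[R]_(2+2) => lsubmx z : 'rV[R]_2).
  by move=> m; apply: Ck_linear; exact: rV_linear_continuous.
have EE v : lsubmx (state i (geo mc i (st v)) 1) = chart i (Exp p v 1) by rewrite /state row_mxKl.
have ES : smooth (st @^-1` N) (fun v => chart i (Exp p v 1)).
  apply: (eq_smooth oU (fun v _ => EE v)).
  exact: (smooth_comp oU openT (fun _ _ => I) ES1 lS).
exists (st @^-1` N); split=> //.
  by move=> v Nv; exact: D.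
move=> v h Nv.
have T0 : 0 <= (1 : R) < 1 + d by rewrite ler01 ltrDl.
have := gauss_variation oN fl d0' d1 D Nd Nv T0 (w := row_mx 0 h).
rewrite row_mxKl row_mxKr => /(_ erefl); rewrite mul1r /st row_mxKl row_mxKr => <-.
rewrite /state row_mxKl row_mxKr; congr (quad _ _ _).
have dst : is_derive v h st (row_mx 0 h) by exact: is_derive_row_mxr (is_derive_id v h).
have dp := flow_differentiable (@spray_dom_open _ _ i) (@spray_smooth _ M i 1%N) oN fl d0' d1 Nv dT.
have dst' : differentiable st v by exact: (smooth_differentiable stS I).
have := derive_comp h dst' dp; have [_ ->] := dst => <-.
have dc : differentiable ((fun z => state i (geo mc i z) 1) \o st) v by exact: differentiable_comp.
have dc' : is_derive v h ((fun z => state i (geo mc i z) 1) \o st) ('D_h ((fun z => state i (geo mc i z) 1) \o st) v).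
  by apply: DeriveDef => //; exact: diff_derivable.
have [_ e] := is_derive_lsubmx dc'; apply: etrans e.
have e3 : (fun v => chart i (Exp p v 1)) = (fun y => lsubmx (((fun z => state i (geo mc i z) 1) \o st) y)).
  by apply/funext => u; rewrite /= EE.
rewrite e3; reflexivity.
Qed.

Lemma Exp_radial v t : dom i (Exp p v t) -> is_derive t 1 (fun s => chart i (Exp p (s *: v) 1)) (vel i (Exp p v) t).
Proof.
move=> it; have [g0 _ _] := ExpP mc p v.
apply: (is_derive_congr (regular_derive (geodesic_regular t g0) it)) => // s.
by rewrite Exp_scale mulr1.
Qed.

Lemma Exp_radial_derive v t : dom i (Exp p v t) -> differentiable (fun v => chart i (Exp p v 1)) (t *: v) ->
  'D_v (fun v => chart i (Exp p v 1)) (t *: v) = vel i (Exp p v) t.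
Proof.
move=> it dE; have [_ <-] := Exp_radial it.
by have [_ <-] := is_derive_comp (is_derive_scalel v t) dE.
Qed.
End NormalFlow.
End Gauss.

(** * Normal neighbourhoods *)

Lemma is_derive_unique (R : realType) (V W : normedModType R) (f : V -> W) x v d d' :
  is_derive x v f d -> is_derive x v f d' -> d = d'.
Proof. by move=> [_ <-] [_ <-]. Qed.

Section NormalBall.
Variables (R : realType) (M : riemannian_surface R).
Hypothesis mc : complete_surface M.
Implicit Types (i j : atlas M) (c : R -> M) (p q : M) (t : R).
Notation Exp := (Exp mc).

(** Only the radial component of [u] enters the growth of the norm to first order. The zero vector,
    where the norm has no derivative, is covered by a separate hypothesis. *)
Lemma nrm_forward i x v u (S e : R) : cod i x -> 0 <= S -> quad (metric i x) v u <= nrm i x v * S ->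
  (v = 0 -> nrm i x u <= S) -> 0 < e ->
  exists2 r : R, 0 < r & forall h, 0 <= h < r -> nrm i x (v + h *: u) <= nrm i x v + h * (S + e).
Proof.
move=> ix S0 vu v0 e0; case: (eqVneq v 0) => [vE|vn].
  exists 1 => // h /andP[h0 _]; rewrite vE add0r nrmZ ger0_norm //.
  rewrite -[leLHS]add0r lerD ?nrm_ge0 // ler_wpM2l //; have := v0 vE; lra.
have a0 := nrm_gt0 ix vn; set a := nrm i x v in a0 vu *; set D := nrm i x u.
have D0 : 0 <= D ^+ 2 by exact: sqr_ge0.
exists (2 * a * e / (D ^+ 2 + 1)); first by rewrite divr_gt0 // ?mulr_gt0 //; lra.
move=> h /andP[h0]; rewrite ltr_pdivlMr; last lra.
move=> hD; rewrite -(@ler_pXn2r _ 2) ?nnegrE ?nrm_ge0 //; last first.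
  by rewrite addr_ge0 ?(ltW a0) // mulr_ge0 //; lra.
rewrite nrm_sqr // quadDl !quadDr !quadZl !quadZr -!nrm_sqr // -/a -/D (quadC u v (Defs.metric_sym ix)).
have h1 : h * quad (metric i x) v u <= h * (a * S) by rewrite ler_wpM2l.
have h2 : h * (h * D ^+ 2) <= h * (2 * a * e).
  rewrite ler_wpM2l //; apply: le_trans (ltW hD); rewrite ler_wpM2l //; lra.
have h3 : 0 <= (h * (S + e)) ^+ 2 by exact: sqr_ge0.
have -> : (a + h * (S + e)) ^+ 2 = a ^+ 2 + 2 * (h * (a * S)) + h * (2 * a * e) + (h * (S + e)) ^+ 2 by ring.
lra.
Qed.

Lemma nrm_forward_curve i x (w : R -> 'rV[R]_2) t u (S e : R) : cod i x -> 0 <= S -> is_derive t 1 w u ->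
  quad (metric i x) (w t) u <= nrm i x (w t) * S -> (w t = 0 -> nrm i x u <= S) -> 0 < e ->
  \forall s \near t, (t <= s -> nrm i x (w s) <= nrm i x (w t) + (S + e) * (s - t)) /\
    nrm i x (w t) <= nrm i x (w s) + e.
Proof.
move=> ix S0 dw H1 H2 e0; set v := w t in H1 H2 *.
have e2 : 0 < e / 2 by rewrite divr_gt0.
have [d d0 hd] := nrm_forward ix S0 H1 H2 e2.
have [C C0 hC] := nrm_le i x.
have C1 : 0 < C + 1 by lra.
have eC : 0 < e / 2 / (C + 1) by rewrite divr_gt0.
have n1 := is_derive_eps dw eC.
have n2 := continuous_near_le (is_derive_continuous dw) eC.
have n3 := @near_ball_norm R R^o t _ d0.
apply: filterS (filterI n1 (filterI n2 n3)) => s [k1 [k2 k3]].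
move: k1 k2 k3; rewrite /= -/v => k1 k2 k3.
have T z : nrm i x z <= (C + 1) * `|z| by apply: le_trans (hC z) _; rewrite ler_wpM2r //; lra.
split=> [ts|].
  have h0 : 0 <= s - t by rewrite subr_ge0.
  rewrite ger0_norm // in k1 k3.
  have hh : 0 <= s - t < d by rewrite h0.
  have t1 := hd _ hh; have t2 := T (w s - v - (s - t) *: u).
  have t3 := nrmD (v + (s - t) *: u) (w s - v - (s - t) *: u) ix.
  have E : v + (s - t) *: u + (w s - v - (s - t) *: u) = w s.
    by rewrite addrC addrACA addNr addr0 subrK.
  rewrite E in t3.
  have t4 : (C + 1) * `|w s - v - (s - t) *: u| <= e / 2 * (s - t).
    have -> : e / 2 * (s - t) = (C + 1) * (e / 2 / (C + 1) * (s - t)) by field; rewrite gt_eqF.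
    by rewrite ler_pM2l.
  move: t1 t2 t3 t4 => t1 t2 t3 t4; lra.
have t1 : (C + 1) * `|w s - v| <= e / 2.
  have -> : e / 2 = (C + 1) * (e / 2 / (C + 1)) by field; rewrite gt_eqF.
  by rewrite ler_pM2l.
have t2 := T (v - w s); have := nrmD (w s) (v - w s) ix; rewrite addrC subrK; rewrite distrC in t2; lra.
Qed.

(** A normal ball read in the chart at [p]: [g] is a logarithm, total but constrained on the image
    of the ball only, and the last clause is the Gauss lemma. *)
Definition normal_radius p (r : R) (g : 'rV[R]_2 -> 'rV[R]_2) :=
  let i := chart_at p in let E := fun v => chart i (Exp p v 1) in let B := [set v | pnorm p v < r] in
  [/\ 0 < r, forall v, B v -> dom i (Exp p v 1) /\ g (E v) = v,
    open (E @` B) /\ smooth (E @` B) g, smooth B E &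
    forall v h, B v -> quad (metric i (E v)) (vel i (Exp p v) 1) ('D_h E v) = inner p v h].

Lemma pnorm_open p r : open [set v | pnorm p v < r].
Proof.
have [C C0 hC] := nrm_le (chart_at p) (chart (chart_at p) p).
have ix := chart_cod (chart_atP p).
rewrite openE => v /= vr; suff : \forall u \near v, pnorm p u < r by [].
have d0 : 0 < (r - pnorm p v) / (C + 1) by rewrite divr_gt0 ?subr_gt0 //; lra.
apply: filterS (near_ball_norm v d0) => u; rewrite ltr_pdivlMr; last lra.
have := nrmD v (u - v) ix; rewrite addrC subrK -/(pnorm p u) -/(pnorm p v).
have := hC (u - v); have := normr_ge0 (u - v); rewrite /pnorm; lra.
Qed.

(** The differential of the exponential map at 0 is the identity, so [inverse_estimate] gives
    injectivity on a small ball, and the inverse function theorem makes the chosen inverse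
    smooth. *)
Lemma normal_radius_exists p : exists r g, normal_radius p r g.
Proof.
have [U [oU U0 UD ES G]] := exp_chart mc p; set i := chart_at p.
pose E v := chart i (Exp p v 1).
have ip : dom i p := chart_atP p.
have ix := chart_cod ip.
have D0 w : 'D_w E 0 = w.
  have dw : dom i (Exp p w 0) by have [_ -> _] := ExpP mc p w.
  have dE : differentiable E (0 *: w) by rewrite scale0r; exact: smooth_differentiable ES U0.
  have := Exp_radial_derive dw dE; rewrite scale0r => ->.
  by have [_ e0 v0] := ExpP mc p w; rewrite velocityE e0 in v0.
have K0 w : 'D_w E 0 = 0 -> w = 0 by rewrite D0.
have ESE : smooth U E := ES.
have [b [r [b0 r0 rU rD rI]]] := inverse_estimate oU (ESE 1%N) U0 K0.
have [C C0 hC] := nrm_ge ix.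
pose B := [set v | pnorm p v < r / C].
have BB v : B v -> `|v - 0| < r.
  by rewrite /B /= subr0 ltr_pdivlMr // => h; apply: le_lt_trans (hC v) _; rewrite mulrC.
have inj v u : B v -> B u -> E v = E u -> u = v.
  move=> Bv Bu e; have := rI v u (BB _ Bv) (BB _ Bu); rewrite e subrr normr0 mulr0 normr_le0 subr_eq0.
  by move/eqP.
pose g y := xget 0 [set v | B v /\ E v = y].
have gE v : B v -> g (E v) = v.
  move=> Bv; apply: xget_unique => //= u [Bu e]; exact: inj.
have oB : open B by exact: pnorm_open.
have ES' : smooth B E by apply: sub_smooth ES => v /BB /rU.
have DI v w : B v -> 'D_w E v = 0 -> w = 0.
  by move=> /BB Bv e; have := rD v w Bv; rewrite e normr0 mulr0 normr_le0 => /eqP.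
have [oW gS] := inverse_function_smooth oB ES' DI gE.
exists (r / C), g; split=> //; first by rewrite divr_gt0.
  by move=> v Bv; split; [apply: UD; exact: rU (BB _ Bv)|exact: gE].
by move=> v h Bv; apply: G; exact: rU (BB _ Bv).
Qed.

(** * The radial function of a normal ball *)

Section Radius.
Variables (p : M) (r : R) (g : 'rV[R]_2 -> 'rV[R]_2).
Hypothesis nr : normal_radius p r g.
Let i := chart_at p.
Let x := chart i p.
Let E v := chart i (Exp p v 1).
Let B := [set v | pnorm p v < r].

Let ix : cod i x. Proof. exact/chart_cod/chart_atP. Qed.

(** The expected distance to [p], truncated at [r] outside the ball so as to be defined and
    1-Lipschitz on the whole surface. *)
Definition radial q : R := if `[< exists2 v, B v & Exp p v 1 = q >] then pnorm p (g (chart i q)) else r.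

Lemma radialE v : B v -> radial (Exp p v 1) = pnorm p v.
Proof.
have [_ nD _ _ _] := nr => Bv; rewrite /radial asboolT; last by exists v.
by have [_ ->] := nD v Bv.
Qed.

Lemma radial_le q : radial q <= r.
Proof.
have [_ nD _ _ _] := nr; rewrite /radial; case: asboolP => [[v Bv <-]|//].
by have [_ ->] := nD v Bv; exact: ltW.
Qed.

Lemma radial_out q : ~ (exists2 v, B v & Exp p v 1 = q) -> radial q = r.
Proof. by move=> o; rewrite /radial asboolF. Qed.

Lemma pnorm_closed_compact (a : R) : compact [set v | pnorm p v <= a].
Proof.
have [C C0 hC] := nrm_ge ix.
apply: bounded_closed_compact.
  exists (C * a); split; first exact: num_real.
  by move=> b Cab v /= va; apply: le_trans (ltW Cab); apply: le_trans (hC v) _; rewrite ler_pM2l.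
rewrite -openC openE => v /negP; rewrite -ltNge => va.
have [C' C'0 hC'] := nrm_le i x.
have d0 : 0 < (pnorm p v - a) / (C' + 1) by rewrite divr_gt0 ?subr_gt0 //; lra.
apply: filterS (near_ball_norm v d0) => u; rewrite ltr_pdivlMr; last lra.
have := nrmD u (v - u) ix; rewrite addrC subrK -/(pnorm p u) -/(pnorm p v) distrC.
have := hC' (v - u); have := normr_ge0 (v - u) => h1 h2 h3 h4; apply/negP; rewrite -ltNge.
rewrite /pnorm -/i -/x in h2 h3 h4 *; lra.
Qed.

Lemma Exp_continuous v : B v -> {for v, continuous (fun v => Exp p v 1)}.
Proof.
have [_ nD _ nE _] := nr => Bv.
have cE : {for v, continuous E} := smooth_continuous nE Bv.
have h := continuous_comp cE (param_continuous (chart_cod (nD v Bv).1)).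
have nE' : \forall u \near v, (param i \o E) u = Exp p u 1.
  apply: filterS (open_nbhs_nbhs (conj (@pnorm_open p r) Bv)) => u Bu.
  by rewrite /= /E chartK //; exact: (nD u Bu).1.
suff : Exp p u 1 @[u --> v] --> Exp p v 1 by [].
rewrite -(nbhs_singleton nE'); apply: cvg_trans h; exact: near_eq_cvg nE'.
Qed.

(** Inside the ball, the Gauss lemma and the Cauchy-Schwarz inequality bound the growth of the norm
    of the lifted curve by the speed. Outside, the function is maximal, and it is lower
    semicontinuous because smaller closed balls have compact, hence closed, images. *)
Lemma radial_forward_lipschitz : forward_lipschitz radial.
Proof.
have [r0 nD [oW gS] nE G] := nr.
move=> c t rc e e0; have S0 := speed_ge0 c t.
case: (pselect (exists2 v, B v & Exp p v 1 = c t)) => [[v Bv vE]|out]; last first.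
  rewrite (radial_out out).
  have h1 : \forall s \near t, r <= radial (c s) + e.
    case: (leP r e) => re.
      apply: filterS filterT => s _; rewrite -[leLHS]add0r lerD //.
      by rewrite /radial; case: asboolP => _; [exact: nrm_ge0|exact: ltW].
    have KB v : pnorm p v <= r - e -> B v by move=> h; rewrite /B /=; lra.
    have cK : compact ((fun v => Exp p v 1) @` [set v | pnorm p v <= r - e]).
      apply: continuous_compact; last exact: pnorm_closed_compact.
      apply: continuous_in_subspaceT => v; rewrite inE => /KB; exact: Exp_continuous.
    have clK := compact_closed (@surface_hausdorff _ M) cK.
    have nK : (~` ((fun v => Exp p v 1) @` [set v | pnorm p v <= r - e])) (c t).
      by move=> [v /KB Bv h]; apply: out; exists v.
    have oK := closed_openC clK.
    have nn : \forall s \near t, (~` ((fun v => Exp p v 1) @` [set v | pnorm p v <= r - e])) (c s).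
      exact: (rc.1 _ (open_nbhs_nbhs (conj oK nK))).
    apply: filterS nn => s ns.
    case: (pselect (exists2 v, B v & Exp p v 1 = c s)) => [[u Bu uE]|o]; last by rewrite radial_out // lerDl ltW.
    rewrite -uE radialE // leNgt; apply/negP => h; apply: ns; exists u => //=; lra.
  apply: filterS h1 => s hs; split=> // ts; apply: le_trans (radial_le _) _.
  by rewrite lerDl mulr_ge0 ?subr_ge0 //; lra.
have [iv gv] := nD v Bv; have ic : dom i (c t) by rewrite -vE.
have Wt : (E @` B) (chart i (c t)) by exists v => //; rewrite -vE.
have dX := regular_derive rc ic.
have cX := is_derive_continuous dX.
have nW : \forall s \near t, dom i (c s) /\ (E @` B) (chart i (c s)).
  by apply: filterI; [exact: near_dom rc.1 ic|exact: (cX _ (open_nbhs_nbhs (conj oW Wt)))].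
pose w s := g (chart i (c s)).
have wE s : dom i (c s) -> (E @` B) (chart i (c s)) -> [/\ B (w s), E (w s) = chart i (c s) & radial (c s) = pnorm p (w s)].
  move=> is_ [u Bu uE]; rewrite /w -uE; have [iu gu] := nD u Bu; rewrite gu; split=> //.
  by rewrite -(radialE Bu); congr radial; rewrite -(chartK is_) -uE /E chartK.
have wt : w t = v by rewrite /w -vE.
have dg := smooth_differentiable gS Wt.
have dw := is_derive_comp dX dg; set u := 'D_(vel i c t) g _ in dw.
have dE : differentiable E (w t) by rewrite wt; exact: smooth_differentiable nE Bv.
have Du : 'D_u E v = vel i c t.
  have nEE : \forall s \near t, (E \o (g \o (chart i \o c))) s = (chart i \o c) s.
    by apply: filterS nW => s [h1 h2]; have [_ h _] := wE s h1 h2; exact: h.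
  rewrite -wt; exact: is_derive_unique (is_derive_near nEE (is_derive_comp dw dE)) dX.
have cV : cod i (E v) by exact: chart_cod.
have Sv : nrm i (E v) (vel i (Exp p v) 1) = pnorm p v.
  have [gE _ _] := ExpP mc p v.
  by rewrite -(Exp_speed mc p v 1) (speedE (geodesic_regular 1 gE) iv).
have Sc : speed c t = nrm i (E v) (vel i c t) by rewrite (speedE rc ic) -vE.
have H1 : quad (metric i x) v u <= nrm i x v * speed c t.
  have := G v u Bv; rewrite -/E Du /inner -/i -/x => <-.
  by rewrite Sc -[nrm i x v]Sv; exact: metric_cs.
have H2 : v = 0 -> nrm i x u <= speed c t.
  move=> v0; have e1 : E v = x by rewrite v0 /E Exp0.
  have du : dom i (Exp p u 0) by have [_ -> _] := ExpP mc p u; exact: chart_atP.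
  have dE0 : differentiable E (0 *: u) by rewrite scale0r -v0 -wt.
  have := Exp_radial_derive du dE0; rewrite scale0r -v0 -/E Du => e2.
  have [_ e3 v3] := ExpP mc p u; rewrite velocityE e3 -/i in v3.
  have e4 : vel i c t = u := etrans e2 v3.
  rewrite Sc e1 e4; exact: lexx.
rewrite -wt in H1 H2.
apply: filterS (filterI nW (nrm_forward_curve ix S0 dw H1 H2 e0)) => s [[is_ Ws] h].
have [_ _ rs] := wE s is_ Ws; have [_ _ rt] := wE t ic Wt; rewrite rs rt; exact: h.
Qed.

Lemma normal_rdist v : pnorm p v < r -> rdist p (Exp p v 1) = pnorm p v.
Proof.
have [r0 nD _ _ _] := nr => vr; apply/eqP; rewrite eq_le; apply/andP; split.
  have := rdist_Exp mc p v 0 1; have [_ -> _] := ExpP mc p v.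
  by rewrite subr0 normr1 mulr1.
have := forward_lipschitz_rdist p (Exp p v 1) radial_forward_lipschitz.
rewrite (radialE vr) (_ : radial p = 0) ?subr0 //.
have B0 : B 0 by rewrite /B /= /pnorm /nrm quad0l sqrtr0.
by have := radialE B0; rewrite Exp0 /pnorm /nrm quad0l sqrtr0.
Qed.

Lemma normal_inside q : rdist p q < r -> exists v, pnorm p v = rdist p q /\ Exp p v 1 = q.
Proof.
have [r0 nD _ _ _] := nr => qr.
case: (pselect (exists2 v, B v & Exp p v 1 = q)) => [[v Bv vE]|o].
  by exists v; split=> //; rewrite -vE normal_rdist.
have := forward_lipschitz_rdist p q radial_forward_lipschitz.
have B0 : B 0 by rewrite /B /= /pnorm /nrm quad0l sqrtr0.
have := radialE B0; rewrite Exp0 /pnorm /nrm quad0l sqrtr0 => ->; rewrite radial_out // subr0.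
by rewrite leNgt qr.
Qed.
End Radius.
End NormalBall.

(** * Minimizing geodesics *)

(** The case analysis of [shell_forward_lipschitz] on reals: [a] and [b] are radial value and
    distance to the target at the current time, primed letters the same at a nearby time. *)
Lemma shell_arith (R : realType) (a a' b b' K e e1 de m dd : R) (P : Prop) :
  a <= a' + e1 -> dd <= K -> b' <= b + dd -> b <= b' + dd -> K < e -> (a < de -> K < de - a) -> 0 <= K ->
  (P -> a' <= a + K) -> (de < a -> de <= a - e1) -> (a = de -> m <= b) -> e1 <= e -> 0 < e ->
  (P -> (if a' < de then a' else de + Num.max 0 (m - b')) <= (if a < de then a else de + Num.max 0 (m - b)) + K) /\
  (if a < de then a else de + Num.max 0 (m - b)) <= (if a' < de then a' else de + Num.max 0 (m - b')) + e.
Proof.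
move=> h1 h2 h3 h4 h5 h6 h7 h8 h9 h10 h11 h12.
have M1 : 0 <= Num.max 0 (m - b) by rewrite le_max lexx.
have M1' : 0 <= Num.max 0 (m - b') by rewrite le_max lexx.
have M2 : m - b <= Num.max 0 (m - b) by rewrite le_max lexx orbT.
have M2' : m - b' <= Num.max 0 (m - b') by rewrite le_max lexx orbT.
have M3 : Num.max 0 (m - b) <= Num.max 0 (m - b') + dd by rewrite ge_max; apply/andP; split; lra.
have M3' : Num.max 0 (m - b') <= Num.max 0 (m - b) + dd by rewrite ge_max; apply/andP; split; lra.
have M4 : a = de -> Num.max 0 (m - b) = 0 by move=> /h10 h; apply/max_idPl; lra.
move: M1 M1' M3 M3' M4; clear M2 M2'; move: (Num.max 0 (m - b)) (Num.max 0 (m - b')) => x x' M1 M1' M3 M3' M4.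
case: (ltgtP a de) => ad; case: (ltP a' de) => ad'.
- split=> [/h8|]; lra.
- split=> [/h8|]; [have := h6 ad; lra|lra].
- by have := h9 ad; lra.
- split=> [/h8|]; lra.
- have := M4 ad; split=> [_|]; lra.
- have := M4 ad; split=> [_|]; lra.
Qed.

Section NoCorner.
Variables (R : realType) (M : riemannian_surface R).
Hypothesis mc : complete_surface M.
Implicit Types (i j : atlas M) (c : R -> M) (p q : M) (t : R).
Notation Exp := (Exp mc).

(** Cost, to first order, of the shortcut across a corner with incoming velocity [V] and outgoing
    velocity [W]. *)
Lemma chart_two_sided i (y z : R -> 'rV[R]_2) x V W (k : R) : cod i x -> 0 < k ->
  is_derive (0 : R) 1 y V -> is_derive (0 : R) 1 z W -> y 0 = x -> z 0 = x ->
  \forall e \near (0 : R), 0 < e -> rdist (param i (y (- e))) (param i (z e)) <= e * (nrm i x (V + W) + k).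
Proof.
move=> ix k0 dy dz y0 z0.
have [C C0 hC] := nrm_le i x.
set D := `|V + W|; have D0 : 0 <= D by exact: normr_ge0.
pose h1 := k / (4 * (D + 1)); pose h2 := Num.min (1 / 2) (k / (4 * (C + 1))).
have D1 : 0 < 4 * (D + 1) by lra.
have C1 : 0 < 4 * (C + 1) by lra.
have h10 : 0 < h1 by rewrite divr_gt0.
have h20 : 0 < h2 by rewrite lt_min !divr_gt0.
have e1 : h1 * (D + 1) = k / 4 by rewrite /h1; field; lra.
have e2 : C * h2 <= k / 4.
  have h : h2 <= k / (4 * (C + 1)) by rewrite ge_min lexx orbT.
  have -> : k / 4 = (C + 1) * (k / (4 * (C + 1))) by field; lra.
  by apply: ler_pM => //; [exact: ltW|lra].
have e3 : h2 <= 1 / 2 by rewrite ge_min lexx.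
have [r r0 hr] := rdist_chart_le ix h10.
have /near_realP [r1 r10 H1] := is_derive_eps dy h20.
have /near_realP [r2 r20 H2] := is_derive_eps dz h20.
have /near_realP [r3 r30 H3] : \forall s \near (0 : R), `|y s - y 0| < r.
  exact: (is_derive_continuous dy (near_ball_norm (y 0) r0)).
have /near_realP [r4 r40 H4] : \forall s \near (0 : R), `|z s - z 0| < r.
  exact: (is_derive_continuous dz (near_ball_norm (z 0) r0)).
have rr : 0 < Num.min (Num.min r1 r2) (Num.min r3 r4) by rewrite !lt_min r10 r20 r30.
apply: (near_realP' rr) => e; rewrite subr0 !lt_min => /andP[/andP[s1 s2] /andP[s3 s4]] e0.
rewrite gtr0_norm // in s1 s2 s3 s4.
have ne : `|- e - 0| = e by rewrite subr0 normrN gtr0_norm.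
have pe : `|e - 0| = e by rewrite subr0 gtr0_norm.
have k1 : `|y (- e) - y 0 - (- e - 0) *: V| <= h2 * `|- e - 0| by apply: H1; rewrite ne.
have k2 : `|z e - z 0 - (e - 0) *: W| <= h2 * `|e - 0| by apply: H2; rewrite pe.
have k3 : `|y (- e) - y 0| < r by apply: H3; rewrite ne.
have k4 : `|z e - z 0| < r by apply: H4; rewrite pe.
rewrite ne in k1; rewrite pe in k2.
rewrite y0 in k1 k3; rewrite z0 in k2 k4; rewrite !subr0 scaleNr opprK in k1; rewrite subr0 in k2.
have [_ _ h] := hr _ _ k3 k4; apply: (le_trans h).
set w := z e - y (- e); set rem := w - e *: (V + W).
have hrem : `|rem| <= h2 * e + h2 * e.
  have -> : rem = (z e - x - e *: W) - (y (- e) - x + e *: V).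
    rewrite /rem /w scalerDr; apply/rowP => j; rewrite !mxE; ring.
  by apply: le_trans (ler_normB _ _) _; apply: lerD.
have wE : w = e *: (V + W) + rem by rewrite addrC subrK.
have q1 : nrm i x w <= e * nrm i x (V + W) + C * `|rem|.
  by rewrite wE; apply: le_trans (nrmD _ _ ix) _; rewrite nrmZ gtr0_norm // lerD2l.
have q2 : `|w| <= e * D + `|rem|.
  by rewrite wE; apply: le_trans (ler_normD _ _) _; rewrite normrZ gtr0_norm.
have q3 : C * `|rem| <= C * (h2 * e + h2 * e) by rewrite ler_wpM2l.
have q4 : C * h2 * e <= k / 4 * e by rewrite ler_wpM2r // ltW.
have q5 : h1 * `|w| <= h1 * (e * (D + 1)).
  rewrite ler_wpM2l ?(ltW h10) //; apply: le_trans q2 _; rewrite mulrDr lerD2l mulr1.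
  apply: le_trans hrem _; have : h2 * e <= 1 / 2 * e by rewrite ler_wpM2r // ltW.
  lra.
have q6 : h1 * (e * (D + 1)) = k / 4 * e by rewrite -e1; ring.
have q7 : C * (h2 * e + h2 * e) = C * h2 * e + C * h2 * e by ring.
have q8 : 0 < k * e by rewrite mulr_gt0.
rewrite mulrDr; move: q1 q3 q4 q5 q6 q7 q8; move: (nrm i x w) (nrm i x (V + W)) `|w| `|rem| => *; lra.
Qed.

(** Equality case of the triangle inequality, by the parallelogram law. *)
Lemma unit_sum_eq i x V W : cod i x -> nrm i x V = 1 -> nrm i x W = 1 -> 2 <= nrm i x (V + W) -> V = W.
Proof.
move=> ix nV nW two; apply/eqP; rewrite -subr_eq0; apply/eqP; apply: (nrm_eq0 ix).
have sG := Defs.metric_sym ix.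
have q1 : nrm i x (V + W) ^+ 2 = 2 + 2 * quad (metric i x) V W.
  rewrite nrm_sqr // quadDl !quadDr -!nrm_sqr // nV nW (quadC W V sG); ring.
have q2 : nrm i x (V - W) ^+ 2 = 2 - 2 * quad (metric i x) V W.
  rewrite nrm_sqr // quadDl !quadDr !quadNl !quadNr opprK -!nrm_sqr // nV nW (quadC W V sG); ring.
have q3 : 2 ^+ 2 <= nrm i x (V + W) ^+ 2 by rewrite ler_pXn2r ?nnegrE ?nrm_ge0.
apply/eqP; rewrite -sqrf_eq0 eq_le sqr_ge0 andbT q2.
rewrite q1 in q3; move: q3; move: (quad _ _ _) => z; lra.
Qed.

Lemma rdist_unit_geodesic c (s t : R) : geodesic c -> speed c 0 = 1 -> s <= t -> rdist (c s) (c t) <= t - s.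
Proof.
move=> gc S st; have := rdist_geodesic s t gc.
by rewrite S mul1r ger0_norm // subr_ge0.
Qed.

Lemma corner_shrink c1 c2 (t1 t2 a b : R) : geodesic c1 -> geodesic c2 ->
  (forall s, speed c1 s = 1) -> (forall s, speed c2 s = 1) ->
  a + b <= rdist (c1 (t1 - a)) (c2 (t2 + b)) ->
  forall e : R, 0 < e -> e < a -> e < b -> e + e <= rdist (c1 (t1 - e)) (c2 (t2 + e)).
Proof.
move=> g1 g2 s1 s2 dab e e0 ea eb.
have l1 : t1 - a <= t1 - e by lra.
have l2 : t2 + e <= t2 + b by lra.
have h1 := rdist_unit_geodesic g1 (s1 0) l1; have h2 := rdist_unit_geodesic g2 (s2 0) l2.
have h3 := rdist_triangle (c1 (t1 - a)) (c1 (t1 - e)) (c2 (t2 + b)).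
have h4 := rdist_triangle (c1 (t1 - e)) (c2 (t2 + e)) (c2 (t2 + b)).
clear - dab h1 h2 h3 h4; lra.
Qed.

(* A minimizer has no corner: cutting the corner inside a chart would give a shorter path. *)
Lemma no_corner c1 c2 (t1 t2 a b : R) : geodesic c1 -> geodesic c2 -> c1 t1 = c2 t2 ->
  speed c1 t1 = 1 -> speed c2 t2 = 1 -> 0 < a -> 0 < b ->
  a + b <= rdist (c1 (t1 - a)) (c2 (t2 + b)) -> forall s : R, c1 (t1 + s) = c2 (t2 + s).
Proof.
move=> g1 g2 e12 S1 S2 a0 b0 dab.
set p := c1 t1; set i := chart_at p.
have i1 : dom i (c1 t1) := chart_atP _.
have i2 : dom i (c2 t2) by rewrite -e12.
have r1 := geodesic_regular t1 g1; have r2 := geodesic_regular t2 g2.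
have s1 (s : R) : speed c1 s = 1 by rewrite (geodesic_speed s g1) -(geodesic_speed t1 g1).
have s2 (s : R) : speed c2 s = 1 by rewrite (geodesic_speed s g2) -(geodesic_speed t2 g2).
set x := chart i p; have ix : cod i x by exact: chart_cod.
set V := vel i c1 t1; set W := vel i c2 t2.
have nV : nrm i x V = 1 by rewrite -S1 (speedE r1 i1).
have nW : nrm i x W = 1 by rewrite -S2 (speedE r2 i2) -e12.
have small := corner_shrink g1 g2 s1 s2 dab.
have two : 2 <= nrm i x (V + W).
  apply/ler_addgt0Pr => k k0.
  pose y e := chart i (c1 (1 * e + t1)); pose z e := chart i (c2 (1 * e + t2)).
  have d1 : is_derive (0 : R) 1 y V.
    by rewrite -[V]scale1r; apply: (@is_derive_affine _ _ (chart i \o c1)); rewrite mulr0 add0r; exact: regular_derive.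
  have d2 : is_derive (0 : R) 1 z W.
    by rewrite -[W]scale1r; apply: (@is_derive_affine _ _ (chart i \o c2)); rewrite mulr0 add0r; exact: regular_derive.
  have y0 : y 0 = x by rewrite /y mulr0 add0r.
  have z0 : z 0 = x by rewrite /z mulr0 add0r -e12.
  have n1 : \forall s \near (0 : R), dom i (c1 (1 * s + t1)).
    apply: (@near_dom _ _ (fun s => c1 (1 * s + t1)) 0 i); last by rewrite mulr0 add0r.
    exact: (geodesic_regular 0 (geodesic_affine 1 t1 g1)).1.
  have n2 : \forall s \near (0 : R), dom i (c2 (1 * s + t2)).
    apply: (@near_dom _ _ (fun s => c2 (1 * s + t2)) 0 i); last by rewrite mulr0 add0r.
    exact: (geodesic_regular 0 (geodesic_affine 1 t2 g2)).1.
  have /near_realP [d d0 hd] := chart_two_sided ix k0 d1 d2 y0 z0.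
  have /near_realP [d' d0' hd'] := n1; have /near_realP [d3 d30 hd3] := n2.
  have m0 : 0 < Num.min (Num.min d d') (Num.min (Num.min a b) d3) by rewrite !lt_min d0 d0' a0 b0 d30.
  set m := Num.min _ _ in m0; have e0 : 0 < m / 2 by rewrite divr_gt0.
  have em : m / 2 < m by rewrite ltr_pdivrMr // ltr_pMr // ltr1n.
  have := em; rewrite {2}/m !lt_min => /andP[/andP[m1 m2] /andP[/andP[ma mb] m3]].
  set e := m / 2 in e0 m1 m2 ma mb m3.
  have ed : `|e - 0| < d by rewrite subr0 gtr0_norm.
  have ed' : `|- e - 0| < d' by rewrite subr0 normrN gtr0_norm.
  have ed3 : `|e - 0| < d3 by rewrite subr0 gtr0_norm.
  have := hd e ed e0; rewrite /y /z !chartK; [|exact: hd3|exact: hd'].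
  rewrite !mul1r addrC [e + t2]addrC => h; have := le_trans (small e e0 ma mb) h.
  have -> : e + e = e * 2 by ring.
  by rewrite ler_pM2l.
have VW : V = W := unit_sum_eq ix nV nW two.
move=> s; rewrite !(addrC _ s) -[s in LHS]mul1r -[s in RHS]mul1r.
have ga := geodesic_affine 1 t1 g1; have gb := geodesic_affine 1 t2 g2.
apply: (@geodesic_unique _ _ _ _ 0 i ga gb); first by rewrite mulr0 !add0r.
  by rewrite mulr0 add0r.
have rc1 : curve_regular c1 (1 * 0 + t1) by rewrite mulr0 add0r.
have rc2 : curve_regular c2 (1 * 0 + t2) by rewrite mulr0 add0r.
have ic1 : dom i (c1 (1 * 0 + t1)) by rewrite mulr0 add0r.
have ic2 : dom i (c2 (1 * 0 + t2)) by rewrite mulr0 add0r.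
by rewrite (vel_affine rc1 ic1) (vel_affine rc2 ic2) mulr0 !add0r -/V -/W VW.
Qed.

Lemma rdist_eq0 p q : rdist p q = 0 -> p = q.
Proof.
move=> h; have [r [g nr]] := normal_radius_exists mc p.
have r0 : 0 < r by case: nr.
have [|v [v0 <-]] := normal_inside nr (q := q); first by rewrite h.
rewrite h in v0; have -> : v = 0 by apply: (nrm_eq0 (chart_cod (chart_atP p))) v0.
by rewrite Exp0.
Qed.

(** A barrier for paths from [p] to [q]. With [m] the distance from [q] to the sphere of radius
    [de], it is 0 at [p] and [de + m] at [q]; being 1-Lipschitz, it shows that every such path pays
    [de] to reach the sphere and [m] afterwards. *)
Definition shell p r g (de m : R) q z := if radial mc p r g z < de then radial mc p r g z
  else de + Num.max 0 (m - rdist q z).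

(** The two pieces agree on the sphere, where the distance to [q] is at least [m] and the second
    term of the outer piece vanishes. *)
Lemma shell_forward_lipschitz p r g (de m : R) q : normal_radius mc p r g -> 0 < de -> de < r ->
  (forall v, pnorm p v = de -> m <= rdist q (Exp p v 1)) -> forward_lipschitz (shell p r g de m q).
Proof.
move=> nr d0 dr hm c t rc e e0; set f := radial mc p r g.
have fL : forward_lipschitz f := radial_forward_lipschitz nr.
have S0 := speed_ge0 c t.
(* Outside the sphere, a tolerance small enough to keep nearby points of the curve from falling
   inside. *)
pose e1 := if f (c t) <= de then e else Num.min e (f (c t) - de).
have e10 : 0 < e1 by rewrite /e1; case: ifPn => //; rewrite -ltNge => h; rewrite lt_min e0 subr_gt0.
have e1e : e1 <= e by rewrite /e1; case: ifPn => // h; rewrite ge_min lexx.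
have e1f : de < f (c t) -> de <= f (c t) - e1.
  move=> h; rewrite /e1 [f (c t) <= de]leNgt h /=; have : Num.min e (f (c t) - de) <= f (c t) - de by rewrite ge_min lexx orbT.
  by rewrite !lerBrDr addrC.
have hs : f (c t) = de -> m <= rdist q (c t).
  case: (pselect (exists2 v, pnorm p v < r & Exp p v 1 = c t)) => [[v vr <-]|o].
    by rewrite /f (radialE nr vr); exact: hm.
  by rewrite /f (radial_out g o) => h; move: dr; rewrite h ltxx.
have KK : 0 < speed c t + e by lra.
have d'0 : 0 < Num.min (e / (speed c t + e)) (if f (c t) < de then (de - f (c t)) / (speed c t + e) else 1).
  by rewrite lt_min divr_gt0 //=; case: ifPn => // h; rewrite divr_gt0 // subr_gt0.
have n1 := fL c t rc _ e10.
have n1' := fL c t rc _ e0.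
have n2 := rdist_curve rc e0.
have n3 := @near_ball_norm R R^o t _ d'0.
apply: filterS (filterI n1 (filterI n1' (filterI n2 n3))) => s [[_ k2] [[k1 _] [k3 k4]]].
have B1 := rdist_triangle q (c t) (c s); have B2 := rdist_triangle q (c s) (c t).
rewrite (rdist_sym (c s) (c t)) in B2.
have k5 : (speed c t + e) * `|s - t| < e.
  by move: k4; rewrite /= lt_min ltr_pdivlMr // mulrC => /andP[].
have k6 : f (c t) < de -> (speed c t + e) * `|s - t| < de - f (c t).
  by move=> h; move: k4; rewrite /= lt_min h !(ltr_pdivlMr _ _ KK) => /andP[_]; rewrite mulrC.
have k0 : 0 <= (speed c t + e) * `|s - t| by rewrite mulr_ge0 // ltW.
have k7 : t <= s -> f (c s) <= f (c t) + (speed c t + e) * `|s - t|.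
  by move=> ts; have := k1 ts; rewrite ger0_norm // subr_ge0.
suff [h1 h2] : (t <= s -> shell p r g de m q (c s) <= shell p r g de m q (c t) + (speed c t + e) * `|s - t|) /\
    shell p r g de m q (c t) <= shell p r g de m q (c s) + e.
  by split=> // ts; have := h1 ts; rewrite ger0_norm // subr_ge0.
rewrite /shell -/f; clear - k2 k3 B1 B2 k5 k6 k0 k7 e1f hs e1e e0.
set K := (speed c t + e) * `|s - t| in k3 k5 k6 k0 k7 *.
set a := f (c t) in k2 k6 k7 hs e1f *; set a' := f (c s) in k2 k7 *.
set b := rdist q (c t) in B1 B2 hs *; set b' := rdist q (c s) in B1 B2 *.
set dd := rdist (c t) (c s) in k3 B1 B2.
exact: (@shell_arith R a a' b b' K e e1 de m dd).
Qed.

Lemma pnormZ p (a : R) v : pnorm p (a *: v) = `|a| * pnorm p v. Proof. exact: nrmZ. Qed.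

Lemma pnorm_eq0 p v : pnorm p v = 0 -> v = 0.
Proof. exact: (nrm_eq0 (chart_cod (chart_atP p))). Qed.

Lemma unit_vector p : exists u, pnorm p u = 1.
Proof.
have d1 : delta_mx 0 0 != 0 :> 'rV[R]_2.
  by apply/eqP => /matrixP /(_ 0 0); rewrite !mxE /= => /eqP; rewrite oner_eq0.
have n0 := nrm_gt0 (chart_cod (chart_atP p)) d1.
exists ((pnorm p (delta_mx 0 0))^-1 *: delta_mx 0 0).
by rewrite pnormZ ger0_norm ?invr_ge0 ?ltW // mulVf // gt_eqF.
Qed.

Lemma pnorm_continuous p : continuous (pnorm p : 'rV[R]_2 -> R^o).
Proof.
have ix := chart_cod (chart_atP p).
have [C C0 hC] := nrm_le (chart_at p) (chart (chart_at p) p).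
move=> v; apply: near_continuous => e e0.
have d0 : 0 < e / (C + 1) by rewrite divr_gt0 //; lra.
apply: filterS (near_ball_norm v d0) => u; rewrite ltr_pdivlMr; last lra.
have a1 := nrmD v (u - v) ix; have a2 := nrmD u (v - u) ix.
rewrite addrC subrK in a1; rewrite addrC subrK in a2.
have := hC (u - v); have := hC (v - u); rewrite (distrC v u); have := normr_ge0 (u - v).
rewrite /pnorm ler_norml; lra.
Qed.

(** The direction [w] points to a point of a small sphere closest to [q], which exists by
    compactness; the barrier [shell] shows that moving there shortens the distance to [q] by the
    full radius. *)
Lemma sphere_step p q : 0 < rdist p q -> exists de w, [/\ 0 < de, de <= rdist p q, pnorm p w = 1 &
  rdist (Exp p w de) q <= rdist p q - de].
Proof.
move=> d0; have [r [g nr]] := normal_radius_exists mc p.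
have r0 : 0 < r by case: nr.
pose de := Num.min (r / 2) (rdist p q).
have de0 : 0 < de by rewrite lt_min d0 divr_gt0.
have der : de < r by rewrite gt_min ltr_pdivrMr // ltr_pMr // ltr1n.
have ded : de <= rdist p q by rewrite ge_min lexx orbT.
pose S := [set v | pnorm p v = de].
have cS : compact S.
  have : compact ([set v | pnorm p v <= de] `&` S).
    apply: compact_closedI; first exact: pnorm_closed_compact.
    apply: (@closed_comp _ _ (pnorm p : 'rV[R]_2 -> R^o) [set de]); last exact: closed_eq.
    by move=> v _; exact: pnorm_continuous.
  by congr compact; apply/seteqP; split=> [v []//|v /= h]; split=> //=; rewrite h.
have [u u1] := unit_vector p.
have S0 : S !=set0 by exists (de *: u); rewrite /S /= pnormZ u1 mulr1 gtr0_norm.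
have cf : {within S, continuous (fun v => rdist q (Exp p v 1) : R^o)}.
  apply: continuous_in_subspaceT => v; rewrite inE /S /= => vS.
  apply: (@continuous_comp _ _ _ (fun v => Exp p v 1) (rdist q : M -> R^o)).
    by apply: (Exp_continuous nr); rewrite /= vS.
  exact: rdist_continuous.
have [v vS hv] := compact_EVT_min S0 cS cf.
have {}vS : pnorm p v = de by move: vS; rewrite inE.
set m := rdist q (Exp p v 1) in hv.
have hm u' : pnorm p u' = de -> m <= rdist q (Exp p u' 1) by move=> h; apply: hv; rewrite inE.
have h := forward_lipschitz_rdist p q (shell_forward_lipschitz nr de0 der hm).
have p0 : pnorm p 0 = 0 by rewrite -(scale0r 0) pnormZ normr0 mul0r.
have rp : radial mc p r g p = 0.
  have p0r : pnorm p 0 < r by rewrite p0.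
  by have := radialE nr p0r; rewrite Exp0 p0.
have rq : (radial mc p r g q < de) = false.
  apply/negP; case: (pselect (exists2 v, pnorm p v < r & Exp p v 1 = q)) => [[w wr wq]|o].
    by rewrite -wq (radialE nr wr) -(normal_rdist nr wr) wq ltNge ded.
  by rewrite (radial_out g o) ltNge (ltW der).
rewrite /shell rp de0 rq rdistxx !subr0 in h.
have m0 : Num.max 0 m = m by apply/max_idPr; exact: rdist_ge0.
exists de, (de^-1 *: v); split=> //.
  by rewrite pnormZ vS ger0_norm ?invr_ge0 ?ltW // mulVf // gt_eqF.
rewrite Exp_scale mulVf ?gt_eqF // rdist_sym -/m; rewrite m0 in h; lra.
Qed.

(** The Hopf-Rinow theorem. The geodesic leaving in the direction of [sphere_step] approaches [q] at
    unit rate; this is continued in time up to the distance itself. *)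
Theorem minimizing_geodesic p q : exists v, pnorm p v = rdist p q /\ Exp p v 1 = q.
Proof.
set d := rdist p q; case: (ltgtP 0 d) => [d0||d0]; first 1 last.
- by rewrite ltNge rdist_ge0.
- have p0 : pnorm p 0 = 0 by rewrite -(scale0r 0) pnormZ normr0 mul0r.
  by exists 0; rewrite Exp0 p0 -d0; split=> //; exact/rdist_eq0.
have [de [w [de0 ded w1 h0]]] := sphere_step d0.
have [gg e0 v0] := ExpP mc p w.
have S (t : R) : speed (Exp p w) t = 1 by rewrite Exp_speed.
have ul (s t : R) : s <= t -> rdist (Exp p w s) (Exp p w t) <= t - s by exact: rdist_unit_geodesic gg (S 0).
suff H : forall t : R, de <= t <= d -> rdist (Exp p w t) q <= d - t.
  exists (d *: w); rewrite pnormZ w1 mulr1 gtr0_norm //; split=> //.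
  rewrite Exp_scale mulr1; apply: rdist_eq0; apply/eqP; rewrite eq_le rdist_ge0 andbT.
  by have := H d; rewrite ded lexx subrr; apply.
apply: real_induction => t td.
  move=> H; case: (ltgtP de t) => det; [|by move: td; rewrite leNgt det|by rewrite -det].
  apply/ler_addgt0Pr => e e1.
  pose s := Num.max de (t - e / 2).
  have st : s < t by rewrite gt_max det /= ltrBlDr ltrDl divr_gt0.
  have des : de <= s by rewrite le_max lexx.
  have es : t - e / 2 <= s by rewrite le_max lexx orbT.
  have := H s; rewrite des st => /(_ isT) h1.
  have h2 := ul s t (ltW st); have := rdist_triangle (Exp p w t) (Exp p w s) q.
  rewrite (rdist_sym (Exp p w t) (Exp p w s)); clear - h1 h2 es; lra.
move=> H; set b := Exp p w t.
have t0 : 0 < t by case/andP: td => h _; exact: lt_le_trans de0 h.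
have pb : rdist p b <= t by rewrite -{1}e0 -[leRHS]subr0; apply: ul; exact: ltW.
have tr := rdist_triangle p b q; rewrite -/d in tr.
have bq : 0 < rdist b q by case/andP: td => _ h; clear - tr pb h; lra.
have [de' [w' [de0' ded' w1' h1]]] := sphere_step bq.
have [gg' e0' v0'] := ExpP mc b w'.
have tr' := rdist_triangle p (Exp b w' de') q; rewrite -/d in tr'.
(* A new step from [b] reaches a point at distance at least [t + de'] from [p], so the broken path
   through [b] is minimizing and has no corner: the step prolongs the same geodesic. *)
have corner : forall s : R, Exp p w (t + s) = Exp b w' (0 + s).
  apply: (@no_corner _ _ t 0 t de' gg gg') => //; first by rewrite Exp_speed.
  by rewrite subrr e0 add0r; clear - tr' h1 H; lra.
exists de' => // s /andP[ts sd] _.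
have := corner de'; rewrite add0r => c1.
have h2 := ul s (t + de') (ltW sd); rewrite c1 in h2.
have := rdist_triangle (Exp p w s) (Exp b w' de') q.
rewrite -/b in H; clear - h1 h2 H; lra.
Qed.
End NoCorner.

(** * Lifting curves on the circle *)

Section Primitive.
Variables (R : realType).
Notation mu := (@lebesgue_measure R).

Lemma primitive_exists (f : R -> R) (a u : R) : a < u -> (forall t : R, a <= t <= u -> {for t, continuous f}) ->
  exists F : R -> R, forall t : R, a < t < u -> is_derive t 1 F (f t).
Proof.
move=> au sC.
have cI : mu.-integrable `[a, u] (EFin \o f).
  by apply: continuous_compact_integrable; [exact: segment_compact|exact: within_continuous].
exists (fun x => (\int[mu]_(t in `[a, x]) f t)%R) => t /andP[at_ tu].
have [] := @continuous_FTC1_closed R f a t u tu cI at_ (sC t _); first by rewrite !ltW.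
by move=> d1 d2; apply: DeriveDef; [exact: d1|rewrite -derive1E; exact: d2].
Qed.

Lemma derive0_constant (f : R -> R) (a b : R) : a <= b -> (forall t : R, a <= t <= b -> is_derive t 1 f 0) -> f b = f a.
Proof.
move=> ab d0; apply/eqP; rewrite -subr_eq0 eq_le.
have h1 := @derive_le R f (cst 0) (cst 0) (cst 0) a b ab (fun t ht => d0 t ht) (fun t _ => is_derive_cst _ _ _) (fun t _ => lexx _).
have h2 := @derive_le R (cst 0) (cst 0) f (cst 0) a b ab (fun t _ => is_derive_cst _ _ _) (fun t ht => d0 t ht) (fun t _ => lexx _).
by move: h1 h2; rewrite /cst (subrr 0) => h1 h2; apply/andP; split.
Qed.

Lemma real_ivt (f : R -> R) (a b v : R) : a <= b -> (forall t : R, a <= t <= b -> {for t, continuous f}) ->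
  (f a <= v <= f b) || (f b <= v <= f a) -> exists2 t : R, a <= t <= b & f t = v.
Proof.
move=> ab cf hv.
have [] := @IVT R f a b v ab (within_continuous cf).
  by rewrite ge_min le_max; move: hv => /orP[/andP[-> ->]|/andP[-> ->]]; rewrite ?orbT.
by move=> t; rewrite in_itv /= => tab <-; exists t.
Qed.

Lemma angle_exists (x y : R) : x ^+ 2 + y ^+ 2 = 1 -> exists t : R, cos t = x /\ sin t = y.
Proof.
move=> h; have x1 : -1 <= x <= 1 by rewrite -ler_norml -(@ler_pXn2r _ 2) ?nnegrE // expr1n real_normK ?num_real // -h lerDl sqr_ge0.
have hs : sin (acos x) = `|y|.
  rewrite sin_acos // (_ : 1 - x ^+ 2 = y ^+ 2) ?sqrtr_sqr //; lra.
have xi : x \in `[-1, 1] by rewrite in_itv.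
case: (leP 0 y) => y0.
  by exists (acos x); rewrite acosK // hs ger0_norm.
by exists (- acos x); rewrite cosN sinN acosK // hs ltr0_norm // opprK.
Qed.

(** The angle is defined as a primitive of the angular velocity, with the right initial value,
    rather than by lifting through a covering. *)
Lemma circle_lift (x y dx dy : R -> R) (T : R) : 0 <= T ->
  (forall t : R, is_derive t 1 x (dx t)) -> (forall t : R, is_derive t 1 y (dy t)) ->
  (forall t : R, {for t, continuous dx}) -> (forall t : R, {for t, continuous dy}) ->
  (forall t, x t ^+ 2 + y t ^+ 2 = 1) ->
  exists th : R -> R, forall t : R, 0 <= t <= T ->
    [/\ is_derive t 1 th (x t * dy t - y t * dx t), x t = cos (th t) & y t = sin (th t)].
Proof.
move=> T0 hx hy cdx cdy h1; pose om t := x t * dy t - y t * dx t.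
have [t0 [c0 s0]] := angle_exists (h1 0).
have com (t : R) : {for t, continuous om}.
  apply: (@continuousB _ R^o); apply: (@continuousM R _); [|exact: cdy| |exact: cdx].
    exact: is_derive_continuous (hx t).
  exact: is_derive_continuous (hy t).
have lt1 : -1 < T + 1 by lra.
have [F dF] := primitive_exists lt1 (fun t _ => com t).
pose th t := F t + (t0 - F 0).
have dth (t : R) : 0 <= t <= T -> is_derive t 1 th (om t).
  move=> tT; have d : is_derive t 1 F (om t) by apply: dF; lra.
  by apply: is_derive_eq; rewrite addr0.
have th0 : th 0 = t0 by rewrite /th addrC subrK.
have orth t : x t * dx t + y t * dy t = 0.
  have d1 := hx t; have d2 := hy t.
  have d : is_derive t (1 : R) (fun t => x t ^+ 2 + y t ^+ 2 : R) (2 * (x t * dx t + y t * dy t)).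
    by apply: is_derive_eq; rewrite /GRing.scale /=; ring.
  have d' : is_derive t (1 : R) (fun t => x t ^+ 2 + y t ^+ 2 : R) 0.
    by apply: (is_derive_congr (is_derive_cst (1 : R) t 1)) => // s; rewrite h1.
  have := is_derive_unique d d' => /eqP; rewrite mulf_eq0 pnatr_eq0 /= => /eqP; exact.
have ex t : dx t = - om t * y t.
  rewrite /om; have -> : - (x t * dy t - y t * dx t) * y t = dx t * (x t ^+ 2 + y t ^+ 2) - x t * (x t * dx t + y t * dy t) by ring.
  by rewrite h1 orth mulr0 subr0 mulr1.
have ey t : dy t = om t * x t.
  rewrite /om; have -> : (x t * dy t - y t * dx t) * x t = dy t * (x t ^+ 2 + y t ^+ 2) - y t * (x t * dx t + y t * dy t) by ring.
  by rewrite h1 orth mulr0 subr0 mulr1.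
have dc (t : R) : 0 <= t <= T -> is_derive t 1 (fun t => cos (th t)) (- sin (th t) * om t).
  by move=> tT; have d := dth t tT; have := @is_derive1_comp R cos th t _ _ (is_derive_cos (th t)) d.
have ds (t : R) : 0 <= t <= T -> is_derive t 1 (fun t => sin (th t)) (cos (th t) * om t).
  by move=> tT; have d := dth t tT; have := @is_derive1_comp R sin th t _ _ (is_derive_sin (th t)) d.
(* This expression and the one in [B] are the cosine and sine of the difference between the true
   angle and [th]; both have zero derivative. *)
have A (t : R) : 0 <= t <= T -> x t * cos (th t) + y t * sin (th t) = 1.
  move=> /andP[t0' tT]; have -> : 1 = x 0 * cos (th 0) + y 0 * sin (th 0) by rewrite th0 c0 s0 -!expr2 h1.
  apply: (@derive0_constant (fun t => x t * cos (th t) + y t * sin (th t)) 0 t t0') => s /andP[s0' st].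
  have sT : 0 <= s <= T by rewrite s0' (le_trans st).
  have d1 := hx s; have d2 := hy s; have d3 := dc s sT; have d4 := ds s sT.
  by apply: is_derive_eq; rewrite /GRing.scale /= ex ey; ring.
have B (t : R) : 0 <= t <= T -> y t * cos (th t) - x t * sin (th t) = 0.
  move=> /andP[t0' tT]; have -> : 0 = y 0 * cos (th 0) - x 0 * sin (th 0) by rewrite th0 c0 s0 mulrC subrr.
  apply: (@derive0_constant (fun t => y t * cos (th t) - x t * sin (th t)) 0 t t0') => s /andP[s0' st].
  have sT : 0 <= s <= T by rewrite s0' (le_trans st).
  have d1 := hx s; have d2 := hy s; have d3 := dc s sT; have d4 := ds s sT.
  by apply: is_derive_eq; rewrite /GRing.scale /= ex ey; ring.
exists th => t tT; split; first exact: dth.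
  have E := cos2Dsin2 (th t).
  have -> : cos (th t) = cos (th t) * (x t * cos (th t) + y t * sin (th t)) - sin (th t) * (y t * cos (th t) - x t * sin (th t)) + cos (th t) * (1 - (x t * cos (th t) + y t * sin (th t))) by rewrite A // B //; ring.
  rewrite A // subrr mulr0 addr0.
  have -> : cos (th t) * 1 = cos (th t) * (x t * cos (th t) + y t * sin (th t)) by rewrite A.
  rewrite -[LHS]mulr1 -E; ring.
have E := cos2Dsin2 (th t).
have -> : sin (th t) = sin (th t) * (x t * cos (th t) + y t * sin (th t)) + cos (th t) * (y t * cos (th t) - x t * sin (th t)) by rewrite A // B //; ring.
rewrite -[LHS]mulr1 -E; ring.
Qed.
End Primitive.

(** * Smooth discs *)

Lemma open_preimage_on (S T : topologicalType) (U : set S) (W : set T) (f : S -> T) : open U ->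
  (forall x, U x -> {for x, continuous f}) -> open W -> open (U `&` f @^-1` W).
Proof.
move=> oU cf oW; rewrite openE => x [Ux Wx]; apply: filterI; first exact: open_nbhs_nbhs.
exact: (cf x Ux _ (open_nbhs_nbhs (conj oW Wx))).
Qed.

Lemma sqr1D_gt1 (R : realFieldType) (z : R) : 0 < z -> (1 + z) * (1 + z) <= 1 -> False.
Proof. by move=> z0; have := mulr_gt0 z0 z0; nra. Qed.

Section Disc.
Variables (R : realType) (M : riemannian_surface R).
Implicit Types (i j : atlas M) (p q : M) (t : R).

Lemma smooth_from_continuous (W : normedModType R) (V : set M) (h : M -> W) q : smooth_from V h -> V q ->
  {for q, continuous h}.
Proof.
move=> hS Vq; set i := chart_at q; have iq : dom i q := chart_atP q.
have Vx : (chart i @` (dom i `&` V)) (chart i q) by exists q.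
have ch := smooth_continuous (hS i) Vx.
have c := continuous_comp (chart_continuous iq) ch.
have nE : \forall y \near q, ((h \o param i) \o chart i) y = h y.
  by apply: filterS (open_nbhs_nbhs (conj (@dom_open _ _ i) iq)) => y iy; rewrite /= chartK.
suff : h y @[y --> q] --> h q by [].
rewrite -(nbhs_singleton nE); apply: cvg_trans c; exact: near_eq_cvg nE.
Qed.

Lemma smooth_composite (O : set 'rV[R]_2) (U1 V : set M) (f : 'rV[R]_2 -> M) (f1 : M -> M) (h : M -> 'rV[R]_2) v :
  open O -> open U1 -> open V -> smooth_to O f -> smooth_map U1 f1 -> smooth_from V h ->
  O v -> U1 (f v) -> V (f1 (f v)) ->
  exists O', [/\ open O', O' v, O' `<=` O, forall u, O' u -> U1 (f u) /\ V (f1 (f u)) & smooth O' (h \o f1 \o f)].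
Proof.
move=> oO oU oV fS f1S hS Ov Uv Vv.
set i := chart_at (f v); set j := chart_at (f1 (f v)).
have iv : dom i (f v) := chart_atP _; have jv : dom j (f1 (f v)) := chart_atP _.
have oiU : open (dom i `&` U1) by apply: openI => //; exact: dom_open.
have ojV : open (dom j `&` V) by apply: openI => //; exact: dom_open.
have oA : open (chart i @` (dom i `&` U1)) by apply: chart_image_open => // q [].
have oB := open_preimage_on oA (f1S i).1 ojV.
set B := _ `&` _ in oB.
have oO1 := open_preimage_on oO fS.1 oiU; set O1 := _ `&` _ in oO1.
have gS : smooth O1 (chart i \o f) by apply: sub_smooth (fS.2 i) => u [Ou [iu _]].
have oO' := open_preimage_on oO1 (fun u => smooth_continuous gS (x := u)) oB; set O' := _ `&` _ in oO'.
have pK u : O1 u -> param i (chart i (f u)) = f u by move=> [_ [iu _]]; exact: chartK.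
have mem u : O' u -> [/\ O u, dom i (f u), U1 (f u), dom j (f1 (f u)) & V (f1 (f u))].
  by move=> [uO1 [uA]]; rewrite /= (pK _ uO1) => -[ju Vu]; case: uO1 => Ou [iu Uu]; split.
exists O'; split=> //.
- split; first by split.
  split; first by exists (f v).
  by rewrite /= chartK.
- by move=> u /mem [].
- by move=> u /mem [].
have g2 : smooth B (chart j \o (f1 \o param i)).
  by apply: sub_smooth ((f1S i).2 j) => u [Au [ju _]]; split.
have UB u : O' u -> B ((chart i \o f) u) by case.
have g3 := smooth_comp oO' oB UB (sub_smooth (fun u (hu : O' u) => hu.1) gS) g2.
have oC : open (chart j @` (dom j `&` V)) by apply: chart_image_open => // q [].
have UC u : O' u -> (chart j @` (dom j `&` V)) (((chart j \o (f1 \o param i)) \o (chart i \o f)) u).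
  by move=> /mem [Ou iu Uu ju Vu]; exists (f1 (f u)) => //; rewrite /= chartK.
apply: (eq_smooth oO' _ (smooth_comp oO' oC UC g3 (hS j))) => u /mem [Ou iu Uu ju Vu].
by rewrite /= !chartK.
Qed.

(** The norm carried by row vectors is the maximum norm; the round disc needs the Euclidean one. *)
Definition esq (v : 'rV[R]_2) : R := v 0 0 ^+ 2 + v 0 1 ^+ 2.

Lemma esq_continuous : continuous (esq : 'rV[R]_2 -> R^o).
Proof.
move=> v; apply: (@continuousD _ R^o _ (fun v : 'rV[R]_2 => v 0 0 ^+ 2 : R^o) (fun v : 'rV[R]_2 => v 0 1 ^+ 2 : R^o));
  apply: (@continuousM R _); exact: coord_continuous.
Qed.

Lemma esq_norm_le v : esq v <= 1 -> `|v| <= 1.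
Proof.
move=> h; apply: mx_norm_le => // a b; rewrite (ord1 a).
rewrite -(@ler_pXn2r _ 2) ?nnegrE // expr1n real_normK ?num_real //; apply: le_trans h.
have [->|->] : b = 0 \/ b = 1 by case: b => [[|[|//]] ?]; [left|right]; exact/val_inj.
  by rewrite lerDl sqr_ge0.
by rewrite lerDr sqr_ge0.
Qed.

Lemma disc_compact : compact [set v | esq v <= 1].
Proof.
apply: bounded_closed_compact.
  exists 1; split; first exact: num_real.
  by move=> b b1 v /= /esq_norm_le h; exact: le_trans h (ltW b1).
have -> : [set v | esq v <= 1] = esq @^-1` [set x : R^o | x <= 1] by [].
by apply: closed_comp => [v _|]; [exact: esq_continuous|exact: closed_le].
Qed.

Definition disc_chart (Om : set M) (U : set 'rV[R]_2) (f : 'rV[R]_2 -> M) (h : M -> 'rV[R]_2) :=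
  [/\ [/\ open U, smooth_to U f, open (f @` U) & smooth_from (f @` U) h],
      forall v, U v -> h (f v) = v, forall v, esq v <= 1 -> U v & Om = f @` [set v | esq v <= 1]].

Lemma smooth_disc_chart Om : smooth_disc Om -> exists U f h, disc_chart Om U f h.
Proof. by move=> [U [f [[oU fS oV [h [hf hS]]] DU ->]]]; exists U, f, h. Qed.

Section Chart.
Variables (Om : set M) (U : set 'rV[R]_2) (f : 'rV[R]_2 -> M) (h : M -> 'rV[R]_2).
Hypothesis dc : disc_chart Om U f h.

Lemma disc_continuous v : U v -> {for v, continuous f}.
Proof. by case: dc => -[_ [fc _] _ _] _ _ _; exact: fc. Qed.

Lemma disc_compact_image (D : set 'rV[R]_2) : compact D -> (forall v, D v -> esq v <= 1) -> compact (f @` D).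
Proof.
case: dc => _ _ DU _ cD D1; apply: continuous_compact => //.
by apply: continuous_in_subspaceT => v; rewrite inE => /D1 /DU; exact: disc_continuous.
Qed.

Lemma Om_compact : compact Om.
Proof. by case: (dc) => _ _ _ ->; apply: disc_compact_image => //; exact: disc_compact. Qed.

Lemma Om_closed : closed Om.
Proof. by apply: compact_closed; [exact: surface_hausdorff|exact: Om_compact]. Qed.

Lemma disc_open (V : set 'rV[R]_2) : open V -> V `<=` U -> open (f @` V).
Proof.
case: dc => -[oU fS oV hS] hf DU _ oW WU.
have -> : f @` V = f @` U `&` h @^-1` V.
  apply/seteqP; split=> [_ [v Vv <-]|_ [[v Uv <-]]]; last by rewrite /= hf // => Vv; exists v.
  by split; [exists v => //; exact: WU|rewrite /= hf //; exact: WU].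
by apply: open_preimage_on => // q Vq; exact: smooth_from_continuous hS Vq.
Qed.

(** A point of the circle is not interior: pushing it slightly outwards along its radius stays in
    [U], where [f] is injective, but leaves the disc. *)
Lemma Om_interior v : U v -> (Om°) (f v) <-> esq v < 1.
Proof.
case: (dc) => -[oU fS oV hS] hf DU OmE Uv; split=> [nO|v1]; last first.
  have oW : open (esq @^-1` [set x : R^o | x < 1]).
    by apply: open_comp => [u _|]; [exact: esq_continuous|exact: open_lt].
  have oI := disc_open oW (fun u (hu : esq u < 1) => DU u (ltW hu)).
  suff : nbhs (f v) Om by [].
  apply: filterS (open_nbhs_nbhs (conj oI _)); last by exists v.
  by move=> _ [u u1 <-]; rewrite OmE; exists u => //=; exact: ltW.
have [u u1 ufv] : (f @` [set v | esq v <= 1]) (f v) by rewrite -OmE; exact: nbhs_singleton nO.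
have uv : u = v by rewrite -(hf u (DU _ u1)) ufv hf.
move: u1; rewrite /= uv le_eqVlt => /orP[/eqP v1|//].
have n1 : \forall e \near (0 : R), U ((1 + e) *: v) /\ Om (f ((1 + e) *: v)).
  have cl : {for (0 : R), continuous (fun e : R^o => (1 + e) *: v)}.
    apply: (@continuous_comp _ _ _ (fun e : R^o => 1 + e : R^o) (fun e => e *: v)).
      by apply: continuousD; [exact: cst_continuous|exact: id].
    exact: scalel_continuous.
  have E0 : (1 + 0) *: v = v by rewrite addr0 scale1r.
  apply: filterI.
    by apply: cl; rewrite /= E0; exact: open_nbhs_nbhs.
  have cf : {for (0 : R), continuous (fun e : R^o => f ((1 + e) *: v))}.
    by apply: continuous_comp => //; rewrite E0; exact: disc_continuous.
  by apply: cf; rewrite /= E0.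
have [d d0 hd] := near_realP n1.
have dd : `|d / 2 - 0| < d by rewrite subr0 gtr0_norm ?divr_gt0 // ltr_pdivrMr // ltr_pMr // ltr1n.
have [U2] := hd _ dd; rewrite OmE => -[w w1 wE].
have wv : w = (1 + d / 2) *: v by rewrite -(hf w (DU _ w1)) wE hf.
move: w1; rewrite wv /= /esq !mxE !exprMn -mulrDr -/(esq v) v1 mulr1 expr2.
have d2 : 0 < d / 2 by rewrite divr_gt0.
by move=> /(sqr1D_gt1 d2).
Qed.

Lemma bdryE : bdry Om = f @` [set v | esq v = 1].
Proof.
case: (dc) => -[oU fS oV hS] hf DU OmE.
rewrite /bdry -(closure_id Om).1; last exact: Om_closed.
apply/seteqP; split=> [q [Oq nI]|_ [v /= v1 <-]].
  have [v v1 vq] : (f @` [set v | esq v <= 1]) q by rewrite -OmE.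
  exists v => //; move: v1 nI; rewrite -vq /= => v1; rewrite Om_interior; last exact: DU.
  by move/negP; rewrite -leNgt => h1; apply/eqP; rewrite eq_le v1.
have Uv : U v by apply: DU; rewrite v1.
split; first by rewrite OmE; exists v => //=; rewrite v1.
by rewrite Om_interior // v1 ltxx.
Qed.

Lemma disc_inv q : Om q -> [/\ esq (h q) <= 1, U (h q) & f (h q) = q].
Proof. by case: (dc) => _ hf DU -> [v v1 <-]; rewrite hf; [split=> //; exact: DU|exact: DU]. Qed.

Lemma bdry_Om q : bdry Om q -> Om q.
Proof. by rewrite bdryE; case: (dc) => _ _ _ -> [v v1 <-]; exists v => //=; rewrite v1. Qed.

Lemma bdry_esq q : Om q -> bdry Om q <-> esq (h q) = 1.
Proof.
move=> /disc_inv [v1 Uv vq]; rewrite bdryE; split=> [[w w1 wq]|v2]; last by exists (h q).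
have w1' : esq w = 1 := w1.
by case: (dc) => _ hf DU _; rewrite -wq hf //; apply: DU; rewrite w1'.
Qed.
End Chart.
End Disc.

(** * Isometric involutions of a disc *)

Lemma esq_derive (R : realType) (c : R -> 'rV[R]_2) (t : R) dc : is_derive t 1 c dc ->
  is_derive t 1 (fun s => esq (c s) : R^o) (2 * (c t 0 0 * dc 0 0 + c t 0 1 * dc 0 1)).
Proof.
move=> /is_derive_mxP hc; have h0 := hc 0 0; have h1 := hc 0 1.
by apply: is_derive_eq; rewrite /GRing.scale /=; ring.
Qed.

Lemma is_derive_line (R : realType) (n : nat) (W : normedModType R) (k : 'rV[R]_n -> W) (b u : 'rV[R]_n) : differentiable k b ->
  is_derive (0 : R) 1 (fun t : R => k (t *: u + b)) ('D_u k b).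
Proof.
move=> dk; have d0 : is_derive (0 : R) 1 (fun t : R => t *: u + b) u.
  have := @is_deriveD _ _ _ _ (cst b) _ _ _ _ (is_derive_scalel u (0 : R)) (is_derive_cst _ _ _); rewrite addr0; exact.
have dk' : differentiable k ((fun t : R => t *: u + b) 0) by rewrite scale0r add0r.
have h := is_derive_comp d0 dk'; rewrite /= scale0r add0r in h; exact: h.
Qed.

Lemma near_line (R : realType) (n : nat) (P : 'rV[R]_n -> Prop) (b u : 'rV[R]_n) : (\forall w \near b, P w) ->
  \forall t \near (0 : R), P (t *: u + b).
Proof.
move=> /near_normP [r r0 hr].
have d0 : 0 < r / (`|u| + 1) by rewrite divr_gt0 //; have := normr_ge0 u; lra.
apply: (near_realP' d0) => t; rewrite subr0 ltr_pdivlMr; last by have := normr_ge0 u; lra.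
move=> h; apply: hr; rewrite addrK normrZ; apply: le_lt_trans h.
by rewrite ler_wpM2l // lerDl.
Qed.

Lemma max_contradiction (R : realFieldType) (z a : R) : 0 < z -> a <= 1 -> - (1 * z) <= a - 1 - z * 2 -> False.
Proof. by move=> z0 a1 h; lra. Qed.

(** Serves for the image of a geodesic under the involution: that curve is controlled only locally,
    through extensions, so a local Lipschitz bound replaces its length. *)
Lemma local_lipschitz_rdist (R : realType) (M : riemannian_surface R) (ga : R -> M) (K : R) :
  (forall t : R, 0 <= t <= 1 -> exists2 d : R, 0 < d & forall t', 0 <= t' <= 1 -> `|t' - t| < d ->
    rdist (ga t) (ga t') <= K * `|t' - t|) -> rdist (ga 0) (ga 1) <= K.
Proof.
move=> loc; suff H : forall t : R, 0 <= t <= 1 -> rdist (ga 0) (ga t) <= K * t.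
  by have := H 1; rewrite mulr1 lexx ler01; apply.
apply: real_induction => t t01.
  move=> H; have [d d0 hd] := loc t t01.
  case: (ltgtP 0 t) => t0; [|by move: t01; rewrite leNgt t0|by rewrite -t0 rdistxx mulr0].
  pose t' := Num.max 0 (t - d / 2).
  have t't : t' < t by rewrite gt_max t0 /= ltrBlDr ltrDl divr_gt0.
  have t'0 : 0 <= t' by rewrite le_max lexx.
  have t'd : t - d / 2 <= t' by rewrite le_max lexx orbT.
  have t'1 : 0 <= t' <= 1 by case/andP: t01 => _ h1; rewrite t'0 (le_trans (ltW t't)).
  have td : `|t' - t| < d by rewrite ltr0_norm ?subr_lt0 // opprB; lra.
  have := hd t' t'1 td; rewrite ltr0_norm ?subr_lt0 // opprB => h2.
  have := H t'; rewrite t'0 t't => /(_ isT) h1.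
  have h3 := rdist_triangle (ga 0) (ga t') (ga t).
  rewrite (rdist_sym (ga t') (ga t)) in h3.
  have -> : K * t = K * t' + K * (t - t') by ring.
  by apply: le_trans h3 _; apply: lerD.
move=> H; have t01' : 0 <= t <= 1 by case/andP: t01 => -> /ltW ->.
have [d d0 hd] := loc t t01'; exists d => // t' /andP[tt' t'd] t'1.
have t'01 : 0 <= t' <= 1 by case/andP: t01 => h1 _; rewrite t'1 andbT (le_trans h1) // ltW.
have td : `|t' - t| < d by rewrite gtr0_norm ?subr_gt0 // ltrBlDl.
have := hd t' t'01 td; rewrite gtr0_norm ?subr_gt0 // => h2.
have h3 := rdist_triangle (ga 0) (ga t) (ga t').
have -> : K * t' = K * t + K * (t' - t) by ring.
by apply: le_trans h3 _; apply: lerD.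
Qed.

Section Involution.
Variables (R : realType) (M : riemannian_surface R).
Hypothesis mc : complete_surface M.
Variables (Om : set M) (U : set 'rV[R]_2) (f : 'rV[R]_2 -> M) (h : M -> 'rV[R]_2) (s : M -> M).
Hypothesis dc : disc_chart Om U f h.
Hypothesis si : isometric_involution Om s.
Hypothesis tc : totally_convex Om.
Implicit Types (i j : atlas M) (p q : M) (t : R).

Definition disc_map (u : 'rV[R]_2) := h (s (f u)).
Notation k := disc_map.

Lemma disc_in u : esq u <= 1 -> Om (f u).
Proof. by case: (dc) => _ _ _ -> u1; exists u. Qed.

Lemma disc_mapP u : esq u <= 1 -> esq (k u) <= 1 /\ f (k u) = s (f u).
Proof.
move=> /disc_in Ou; have [sO _ _] := si.
by have [k1 _ fk] := disc_inv dc (sO _ Ou).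
Qed.

Lemma disc_map_inv u : esq u <= 1 -> k (k u) = u.
Proof.
move=> u1; rewrite {1}/disc_map (disc_mapP u1).2; have [_ ss _] := si.
by rewrite ss; [case: (dc) => _ hf DU _; rewrite hf //; exact: DU|exact: disc_in].
Qed.

Lemma disc_map_ext u : esq u <= 1 -> exists O k', [/\ open O, O u, smooth O k' &
  forall w, O w -> esq w <= 1 -> k' w = k w].
Proof.
move=> u1; have Ou := disc_in u1; have [sO ss /(_ _ Ou)[U1 [f1 [oU1 U1u f1S e1 _]]]] := si.
case: (dc) => -[oU fS oV hS] hf DU OmE.
have Vu : (f @` U) (f1 (f u)).
  rewrite e1 //; have := sO _ Ou; rewrite OmE => -[w w1 <-]; exists w => //; exact: DU.
have [A' [oA' A'u A'U mem S]] := smooth_composite oU oU1 oV fS f1S hS (DU _ u1) U1u Vu.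
exists A', (h \o f1 \o f); split=> // w A'w w1; have [U1w _] := mem w A'w.
by rewrite /= e1 //; exact: disc_in.
Qed.

Lemma near_preimage (k' : 'rV[R]_2 -> 'rV[R]_2) (O A2 : set 'rV[R]_2) b : open O -> O b -> smooth O k' -> open A2 -> A2 (k' b) ->
  \forall w \near b, O w /\ A2 (k' w).
Proof.
move=> oO Ob kS oO2 O2b; apply: filterI; first exact: open_nbhs_nbhs.
exact: (smooth_continuous kS Ob (open_nbhs_nbhs (conj oO2 O2b))).
Qed.

Lemma near_disc (b : 'rV[R]_2) : esq b < 1 -> \forall w \near b, esq w < 1.
Proof.
move=> b1; have : nbhs (esq b : R^o) [set x : R^o | x < 1] by apply: open_nbhs_nbhs; split=> //; exact: open_lt.
by move/esq_continuous.
Qed.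

Lemma inverse_derive (k1 k2 : 'rV[R]_2 -> 'rV[R]_2) b u : differentiable k1 b -> differentiable k2 (k1 b) ->
  (\forall w \near b, k2 (k1 w) = w) -> 'D_('D_u k1 b) k2 (k1 b) = u.
Proof.
move=> d1 d2 e; rewrite -(derive_comp u d1 d2).
have dd : is_derive b u (k2 \o k1) ('D_u (k2 \o k1) b).
  by apply: DeriveDef => //; apply: diff_derivable; exact: differentiable_comp.
exact: is_derive_unique (is_derive_near e dd) (is_derive_id b u).
Qed.

(** Were the image [b] of a boundary point [e] interior, the map would be a local diffeomorphism at
    [b] sending a full neighbourhood into the closed disc and [b] to its rim, which is
    impossible. *)
Lemma s_bdry x : bdry Om x -> bdry Om (s x).
Proof.
move=> bx; have Ox := bdry_Om dc bx; have [sO _ _] := si.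
have [e1 _ fx] := disc_inv dc Ox.
have e2 := (bdry_esq dc Ox).1 bx.
set e := h x in e1 e2 fx; have [b1 fb] := disc_mapP e1; set b := k e in b1 fb.
rewrite fx in fb; apply/(bdry_esq dc (sO _ Ox)).
rewrite -fb; have -> : h (f b) = b by case: (dc) => _ hf DU _; rewrite hf //; exact: DU.
apply/eqP; rewrite eq_le b1 leNgt /=; apply/negP => b1'.
have [A1 [k1 [oO1 O1e k1S k1E]]] := disc_map_ext e1.
have [A2 [k2 [oO2 O2b k2S k2E]]] := disc_map_ext b1.
have k2b : k2 b = e by rewrite k2E // disc_map_inv.
have O1b : A1 (k2 b) by rewrite k2b.
have n1 : \forall w \near b, (A2 w /\ A1 (k2 w)) /\ esq w < 1.
  by apply: filterI; [exact: near_preimage oO2 O2b k2S oO1 O1b|exact: near_disc].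
have dk2 := smooth_differentiable k2S O2b.
have dk1 : differentiable k1 (k2 b) by rewrite k2b; exact: smooth_differentiable k1S O1e.
have inv : \forall w \near b, k1 (k2 w) = w.
  apply: filterS n1 => w [[w2A w1A] w1]; have w1' := ltW w1.
  have [kw1 _] := disc_mapP w1'.
  by rewrite k2E // in w1A *; rewrite k1E ?disc_map_inv.
have inj w : 'D_w k2 b = 0 -> w = 0.
  move=> w0; have := inverse_derive w dk2 dk1 inv; rewrite w0 => <-.
  by rewrite derive0.
have uJ := jacobian_unit dk2 inj.
have [u uE] : exists u, 'D_u k2 b = e.
  by exists (e *m invmx (jacobian k2 b)); rewrite deriveEjacobian // mulmxKV.
have dl := esq_derive (is_derive_line u dk2).
rewrite /= scale0r add0r uE k2b -!expr2 -/(esq e) e2 mulr1 in dl.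
have n2 : \forall t \near (0 : R), esq (k2 (t *: u + b)) <= 1.
  have n3 : \forall w \near b, esq (k2 w) <= 1.
    apply: filterS n1 => w [[w2A _] w1]; have w1' := ltW w1.
    by rewrite k2E //; have [] := disc_mapP w1'.
  exact: near_line n3.
have n4 := is_derive_eps dl ltr01.
have /near_realP [d d0 hd] : \forall t \near (0 : R), esq (k2 (t *: u + b)) <= 1 /\
    `|esq (k2 (t *: u + b)) - esq (k2 (0 *: u + b)) - (t - 0) *: (2 : R^o)| <= 1 * `|t - 0| by exact: filterI n2 n4.
have dd : `|d / 2 - 0| < d by rewrite subr0 gtr0_norm ?divr_gt0 // ltr_pdivrMr // ltr_pMr // ltr1n.
have [q1 q2] := hd _ dd; move: q1 q2; rewrite subr0 scale0r add0r k2b e2.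
have d2 : 0 < d / 2 by rewrite divr_gt0.
rewrite (gtr0_norm d2) ler_norml /GRing.scale /= => q1 /andP[q2 _].
exact: max_contradiction d2 q1 q2.
Qed.

Lemma s_interior u : esq u < 1 -> esq (k u) < 1.
Proof.
move=> u1; have u1' := ltW u1; have [k1 fk] := disc_mapP u1'.
rewrite lt_neqAle k1 andbT; apply/negP => /eqP ke.
have Ok := disc_in k1; have hk : h (f (k u)) = k u by case: (dc) => _ hf DU _; rewrite hf //; exact: DU.
have : bdry Om (f (k u)) by apply/(bdry_esq dc Ok); rewrite hk.
move=> /s_bdry; have [sO ss _] := si; rewrite fk ss; last exact: disc_in.
move/(bdry_esq dc (disc_in u1')); have -> : h (f u) = u by case: (dc) => _ hf DU _; rewrite hf //; exact: DU.
by move=> e; move: u1; rewrite e ltxx.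
Qed.

Lemma isometry_curve (U1 : set M) (f1 : M -> M) c (t : R) : open U1 -> smooth_map U1 f1 -> U1 (c t) -> curve_regular c t ->
  (forall u v, inner (f1 (c t)) (tangent_map f1 (c t) u) (tangent_map f1 (c t) v) = inner (c t) u v) ->
  curve_regular (f1 \o c) t /\ speed (f1 \o c) t = speed c t.
Proof.
move=> oU1 f1S U1t rc iso; set i := chart_at (c t).
have ic : dom i (c t) := chart_atP _.
have oiU : open (dom i `&` U1) by apply: openI => //; exact: dom_open.
have oA : open (chart i @` (dom i `&` U1)) by apply: chart_image_open => // q [].
have Ac : (chart i @` (dom i `&` U1)) (chart i (c t)) by exists (c t).
have nE : \forall y \near t, ((f1 \o param i) \o (chart i \o c)) y = (f1 \o c) y.
  by apply: filterS (near_dom rc.1 ic) => y iy; rewrite /= chartK.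
have dX := regular_derive rc ic.
have cc : {for t, continuous (f1 \o c)}.
  have c1 := continuous_comp (is_derive_continuous dX) ((f1S i).1 _ Ac).
  suff : (f1 \o c) y @[y --> t] --> (f1 \o c) t by [].
  rewrite -(nbhs_singleton nE); apply: cvg_trans c1; exact: near_eq_cvg nE.
have dv j : dom j (f1 (c t)) -> is_derive t 1 (chart j \o (f1 \o c)) ('D_(vel i c t) (chart j \o f1 \o param i) (chart i (c t))).
  move=> jc; have S := (f1S i).2 j.
  have B : (chart i @` (dom i `&` U1) `&` (f1 \o param i) @^-1` dom j) (chart i (c t)) by split=> //=; rewrite chartK.
  have dB := smooth_differentiable S B.
  apply: is_derive_near (is_derive_comp dX dB).
  by apply: filterS (near_dom rc.1 ic) => y iy; rewrite /= chartK.
have rr : curve_regular (f1 \o c) t by split=> // j jc; have [] := dv j jc.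
split; first exact: rr.
set j := chart_at (f1 (c t)); have jc : dom j (f1 (c t)) := chart_atP _.
have ve : velocity (f1 \o c) t = tangent_map f1 (c t) (velocity c t).
  rewrite !velocityE /vel derive1E; have [_ e] := dv j jc; exact: e.
by rewrite /speed ve iso.
Qed.

Lemma Om_geodesic (x y : M) c : Om x -> Om y -> geodesic c -> c 0 = x -> c 1 = y ->
  forall t : R, 0 <= t <= 1 -> Om (c t).
Proof.
move=> Ox Oy gc c0 c1; apply: (tc Ox Oy); split=> //; exists 1 => //.
split=> [|t i _]; last by apply: gc.2.
by split=> [t _|i]; [exact: gc.1.1|apply: sub_smooth (gc.1.2 i) => t []].
Qed.

(** Total convexity keeps a minimizing geodesic of the surface inside [Om], where [s] preserves its
    speed; so [s] contracts the ambient distance, and being an involution it preserves it. *)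
Lemma s_dist_le (x y : M) : Om x -> Om y -> rdist (s x) (s y) <= rdist x y.
Proof.
move=> Ox Oy; have [v [vl vy]] := minimizing_geodesic mc x y.
have [gc c0 _] := ExpP mc x v; set c := Exp mc x v in gc c0 vy.
have cO := Om_geodesic Ox Oy gc c0 vy.
have S t : speed c t = rdist x y by rewrite /c Exp_speed.
apply/ler_addgt0Pr => e e0; have -> : s y = s (c 1) by rewrite vy.
have E : rdist x y + e = (rdist x y + e) * 1 by rewrite mulr1.
rewrite E; have [sO ss ext] := si.
have l0 := rdist_ge0 x y; have le0 : 0 < rdist x y + e by lra.
have loc (t : R) : 0 <= t <= 1 -> exists2 d : R, 0 < d & forall t', 0 <= t' <= 1 -> `|t' - t| < d ->
    rdist (s (c t)) (s (c t')) <= (rdist x y + e) * `|t' - t|.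
  move=> t01; have Oc := cO t t01; have [U1 [f1 [oU1 U1t f1S e1 iso]]] := ext _ Oc.
  have [rr sp] := isometry_curve oU1 f1S U1t (geodesic_regular t gc) (iso _ U1t Oc).
  have n1 := rdist_curve rr e0; rewrite sp S in n1.
  have n2 : \forall t' \near t, U1 (c t') by exact: ((geodesic_regular t gc).1 _ (open_nbhs_nbhs (conj oU1 U1t))).
  have /near_realP [d d0 hd] : \forall t' \near t, rdist ((f1 \o c) t) ((f1 \o c) t') <= (rdist x y + e) * `|t' - t| /\ U1 (c t') by exact: filterI n1 n2.
  exists d; first exact: d0.
  move=> t' t'01 /hd [h1 h2]; rewrite -(e1 _ U1t Oc) -(e1 _ h2 (cO t' t'01)); exact: h1.
by have := local_lipschitz_rdist (ga := fun t => s (c t)) loc; rewrite c0 mulr1.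
Qed.

Lemma s_dist (x y : M) : Om x -> Om y -> rdist (s x) (s y) = rdist x y.
Proof.
move=> Ox Oy; have [sO ss _] := si; apply/eqP; rewrite eq_le s_dist_le //=.
by rewrite -{1}(ss x Ox) -{1}(ss y Oy); apply: s_dist_le; exact: sO.
Qed.
End Involution.

(** * Isolated fixed points *)

Lemma Ck_local (R : realType) (V W : normedModType R) n (U : set V) (f : V -> W) :
  (forall x, U x -> exists A, A x /\ Ck n A f) -> Ck n U f.
Proof.
elim: n f => [|n IH] f h /=.
  by move=> x /h [A [Ax hA]]; exact: hA.
split; first by move=> x /h [A [Ax [hA _]]]; exact: hA.
by move=> v; apply: IH => x /h [A [Ax [_ hA]]]; exists A; split; [exact: Ax|exact: hA].
Qed.

(** * Planar determinants, one-sided derivatives and the standard circle *)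

Section Planar.
Variable R : realType.
Implicit Types (u v w : 'rV[R]_2).

Definition cross u v : R := u 0 0 * v 0 1 - u 0 1 * v 0 0.
Definition dot u v : R := u 0 0 * v 0 0 + u 0 1 * v 0 1.
Definition jac2 (k : 'rV[R]_2 -> 'rV[R]_2) a : R := cross ('D_(delta_mx 0 0) k a) ('D_(delta_mx 0 1) k a).

Lemma dotB u v w : dot u (v - w) = dot u v - dot u w.
Proof. rewrite /dot !mxE; ring. Qed.

Lemma rV2P u v : u 0 0 = v 0 0 -> u 0 1 = v 0 1 -> u = v.
Proof.
move=> h0 h1; apply/rowP => k.
by have [->|->] : k = 0 \/ k = 1 by case: k => [[|[|//]] ?]; [left|right]; exact/val_inj.
Qed.

Lemma derive2 (k : 'rV[R]_2 -> 'rV[R]_2) a u : differentiable k a ->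
  'D_u k a = u 0 0 *: 'D_(delta_mx 0 0) k a + u 0 1 *: 'D_(delta_mx 0 1) k a.
Proof. by move=> dk; rewrite derive_rV // sum2. Qed.

Lemma crossC u v : cross u v = - cross v u.
Proof. rewrite /cross; ring. Qed.

Lemma cross_lin (p q : 'rV[R]_2) (a b c d : R) :
  cross (a *: p + b *: q) (c *: p + d *: q) = (a * d - b * c) * cross p q.
Proof. rewrite /cross !mxE; ring. Qed.

Lemma cross_derive (k : 'rV[R]_2 -> 'rV[R]_2) a u v : differentiable k a -> cross ('D_u k a) ('D_v k a) = cross u v * jac2 k a.
Proof. by move=> dk; rewrite (derive2 u dk) (derive2 v dk) cross_lin. Qed.

Lemma cross_eq0 u v : v != 0 -> cross u v = 0 -> exists l : R, u = l *: v.
Proof.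
move=> v0 /eqP; rewrite subr_eq0 => /eqP h.
case: (eqVneq (v 0 0) 0) => [v00|v00].
  have v01 : v 0 1 != 0 by apply: contra_neq v0 => v01; apply: rV2P; rewrite mxE.
  exists (u 0 1 / v 0 1); apply: rV2P; rewrite mxE; last by rewrite divfK.
  by rewrite v00 mulr0; apply/eqP; have := h; rewrite v00 mulr0 => /eqP; rewrite mulf_eq0 (negPf v01) orbF.
exists (u 0 0 / v 0 0); apply: rV2P; rewrite mxE; first by rewrite divfK.
by apply/eqP; rewrite -(inj_eq (mulIf v00)) mulrAC divfK // h.
Qed.

Lemma jac2_neq0 (k : 'rV[R]_2 -> 'rV[R]_2) a : differentiable k a -> (forall w, 'D_w k a = 0 -> w = 0) -> jac2 k a != 0.
Proof.
move=> dk inj; apply/eqP => j0; set p := 'D_(delta_mx 0 0) k a; set q := 'D_(delta_mx 0 1) k a.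
have E0 : p != 0.
  by apply/eqP => p0; have := inj _ p0 => /matrixP /(_ 0 0); rewrite !mxE /= => /eqP; rewrite oner_eq0.
have j1 : cross q p = 0 by rewrite crossC -/(jac2 k a) j0 oppr0.
have [l ql] := cross_eq0 E0 j1.
pose w : 'rV[R]_2 := delta_mx 0 1 - l *: delta_mx 0 0.
have w0 : 'D_w k a = 0 by rewrite derive_dirB // derive_dirZ // -/p -/q ql subrr.
have := inj _ w0 => /matrixP /(_ 0 1); rewrite !mxE /= mulr0 subr0 => /eqP; by rewrite oner_eq0.
Qed.

Lemma right_derive_unique (f : R -> 'rV[R]_2) D u : is_derive (0 : R) 1 f D ->
  (\forall t \near (0 : R), 0 < t -> f t = t *: u + f 0) -> D = u.
Proof.
move=> d n1; apply/eqP; rewrite -subr_eq0 -normr_eq0 eq_le normr_ge0 andbT; apply/ler_addgt0Pr => e e0; rewrite add0r.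
have n2 := is_derive_eps d e0.
have /near_realP [r r0 hr] : \forall t \near (0 : R), (0 < t -> f t = t *: u + f 0) /\ `|f t - f 0 - (t - 0) *: D| <= e * `|t - 0| by exact: filterI n1 n2.
have r2 : 0 < r / 2 by rewrite divr_gt0.
have rr : `|r / 2 - 0| < r by rewrite subr0 gtr0_norm // ltr_pdivrMr // ltr_pMr // ltr1n.
have [/(_ r2) -> h] := hr _ rr; move: h; rewrite subr0 addrK -scalerBr normrZ mulrC distrC gtr0_norm //.
by rewrite ler_pM2r.
Qed.

Lemma right_max (f : R -> R) d : is_derive (0 : R) 1 f d -> (\forall t \near (0 : R), 0 < t -> f t <= f 0) -> d <= 0.
Proof.
move=> dd n1; apply/ler_addgt0Pr => e e0; rewrite add0r.
have n2 := is_derive_eps dd e0.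
have /near_realP [r r0 hr] : \forall t \near (0 : R), (0 < t -> f t <= f 0) /\ `|f t - f 0 - (t - 0) *: (d : R^o)| <= e * `|t - 0| by exact: filterI n1 n2.
have r2 : 0 < r / 2 by rewrite divr_gt0.
have rr : `|r / 2 - 0| < r by rewrite subr0 gtr0_norm // ltr_pdivrMr // ltr_pMr // ltr1n.
have [/(_ r2) h1] := hr _ rr; rewrite subr0 (gtr0_norm r2) ler_norml /GRing.scale /= => /andP[h2 _].
rewrite -(ler_pM2l r2) mulrC; lra.
Qed.

Lemma inward_near e u : esq e = 1 -> dot e u < 0 -> \forall t \near (0 : R), 0 < t -> esq (t *: u + e) <= 1.
Proof.
move=> e1 d0; have q0 : 0 < esq u + 1 by rewrite /esq; have := sqr_ge0 (u 0 0); have := sqr_ge0 (u 0 1); lra.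
have r0 : 0 < - 2 * dot e u / (esq u + 1) by rewrite divr_gt0 // mulNr; lra.
apply: (near_realP' r0) => t; rewrite subr0 => h t0; move: h; rewrite gtr0_norm // ltr_pdivlMr // => h.
have -> : esq (t *: u + e) = esq e + t * (2 * dot e u + t * esq u) by rewrite /esq /dot !mxE; ring.
rewrite e1 gerDl; apply: mulr_ge0_le0; [exact: ltW|lra].
Qed.

Lemma trig_Ck n (om a b : R) : Ck n setT (fun t : R^o => a * cos (om * t) + b * sin (om * t) : R^o).
Proof.
have D a' b' (t : R) : is_derive t (1 : R) (fun t => a' * cos (om * t) + b' * sin (om * t)) (om * b' * cos (om * t) + (- om * a') * sin (om * t)).
  have d0 : is_derive t (1 : R) (fun t => om * t) om by apply: is_derive_eq; rewrite /GRing.scale /= mulr1.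
  have d1 := @is_derive1_comp R cos (fun t => om * t) t _ _ (is_derive_cos (om * t)) d0.
  have d2 := @is_derive1_comp R sin (fun t => om * t) t _ _ (is_derive_sin (om * t)) d0.
  by apply: is_derive_eq; rewrite /GRing.scale /=; ring.
elim: n a b => [|n IH] a b; first by move=> t _; exact: is_derive_continuous (D a b t).
have df t : differentiable (fun t : R^o => a * cos (om * t) + b * sin (om * t) : R^o) t by apply/derivable1_diffP; case: (D a b t).
split=> [t _|v]; first exact: df.
apply: (eq_Ck openT _ (IH (v * (om * b)) (v * (- om * a)))) => t _.
have -> : v = v *: (1 : R^o) by rewrite /GRing.scale /= mulr1.
rewrite derive_dirZ //; have [_ ->] := D a b t; rewrite /GRing.scale /=; ring.
Qed.

(** Normalized to period 1, as the parametrizations of [circle_param]. *)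
Definition circ (t : R) : 'rV[R]_2 := \row_k (if k == 0 then cos (2 * pi * t) else sin (2 * pi * t)).
Definition dcirc (t : R) : 'rV[R]_2 := \row_k (if k == 0 then - (2 * pi) * sin (2 * pi * t) else 2 * pi * cos (2 * pi * t)).

Lemma circ_smooth : smooth setT (circ : R^o -> 'rV[R]_2).
Proof.
move=> n; apply/Ck_mxP; first exact: openT.
move=> a k; have [->|->] : k = 0 \/ k = 1 by case: k => [[|[|//]] ?]; [left|right]; exact/val_inj.
  by apply: (eq_Ck openT _ (trig_Ck n (2 * pi) 1 0)) => t _; rewrite mxE /= mul1r mul0r addr0.
by apply: (eq_Ck openT _ (trig_Ck n (2 * pi) 0 1)) => t _; rewrite mxE /= mul1r mul0r add0r.
Qed.

Lemma circ_derive (t : R) : is_derive t 1 circ (dcirc t).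
Proof.
have d0 : is_derive t (1 : R) (fun t => 2 * pi * t) (2 * pi) by apply: is_derive_eq; rewrite /GRing.scale /= mulr1.
have d1 := @is_derive1_comp R cos (fun t => 2 * pi * t) t _ _ (is_derive_cos _) d0.
have d2 := @is_derive1_comp R sin (fun t => 2 * pi * t) t _ _ (is_derive_sin _) d0.
apply/is_derive_mxP => a k; have [->|->] : k = 0 \/ k = 1 by case: k => [[|[|//]] ?]; [left|right]; exact/val_inj.
  by apply: (is_derive_congr d1) => [s|]; rewrite !mxE //= mulrC mulrN mulNr.
by apply: (is_derive_congr d2) => [s|]; rewrite !mxE //= mulrC.
Qed.

Lemma circ_esq t : esq (circ t) = 1. Proof. by rewrite /esq !mxE /= cos2Dsin2. Qed.

Lemma circ_surj v : esq v = 1 -> exists t, v = circ t.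
Proof.
move=> /angle_exists [t [c1 c2]]; have p0 : 2 * pi != 0 :> R by rewrite mulf_neq0 ?pnatr_eq0 // gt_eqF // pi_gt0.
by exists (t / (2 * pi)); apply: rV2P; rewrite mxE /= mulrC divfK.
Qed.

Lemma cos_sin_int (x : R) (n : int) : cos (x + 2 * pi * n%:~R) = cos x /\ sin (x + 2 * pi * n%:~R) = sin x.
Proof.
have E (m : nat) : 2 * pi * m%:R = (pi *+ 2) *+ m :> R by rewrite -[RHS]mulr_natr -[pi *+ 2]mulr_natl.
case: n => m; first by rewrite -[(Posz m)%:~R]/(m%:R) E (periodicn (@cosD2pi R)) (periodicn (@sinD2pi R)).
rewrite NegzE mulrNz mulrN -[(Posz m.+1)%:~R]/(m.+1%:R) E.
by rewrite -(periodicn (@cosD2pi R) m.+1 (x - _)) -(periodicn (@sinD2pi R) m.+1 (x - _)) subrK.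
Qed.

Lemma circ_int (t : R) (n : int) : circ (t + n%:~R) = circ t.
Proof. by have [c s] := cos_sin_int (2 * pi * t) n; apply: rV2P; rewrite !mxE /= mulrDr ?c ?s. Qed.

Lemma sign_constant (q : R -> R) (t : R) : (forall x : R, {for x, continuous q}) -> (forall x, q x != 0) ->
  q t < 0 -> forall x, q x < 0.
Proof.
move=> cq nz qt x; rewrite ltNge; apply/negP => qx; case: (leP t x) => tx.
  have [|y _ y0] := @real_ivt R q t x 0 tx (fun y _ => cq y); first by rewrite qx (ltW qt).
  by have := nz y; rewrite y0 eqxx.
have [|y _ y0] := @real_ivt R q x t 0 (ltW tx) (fun y _ => cq y); first by rewrite qx (ltW qt) orbT.
by have := nz y; rewrite y0 eqxx.
Qed.

Lemma floor_range (x T : R) : 0 < T -> exists n : int, x - T <= T * n%:~R <= x.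
Proof.
move=> T0; exists (Num.floor (x / T)); have /andP[h1 h2] := floor_itv (x / T).
move: h1 h2; rewrite ler_pdivlMr // ltr_pdivrMr // intrD => h1 h2.
by rewrite mulrC h1 andbT lerBlDr; move: h2; rewrite mulrDl mul1r => /ltW.
Qed.
End Planar.
Arguments circ {R}. Arguments dcirc {R}.

Lemma positive_combination (R : realFieldType) (a om j P : R) : 0 < P -> 0 <= a -> 0 < om -> a * om = P * j -> j != 0 -> 0 < j.
Proof.
move=> P0 a0 om0 e j0; rewrite lt_neqAle eq_sym j0 /= -(pmulr_rge0 _ P0) -e.
by apply: mulr_ge0 => //; exact: ltW.
Qed.

Lemma segment_in_disc (R : realType) (v e : 'rV[R]_2) (t : R) : esq v < 1 -> esq e = 1 -> 0 <= t < 1 ->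
  esq (t *: (e - v) + v) < 1.
Proof.
rewrite /esq !mxE; move: (v 0 0) (v 0 1) (e 0 0) (e 0 1) => a b c d v1 e1 /andP[t0 t1].
have -> : (t * (c - a) + a) ^+ 2 + (t * (d - b) + b) ^+ 2 =
  (1 - t) * (a ^+ 2 + b ^+ 2) + t * (c ^+ 2 + d ^+ 2) - t * (1 - t) * ((c - a) ^+ 2 + (d - b) ^+ 2) by ring.
have h1 : 0 <= t * (1 - t) * ((c - a) ^+ 2 + (d - b) ^+ 2).
  by rewrite mulr_ge0 ?addr_ge0 ?sqr_ge0 // mulr_ge0 // subr_ge0 ltW.
have h2 : (1 - t) * (a ^+ 2 + b ^+ 2) < (1 - t) * 1 by rewrite ltr_pM2l // subr_gt0.
rewrite e1; lra.
Qed.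

(** * The involution preserves orientation *)

Section Orientation.
Variables (R : realType) (M : riemannian_surface R).
Hypothesis mc : complete_surface M.
Variables (Om : set M) (U : set 'rV[R]_2) (f : 'rV[R]_2 -> M) (h : M -> 'rV[R]_2) (s : M -> M).
Hypothesis dc : disc_chart Om U f h.
Hypothesis si : isometric_involution Om s.
Hypothesis sb : forall x : M, bdry Om x -> s x <> x.
Notation k := (disc_map f h s).
Notation Do := [set u : 'rV[R]_2 | esq u < 1].

Let ext := disc_map_ext dc si.
Let kP := disc_mapP dc si.
Let kK := disc_map_inv dc si.
Let kint := s_interior dc si.

Lemma k_bdry e : esq e = 1 -> esq (k e) = 1.
Proof.
move=> e1; have e1' : esq e <= 1 by rewrite e1.
have [k1 _] := kP e1'; apply/eqP; rewrite eq_le k1 leNgt /=; apply/negP => /kint.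
by rewrite kK // e1 ltxx.
Qed.

(** The extensions of the involution are inverse to each other only on the disc, so the composite is
    known to have derivative [u] only in inward directions [u]. Inward directions span the plane,
    which is enough. *)
Lemma boundary_injective e A k1 w : esq e = 1 -> open A -> A e -> smooth A k1 ->
  (forall w, A w -> esq w <= 1 -> k1 w = k w) -> 'D_w k1 e = 0 -> w = 0.
Proof.
move=> e1 oA Ae k1S k1E; have e1' : esq e <= 1 by rewrite e1.
have [ke1 _] := kP e1'; have [A2 [k2 [oA2 A2b k2S k2E]]] := ext ke1.
have k1e : k1 e = k e by exact: k1E.
have A2b' : A2 (k1 e) by rewrite k1e.
have dk1 := smooth_differentiable k1S Ae.
have dk2 := smooth_differentiable k2S A2b'.
have inw u : dot e u < 0 -> 'D_('D_u k1 e) k2 (k1 e) = u.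
  move=> eu; have dk21 : differentiable (k2 \o k1) e by exact: differentiable_comp.
  rewrite -(derive_comp u dk1 dk2); apply: right_derive_unique (is_derive_line u dk21) _.
  have n1 := near_line u (near_preimage oA Ae k1S oA2 A2b'); have n2 := inward_near e1 eu.
  apply: filterS (filterI n1 n2) => t [[At A2t] h1] /h1 h2.
  rewrite /= scale0r add0r (k1E _ At h2) in A2t *; have [kt _] := kP h2.
  by rewrite (k2E _ A2t kt) kK // k1e (k2E _ A2b ke1) kK.
have D0 : 'D_0 k2 (k1 e) = 0 by rewrite derive0.
have dN u : dot e (- u) = - dot e u by rewrite /dot !mxE; ring.
have ee : dot e (- e) < 0 by rewrite dN /dot -!expr2 -/(esq e) e1; lra.
move=> w0; case: (ltgtP (dot e w) 0) => [ew|ew|ew].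
- by rewrite -(inw _ ew) w0.
- have ew' : dot e (- w) < 0 by rewrite dN oppr_lt0.
  have := inw _ ew'; rewrite -scaleN1r derive_dirZ // w0 scaler0 D0 scaleN1r => /esym/eqP.
  by rewrite oppr_eq0 => /eqP.
(* A tangential [w] is tilted inwards by adding [- e]; the two inward vectors have the same image
   and must coincide. *)
have ew' : dot e (- e - - w) < 0.
  by rewrite dotB (dN w) ew oppr0 subr0.
have E1 : 'D_(- e - - w) k1 e = 'D_(- e) k1 e.
  have Nw : 'D_(- w) k1 e = 0 by rewrite -scaleN1r derive_dirZ // w0 scaler0.
  by rewrite derive_dirB // Nw subr0.
have := inw _ ew'; rewrite E1 (inw _ ee) opprK => /eqP.
by rewrite -subr_eq0 opprD addrA subrr add0r oppr_eq0 => /eqP.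
Qed.

Let w t := k (circ t).

Lemma boundary_curve_smooth t : exists N : set R^o, [/\ open N, N t & smooth N (w : R^o -> 'rV[R]_2)].
Proof.
have e1 : esq (circ t) <= 1 by rewrite circ_esq.
have [A [k1 [oA Ae k1S k1E]]] := ext e1.
have oN : open ((circ : R^o -> 'rV[R]_2) @^-1` A).
  apply: (@open_comp R^o 'rV[R]_2 circ A _ oA) => x _.
  exact: (smooth_continuous (@circ_smooth R) I).
exists ((circ : R^o -> 'rV[R]_2) @^-1` A); split=> //.
have UU x : ((circ : R^o -> 'rV[R]_2) @^-1` A) x -> A (circ x) by [].
have cS := sub_smooth (fun x (hx : ((circ : R^o -> 'rV[R]_2) @^-1` A) x) => I) (@circ_smooth R).
apply: (eq_smooth oN _ (smooth_comp oN oA UU cS k1S)) => x Ax.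
by rewrite /= k1E // circ_esq.
Qed.

Let dw t := 'D_1 (w : R^o -> 'rV[R]_2) t.

Lemma boundary_derive t : is_derive t (1 : R) w (dw t).
Proof.
have [N [oN Nt S]] := boundary_curve_smooth t.
by apply: DeriveDef => //; apply: diff_derivable; exact: smooth_differentiable S Nt.
Qed.

Lemma boundary_ext_derive t A k1 : open A -> A (circ t) -> smooth A k1 ->
  (forall w, A w -> esq w <= 1 -> k1 w = k w) -> dw t = 'D_(dcirc t) k1 (circ t).
Proof.
move=> oA Ae k1S k1E.
have d1 := is_derive_comp (circ_derive t) (smooth_differentiable k1S Ae).
have nE : \forall x \near t, (k1 \o @circ R) x = w x.
  have cc : {for t, continuous (@circ R)} by exact: is_derive_continuous (circ_derive t).
  have nA : \forall x \near t, A (circ x) by exact: (cc _ (open_nbhs_nbhs (conj oA Ae))).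
  by apply: filterS nA => x Ax; rewrite /= k1E // circ_esq.
exact: is_derive_unique (boundary_derive t) (is_derive_near nE d1).
Qed.

Lemma boundary_orth t : dot (w t) (dw t) = 0.
Proof.
have d := esq_derive (boundary_derive t).
have d' : is_derive t (1 : R) (fun x => esq (w x) : R^o) 0.
  by apply: (is_derive_congr (is_derive_cst (1 : R^o) t 1)) => // x; rewrite /w k_bdry // circ_esq.
have := is_derive_unique d d' => /eqP; rewrite mulf_eq0 pnatr_eq0 /= => /eqP; exact.
Qed.

Lemma boundary_dw t : dw t = cross (w t) (dw t) *: (\row_j (if j == 0 then - w t 0 1 else w t 0 0)).
Proof.
have o := boundary_orth t; have w1 : esq (w t) = 1 by rewrite /w k_bdry // circ_esq.
move: o w1; rewrite /dot /esq /cross; move: (w t) (dw t) => a b o w1.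
apply: rV2P; rewrite !mxE /=.
  have -> : (a 0 0 * b 0 1 - a 0 1 * b 0 0) * - a 0 1 = b 0 0 * (a 0 0 ^+ 2 + a 0 1 ^+ 2) - a 0 0 * (a 0 0 * b 0 0 + a 0 1 * b 0 1) by ring.
  by rewrite o w1 mulr1 mulr0 subr0.
have -> : (a 0 0 * b 0 1 - a 0 1 * b 0 0) * a 0 0 = b 0 1 * (a 0 0 ^+ 2 + a 0 1 ^+ 2) - a 0 1 * (a 0 0 * b 0 0 + a 0 1 * b 0 1) by ring.
by rewrite o w1 mulr1 mulr0 subr0.
Qed.

Lemma dcirc_neq0 t : dcirc t <> 0 :> 'rV[R]_2.
Proof.
have p0 : 0 < 2 * pi :> R by rewrite mulr_gt0 // pi_gt0.
move=> /matrixP E; have := E 0 0; have := E 0 1; rewrite !mxE /= => /eqP; rewrite mulf_eq0 gt_eqF //= => /eqP c0.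
move=> /eqP; rewrite mulf_eq0 oppr_eq0 gt_eqF //= => /eqP s0.
by have := cos2Dsin2 (2 * pi * t); rewrite c0 s0 expr0n /= addr0 => /eqP; rewrite eq_sym oner_eq0.
Qed.

Lemma boundary_speed_neq0 t : cross (w t) (dw t) != 0.
Proof.
apply/eqP => c0; have := boundary_dw t; rewrite c0 scale0r => d0.
have e1 : esq (circ t) <= 1 by rewrite circ_esq.
have [A [k1 [oA Ae k1S k1E]]] := ext e1.
rewrite (boundary_ext_derive oA Ae k1S k1E) in d0.
exact: dcirc_neq0 (boundary_injective (circ_esq t) oA Ae k1S k1E d0).
Qed.

Lemma boundary_coord t (j : 'I_2) : is_derive t (1 : R) (fun x => w x 0 j : R) (dw t 0 j) /\
  {for t, continuous (fun x => dw x 0 j : R)}.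
Proof.
split; first exact: (is_derive_mxP _ _ _ _).1 (boundary_derive t) 0 j.
have [N [oN Nt S]] := boundary_curve_smooth t.
exact: (continuous_mxP _ _).1 (smooth_continuous (smooth_derive (1 : R^o) S) Nt) 0 j.
Qed.

(** The angular velocity has constant sign. If it were negative, the lifted angle would decrease
    while the angle of the source point makes one positive turn; their difference would hit a
    multiple of [2 * pi], giving a fixed boundary point. *)
Lemma boundary_rotation t : 0 < cross (w t) (dw t).
Proof.
rewrite lt_neqAle eq_sym boundary_speed_neq0 /= leNgt; apply/negP => ct.
have cc (x : R) : {for x, continuous (fun x => cross (w x) (dw x) : R)}.
  have [d0 c0] := boundary_coord x 0; have [d1 c1] := boundary_coord x 1.
  apply: (@continuousB _ R^o); apply: (@continuousM R _) => //; exact: is_derive_continuous.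
have neg x : cross (w x) (dw x) < 0 by exact: (sign_constant cc boundary_speed_neq0 ct).
have w1 x : (w x 0 0) ^+ 2 + (w x 0 1) ^+ 2 = 1 by rewrite -/(esq (w x)) /w k_bdry // circ_esq.
have [th H] := circle_lift ler01 (fun x => (boundary_coord x 0).1) (fun x => (boundary_coord x 1).1)
  (fun x => (boundary_coord x 0).2) (fun x => (boundary_coord x 1).2) w1.
have p0 : 0 < 2 * pi :> R by rewrite mulr_gt0 // pi_gt0.
have thd (x : R) : 0 <= x <= 1 -> is_derive x 1 th (cross (w x) (dw x)) by move=> /H [].
have mono : th 1 - th 0 <= 0.
  have := @derive_le R th (fun x => cross (w x) (dw x)) (cst 0) (cst 0) 0 1 ler01 thd (fun x _ => is_derive_cst _ _ _) (fun x _ => ltW (neg x)).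
  by rewrite /cst (subrr 0).
have [n /andP[n1 n2]] := floor_range (th 0) p0.
(* It drops by at least [2 * pi] over one period, hence passes through the multiple of [2 * pi]
   found just above. *)
pose ph x := th x - 2 * pi * x.
have cph (x : R) : 0 <= x <= 1 -> {for x, continuous ph}.
  move=> x01; apply: (@continuousB _ R^o); first exact: is_derive_continuous (thd x x01).
  by apply: (@continuousM R _); [exact: cst_continuous|exact: id].
have [|x x01 xE] := @real_ivt R ph 0 1 (2 * pi * n%:~R) ler01 cph.
  apply/orP; right; rewrite /ph mulr0 subr0 n2 andbT mulr1; apply: le_trans n1; lra.
have [_ c1 s1] := H x x01.
have [c2 s2] := cos_sin_int (2 * pi * x) n.
have tE : th x = 2 * pi * x + 2 * pi * n%:~R by rewrite -xE /ph addrC subrK.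
have kx : k (circ x) = circ x.
  by apply: rV2P; rewrite -/(w x) mxE /= ?c1 ?s1 tE ?c2 ?s2.
have x1 : esq (circ x) <= 1 by rewrite circ_esq.
have [_ fk] := kP x1; apply: (sb (x := f (circ x))); last by rewrite -fk kx.
have Of := disc_in dc x1; apply/(bdry_esq dc Of).
by case: (dc) => _ hf DU _; rewrite hf ?circ_esq //; exact: DU.
Qed.

(** In the frame of outward normal and tangent, the determinant is the tangential rotation, which is
    positive, times the outward component of the image of the normal, which is nonnegative since the
    disc is mapped to itself. It is nonzero by injectivity. *)
Lemma boundary_jac e A k1 : esq e = 1 -> open A -> A e -> smooth A k1 ->
  (forall w, A w -> esq w <= 1 -> k1 w = k w) -> 0 < jac2 k1 e.
Proof.
move=> e1 oA Ae k1S k1E; have [t et] := circ_surj e1.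
have dk1 := smooth_differentiable k1S Ae.
have p0 : 0 < 2 * pi :> R by rewrite mulr_gt0 // pi_gt0.
have j0 : jac2 k1 e != 0 by apply: (jac2_neq0 dk1) => u; exact: (boundary_injective e1 oA Ae k1S k1E).
have Ae' : A (circ t) by rewrite -et.
have dE := boundary_ext_derive oA Ae' k1S k1E; rewrite -et in dE.
have e1' : esq e <= 1 by rewrite e1.
have wE : w t = k1 e by rewrite /w -et k1E.
have dl := esq_derive (is_derive_line (- e) dk1); rewrite /= scale0r add0r in dl.
have d0 : dot e (- e) < 0.
  have -> : dot e (- e) = - esq e by rewrite /dot /esq !mxE; ring.
  by rewrite e1; lra.
have a0 : 0 <= dot (w t) ('D_e k1 e).
  have dN : 'D_(- e) k1 e = - 'D_e k1 e by rewrite -scaleN1r derive_dirZ // scaleN1r.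
  have := @right_max R _ _ dl; rewrite dN => rm.
  have : 2 * (k1 e 0 0 * (- 'D_e k1 e) 0 0 + k1 e 0 1 * (- 'D_e k1 e) 0 1) <= 0.
    apply: rm; have n1 := inward_near e1 d0.
    have n2 : \forall x \near (0 : R), A (x *: (- e) + e) by exact: near_line (open_nbhs_nbhs (conj oA Ae)).
    apply: filterS (filterI n1 n2) => x [h1 Ax] /h1 h2.
    rewrite scale0r add0r (k1E _ Ax h2) (k1E _ Ae e1') (k_bdry e1); exact: (kP h2).1.
  rewrite wE /dot; move: (k1 e) ('D_e k1 e) => p q; rewrite !mxE; lra.
have crossE : cross ('D_e k1 e) (dw t) = dot (w t) ('D_e k1 e) * cross (w t) (dw t).
  rewrite {1}boundary_dw; move: ('D_e k1 e) (cross (w t) (dw t)) (w t) => p q r.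
  rewrite /cross /dot !mxE /=; ring.
apply: (positive_combination p0 a0 (boundary_rotation t) _ j0).
rewrite -crossE dE (cross_derive _ _ dk1); congr (_ * _).
rewrite et /cross !mxE /=.
have -> : cos (2 * pi * t) * (2 * pi * cos (2 * pi * t)) - sin (2 * pi * t) * (- (2 * pi) * sin (2 * pi * t)) = 2 * pi * (cos (2 * pi * t) ^+ 2 + sin (2 * pi * t) ^+ 2) by ring.
by rewrite cos2Dsin2 mulr1.
Qed.

Lemma open_Do : open Do.
Proof.
have -> : Do = (@esq R) @^-1` [set x : R^o | x < 1] by [].
by apply: open_comp => [u _|]; [exact: esq_continuous|exact: open_lt].
Qed.

Lemma k_smooth : smooth Do k.
Proof.
move=> n; apply: Ck_local => u u1; have u1' := ltW u1.
have [A [k1 [oA Au k1S k1E]]] := ext u1'.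
have oAD : open (A `&` Do) by apply: openI => //; exact: open_Do.
exists (A `&` Do); split=> //.
apply: (@eq_Ck _ _ _ n (A `&` Do) k1 k oAD).
  by move=> x [Ax x1]; apply: k1E => //; exact: ltW.
by apply: sub_Ck (k1S n) => x [].
Qed.

Lemma k_injective u v : esq u < 1 -> 'D_v k u = 0 -> v = 0.
Proof.
move=> u1 v0; have dk := smooth_differentiable k_smooth u1.
have dk2 : differentiable k (k u) by apply: (smooth_differentiable k_smooth); exact: kint.
have inv : \forall x \near u, k (k x) = x.
  by apply: filterS (near_disc u1) => x x1; rewrite kK // ltW.
by have := inverse_derive v dk dk2 inv; rewrite v0 derive0 => <-.
Qed.

Lemma jac2_continuous A (k1 : 'rV[R]_2 -> 'rV[R]_2) x : smooth A k1 -> A x -> {for x, continuous (jac2 k1 : 'rV[R]_2 -> R^o)}.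
Proof.
move=> S Ax; have c0 := smooth_continuous (smooth_derive (delta_mx 0 0) S) Ax.
have c1 := smooth_continuous (smooth_derive (delta_mx 0 1) S) Ax.
apply: (@continuousB _ R^o); apply: (@continuousM R _).
- exact: (continuous_mxP _ _).1 c0 0 0.
- exact: (continuous_mxP _ _).1 c1 0 1.
- exact: (continuous_mxP _ _).1 c0 0 1.
- exact: (continuous_mxP _ _).1 c1 0 0.
Qed.

(* An orientation-reversing involution would reverse the boundary circle, hence fix one of its points. *)
Lemma jac2_pos u : esq u < 1 -> 0 < jac2 k u.
Proof.
move=> u1; set e : 'rV[R]_2 := circ 0; have e1 : esq e = 1 by exact: circ_esq.
have e1' : esq e <= 1 by rewrite e1.
have [A [k1 [oA Ae k1S k1E]]] := ext e1'.
have jp := boundary_jac e1 oA Ae k1S k1E.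
pose v (t : R) := t *: (e - u) + u.
have cv (t : R) : {for t, continuous v} by exact: (Ck_line 0 (e - u) u openT t I).
have v1 : v 1 = e by rewrite /v scale1r subrK.
have nz x : esq x < 1 -> jac2 k x != 0.
  by move=> x1; apply: (jac2_neq0 (smooth_differentiable k_smooth x1)) => y; exact: k_injective.
have nJ : \forall x \near e, A x /\ 0 < jac2 k1 x.
  apply: filterI; first exact: open_nbhs_nbhs.
  have N0 : nbhs (jac2 k1 e : R^o) [set x : R^o | 0 < x] by apply: open_nbhs_nbhs; split=> //; exact: open_gt.
  exact: (jac2_continuous k1S Ae N0).
have nJ' : nbhs (v 1) (fun x => A x /\ 0 < jac2 k1 x) by rewrite v1.
have /near_realP [d d0 hd] : \forall t \near (1 : R), A (v t) /\ 0 < jac2 k1 (v t) by exact: (cv 1 _ nJ').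
pose t1 := Num.max 0 (1 - d / 2).
have t11 : t1 < 1 by rewrite gt_max ltr01 /= ltrBlDr ltrDl divr_gt0.
have t10 : 0 <= t1 by rewrite le_max lexx.
have t1d : 1 - d / 2 <= t1 by rewrite le_max lexx orbT.
have [|Av jv] := hd t1; first by rewrite ltr0_norm ?subr_lt0 // opprB; lra.
have vt1 : esq (v t1) < 1 by apply: segment_in_disc => //; rewrite t10.
have jE : jac2 k (v t1) = jac2 k1 (v t1).
  have n1 : \forall x \near v t1, k x = k1 x.
    apply: filterS (filterI (open_nbhs_nbhs (conj oA Av)) (near_disc vt1)) => x [Ax x1].
    by rewrite k1E // ltW.
  by rewrite /jac2 !(near_eq_derive _ n1).
rewrite lt_neqAle eq_sym nz //= leNgt; apply/negP => ju.
have cJ (t : R) : 0 <= t <= t1 -> {for t, continuous (fun t => jac2 k (v t))}.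
  move=> /andP[t0 tt]; apply: continuous_comp; first exact: cv.
  by apply: (jac2_continuous k_smooth); apply: segment_in_disc => //; rewrite t0 (le_lt_trans tt).
have v0 : v 0 = u by rewrite /v scale0r add0r.
have [|t /andP[t0 tt] tE] := @real_ivt R (fun t => jac2 k (v t)) 0 t1 0 t10 cJ.
  by rewrite v0 jE (ltW ju) (ltW jv).
have vt : esq (v t) < 1 by apply: segment_in_disc => //; rewrite t0 (le_lt_trans tt).
by have := nz _ vt; rewrite tE eqxx.
Qed.

(* As orientation is preserved, reversing one direction forces the differential to be minus the identity. *)
Lemma reversal_isolated b v : esq b < 1 -> k b = b -> v != 0 -> 'D_v k b = - v ->
  \forall x \near b, k x = x -> x = b.
Proof.
move=> b1 kb v0 vE; have dk := smooth_differentiable k_smooth b1.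
have dk2 : differentiable k (k b) by rewrite kb.
have inv : \forall x \near b, k (k x) = x.
  by apply: filterS (near_disc b1) => x x1; rewrite kK // ltW.
have AA u : 'D_('D_u k b) k b = u by have := inverse_derive u dk dk2 inv; rewrite kb.
have A1 u : 'D_u k b = - u.
  (* [y] is fixed by the differential while [v] is reversed. Positivity of the determinant forces
     [y] to be parallel to [v], hence reversed as well, hence zero. *)
  set y := u + 'D_u k b.
  have Ay : 'D_y k b = y by rewrite /y (derive_dirD _ _ dk) AA addrC.
  have := cross_derive y v dk; rewrite Ay vE => h1.
  have h2 : cross y (- v) = - cross y v by rewrite /cross !mxE; ring.
  have jb := jac2_pos b1; have c0 : cross y v = 0.
    have : (1 + jac2 k b) * cross y v = 0 by rewrite mulrDl mul1r (mulrC (jac2 k b)) -h1 h2 subrr.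
    by move/eqP; rewrite mulf_eq0 gt_eqF /= => [/eqP//|]; lra.
  have [l yl] := cross_eq0 v0 c0.
  have y2 : y = - y by rewrite -{1}Ay {1}yl derive_dirZ // vE scalerN -yl.
  have y0 : y = 0.
    by apply: rV2P; have := congr1 (fun z : 'rV[R]_2 => z 0 0) y2; have := congr1 (fun z : 'rV[R]_2 => z 0 1) y2; rewrite !mxE; lra.
  by apply/eqP; rewrite -addr_eq0 addrC -/y y0.
have n1 := differentiable_eps dk (ltr01 : 0 < 1 :> R).
apply: filterS n1 => x; rewrite -deriveE // A1 kb opprK mul1r => + kx.
rewrite kx -mulr2n -scaler_nat normrZ ger0_norm ?ler0n // => h2.
by apply/eqP; rewrite -subr_eq0 -normr_eq0; have := normr_ge0 (x - b); rewrite le_eqVlt => /orP[/eqP <- //|h3]; exfalso; lra.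
Qed.
End Orientation.

(** * Chords and their midpoints *)

Lemma sub_le_of_sum (R : realType) (a b t l : R) : a <= t -> l <= a + b -> l - t <= b.
Proof. by move=> h1 h2; lra. Qed.

Lemma le_of_sub_sum (R : realType) (a b t l : R) : b <= l - t -> l <= a + b -> t <= a.
Proof. by move=> h1 h2; lra. Qed.

Lemma half_unit (R : realType) : 0 <= (2^-1 : R) <= 1.
Proof. by apply/andP; split; lra. Qed.

Lemma locally_constant (R : realType) (T : Type) (g : R -> T) :
  (forall t : R, exists2 d : R, 0 < d & forall t', `|t' - t| < d -> g t' = g t) -> forall a b : R, a <= b -> g a = g b.
Proof.
move=> loc a b ab; suff H : forall t : R, a <= t <= b -> g t = g a by apply/esym/H; rewrite ab lexx.
apply: real_induction => t tab.
  move=> H; have [d d0 hd] := loc t; case: (eqVneq t a) => [->//|ta].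
  have at_ : a < t by rewrite lt_neqAle eq_sym ta; case/andP: tab.
  pose t' := Num.max a (t - d / 2).
  have t't : t' < t by rewrite gt_max at_ /= ltrBlDr ltrDl divr_gt0.
  have at' : a <= t' by rewrite le_max lexx.
  have t'd : t - d / 2 <= t' by rewrite le_max lexx orbT.
  rewrite -(H t') ?at' // (hd t') // ltr0_norm ?subr_lt0 // opprB; lra.
move=> H; have [d d0 hd] := loc t; exists d => // t' /andP[tt' t'd] _.
by rewrite hd // gtr0_norm ?subr_gt0 // ltrBlDl.
Qed.

Lemma chord_estimate (R : realType) (ta zy zs zx zsx d lx ly a b : R) : 0 <= ta <= 1 -> zy = ta * ly -> zs = ly - ta * ly ->
  zx <= d + zy -> zy <= d + zx -> zsx <= d + zs -> zs <= d + zsx ->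
  lx <= d + a -> a <= ly + d -> ly <= d + b -> b <= lx + d ->
  `|zx - ta * lx| + `|zsx - (1 - ta) * lx| <= 6 * d.
Proof.
move=> /andP[t0 t1] -> -> h1 h2 h3 h4 h5 h6 h7 h8.
have l1 : ta * lx <= ta * (ly + 2 * d) by rewrite ler_wpM2l //; lra.
have l2 : ta * ly <= ta * (lx + 2 * d) by rewrite ler_wpM2l //; lra.
have l3 : (1 - ta) * lx <= (1 - ta) * (ly + 2 * d) by rewrite ler_wpM2l //; lra.
have l4 : (1 - ta) * ly <= (1 - ta) * (lx + 2 * d) by rewrite ler_wpM2l //; lra.
have d0 : 0 <= d by lra.
have k1 : `|zx - ta * lx| <= d + 2 * (ta * d) by rewrite ler_norml; lra.
have k2 : `|zsx - (1 - ta) * lx| <= d + 2 * ((1 - ta) * d) by rewrite ler_norml; lra.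
lra.
Qed.

Section Between.
Variables (R : realType) (M : riemannian_surface R).
Hypothesis mc : complete_surface M.
Implicit Types (p q x y z : M) (t : R).
Notation Exp := (Exp mc).

(** Together with [rdist_near], it identifies the topology of the surface with that of the
    distance. *)
Lemma rdist_nbhs p (A : set M) : nbhs p A -> exists2 r : R, 0 < r & forall q, rdist p q < r -> A q.
Proof.
move=> nA; have [r [g nr]] := normal_radius_exists mc p.
have r0 : 0 < r by case: nr.
have p0 : pnorm p 0 < r by rewrite -(scale0r 0) pnormZ normr0 mul0r.
have cE := Exp_continuous nr p0.
have nB : nbhs (Exp p 0 1) A by rewrite Exp0.
have [d d0 hd] := (near_normP _ _).1 (cE _ nB).
have [C C0 hC] := nrm_ge (chart_cod (chart_atP p)).
exists (Num.min r (d / C)); first by rewrite lt_min r0 divr_gt0.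
move=> q; rewrite lt_min => /andP[qr qd]; have [v [vn <-]] := normal_inside nr qr.
apply: hd; rewrite subr0; apply: le_lt_trans (hC v) _.
by rewrite -/(pnorm p v) vn mulrC -ltr_pdivlMr.
Qed.

Lemma unit_minimizer p q : p <> q -> exists2 w, pnorm p w = 1 & Exp p w (rdist p q) = q.
Proof.
move=> pq; have [v [vn vq]] := minimizing_geodesic mc p q.
have d0 : 0 < rdist p q by rewrite lt_neqAle rdist_ge0 andbT; apply/eqP => /esym /(rdist_eq0 mc).
exists ((rdist p q)^-1 *: v).
  by rewrite pnormZ vn ger0_norm ?invr_ge0 ?ltW // mulVf // gt_eqF.
by rewrite Exp_scale mulVf // gt_eqF.
Qed.

Lemma complete_geodesic_segment (c : R -> M) : geodesic c -> geodesic_segment c (c 0) (c 1).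
Proof.
move=> gc; split=> //; exists 1 => //; split=> [|t i _]; last by apply: gc.2.
by split=> [t _|i]; [exact: gc.1.1|apply: sub_smooth (gc.1.2 i) => t []].
Qed.

(** Minimizers from [x] to [z] and from [z] to [y] join into a minimizing path, which has no corner
    at [z]; so [z] lies on a minimizing geodesic. *)
Lemma between_geodesic x y z : x <> y -> rdist x z + rdist z y = rdist x y ->
  exists w, [/\ pnorm x w = 1, Exp x w (rdist x z) = z & Exp x w (rdist x y) = y].
Proof.
move=> xy e; case: (pselect (x = z)) => [xz|xz].
  have [w w1 wy] := unit_minimizer xy; exists w; split=> //.
  by rewrite -xz rdistxx; have [_ -> _] := ExpP mc x w.
case: (pselect (z = y)) => [zy|zy].
  by have [w w1 wy] := unit_minimizer xy; exists w; rewrite zy.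
have [w1 n1 e1] := unit_minimizer xz; have [w2 n2 e2] := unit_minimizer zy.
have [g1 c10 _] := ExpP mc x w1; have [g2 c20 _] := ExpP mc z w2.
have a0 : 0 < rdist x z by rewrite lt_neqAle rdist_ge0 andbT; apply/eqP => /esym /(rdist_eq0 mc).
have b0 : 0 < rdist z y by rewrite lt_neqAle rdist_ge0 andbT; apply/eqP => /esym /(rdist_eq0 mc).
have H : forall s : R, Exp x w1 (rdist x z + s) = Exp z w2 (0 + s).
  apply: (@no_corner R M (Exp x w1) (Exp z w2) (rdist x z) 0 (rdist x z) (rdist z y) g1 g2) => //.
  - by rewrite e1 c20.
  - by rewrite Exp_speed.
  - by rewrite Exp_speed.
  - by rewrite subrr c10 add0r e2 e.
by exists w1; split=> //; rewrite -e H add0r.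
Qed.
End Between.

Section Chords.
Variables (R : realType) (M : riemannian_surface R).
Hypothesis mc : complete_surface M.
Variables (Om : set M) (U : set 'rV[R]_2) (f : 'rV[R]_2 -> M) (h : M -> 'rV[R]_2) (s : M -> M).
Hypothesis dc : disc_chart Om U f h.
Hypothesis si : isometric_involution Om s.
Hypothesis tc : totally_convex Om.
Hypothesis ug : forall x y : M, bdry Om x -> bdry Om y -> x <> y -> joined_by_unique_geodesic x y.
Hypothesis sb : forall x : M, bdry Om x -> s x <> x.
Implicit Types (p q x y z : M) (t : R).
Notation Exp := (Exp mc).
Notation len x := (rdist x (s x)).

Let sO : forall x, Om x -> Om (s x). Proof. by case: si. Qed.
Let ss : forall x, Om x -> s (s x) = x. Proof. by case: si. Qed.
Let sd : forall x y, Om x -> Om y -> rdist (s x) (s y) = rdist x y. Proof. exact: s_dist. Qed.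
Let sbd : forall x, bdry Om x -> bdry Om (s x). Proof. by move=> x; exact: (s_bdry dc si). Qed.

Lemma len_gt0 x : bdry Om x -> 0 < len x.
Proof. by move=> bx; rewrite lt_neqAle rdist_ge0 andbT; apply/eqP => /esym /(rdist_eq0 mc) /esym; exact: sb. Qed.

(** The third clause expresses the uniqueness of the geodesic from [x] to [s x] in terms of
    distances only: equality in the triangle inequality determines the point. In this form it can be
    used with [s], of which only the preservation of distances is needed. *)
Definition chord_dir x v := [/\ pnorm x v = 1, Exp x v (len x) = s x,
  forall z, rdist x z + rdist z (s x) = len x -> z = Exp x v (rdist x z) &
  forall t, 0 <= t <= len x -> [/\ Om (Exp x v t), rdist x (Exp x v t) = t & rdist (Exp x v t) (s x) = len x - t]].

Lemma chord_exists x : bdry Om x -> exists v, chord_dir x v.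
Proof.
move=> bx; have xs : x <> s x by move/esym; exact: sb.
have l0 := len_gt0 bx; have [v v1 vs] := unit_minimizer mc xs.
have Ox := bdry_Om dc bx; have Osx := sO Ox.
have [gv v0 _] := ExpP mc x v.
have seg w : pnorm x w = 1 -> Exp x w (len x) = s x -> geodesic_segment (fun t => Exp x w (len x * t + 0)) x (s x).
  move=> w1 ws; have [gw w0 _] := ExpP mc x w.
  have := complete_geodesic_segment (geodesic_affine (len x) 0 gw).
  by rewrite mulr0 mulr1 !addr0 w0 ws.
exists v; split=> //.
  move=> z e; have [w [w1 wz ws]] := between_geodesic mc xs e.
  have [_ /(_ _ _ (seg v v1 vs) (seg w w1 ws))] := ug bx (sbd bx) xs.
  have tz : 0 <= rdist x z / len x <= 1.
    by rewrite divr_ge0 ?rdist_ge0 // ler_pdivrMr // mul1r -e lerDl rdist_ge0.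
  by move=> /(_ _ tz); rewrite addr0 mulrC divfK ?gt_eqF // wz => ->.
move=> t /andP[t0 tl].
have ul (a b : R) : a <= b -> rdist (Exp x v a) (Exp x v b) <= b - a.
  by apply: rdist_unit_geodesic gv _; rewrite Exp_speed.
have a1 := ul 0 t t0; have a2 := ul t (len x) tl; rewrite v0 subr0 in a1; rewrite vs in a2.
have a3 := rdist_triangle x (Exp x v t) (s x).
split; last 1 first.
- by apply/eqP; rewrite eq_le a2 /=; exact: (sub_le_of_sum a1 a3).
- have te : len x * (t / len x) + 0 = t by rewrite addr0 mulrC divfK ?gt_eqF.
  have := tc Ox Osx (seg v v1 vs) (t := t / len x); rewrite te; apply.
  by rewrite divr_ge0 // ?(ltW l0) //= ler_pdivrMr // mul1r.
by apply/eqP; rewrite eq_le a1 /=; exact: (le_of_sub_sum a2 a3).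
Qed.

(** The default vector 0 is never reached for boundary points, by [chord_exists]. *)
Definition chord x : R -> M := Exp x (xget 0 [set v | chord_dir x v]).

Lemma chordP x : bdry Om x -> [/\ pnorm x (xget 0 [set v | chord_dir x v]) = 1, chord x (len x) = s x,
  forall z, rdist x z + rdist z (s x) = len x -> z = chord x (rdist x z) &
  forall t, 0 <= t <= len x -> [/\ Om (chord x t), rdist x (chord x t) = t & rdist (chord x t) (s x) = len x - t]].
Proof. by move=> /chord_exists [v hv]; exact: (xgetPex 0 (ex_intro _ v hv)). Qed.

Lemma chord_reverse x t : bdry Om x -> 0 <= t <= len x -> s (chord x t) = chord x (len x - t).
Proof.
move=> bx tl; have [_ _ U1 C] := chordP bx; have [Oz d1 d2] := C t tl.
have Ox := bdry_Om dc bx.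
have e1 : rdist x (s (chord x t)) = len x - t by rewrite -[X in rdist X _](ss Ox) (sd (sO Ox) Oz) rdist_sym d2.
have e2 : rdist (s (chord x t)) (s x) = t by rewrite (sd Oz Ox) rdist_sym d1.
by rewrite (U1 (s (chord x t))) ?e1 // e2 subrK.
Qed.

Definition mid x := chord x (len x / 2).

Lemma midP x : bdry Om x -> [/\ Om (mid x), s (mid x) = mid x, rdist x (mid x) = len x / 2 & rdist (mid x) (s x) = len x / 2].
Proof.
move=> bx; have l0 := len_gt0 bx; have hl : 0 <= len x / 2 <= len x by lra.
have [_ _ _ C] := chordP bx; have [Oz d1 d2] := C _ hl.
split=> //; first by rewrite /mid chord_reverse //; congr chord; lra.
by rewrite d2; lra.
Qed.

(** Continuity follows from uniqueness by compactness, without differentiating in the end points: a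
    point of [Om] that nearly divides [x] and [s x] in the ratio [ta] must be close to the one that
    does so exactly. *)
Lemma chord_continuous x (ta e : R) : bdry Om x -> 0 <= ta <= 1 -> 0 < e ->
  exists2 d : R, 0 < d & forall y, bdry Om y -> rdist x y < d -> rdist (chord x (ta * len x)) (chord y (ta * len y)) < e.
Proof.
move=> bx ta01 e0; have Ox := bdry_Om dc bx.
have tl y : bdry Om y -> 0 <= ta * len y <= len y.
  move=> by_; have l0 := len_gt0 by_; case/andP: ta01 => h0 h1.
  by rewrite mulr_ge0 ?(ltW l0) //= ger_pMl.
set z0 := chord x (ta * len x).
pose K := Om `&` (rdist z0) @^-1` [set r : R^o | e <= r].
have cK : compact K.
  apply: compact_closedI; first exact: (Om_compact dc).
  by apply: closed_comp => [z _|]; [exact: rdist_continuous|exact: closed_ge].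
(* The defect of [z] from being the required point. It is positive on the compact set [K] of points
   away from [z0], while at the corresponding point of a nearby chord it is at most six times the
   displacement of [x]. *)
pose Psi z := `|rdist x z - ta * len x| + `|rdist (s x) z - (1 - ta) * len x|.
have cPsi : {within K, continuous (Psi : M -> R^o)}.
  apply: continuous_in_subspaceT => z _.
  apply: (@continuousD _ R^o _ (fun z => `|rdist x z - ta * len x| : R^o) (fun z => `|rdist (s x) z - (1 - ta) * len x| : R^o)).
    apply: (@continuous_comp _ _ _ (fun z => rdist x z - ta * len x : R^o) Num.norm); last exact: norm_continuous.
    by apply: (@continuousB _ R^o); [exact: rdist_continuous|exact: cst_continuous].
  apply: (@continuous_comp _ _ _ (fun z => rdist (s x) z - (1 - ta) * len x : R^o) Num.norm); last exact: norm_continuous.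
  by apply: (@continuousB _ R^o); [exact: rdist_continuous|exact: cst_continuous].
have key y : bdry Om y -> Psi (chord y (ta * len y)) <= 6 * rdist x y.
  move=> by_; have [_ _ _ C] := chordP by_; have [Oz d1 d2] := C _ (tl y by_).
  have Oy := bdry_Om dc by_.
  set z := chord y _ in Oz d1 d2 *.
  have t1 := rdist_triangle x y z; have t2 := rdist_triangle y x z; rewrite (rdist_sym y x) in t2.
  have t3 := rdist_triangle (s x) (s y) z; have t4 := rdist_triangle (s y) (s x) z.
  rewrite (rdist_sym (s y) (s x)) in t4; rewrite (sd Ox Oy) in t3 t4; rewrite (rdist_sym z) in d2.
  have t5 := rdist_triangle x y (s x); have t6 := rdist_triangle y (s y) (s x).
  have t7 := rdist_triangle y x (s y); have t8 := rdist_triangle x (s x) (s y).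
  rewrite (rdist_sym (s y) (s x)) (sd Ox Oy) in t6; rewrite (sd Ox Oy) in t8; rewrite (rdist_sym y x) in t7.
  exact: (chord_estimate ta01 d1 d2 t1 t2 t3 t4 t5 t6 t7 t8).
case: (pselect (K !=set0)) => [K0|K0]; last first.
  exists 1 => // y by_ _; rewrite ltNge; apply/negP => h1; apply: K0; exists (chord y (ta * len y)).
  by have [_ _ _ C] := chordP by_; have [Oz _ _] := C _ (tl y by_).
have [z1 z1K hmin] := compact_EVT_min K0 cK cPsi.
have {}z1K : K z1 by move: z1K; rewrite inE.
have m0 : 0 < Psi z1.
  rewrite lt_neqAle addr_ge0 // andbT; apply/eqP => /esym/eqP; rewrite paddr_eq0 // !normr_eq0 !subr_eq0 => /andP[/eqP q1 /eqP q2].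
  have [_ _ U1 _] := chordP bx; case: z1K => _ /=.
  rewrite (U1 z1) q1; last by rewrite (rdist_sym z1) q2; ring.
  by rewrite -/z0 rdistxx leNgt e0.
exists (Psi z1 / 6); first by rewrite divr_gt0.
move=> y by_ dy; rewrite ltNge; apply/negP => h1.
have [_ _ _ C] := chordP by_; have [Oz _ _] := C _ (tl y by_).
have : Psi z1 <= Psi (chord y (ta * len y)) by apply: hmin; rewrite inE.
move/le_trans => /(_ _ (key y by_)); rewrite leNgt => /negP; apply.
by rewrite mulrC -ltr_pdivlMr.
Qed.

(* Near its midpoint the chord is reversed by the involution. *)
Lemma mid_isolated x : bdry Om x -> exists2 r : R, 0 < r & forall z, Om z -> s z = z -> rdist (mid x) z < r -> z = mid x.
Proof.
move=> bx; have [Om_m sm d1 d2] := midP bx; have l0 := len_gt0 bx.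
have [b1 Ub fb] := disc_inv dc Om_m; set b := h (mid x) in b1 Ub fb.
have b1' : esq b < 1.
  rewrite lt_neqAle b1 andbT; apply/eqP => /(bdry_esq dc Om_m) bm; exact: sb bm sm.
have kb : disc_map f h s b = b by rewrite /disc_map fb sm.
case: (dc) => -[oU fS oV hS] hf DU OmE.
set t0 := len x / 2; set c := chord x.
have [gc c0 _] := ExpP mc x (xget 0 [set v | chord_dir x v]).
have S1 : speed c t0 = 1 by have [n1 _ _ _] := chordP bx; rewrite /c /chord Exp_speed.
have rc := geodesic_regular t0 gc; rewrite -/(chord x) -/c in rc gc.
have Vm : (f @` U) (c t0) by exists b.
set i := chart_at (c t0); have ic : dom i (c t0) := chart_atP _.
have dX := regular_derive rc ic.
have Wx : (chart i @` (dom i `&` f @` U)) (chart i (c t0)) by exists (c t0).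
have dh := smooth_differentiable (hS i) Wx.
have dhc := is_derive_comp dX dh; set v := 'D_(vel i c t0) _ _ in dhc.
have dg : is_derive t0 (1 : R) (fun t => h (c t)) v.
  apply: is_derive_near dhc; apply: filterS (near_dom rc.1 ic) => t it.
  by rewrite /= chartK.
have hb : h (c t0) = b by [].
have cV : \forall t \near t0, (f @` U) (c t) by exact: (rc.1 _ (open_nbhs_nbhs (conj oV Vm))).
(* The chord is recovered by [f] from its disc coordinates, so zero coordinate velocity would
   contradict unit speed. *)
have v0 : v != 0.
  apply/eqP => v0; have vn : vel i c t0 = 0.
    have df : differentiable (chart i \o f) (h (c t0)).
      apply: (smooth_differentiable (fS.2 i)); split; first by rewrite hb.
      by rewrite /= hb fb.
    have d3 := is_derive_comp dg df; rewrite v0 derive0 in d3.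
    apply: is_derive_unique dX _; apply: is_derive_near d3.
    by apply: filterS cV => t [u Uu ut]; rewrite /= -ut hf.
  by move: S1; rewrite (speedE rc ic) vn quad0l sqrtr0 => /eqP; rewrite eq_sym oner_eq0.
have vE : 'D_v (disc_map f h s) b = - v.
  have dk : differentiable (disc_map f h s) (h (c t0)) by rewrite hb; exact: smooth_differentiable (k_smooth dc si) b1'.
  have d3 := is_derive_comp dg dk; rewrite hb in d3.
  have t0E : -1 * t0 + len x = t0 by rewrite /t0; lra.
  have d4 : is_derive t0 1 (fun t => h (c (-1 * t + len x))) (-1 *: v).
    by apply: (@is_derive_affine _ _ (fun t => h (c t))); rewrite t0E.
  rewrite -scaleN1r; apply: is_derive_unique d3 _; apply: is_derive_near d4.
  have t00 : 0 < t0 by rewrite divr_gt0.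
  apply: (near_realP' t00) => t; rewrite ltr_norml => /andP[q1 q2].
  have tl : 0 <= t <= len x by move: q1 q2; rewrite /t0; lra.
  have [_ _ _ C] := chordP bx; have [Oc _ _] := C t tl.
  have [_ _ fc] := disc_inv dc Oc.
  by rewrite /disc_map /= fc chord_reverse // mulN1r addrC.
have iso := reversal_isolated dc si sb b1' kb v0 vE.
have nm : nbhs (mid x) [set z | disc_map f h s (h z) = h z -> h z = b].
  exact: (smooth_from_continuous hS Vm iso).
have [r r0 hr] := rdist_nbhs mc nm.
exists r => // z Oz sz /hr /=; have [_ _ fz] := disc_inv dc Oz.
by rewrite /disc_map fz sz => /(_ erefl) hz; rewrite -fz hz fb.
Qed.

Lemma mid_constant x y : bdry Om x -> bdry Om y -> mid x = mid y.
Proof.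
have bc t : bdry Om (f (circ t)) by rewrite (bdryE dc); exists (circ t) => //; exact: circ_esq.
suff H a b : mid (f (circ a)) = mid (f (circ b)).
  by rewrite (bdryE dc) => -[u /circ_surj [a ->] <-] [v /circ_surj [b ->] <-].
wlog ab : a b / a <= b.
  by move=> wl; case: (leP a b) => [/wl//|/ltW /wl ->].
apply: (@locally_constant R M (fun t => mid (f (circ t)))) ab => t.
have [r r0 hr] := mid_isolated (bc t).
have h2 : 0 <= 2^-1 <= (1 : R) := half_unit R.
have [d d0 hd] := chord_continuous (bc t) h2 r0.
have ct : {for t, continuous (fun t => f (circ t))}.
  apply: continuous_comp; first exact: is_derive_continuous (circ_derive t).
  by apply: (disc_continuous dc); case: (dc) => _ _ DU _; apply: DU; rewrite circ_esq.
have /near_realP [d' d'0 hd'] : \forall t' \near t, rdist (f (circ t)) (f (circ t')) < d by exact: (ct _ (rdist_near (f (circ t)) d0)).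
exists d' => // t' /hd' h3; have [Om_m sm _ _] := midP (bc t').
by apply: hr => //; rewrite /mid ![_ / 2]mulrC; exact: hd.
Qed.

Theorem center_exists : exists x0, [/\ Om x0, s x0 = x0, ~ bdry Om x0 &
  forall x, bdry Om x -> mid x = x0 ].
Proof.
have bc : bdry Om (f (circ 0)) by rewrite (bdryE dc); exists (circ 0) => //; exact: circ_esq.
have [Om_m sm _ _] := midP bc; exists (mid (f (circ 0))); split=> // [bm|x bx]; first exact: sb bm sm.
exact: mid_constant.
Qed.
End Chords.

(** * Parametrizations of the boundary *)

Lemma cos_eq1_int (R : realType) (x : R) : cos (2 * pi * x) = 1 -> exists k : int, x = k%:~R.
Proof.
move=> cx; have p0 : 0 < pi :> R := pi_gt0 R.
pose n := Num.floor x; pose y := x - n%:~R.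
have /andP[n1 n2] := floor_itv x; rewrite -/n in n1 n2.
have y0 : 0 <= y by rewrite subr_ge0.
have y1 : y < 1 by rewrite ltrBlDl; move: n2; rewrite intrD.
have cy : cos (2 * pi * y) = 1.
  have [c _] := cos_sin_int (2 * pi * y) n; rewrite -c -mulrDr /y subrK; exact: cx.
exists n; apply/eqP; rewrite -subr_eq0 -/y; apply/eqP.
have inj (z : R) : 0 <= z <= 2^-1 -> cos (2 * pi * z) = 1 -> z = 0.
  move=> z01 cz; have := @cos_inj R (2 * pi * z) 0; rewrite cos0 !in_itv /= lexx (ltW p0).
  have h1 : 0 <= 2 * pi * z <= pi.
    case/andP: z01 => z0 z1; rewrite mulr_ge0 ?(ltW p0) ?mulr_ge0 //=; last by exact: ltW.
    have e : 2 * pi * 2^-1 = pi :> R by field.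
    by rewrite -[leRHS]e ler_wpM2l // mulr_ge0 // ltW.
  move=> /(_ h1 isT cz) /eqP; rewrite !mulf_eq0 pnatr_eq0 (gt_eqF p0) /= => /eqP; exact.
case: (leP y 2^-1) => y2; first by apply: inj; rewrite ?y0.
have : cos (2 * pi * (1 - y)) = 1.
  have [c _] := cos_sin_int (- (2 * pi * y)) 1; rewrite cosN cy in c.
  by rewrite -[RHS]c; congr cos; rewrite (_ : (1 : int)%:~R = 1 :> R) //; ring.
move/inj => /(_ _) h1; have : 1 - y = 0 by apply: h1; apply/andP; split; lra.
lra.
Qed.

Lemma circ_eq (R : realType) (s t : R) : circ s = circ t -> exists k : int, s - t = k%:~R.
Proof.
move=> /matrixP E; have := E 0 0; have := E 0 1; rewrite !mxE /= => es ec.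
apply: cos_eq1_int; rewrite mulrBr cosB ec es -!expr2; exact: cos2Dsin2.
Qed.

(** * A periodic bump and its integral *)

Section Bump.
Variables (R : realType) (m de : R).
Hypothesis de0 : 0 < de.
Hypothesis de1 : de < 2^-1.

(** A continuous function of period 1, equal to 1 at [m] and zero at distance at least [de] from [m]
    modulo integers. The cosine makes periodicity automatic, so it descends to the boundary
    circle. *)
Definition bump (x : R) : R := Num.max 0 (1 - (1 - cos (2 * pi * (x - m))) / (1 - cos (2 * pi * de))).

Lemma bump_continuous (x : R) : {for x, continuous bump}.
Proof.
have cm : {for x, continuous (fun x : R => 1 - (1 - cos (2 * pi * (x - m))) / (1 - cos (2 * pi * de)) : R)}.
  apply: (@continuousB _ R^o); first exact: cst_continuous.
  apply: (@continuousM R _); last exact: cst_continuous.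
  apply: (@continuousB _ R^o); first exact: cst_continuous.
  have cl : {for x, continuous (fun x : R => 2 * pi * (x - m) : R)}.
    apply: (@continuousM R _); first exact: cst_continuous.
    by apply: (@continuousB _ R^o); [exact: id|exact: cst_continuous].
  exact: (continuous_comp cl (@continuous_cos R _)).
exact: (@continuous_max _ _ _ _ _ (@cst_continuous _ _ (0 : R) x) cm).
Qed.

Lemma bump_ge0 x : 0 <= bump x. Proof. by rewrite le_max lexx. Qed.

Lemma bump_le1 x : bump x <= 1.
Proof.
rewrite ge_max ler01 /= gerBl divr_ge0 // subr_ge0; exact: cos_le1.
Qed.

Lemma bump_int x (n : int) : bump (x + n%:~R) = bump x.
Proof. by have [c _] := cos_sin_int (2 * pi * (x - m)) n; rewrite /bump addrAC mulrDr c. Qed.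

Lemma cos_decreasing (a b : R) : 0 <= a -> a <= b -> b <= 2^-1 -> cos (2 * pi * b) <= cos (2 * pi * a).
Proof.
move=> a0 ab b2; have p0 : 0 < pi :> R := pi_gt0 R.
have d (t : R) : is_derive t (1 : R) (fun t => cos (2 * pi * t)) (- sin (2 * pi * t) * (2 * pi)).
  have d0 : is_derive t (1 : R) (fun t => 2 * pi * t) (2 * pi) by apply: is_derive_eq; rewrite /GRing.scale /= mulr1.
  exact: (@is_derive1_comp R cos (fun t => 2 * pi * t) t _ _ (is_derive_cos _) d0).
have := @derive_le R (fun t => cos (2 * pi * t)) (fun t => - sin (2 * pi * t) * (2 * pi)) (cst 0) (cst 0) a b ab
  (fun t _ => d t) (fun t _ => is_derive_cst _ _ _).
rewrite /cst (subrr 0) subr_le0; apply=> t /andP[at_ tb].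
rewrite mulNr oppr_le0 mulr_ge0 //; last by rewrite mulr_ge0 // ltW.
apply: sin_ge0_pi; rewrite mulr_ge0 ?mulr_ge0 ?(ltW p0) ?(le_trans a0 (ltW at_)) //=.
have e : 2 * pi * 2^-1 = pi :> R by field.
by rewrite -[leRHS]e ler_wpM2l ?mulr_ge0 ?(ltW p0) // (le_trans (ltW tb)).
Qed.

Lemma bump_denominator : 0 < 1 - cos (2 * pi * de).
Proof.
rewrite subr_gt0 lt_neqAle cos_le1 andbT; apply/eqP => /cos_eq1_int [k dk].
have k0 : (0 < k)%R by rewrite -(ltr0z R) -dk.
have : (1 : R) <= k%:~R by rewrite -[1]/(1%:~R) ler_int.
by rewrite -dk => h; move: de1 h; lra.
Qed.

Lemma bump_out x : de <= x - m -> x - m <= 2^-1 -> bump x = 0.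
Proof.
move=> h1 h2; apply/max_idPl; rewrite subr_le0 ler_pdivlMr ?bump_denominator // mul1r lerD2l lerN2.
by apply: cos_decreasing => //; exact: ltW.
Qed.

Lemma bump_out_left x : de <= m - x -> m - x <= 2^-1 -> bump x = 0.
Proof.
move=> h1 h2; apply/max_idPl; rewrite subr_le0 ler_pdivlMr ?bump_denominator // mul1r lerD2l lerN2.
rewrite -(opprB m x) mulrN cosN; apply: cos_decreasing => //; exact: ltW.
Qed.

(* The integral of the bump over a period is at most twice its half-width. *)
Lemma bump_period (B : R -> R) (N : R) : `|m| + 3 <= N ->
  (forall t : R, - N < t < N -> is_derive t 1 B (bump t)) ->
  (forall x : R, - N < x -> x + 1 < N -> B (x + 1) - B x <= 2 * de).
Proof.
move=> mN dB x xN x1N.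
have de0' := de0; have de1' := de1; have m0 := ler_norm m; have m1 := ler_norm (- m); rewrite normrN in m1.
have dD (t : R) : - N < t -> t + 1 < N -> is_derive t 1 (fun t => B (t + 1) - B t) 0.
  move=> t1 t2; have d1 : is_derive (t + 1) 1 B (bump (t + 1)) by apply: dB; lra.
  have d2 : is_derive t 1 B (bump t) by apply: dB; lra.
  have e1 : is_derive t (1 : R) (fun t => B (1 * t + 1)) (1 *: bump (t + 1)).
    by apply: (@is_derive_affine _ _ B); rewrite mul1r.
  have := is_deriveB e1 d2; have -> : 1 *: bump (t + 1) - bump t = 0 :> R.
    by rewrite scale1r (bump_int t 1) subrr.
  by move=> d3; apply: (is_derive_congr d3) => // s; transitivity (B (1 * s + 1) - B s) => //; rewrite mul1r.
have E : B (x + 1) - B x = B (m - 2^-1 + 1) - B (m - 2^-1).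
  case: (leP x (m - 2^-1)) => xm.
    by apply: esym; apply: (@derive0_constant R (fun t => B (t + 1) - B t) _ _ xm) => t /andP[t1 t2]; apply: dD; lra.
  by apply: (@derive0_constant R (fun t => B (t + 1) - B t) _ _ (ltW xm)) => t /andP[t1 t2]; apply: dD; lra.
rewrite E.
have P (a b c : R) : a <= b -> - N < a -> b < N -> (forall t, a < t < b -> bump t <= c) -> B b - B a <= c * (b - a).
  move=> ab aN bN hc.
  have := @derive_le R B bump (fun t => t *: (c : R^o)) (cst c) a b ab.
  rewrite /GRing.scale /= -mulrBl mulrC; apply=> [t tab|t _|t /hc //]; first by apply: dB; lra.
  exact: (@is_derive_scalel R R^o).
have h1 : B (m - de) - B (m - 2^-1) <= 0 * (m - de - (m - 2^-1)).
  by apply: P; [lra|lra|lra|move=> t /andP[t1 t2]; rewrite bump_out_left //; lra].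
have h2 : B (m + de) - B (m - de) <= 1 * (m + de - (m - de)).
  by apply: P; [lra|lra|lra|move=> t _; exact: bump_le1].
have h3 : B (m - 2^-1 + 1) - B (m + de) <= 0 * (m - 2^-1 + 1 - (m + de)).
  by apply: P; [lra|lra|lra|move=> t /andP[t1 t2]; rewrite bump_out //; lra].
lra.
Qed.
End Bump.

Lemma bump_half (R : realType) (de : R) : 0 < de -> de < 2^-1 -> exists2 d : R, 0 < d &
  forall m x : R, `|x - m| <= d -> 2^-1 <= bump m de x.
Proof.
move=> d0 d1; have k0 := bump_denominator d0 d1; set kk := 1 - _ in k0.
have cl : {for (0 : R), continuous (fun y : R => cos (2 * pi * y))}.
  have cl : {for (0 : R), continuous (fun x : R => 2 * pi * x : R)}.
    by apply: (@continuousM R _); [exact: cst_continuous|exact: id].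
  exact: (continuous_comp cl (@continuous_cos R _)).
have k2 : 0 < kk / 2 by rewrite divr_gt0.
have /near_realP [r r0 hr] := continuous_near_le cl k2.
exists (r / 2) => [|m x xm]; first by rewrite divr_gt0.
rewrite le_max; apply/orP; right.
have xr : `|(x - m) - 0| < r by rewrite subr0; apply: le_lt_trans xm _; rewrite ltr_pdivrMr // ltr_pMr // ltr1n.
have := hr _ xr; rewrite mulr0 cos0 ler_norml -/kk => /andP[h1 _].
have : (1 - cos (2 * pi * (x - m))) / kk <= 2^-1 by rewrite ler_pdivrMr //; lra.
lra.
Qed.

Lemma le_add1 (R : realType) (a : R) : a <= a + 1.
Proof. by lra. Qed.

Section CircleParam.
Variables (R : realType) (M : riemannian_surface R).
Variables (Om : set M) (U : set 'rV[R]_2) (f : 'rV[R]_2 -> M) (h : M -> 'rV[R]_2).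
Hypothesis dc : disc_chart Om U f h.
Notation mu := (@lebesgue_measure R).

Definition c0 (t : R) : M := f (circ t).

Lemma c0_int t (n : int) : c0 (t + n%:~R) = c0 t. Proof. by rewrite /c0 circ_int. Qed.

Lemma c0_bdry t : bdry Om (c0 t).
Proof. by rewrite (bdryE dc); exists (circ t) => //; exact: circ_esq. Qed.

Lemma hc0 t : h (c0 t) = circ t.
Proof. by case: (dc) => _ hf DU _; rewrite hf //; apply: DU; rewrite circ_esq. Qed.

Lemma bdry_c0 x : bdry Om x -> exists t, x = c0 t.
Proof. by rewrite (bdryE dc) => -[v /circ_surj [t ->] <-]; exists t. Qed.

Lemma h_curve_smooth (c : R -> M) t : smooth_to ([set: R] : set R^o) c -> (f @` U) (c t) ->
  exists N : set R^o, [/\ open N, N t & smooth N ((h \o c) : R^o -> 'rV[R]_2)].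
Proof.
move=> cS Vt; case: (dc) => -[oU fS oV hS] hf DU OmE; set i := chart_at (c t).
have ic : dom i (c t) := chart_atP _.
have oiV : open (dom i `&` f @` U) by apply: openI => //; exact: dom_open.
have oN := open_preimage_on openT cS.1 oiV; set N := _ `&` _ in oN.
have gS : smooth N (chart i \o c) by apply: sub_smooth (cS.2 i) => u [_ [iu _]].
have oW : open (chart i @` (dom i `&` f @` U)) by apply: chart_image_open => // q [].
have UU x : N x -> (chart i @` (dom i `&` f @` U)) ((chart i \o c) x) by move=> [_ Vx]; exists (c x).
exists N; split=> //.
by apply: (eq_smooth oN _ (smooth_comp oN oW UU gS (hS i))) => x [_ [ix _]]; rewrite /= chartK.
Qed.

Lemma c0_smooth : smooth_to ([set: R] : set R^o) c0.
Proof.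
case: (dc) => -[oU fS oV hS] hf DU OmE.
by apply: (smooth_to_comp oU openT _ fS (@circ_smooth R)) => t _; apply: DU; rewrite circ_esq.
Qed.

Lemma c0_circle : circle_param (bdry Om) c0.
Proof.
case: (dc) => -[oU fS oV hS] hf DU OmE; split.
- exact: c0_smooth.
- move=> t; apply/eqP => s0; set i := chart_at (c0 t).
  have rc := smooth_to_regular c0_smooth (I : [set: R] t).
  have ic : dom i (c0 t) := chart_atP _.
  have vn : vel i c0 t = 0.
    have := s0; rewrite (speedE rc ic); apply: nrm_eq0; exact: chart_cod.
  have Vt : (f @` U) (c0 t) by exists (circ t) => //; apply: DU; rewrite circ_esq.
  have Wx : (chart i @` (dom i `&` f @` U)) (chart i (c0 t)) by exists (c0 t).
  have d := is_derive_comp (regular_derive rc ic) (smooth_differentiable (hS i) Wx).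
  rewrite vn derive0 in d.
  apply: (@dcirc_neq0 R t); apply: is_derive_unique (circ_derive t) _; apply: is_derive_near d.
  by apply: filterS (near_dom rc.1 ic) => x ix; rewrite /= chartK // hc0.
- move=> s t; split=> [e|[k e]]; last by rewrite -(subrK t s) e addrC c0_int.
  by apply: circ_eq; rewrite -!hc0 e.
- apply/seteqP; split=> [_ [t _ <-]|x /bdry_c0 [t ->]]; first exact: c0_bdry.
  by exists t.
Qed.

Lemma speed_c0_bounded : exists2 K : R, 0 < K & forall t, speed c0 t <= K.
Proof.
have cs (t : R) : {for t, continuous (speed c0)} by exact: (speed_continuous openT c0_smooth I).
have [t1 _ H] := EVT_max (ler01 : 0 <= 1 :> R) (within_continuous (fun t _ => cs t)).
exists (speed c0 t1 + 1) => [|t]; first by have := speed_ge0 c0 t1; lra.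
have /andP[n1 n2] := floor_itv t; set n := Num.floor t in n1 n2.
have E : c0 = (fun s => c0 (1 * s + n%:~R)) by apply/funext => s; rewrite mul1r c0_int.
have rc := smooth_to_regular c0_smooth (I : [set: R] (1 * (t - n%:~R) + n%:~R)).
have e1 : speed c0 (t - n%:~R) = speed c0 t.
  by rewrite [in LHS]E (speed_affine rc) normr1 mul1r mul1r subrK.
rewrite -e1; have := H (t - n%:~R); rewrite in_itv /= subr_ge0 n1 /= lerBlDl => h1.
rewrite intrD in n2; apply: le_trans (h1 (ltW n2)) _; exact: le_add1.
Qed.
End CircleParam.

(** * Absence of conjugate points *)

Lemma is_derive_cross (R : realType) (c : R -> 'rV[R]_2) (t : R) dc V : is_derive t (1 : R) c dc ->
  is_derive t (1 : R) (fun s => cross (c s) V) (cross dc V).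
Proof.
move=> /is_derive_mxP d; have d0 := d 0 0; have d1 := d 0 1.
have h0 := is_deriveM d0 (is_derive_cst (V 0 1 : R^o) t 1).
have h1 := is_deriveM d1 (is_derive_cst (V 0 0 : R^o) t 1).
apply: (is_derive_congr (is_deriveB h0 h1)) => //.
by rewrite /cross /cst /GRing.scale /= !mulr0 !add0r (mulrC (V 0 1)) (mulrC (V 0 0)).
Qed.

Lemma left_inverse_injective (R : realType) n m (k : 'rV[R]_n -> 'rV[R]_m) (G : 'rV[R]_m -> 'rV[R]_n) a w :
  differentiable k a -> differentiable G (k a) -> (\forall u \near a, G (k u) = u) -> 'D_w k a = 0 -> w = 0.
Proof.
move=> dk dG e Dw; have l := is_derive_line w dk; rewrite Dw in l.
have dG' : differentiable G (k (0 *: w + a)) by rewrite scale0r add0r.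
have l1 := is_derive_comp l dG'; rewrite derive0 in l1.
have l2 : is_derive (0 : R) (1 : R) (fun t : R => t *: w) 0.
  have l3 : is_derive (0 : R) (1 : R) (fun t : R => t *: w + a - a) 0.
    have := is_deriveB l1 (is_derive_cst a (0 : R) (1 : R)); rewrite subr0 => l3.
    by apply: is_derive_near l3; apply: filterS (near_line w e) => t te; rewrite /= -[X in _ = X - _]te.
  by apply: (is_derive_congr l3) => // t; rewrite addrK.
exact: is_derive_unique (is_derive_scalel w 0) l2.
Qed.

Lemma is_derive_scale_fun (R : realType) n (a : R -> R) (c : R -> 'rV[R]_n) (t : R) da dc :
  is_derive t (1 : R) a da -> is_derive t (1 : R) c dc ->
  is_derive t (1 : R) (fun s => a s *: c s) (a t *: dc + da *: c t).
Proof.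
move=> d1 /is_derive_mxP d2; apply/is_derive_mxP => x k.
apply: (is_derive_congr (is_deriveM d1 (d2 x k))) => [s|]; first by rewrite !mxE.
by rewrite !mxE /GRing.scale /= (mulrC da).
Qed.

Lemma radial_arith (R : realType) (r t a b c d : R) : a <= r -> c <= r - t -> 2 * r <= a + b -> b <= d + c -> t <= d.
Proof. by move=> h1 h2 h3 h4; lra. Qed.

Lemma le_of_eq (R : realType) (x y : R) : x = y -> x <= y.
Proof. by move=> ->. Qed.

Lemma cross_scale_self (R : realType) (h : R) (V : 'rV[R]_2) : cross (h *: V) V = 0.
Proof. by rewrite /cross !mxE; ring. Qed.

Lemma below_mid (R : realType) (x r v : R) : x < (r + v) / 2 -> v < r -> x <= r.
Proof. by move=> h1 h2; lra. Qed.

Lemma quarter_half (R : realType) (x : R) : 0 < x -> x / 4 + x / 2 < x.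
Proof. by move=> h; lra. Qed.

Lemma slope_sign (R : realType) (a x : R) : x != 0 -> `|a - x| <= `|x| / 2 -> 0 < a * x.
Proof.
rewrite ler_norml => x0 /andP[h1 h2]; case: (ltP 0 x) => hx.
  by rewrite pmulr_lgt0 //; move: h1; rewrite gtr0_norm //; lra.
have x1 : x < 0 by rewrite lt_neqAle x0.
by rewrite nmulr_lgt0 //; move: h2; rewrite ltr0_norm //; lra.
Qed.

Lemma opposite_signs (R : realType) (A B a b k h t : R) : 0 < t -> 0 < h ->
  0 < A * (t * a) -> 0 < B * (t * b) -> 0 < a * (h * k) -> 0 < b * (- h * k) -> A <= 0 <= B \/ B <= 0 <= A.
Proof.
move=> t0 h0; rewrite mulrCA (pmulr_rgt0 _ t0) mulrCA (pmulr_rgt0 _ t0) mulrCA (pmulr_rgt0 _ h0).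
rewrite mulNr mulrN mulrCA -mulrN (pmulr_rgt0 _ h0) oppr_gt0 => h1 h2 h3 h4.
case: (ltP 0 a) => a0.
  move: h1 h3; rewrite pmulr_lgt0 // (pmulr_rgt0 _ a0) => A0 k0.
  have b0 : b < 0 by rewrite pmulr_llt0 in h4.
  by right; move: h2; rewrite nmulr_lgt0 // => B0; rewrite !ltW.
have a1 : a < 0 by rewrite lt_neqAle a0 andbT; apply/eqP => e; move: h1; rewrite e mulr0 ltxx.
move: h1 h3; rewrite nmulr_lgt0 // (nmulr_rgt0 _ a1) => A0 k0.
have b0 : 0 < b by rewrite nmulr_llt0 in h4.
by left; move: h2; rewrite pmulr_lgt0 // => B0; rewrite !ltW.
Qed.

Lemma stretch_lt (R : realType) (n h r v : R) : 0 <= n -> n < (r + v) / 2 -> v < r -> 0 <= h -> h * r <= (r - v) / 2 ->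
  (1 + h) * n < r.
Proof.
move=> n0 n1 vr h0 hr; have : h * n <= h * r by rewrite ler_wpM2l //; lra.
by rewrite mulrDl mul1r; lra.
Qed.

Lemma solve_parallel (R : realType) (V : lmodType R) (w v : V) (t c l : R) : t != 0 -> c != 0 ->
  c *: (t *: w + v) = l *: v -> w = (t^-1 * (c^-1 * l - 1)) *: v.
Proof.
move=> t0 c0 e; have e1 : t *: w + v = (c^-1 * l) *: v by rewrite -scalerA -e scalerA mulVf // scale1r.
have e2 : t *: w = (c^-1 * l - 1) *: v by rewrite scalerBl scale1r -e1 addrK.
by rewrite -scalerA -e2 scalerA mulVf // scale1r.
Qed.

Lemma is_derive_cross_comp (R : realType) (c : R -> 'rV[R]_2) (G : 'rV[R]_2 -> 'rV[R]_2) (t : R) Y x V :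
  is_derive t (1 : R) c Y -> c t = x -> differentiable G x ->
  is_derive t (1 : R) (fun s => cross (G (c s)) V) (cross ('D_Y G x) V).
Proof. by move=> d <- dG; exact: is_derive_cross (is_derive_comp d dG). Qed.

Lemma scale_sum_arith (R : realType) (y0 y1 a b c d z1 z2 : R) : y0 = 0 -> y1 = 0 ->
  y0 *: (a : R^o) + b *: (z1 : R^o) + (y1 *: (c : R^o) + d *: (z2 : R^o)) = z1 * b + z2 * d.
Proof. by move=> -> ->; rewrite /GRing.scale /=; ring. Qed.

(** As [Y] vanishes at 0, the variation of the differential of [g] along [X] does not contribute and
    only the derivative [zeta] of [Y] remains. *)
Lemma is_derive_cross_gradient (R : realType) (Y X : R -> 'rV[R]_2) (g : 'rV[R]_2 -> 'rV[R]_2) zeta dX V :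
  is_derive (0 : R) (1 : R) Y zeta -> Y 0 = 0 -> is_derive (0 : R) (1 : R) X dX ->
  (forall l : 'I_2, differentiable (fun x => 'D_('e_l) g x) (X 0)) ->
  (\forall h \near (0 : R), differentiable g (X h)) ->
  is_derive (0 : R) (1 : R) (fun h => cross ('D_(Y h) g (X h)) V) (cross ('D_zeta g (X 0)) V).
Proof.
move=> /is_derive_mxP dY Y0 dX' dk ng.
have m l : is_derive (0 : R) (1 : R) (fun h => cross ('D_('e_l) g (X h)) V) _ :=
  is_derive_cross V (is_derive_comp dX' (dk l)).
have p := is_deriveD (is_deriveM (dY 0 0) (m 0)) (is_deriveM (dY 0 1) (m 1)).
have cl (x y : R) (A B : 'rV[R]_2) : cross (x *: A + y *: B) V = x * cross A V + y * cross B V.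
  by rewrite /cross !mxE; ring.
have q : is_derive (0 : R) (1 : R) (fun h => Y h 0 0 * cross ('D_('e_0) g (X h)) V + Y h 0 1 * cross ('D_('e_1) g (X h)) V)
    (cross ('D_zeta g (X 0)) V).
  have E := congr1 (fun z => cross z V) (@derive2 R g (X 0) zeta (nbhs_singleton ng)).
  have E2 := etrans E (cl _ _ _ _).
  have y0 : Y 0 0 0 = 0 by rewrite Y0 mxE.
  have y1 : Y 0 0 1 = 0 by rewrite Y0 mxE.
  apply: (is_derive_congr p (fun _ => erefl)); exact: etrans (scale_sum_arith _ _ _ _ _ _ y0 y1) (esym E2).
apply: is_derive_near q; apply: filterS ng => x gx.
have E := congr1 (fun z => cross z V) (@derive2 R g (X x) (Y x) gx).
exact: esym (etrans E (cl _ _ _ _)).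
Qed.

Lemma le_half_trans (R : realType) (a b c : R) : a <= b / 2 -> b <= c -> a <= c / 2.
Proof. by move=> h1 h2; lra. Qed.

Lemma half_diff_lt (R : realType) (r v : R) : 0 < r -> 0 <= v -> (r - v) / 2 < r.
Proof. by move=> h1 h2; lra. Qed.

Lemma add1_neq0 (R : realType) (h x : R) : - h <= x -> h < 1 -> x + 1 != 0.
Proof. by move=> h1 h2; rewrite gt_eqF //; lra. Qed.

Section FlowDerivative.
Variables (R : realType) (M : riemannian_surface R).
Hypothesis mc : complete_surface M.
Implicit Types (i j : atlas M) (c : R -> M) (p q : M).
Notation Exp := (Exp mc).
Notation geo := (geo mc).

Lemma rev_inj (R' : realType) : injective (@rev R').
Proof.
move=> x y /eq_row_mx [e1 e2]; rewrite -(hsubmxK x) -(hsubmxK y) e1; congr row_mx; exact: oppr_inj.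
Qed.

Lemma derive_rev (z w : 'rV[R]_(2 + 2)) : 'D_w (@rev R : 'rV[R]_(2+2) -> 'rV[R]_(2+2)) z = rev w.
Proof.
have d : is_derive z w (@rev R : 'rV[R]_(2+2) -> 'rV[R]_(2+2)) (rev w).
  have dl := is_derive_lsubmx (is_derive_id z w).
  have dr := is_deriveN (is_derive_rsubmx (is_derive_id z w)).
  apply/is_derive_mxP => b k; move/is_derive_mxP: dl => dl; move/is_derive_mxP: dr => dr.
  rewrite /rev mxE; case: split_ordP => l ->.
    by apply: (is_derive_congr (dl b l)) => // y; rewrite row_mxEl.
  by apply: (is_derive_congr (dr b l)) => // y; rewrite row_mxEr !mxE.
by case: d.
Qed.

(* The geodesic flow from chart [i] to chart [j] is inverted by flipping the velocity. *)
Lemma flow_derive_injective i j z0 T w : 0 <= T -> spray_dom i z0 -> dom j (geo i z0 T) ->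
  'D_w (fun z => state j (geo i z) T) z0 = 0 -> w = 0.
Proof.
move=> T0 sz jz; have [N [oN Nz0 Nd ND NS]] := geodesic_flow_smooth T0 sz jz => Dw.
set S := fun z => state j (geo i z) T in NS Dw.
have inv z t : N z -> geo j (rev (S z)) t = geo i z (T - t).
  move=> Nz; have [g1 _ _] := geoP mc (Nd z Nz).
  have sd : spray_dom j (S z) by apply: state_spray_dom; exact: ND.
  by rewrite geo_rev // /S (@geo_state _ _ mc _ T (- t) j g1 (ND z Nz)) addrC.
have iz z : N z -> dom i (geo j (rev (S z)) T).
  by move=> Nz; rewrite inv // subrr; have [] := geoP mc (Nd z Nz).
have sd0 : spray_dom j (rev (S z0)).
  rewrite /spray_dom /= /rev row_mxKl; have := state_spray_dom (ND z0 Nz0); exact.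
have [N2 [oN2 N2z _ _ NS2]] := geodesic_flow_smooth T0 sd0 (iz z0 Nz0).
set P := fun z => state i (geo j z) T in NS2.
have PE z : N z -> P (rev (S z)) = rev z.
  move=> Nz; have [g1 i1 s1] := geoP mc (Nd z Nz).
  have E : geo j (rev (S z)) = (fun t => geo i z ((-1) * t + T)).
    by apply/funext => t; rewrite inv // mulN1r addrC.
  have e0 : -1 * T + T = 0 :> R by rewrite mulN1r addNr.
  have rc : curve_regular (geo i z) (-1 * T + T) by exact: geodesic_regular.
  have ic : dom i (geo i z (-1 * T + T)) by rewrite e0.
  rewrite /P /state E (vel_affine rc ic) e0 scaleN1r /rev -[in RHS]s1 /state row_mxKl row_mxKr.
  by [].
have dS := smooth_differentiable NS Nz0.
have L := @is_derive_line R _ _ (fun z => rev (S z)) z0 w.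
have lS := is_derive_line w dS; rewrite Dw in lS.
have drev (x : 'rV[R]_(2+2)) : differentiable (@rev R : 'rV[R]_(2+2) -> 'rV[R]_(2+2)) x.
  apply: (@smooth_differentiable _ _ _ setT) => //.
  apply: smooth_row_mx; first exact: openT.
    by move=> m; apply: Ck_linear; exact: rV_linear_continuous.
  have oppE : (fun z : 'rV[R]_(2+2) => - rsubmx z : 'rV[R]_2) = (fun z => (-1 : R) *: (rsubmx z : 'rV[R]_2)).
    by apply/funext => z; rewrite scaleN1r.
  have rS : smooth setT (fun z : 'rV[R]_(2+2) => rsubmx z : 'rV[R]_2).
    by move=> m; apply: Ck_linear; exact: rV_linear_continuous.
  by move=> m; apply: CkN; [exact: openT|exact: rS].
have l1 := is_derive_comp lS (drev _).
have dP : differentiable P (rev (S (0 *: w + z0))).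
  by rewrite scale0r add0r; exact: smooth_differentiable NS2 N2z.
have l2 := is_derive_comp l1 dP; rewrite derive0 derive0 in l2.
have l3 := is_derive_line w (drev z0).
have nN : \forall t \near (0 : R), N (t *: w + z0).
  by apply: near_line; exact: (open_nbhs_nbhs (conj oN Nz0)).
have l4 : is_derive (0 : R) (1 : R) (fun t => rev (t *: w + z0)) 0.
  by apply: is_derive_near l2; apply: filterS nN => t Nt; rewrite /= PE.
have := is_derive_unique l3 l4; rewrite derive_rev => e; apply: rev_inj; rewrite e.
by rewrite /rev !raddf0 row_mx0.
Qed.

(** * Jacobi fields as derivatives of the geodesic flow *)

Section Jacobi.
Variables (p : M) (v : 'rV[R]_2) (j : atlas M).
Hypothesis jb : dom j (Exp p v 1).
Let i := chart_at p.
Let z0 : 'rV[R]_(2+2) := row_mx (chart i p) v.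
Let S (z : 'rV[R]_(2+2)) : 'rV[R]_(2+2) := state j (geo i z) 1.
Let V := vel j (Exp p v) 1.

Let sz : spray_dom i z0. Proof. exact: start_dom. Qed.

Lemma flow_start_differentiable : differentiable S z0.
Proof.
have [N [oN Nz0 Nd ND NS]] := geodesic_flow_smooth ler01 sz jb.
exact: smooth_differentiable NS Nz0.
Qed.
Let dS := flow_start_differentiable.

Lemma row_line (w : 'rV[R]_2) (t : R) : t *: row_mx 0 w + z0 = row_mx (chart i p) (t *: w + v).
Proof. by rewrite scale_row_mx add_row_mx scaler0 add0r. Qed.

Let cg : geodesic (Exp p v). Proof. by have [] := ExpP mc p v. Qed.
Let i0 : dom i (Exp p v 0). Proof. by have [_ -> _] := ExpP mc p v; exact: chart_atP. Qed.
Let s0 : state i (Exp p v) 0 = z0. Proof. by have [_ _] := geoP mc sz. Qed.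

Lemma near_shift_dom : \forall t \near (0 : R), dom j (Exp p v (1 * t + 1)).
Proof.
have c1 := (geodesic_regular 0 (geodesic_affine 1 1 cg)).1.
by apply: (near_dom c1); rewrite mulr0 add0r.
Qed.

(** Moving the initial state along its own geodesic moves the final state along the same
    geodesic. *)
Lemma flow_derive_spray : 'D_(spray i z0) S z0 = spray j (S z0).
Proof.
have [_ d1] := state_derive cg i0; rewrite s0 in d1.
have dS' : differentiable S (state i (Exp p v) 0) by rewrite s0.
have d2 := is_derive_comp d1 dS'; rewrite s0 in d2.
have [_ d3] := state_derive cg jb.
have d4 : is_derive (1 * 0 + 1 : R) (1 : R) (state j (Exp p v)) (spray j (S z0)) by rewrite mulr0 add0r.
have d5 := is_derive_affine d4; rewrite scale1r in d5.
apply: is_derive_unique d2 _; apply: is_derive_near d5.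
have ni : \forall t \near (0 : R), dom i (Exp p v t) := near_dom (geodesic_regular 0 cg).1 i0.
apply: filterS (filterI ni near_shift_dom) => t [it jt].
have E : geo i (state i (Exp p v) t) = (fun u => Exp p v (1 * u + t)).
  by apply/funext => u; rewrite geo_state // mul1r.
have rc : curve_regular (Exp p v) (1 * 1 + t) by exact: geodesic_regular.
have jc : dom j (Exp p v (1 * 1 + t)) by rewrite mul1r addrC -(mul1r t).
by rewrite /= /S E /state (vel_affine rc jc) scale1r mul1r mul1r addrC.
Qed.

(** Scaling the initial velocity runs along the same geodesic at another rate: the final point
    advances and the final velocity is rescaled as well, which gives the extra [V]. *)
Lemma flow_derive_scale : 'D_(row_mx 0 v) S z0 = row_mx V (V + rsubmx (spray j (S z0))).
Proof.
have l := is_derive_line (row_mx 0 v) dS; set D := 'D_(row_mx 0 v) S z0 in l *.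
have E (t : R) : dom j (Exp p v (1 * t + 1)) ->
    S (t *: row_mx 0 v + z0) = row_mx (chart j (Exp p v (1 * t + 1))) ((t + 1) *: vel j (Exp p v) (1 * t + 1)).
  move=> jt; rewrite row_line.
  have e : t *: v + v = (t + 1) *: v by rewrite scalerDl scale1r.
  have Ee : geo i (row_mx (chart i p) (t *: v + v)) = (fun u => Exp p v ((t + 1) * u + 0)).
    by apply/funext => u; rewrite e -/(Exp p ((t + 1) *: v) u) Exp_scale addr0.
  have e1 : (t + 1) * 1 + 0 = 1 * t + 1 by rewrite mulr1 addr0 mul1r.
  have rc : curve_regular (Exp p v) ((t + 1) * 1 + 0) by exact: geodesic_regular.
  have jc : dom j (Exp p v ((t + 1) * 1 + 0)) by rewrite e1.
  by rewrite /S /state Ee (vel_affine rc jc) e1.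
have [_ d3] := state_derive cg jb.
have d4 : is_derive (1 * 0 + 1 : R) (1 : R) (state j (Exp p v)) (spray j (S z0)) by rewrite mulr0 add0r.
have d5 := is_derive_affine d4; rewrite scale1r in d5.
have dl : is_derive (0 : R) (1 : R) (fun t => lsubmx (S (t *: row_mx 0 v + z0))) (lsubmx (spray j (S z0))).
  apply: is_derive_near (is_derive_lsubmx d5).
  by apply: filterS near_shift_dom => t jt; rewrite /= E // /state !row_mxKl.
have dr : is_derive (0 : R) (1 : R) (fun t => rsubmx (S (t *: row_mx 0 v + z0))) (V + rsubmx (spray j (S z0))).
  have d6 := is_derive_rsubmx d5.
  have d7 : is_derive (0 : R) (1 : R) (fun t : R => t + 1) 1.
    by have := is_deriveD (is_derive_id (0 : R) (1 : R)) (is_derive_cst (1 : R) (0 : R) (1 : R)); rewrite addr0.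
  have d8 := is_derive_scale_fun d7 d6.
  apply: (is_derive_near _ (is_derive_congr d8 (fun _ => erefl) _)).
    by apply: filterS near_shift_dom => t jt; rewrite /= E // /state !row_mxKr.
  by rewrite mulr0 !add0r !scale1r /state row_mxKr addrC.
rewrite -(hsubmxK D) (is_derive_unique (is_derive_lsubmx l) dl) (is_derive_unique (is_derive_rsubmx l) dr).
by congr row_mx; rewrite {1}/spray row_mxKl /S /state row_mxKr.
Qed.

(** A field vanishing at both ends cannot arrive tangentially unless it is trivial. The proof
    subtracts a tangential variation with the same final value and uses injectivity of the
    differential of the flow. *)
Lemma jacobi_transversal w (l : R) : v != 0 -> lsubmx ('D_(row_mx 0 w) S z0) = 0 ->
  rsubmx ('D_(row_mx 0 w) S z0) = l *: V -> w = 0.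
Proof.
move=> v0 h1 h2; set D := 'D_(row_mx 0 w) S z0 in h1 h2.
have eD : D = row_mx 0 (l *: V) by rewrite -(hsubmxK D) h1 h2.
have eA : spray j (S z0) = row_mx V (rsubmx (spray j (S z0))).
  rewrite -[LHS]hsubmxK; congr row_mx; by rewrite {1}/spray row_mxKl /S /state row_mxKr.
(* By the two preceding lemmas, the variation in parentheses is sent to the vector with zero
   position and velocity [V]. *)
pose om := row_mx 0 w - l *: (row_mx 0 v - spray i z0).
have : 'D_om S z0 = 0.
  rewrite /om derive_dirB // derive_dirZ // derive_dirB // flow_derive_spray flow_derive_scale -/D eD.
  rewrite [X in _ *: (_ - X)]eA opp_row_mx add_row_mx subrr addrK scale_row_mx opp_row_mx add_row_mx subrr.
  by rewrite scaler0 subrr row_mx0.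
move=> /(flow_derive_injective ler01 sz jb) om0.
have lw : l *: v = 0.
  have := congr1 (fun z : 'rV[R]_(2+2) => (lsubmx z : 'rV[R]_2)) om0.
  rewrite /om /spray opp_row_mx add_row_mx scale_row_mx opp_row_mx add_row_mx row_mxKl !add0r row_mxKr.
  by rewrite scalerN opprK => ->; apply/matrixP => a b; rewrite !mxE.
have l0 : l = 0 by move/eqP: lw; rewrite scaler_eq0 (negbTE v0) orbF => /eqP.
move: om0; rewrite /om l0 scale0r subr0 => e; have := congr1 (fun z : 'rV[R]_(2+2) => (rsubmx z : 'rV[R]_2)) e.
by rewrite row_mxKr => ->; apply/matrixP => a b; rewrite !mxE.
Qed.

Lemma exp_chart_smooth : exists N : set 'rV[R]_2, [/\ open N, N v, forall u, N u -> dom j (Exp p u 1) &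
  smooth N (fun u => chart j (Exp p u 1))].
Proof.
have [N [oN Nz0 Nd ND NS]] := geodesic_flow_smooth ler01 sz jb.
pose st (u : 'rV[R]_2) : 'rV[R]_(2 + 2) := row_mx (chart i p) u.
have stS : smooth setT st.
  by apply: smooth_row_mx; [exact: openT|move=> n; exact: Ck_cst|exact: smooth_id].
have oU : open (st @^-1` N).
  by apply: open_comp => // u _; exact: (smooth_continuous stS I).
have UU u : (st @^-1` N) u -> N (st u) by [].
have ES1 : smooth (st @^-1` N) ((fun z => state j (geo i z) 1) \o st).
  by apply: (smooth_comp oU oN UU) NS; apply: sub_smooth stS.
have lS : smooth setT (fun z : 'rV[R]_(2+2) => lsubmx z : 'rV[R]_2).
  by move=> m; apply: Ck_linear; exact: rV_linear_continuous.
have EE u : lsubmx (state j (geo i (st u)) 1) = chart j (Exp p u 1) by rewrite /state row_mxKl.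
exists (st @^-1` N); split=> //; first by move=> u Nu; exact: ND.
apply: (eq_smooth oU (fun u _ => EE u)).
exact: (smooth_comp oU openT (fun _ _ => I) ES1 lS).
Qed.

Lemma exp_chart_derive w : 'D_w (fun u => chart j (Exp p u 1)) v = lsubmx ('D_(row_mx 0 w) S z0).
Proof.
have [N [oN Nv ND NS]] := exp_chart_smooth.
have l1 := is_derive_line w (smooth_differentiable NS Nv).
have l2 := is_derive_lsubmx (is_derive_line (row_mx 0 w) dS).
apply: is_derive_unique l1 _; apply: (is_derive_congr l2) => // t.
by rewrite row_line /S /state row_mxKl.
Qed.

Lemma exp_continuous : {for v, continuous (fun u => Exp p u 1)}.
Proof.
have [N [oN Nv ND NS]] := exp_chart_smooth.
have c1 := smooth_continuous NS Nv.
have c2 := @param_continuous _ M j _ (chart_cod jb).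
have c3 : {for v, continuous (param j \o (fun u => chart j (Exp p u 1)))} by exact: continuous_comp c1 c2.
move=> A /= nA; have nA' : nbhs ((param j \o (fun u => chart j (Exp p u 1))) v) A by rewrite /= chartK.
have h1 : \forall u \near v, A (param j (chart j (Exp p u 1))) by exact: c3.
have h2 : \forall u \near v, N u := open_nbhs_nbhs (conj oN Nv).
have h3 : \forall u \near v, A (param j (chart j (Exp p u 1))) /\ N u by exact: filterI h1 h2.
by apply: filterS h3 => u [Au Nu] /=; rewrite -(chartK (ND u Nu)).
Qed.
End Jacobi.

(** * Geodesics crossing near a conjugate point *)

Section Crossing.
Variables (p : M) (r : R) (v w : 'rV[R]_2).
Hypothesis inj : forall u u', pnorm p u < r -> pnorm p u' < r -> Exp p u 1 = Exp p u' 1 -> u = u'.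
Hypothesis vr : pnorm p v < r.
Hypothesis v0 : v != 0.
Let b := Exp p v 1.
Let j := chart_at b.
Let jb : dom j b. Proof. exact: chart_atP. Qed.
Let z0 : 'rV[R]_(2+2) := row_mx (chart (chart_at p) p) v.
Let S (z : 'rV[R]_(2+2)) : 'rV[R]_(2+2) := state j (geo (chart_at p) z) 1.
Let V := vel j (Exp p v) 1.
Let eta := 'D_(row_mx 0 w) S z0.
Hypothesis eta0 : lsubmx eta = 0.
Hypothesis w0 : w != 0.
Let zeta := rsubmx eta.
Let cg : geodesic (Exp p v). Proof. by have [] := ExpP mc p v. Qed.

Lemma continue_at_b t : Exp p v (t + 1) = Exp b V t.
Proof. exact: (geodesic_ExpE mc 1 t cg). Qed.

Lemma end_velocity_neq0 : V != 0.
Proof.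
apply/eqP => V0; move/eqP: v0; apply; apply: inj => //.
  by have := pnormZ p 0 v; rewrite scale0r normr0 mul0r => ->; apply: le_lt_trans vr; exact: nrm_ge0.
have e1 := continue_at_b (-1); rewrite addNr V0 Exp0 in e1.
by have [_ e0 _] := ExpP mc p v; rewrite Exp0 -[RHS]e0 e1.
Qed.

Lemma end_pnorm : pnorm b V = pnorm p v.
Proof. by rewrite -(Exp_speed mc p v 1). Qed.

Variables (rb : R) (g : 'rV[R]_2 -> 'rV[R]_2).
Hypothesis nr : normal_radius mc b rb g.
Let W := (fun u => chart j (Exp b u 1)) @` [set u | pnorm b u < rb].

Let Eb0 : chart j (Exp b 0 1) = chart j b. Proof. by rewrite Exp0. Qed.

Let rb0 : 0 < rb. Proof. by case: nr. Qed.

Let small0 : pnorm b 0 < rb.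
Proof. by have := pnormZ b 0 v; rewrite scale0r normr0 mul0r => ->. Qed.

Let Wb : W (chart j b). Proof. by exists 0 => //; exact: small0. Qed.

Let oW : open W. Proof. by case: nr => _ _ []. Qed.
Let gS : smooth W g. Proof. by case: nr => _ _ []. Qed.

Let gE u : pnorm b u < rb -> g (chart j (Exp b u 1)) = u.
Proof. by move=> ub; case: nr => _ /(_ u ub) []. Qed.

Let dg : differentiable g (chart j b). Proof. exact: smooth_differentiable gS Wb. Qed.

Let X0 h := chart j (Exp b V h).

Let dX0 : is_derive (0 : R) (1 : R) X0 V.
Proof.
have [g1 e0 v1] := ExpP mc b V.
have j0 : dom j (Exp b V 0) by rewrite e0.
have vE := v1; rewrite velocityE e0 in vE.
have := regular_derive (geodesic_regular 0 g1) j0; rewrite [X in is_derive _ _ _ X]vE; exact.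
Qed.

Let near_small : \forall h \near (0 : R), pnorm b (h *: V) < rb.
Proof.
have nb : \forall u \near (0 : 'rV[R]_2), pnorm b u < rb.
  exact: (open_nbhs_nbhs (conj (@pnorm_open _ _ b rb) small0)).
by apply: filterS (near_line V nb) => h; rewrite addr0.
Qed.

Let gX0 h : pnorm b (h *: V) < rb -> g (X0 h) = h *: V.
Proof. by move=> hs; have := gE hs; rewrite Exp_scale mulr1. Qed.

Let X0b : X0 0 = chart j b.
Proof. by rewrite /X0; have [_ -> _] := ExpP mc b V. Qed.

Lemma log_derive_end : 'D_V g (chart j b) = V.
Proof.
have dg0 : differentiable g (X0 0) by rewrite X0b.
have d1 := is_derive_comp dX0 dg0; rewrite X0b in d1.
apply: is_derive_unique d1 _; apply: is_derive_near (is_derive_scalel V 0).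
by apply: filterS near_small => h hs; rewrite /= gX0.
Qed.

(** The logarithm [g] at [b] fixes the direction [V], so a zero determinant would make [zeta]
    tangential, which [jacobi_transversal] excludes. *)
Lemma crossing_slope_neq0 : cross ('D_zeta g (chart j b)) V != 0.
Proof.
apply/eqP => c0; have [l hl] := cross_eq0 end_velocity_neq0 c0.
have D0 : 'D_(zeta - l *: V) g (chart j b) = 0.
  by rewrite derive_dirB // derive_dirZ // hl log_derive_end subrr.
have ES : smooth [set u | pnorm b u < rb] (fun u => chart j (Exp b u 1)) by case: nr.
have gb : g (chart j b) = 0 by rewrite -Eb0 gE.
have dE : differentiable (fun u => chart j (Exp b u 1)) (g (chart j b)).
  by rewrite gb; exact: smooth_differentiable ES small0.
have nW : \forall y \near chart j b, chart j (Exp b (g y) 1) = y.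
  by apply: filterS (open_nbhs_nbhs (conj oW Wb)) => y [u ub <-]; rewrite gE.
have /eqP := left_inverse_injective dg dE nW D0; rewrite subr_eq0 => /eqP zl.
by move/eqP: w0; apply; exact: (jacobi_transversal jb v0 eta0 zl).
Qed.

Let q t h := Exp p (t *: w + v) (h + 1).
Let F t h := cross (g (chart j (q t h))) V.

(* The function a is the derivative in t at 0 of the signed side F t h of the varied geodesic with respect to the
   central one. Its value at 0 vanishes as b is conjugate, its slope at 0 does not. *)
Lemma crossing_sides : exists a : R -> R, [/\
  \forall h \near (0 : R), is_derive (0 : R) (1 : R) (F ^~ h) (a h) /\ F 0 h = 0,
  a 0 = 0 & is_derive (0 : R) (1 : R) a (cross ('D_zeta g (chart j b)) V)].
Proof.
have dS : differentiable S z0 := flow_start_differentiable jb.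
have dZ := is_derive_line (row_mx 0 w) dS.
have Z0 : S (0 *: row_mx 0 w + z0) = S z0 by rewrite scale0r add0r.
have sz1 : spray_dom j (S z0) by exact: state_spray_dom.
have H0 t : 0 <= t <= 0 -> dom j (geo j (S z0) t).
  by move=> /andP[t0 t1]; have -> : t = 0 by [apply/eqP; rewrite eq_le t1 t0]; case: (geoP mc sz1).
have [N [d [oN Nz d0 fl D]]] := geo_flow (lexx 0) sz1 H0; rewrite add0r in fl D.
have d0' : - d < 0 by rewrite oppr_lt0.
set phi := (fun z t => state j (geo j z) t) in fl.
pose Y h : 'rV[R]_2 := lsubmx ('D_eta (phi ^~ h) (S z0)).
have FE t h : dom j (Exp p (t *: w + v) 1) -> lsubmx (phi (S (t *: row_mx 0 w + z0)) h) = chart j (q t h).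
  move=> jt; rewrite /phi /state row_mxKl row_line /S.
  have [gt _ _] := ExpP mc p (t *: w + v).
  by rewrite (@geo_state _ _ mc (Exp p (t *: w + v)) 1 h j gt jt).
have nj : \forall t \near (0 : R), dom j (Exp p (t *: w + v) 1).
  have [N' [oN' Nv ND _]] := exp_chart_smooth jb.
  by apply: filterS (near_line w (open_nbhs_nbhs (conj oN' Nv))) => t /ND.
have j0 : dom j (Exp p (0 *: w + v) 1) by rewrite scale0r add0r.
have q0 h : q 0 h = Exp b V h by rewrite /q scale0r add0r continue_at_b.
pose a h := cross ('D_(Y h) g (X0 h)) V.
have nd : \forall h \near (0 : R), - d < h < d.
  by apply: (near_realP' d0) => h; rewrite subr0 ltr_norml.
have nW : \forall h \near (0 : R), W (X0 h).
  have cX : {for (0 : R), continuous X0} := is_derive_continuous dX0.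
  by apply: cX; rewrite X0b; exact: (open_nbhs_nbhs (conj oW Wb)).
exists a; split.
- have n3 : \forall h \near (0 : R), (- d < h < d /\ W (X0 h)) /\ pnorm b (h *: V) < rb.
    by exact: filterI (filterI nd nW) near_small.
  apply: filterS n3 => h [[hd hW] hs]; split; last first.
    have e : g (chart j (q 0 h)) = h *: V by rewrite q0; exact: gX0.
    rewrite /F e; exact: cross_scale_self.
  have dphi := flow_differentiable (@spray_dom_open _ _ j) (@spray_smooth _ M j 1%N) oN fl d0' d0 Nz hd.
  have dphi' : differentiable (phi ^~ h) (S (0 *: row_mx 0 w + z0)) by rewrite Z0.
  have d1 := is_derive_lsubmx (is_derive_comp dZ dphi'); rewrite Z0 in d1.
  have e1 : lsubmx (phi (S (0 *: row_mx 0 w + z0)) h) = X0 h by rewrite FE // q0.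
  have d2 := is_derive_cross_comp V d1 e1 (smooth_differentiable gS hW).
  by apply: is_derive_near d2; apply: filterS nj => t jt; rewrite /F -(FE t h jt).
- have e : 'D_eta (phi ^~ 0) (S z0) = eta.
    have [_ e] := is_derive_id (S z0) eta; apply: etrans e; apply: near_eq_derive.
    by apply: filterS (open_nbhs_nbhs (conj oN Nz)) => y /fl [].
  by rewrite /a /Y e eta0 derive0 /cross !mxE !mul0r subrr.
have e : 'D_eta (phi ^~ 0) (S z0) = eta.
  have [_ e] := is_derive_id (S z0) eta; apply: etrans e; apply: near_eq_derive.
  by apply: filterS (open_nbhs_nbhs (conj oN Nz)) => y /fl [].
have t0 : - d < 0 < d by rewrite d0' d0.
have dY := flow_variation oN eta fl d0' d0 Nz t0; rewrite e in dY.
have Y0 : Y 0 = 0 by rewrite /Y e eta0.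
have dk (l : 'I_2) : differentiable (fun x => 'D_('e_l) g x) (X0 0) by rewrite X0b; exact: ((gS 2).2 'e_l).1.
have ng : \forall h \near (0 : R), differentiable g (X0 h).
  by apply: filterS nW => h hW; exact: smooth_differentiable gS hW.
by have := is_derive_cross_gradient V dY Y0 dX0 dk ng; rewrite X0b.
Qed.

(** Just before and just after the conjugate point the variation pushes to opposite sides, so for
    small [t] the varied geodesic changes sides and meets the central one near [b]. Both preimages
    of the meeting point lie in the ball of radius [r]; injectivity then makes the two initial
    directions parallel. *)
Lemma crossing_contradiction : False.
Proof.
have [a [n1 a0 da]] := crossing_sides; set k := cross _ V in da.
have k0 : k != 0 := crossing_slope_neq0.
have pv : 0 <= pnorm p v by exact: nrm_ge0.
have r0 : 0 < r by exact: le_lt_trans vr.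
(* Within this distance of [b], points lie in the normal ball, and the central geodesic prolonged to
   them is still shorter than [r]. *)
pose rho := Num.min rb (r - pnorm p v).
have rho0 : 0 < rho by rewrite lt_min rb0 subr_gt0.
have [rho1 rho2] : rho <= rb /\ rho <= r - pnorm p v by rewrite !ge_min !lexx orbT.
have k2 : 0 < `|k| / 2 by rewrite divr_gt0 // normr_gt0.
have n2 := is_derive_eps da k2.
have n12 : \forall h \near (0 : R), (is_derive (0 : R) (1 : R) (F ^~ h) (a h) /\ F 0 h = 0) /\
  `|a h - a 0 - (h - 0) *: k| <= `|k| / 2 * `|h - 0| by exact: filterI n1 n2.
have [d d0 hd] := near_realP n12.
(* Small enough for the sign of [a] at [h1] and [- h1] to be that of its linear part, and for a
   geodesic of speed at most [r] to move at most [rho / 2] in time [h1]. *)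
pose h1 := Num.min (d / 2) (rho / 2 / r).
have h10 : 0 < h1 by rewrite lt_min !divr_gt0.
have h1d : h1 < d by apply: (@le_lt_trans _ _ (d / 2)); [rewrite ge_min lexx|lra].
have h1r : h1 * r <= rho / 2 by rewrite -ler_pdivlMr // ge_min lexx orbT.
have side (h : R) : h != 0 -> `|h| < d -> [/\ is_derive (0 : R) (1 : R) (F ^~ h) (a h), F 0 h = 0 & 0 < a h * (h * k)].
  move=> hn hh; have hh' : `|h - 0| < d by rewrite subr0.
  have [[dF F0] e] := hd h hh'; split=> //; apply: slope_sign; first by rewrite mulf_neq0.
  by move: e; rewrite a0 !subr0 /GRing.scale /= normrM mulrAC mulrC (mulrC `|h|).
have h1n : h1 != 0 by rewrite gt_eqF.
have [dF1 F1 s1] := side h1 h1n (le_lt_trans (le_of_eq (gtr0_norm h10)) h1d).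
have h1n' : - h1 != 0 by rewrite oppr_eq0.
have h1d' : `|- h1| < d by rewrite normrN gtr0_norm.
have [dF2 F2 s2] := side (- h1) h1n' h1d'.
have an (x : R) : 0 < a x * (x * k) -> 0 < `|a x| / 2.
  by move=> h; rewrite divr_gt0 // normr_gt0; apply: contraTneq h => ->; rewrite mul0r ltxx.
have m1 := is_derive_eps dF1 (an _ s1); have m2 := is_derive_eps dF2 (an _ s2).
(* Leaves room below [r] to prolong the varied geodesic up to time [1 + h1]. *)
have m3 : \forall t \near (0 : R), pnorm p (t *: w + v) < (r + pnorm p v) / 2.
  have nb : \forall u \near v, pnorm p u < (r + pnorm p v) / 2.
    apply: (open_nbhs_nbhs (conj (@pnorm_open _ _ p ((r + pnorm p v) / 2)) _)); rewrite /=; lra.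
  exact: near_line nb.
have m4 : \forall t \near (0 : R), rdist b (Exp p (t *: w + v) 1) <= rho / 4.
  have c1 := continuous_comp (exp_continuous jb) (@rdist_continuous _ _ b b).
  have r4 : 0 < rho / 4 by rewrite divr_gt0.
  have nb : \forall u \near v, rdist b (Exp p u 1) <= rho / 4.
    have nb := continuous_near_le c1 r4; apply: filterS nb => u; rewrite /= rdistxx subr0.
    by apply: le_trans; exact: ler_norm.
  exact: near_line nb.
have m : \forall t \near (0 : R), ((`|F t h1 - F 0 h1 - (t - 0) *: a h1| <= `|a h1| / 2 * `|t - 0|) /\
   (`|F t (- h1) - F 0 (- h1) - (t - 0) *: a (- h1)| <= `|a (- h1)| / 2 * `|t - 0|)) /\
   (pnorm p (t *: w + v) < (r + pnorm p v) / 2 /\ rdist b (Exp p (t *: w + v) 1) <= rho / 4).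
  by exact: filterI (filterI m1 m2) (filterI m3 m4).
have [d2 d20 hd2] := near_realP m; pose t := d2 / 2.
have t0 : 0 < t by rewrite divr_gt0.
have td : `|t - 0| < d2 by rewrite subr0 gtr0_norm // /t ltr_pdivrMr // ltr_pMr // ltr1n.
have [[f1 f2] [f3 f4]] := hd2 t td; set u := t *: w + v in f3 f4.
rewrite F1 !subr0 /GRing.scale /= (gtr0_norm t0) in f1; rewrite F2 !subr0 /GRing.scale /= (gtr0_norm t0) in f2.
have sgn (x A : R) : 0 < a x * (x * k) -> `|A - t * a x| <= `|a x| / 2 * t -> 0 < A * (t * a x).
  move=> h e; apply: slope_sign.
    by rewrite mulf_neq0 ?(gt_eqF t0) //; apply: contraTneq h => ->; rewrite mul0r ltxx.
  by apply: le_trans e _; rewrite normrM (gtr0_norm t0) -[leRHS]mulrA [leLHS]mulrC.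
have g1 := sgn _ _ s1 f1; have g2 := sgn _ _ s2 f2.
have pu : 0 <= pnorm p u by exact: nrm_ge0.
have ur : pnorm p u <= r := below_mid f3 vr.
have near_b (h : R) : - h1 <= h <= h1 -> exists2 y, pnorm b y < rho & Exp b y 1 = q t h.
  move=> hh; have hn : `|h| <= h1 by rewrite ler_norml.
  have e1 := rdist_Exp mc p u 1 (h + 1); rewrite addrK in e1.
  have e2 : pnorm p u * `|h| <= r * h1 by rewrite ler_pM.
  have e3 := rdist_triangle b (Exp p u 1) (Exp p u (h + 1)).
  have e4 : rdist b (q t h) < rho.
    apply: le_lt_trans e3 _; apply: (@le_lt_trans _ _ (rho / 4 + rho / 2)); last exact: quarter_half.
    by rewrite lerD //; apply: le_trans e1 _; apply: le_trans e2 _; rewrite mulrC.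
  have [y [y1 y2]] := normal_inside nr (lt_le_trans e4 rho1).
  by exists y => //; rewrite y1.
have cF (h : R) : - h1 <= h <= h1 -> {for h, continuous (F t)}.
  move=> /near_b [y yr yE]; have yb : pnorm b y < rb := lt_le_trans yr rho1.
  have jq : dom j (q t h) by rewrite -yE; case: nr => _ /(_ y yb) [].
  have [gu _ _] := ExpP mc p u.
  have E : q t = (fun x => Exp p u (1 * x + 1)) by apply/funext => x; rewrite mul1r.
  have rc : curve_regular (q t) h by rewrite E; exact: geodesic_regular (geodesic_affine 1 1 gu).
  have dq := regular_derive rc jq.
  have dgq : differentiable g ((chart j \o q t) h).
    by rewrite /= -yE; apply: smooth_differentiable gS _; exists y.
  exact: is_derive_continuous (is_derive_cross V (is_derive_comp dq dgq)).
have h1h : - h1 <= h1 by rewrite (le_trans _ (ltW h10)) // oppr_le0 ltW.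
(* At this time the varied geodesic has no component off the direction [V] in the logarithm at [b]:
   it is on the central geodesic. *)
have [|h2 h2b Fh2] := @real_ivt R (F t) (- h1) h1 0 h1h cF.
  by case: (opposite_signs t0 h10 g1 g2 s1 s2) => ->; rewrite ?orbT.
have [y yr yE] := near_b h2 h2b; have yb : pnorm b y < rb := lt_le_trans yr rho1.
move: Fh2; rewrite /F -yE gE // => /(cross_eq0 end_velocity_neq0) [l yl].
have lr : `|l| * pnorm p v < r - pnorm p v by rewrite -{1}end_pnorm -pnormZ -yl; exact: lt_le_trans yr rho2.
have h2n : `|h2| <= h1 by rewrite ler_norml.
have h1r' : h1 * r <= (r - pnorm p v) / 2 by exact: le_half_trans h1r rho2.
have i1 : pnorm p ((h2 + 1) *: u) < r.
  rewrite pnormZ; apply: le_lt_trans (stretch_lt pu f3 vr (ltW h10) h1r').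
  by rewrite ler_wpM2r //; apply: le_trans (ler_normD _ _) _; rewrite normr1 addrC lerD2l.
have i2 : pnorm p ((l + 1) *: v) < r.
  rewrite pnormZ; apply: (@le_lt_trans _ _ (`|l| * pnorm p v + pnorm p v)); last by rewrite -ltrBrDr.
  by rewrite -[X in _ <= _ + X]mul1r -mulrDl ler_wpM2r //; apply: le_trans (ler_normD _ _) _; rewrite normr1.
have e : Exp p ((h2 + 1) *: u) 1 = Exp p ((l + 1) *: v) 1.
  rewrite !Exp_scale !mulr1 -/(q t h2) -yE yl Exp_scale mulr1; exact/esym/continue_at_b.
have h11 : h1 < 1.
  by rewrite -(ltr_pM2r r0) mul1r; apply: le_lt_trans h1r' _; exact: half_diff_lt.
have c0 : h2 + 1 != 0 by case/andP: h2b => x1 _; exact: add1_neq0 x1 h11.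
have wE := solve_parallel (lt0r_neq0 t0) c0 (inj i1 i2 e); set mu := (X in X *: v) in wE.
(* A radial variation moves the end point by a multiple of [V], so it is conjugate only if it is
   zero. *)
have eE : row_mx 0 w = mu *: row_mx 0 v :> 'rV[R]_(2+2) by rewrite wE scale_row_mx scaler0.
move: eta0; rewrite /eta eE (derive_dirZ _ _ (flow_start_differentiable jb)) (flow_derive_scale jb) scale_row_mx row_mxKl.
move/eqP; rewrite scaler_eq0 (negbTE end_velocity_neq0) orbF => /eqP m0.
by move/eqP: w0; apply; rewrite wE m0 scale0r.
Qed.
End Crossing.

(** * From injectivity to a diffeomorphism of the open ball *)

Section InjectivityRadius.
Variables (p : M) (r : R).
Hypothesis inj : forall u u', pnorm p u < r -> pnorm p u' < r -> Exp p u 1 = Exp p u' 1 -> u = u'.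

Lemma exp_derive_injective v w : pnorm p v < r ->
  'D_w (fun u => chart (chart_at (Exp p v 1)) (Exp p u 1)) v = 0 -> w = 0.
Proof.
move=> vr; case: (eqVneq v 0) => [->|v0] Dw.
  rewrite Exp0 in Dw; have [rp [g [rp0 gE [oW gS] ES _]]] := normal_radius_exists mc p.
  have B0 : pnorm p 0 < rp by have := pnormZ p 0 v; rewrite scale0r normr0 mul0r => ->.
  apply: (left_inverse_injective (smooth_differentiable ES B0) _ _ Dw).
    by apply: (smooth_differentiable gS); exists 0.
  by apply: filterS (open_nbhs_nbhs (conj (@pnorm_open _ _ p rp) B0)) => u /gE [].
apply/eqP; apply: contraT => w0; exfalso.
have [rb [g nr]] := normal_radius_exists mc (Exp p v 1).
rewrite (exp_chart_derive (chart_atP _)) in Dw.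
exact: (crossing_contradiction inj vr v0 Dw w0 nr).
Qed.

Lemma exp_chart_derive_injective i v w : pnorm p v < r -> dom i (Exp p v 1) ->
  'D_w (fun u => chart i (Exp p u 1)) v = 0 -> w = 0.
Proof.
move=> vr iv Dw; have jv : dom (chart_at (Exp p v 1)) (Exp p v 1) := chart_atP _.
apply: (exp_derive_injective vr); set j := chart_at _ in jv *.
have [N [oN Nv ND NS]] := exp_chart_smooth iv; have [N' [oN' Nv' ND' NS']] := exp_chart_smooth jv.
have l1 := is_derive_line w (smooth_differentiable NS Nv); rewrite Dw in l1.
have dT : differentiable (transition i j) (chart i (Exp p (0 *: w + v) 1)).
  by rewrite scale0r add0r; exact: transition_differentiable.
have l2 := is_derive_comp l1 dT; rewrite derive0 in l2.
have l3 := is_derive_line w (smooth_differentiable NS' Nv').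
apply: is_derive_unique l3 _; apply: is_derive_near l2.
by apply: filterS (near_line w (open_nbhs_nbhs (conj oN Nv))) => t /ND it; rewrite /= transitionE.
Qed.

Let B := [set v | pnorm p v < r].
Let oB : open B. Proof. exact: pnorm_open. Qed.
Let cE v : {for v, continuous (fun u => Exp p u 1)}. Proof. exact: exp_continuous (chart_atP _). Qed.

Lemma exp_smooth_to : smooth_to B (fun u => Exp p u 1).
Proof.
split=> // i n; apply: Ck_local => v [Bv iv].
by have [N [oN Nv ND NS]] := exp_chart_smooth iv; exists N; split=> //; exact: NS.
Qed.

Definition exp_inverse (y : M) : 'rV[R]_2 := xget 0 [set v | B v /\ Exp p v 1 = y].

Lemma exp_inverseK v : B v -> exp_inverse (Exp p v 1) = v.
Proof. by move=> Bv; apply: xget_unique => // u [Bu e]; exact: inj. Qed.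

(** The inverse function theorem is applied chart by chart; the single global inverse [exp_inverse]
    serves as left inverse in each of them. *)
Lemma exp_inverse_chart i : let W := chart i @` (dom i `&` (fun u => Exp p u 1) @` B) in
  open W /\ smooth W (exp_inverse \o param i).
Proof.
move=> W; have oA : open (B `&` (fun u => Exp p u 1) @^-1` dom i).
  by apply: open_preimage_on => //; exact: dom_open.
set A := _ `&` _ in oA.
have kS : smooth A (fun u => chart i (Exp p u 1)) := exp_smooth_to.2 i.
have DI v w : A v -> 'D_w (fun u => chart i (Exp p u 1)) v = 0 -> w = 0.
  by move=> [Bv iv]; exact: exp_chart_derive_injective.
have G v : A v -> (exp_inverse \o param i) (chart i (Exp p v 1)) = v.
  by move=> [Bv iv]; rewrite /= chartK // exp_inverseK.
have -> : W = (fun u => chart i (Exp p u 1)) @` A.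
  apply/seteqP; split=> [_ [y [iy [v Bv vE]] <-]|_ [v [Bv iv] <-]].
    by exists v; [split=> //; rewrite /= vE|rewrite vE].
  by exists (Exp p v 1) => //; split=> //; exists v.
exact: inverse_function_smooth oA kS DI G.
Qed.

Lemma exp_image_open : open ((fun u => Exp p u 1) @` B).
Proof.
rewrite openE => q Bq; set i := chart_at q; have iq : dom i q := chart_atP q.
have [oW _] := exp_inverse_chart i.
have oP := open_preimage_on (@dom_open _ M i) (fun x ix => @chart_continuous _ M i x ix) oW.
apply: filterS (open_nbhs_nbhs (conj oP _)); last by split=> //; exists q.
by move=> y [iy [z [iz Bz] zE]]; rewrite -(chartK iy) -zE chartK.
Qed.

Lemma exp_diffeo : diffeo_onto_image B (fun u => Exp p u 1).
Proof.
split; [exact: oB|exact: exp_smooth_to|exact: exp_image_open|].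
by exists exp_inverse; split=> [v|i]; [exact: exp_inverseK|exact: (exp_inverse_chart i).2].
Qed.
End InjectivityRadius.

(** * Minimizing diameters bound the injectivity radius from below *)

Section OppositePoints.
Variables (p : M) (r : R).
Hypothesis r0 : 0 < r.
Hypothesis opp : forall v, pnorm p v = 1 -> rdist (Exp p v (- r)) (Exp p v r) = 2 * r.

(** A subsegment of a minimizing segment is minimizing: any shorter distance would shorten the
    diameter. *)
Lemma opposite_radial v t : pnorm p v = 1 -> 0 <= t <= r -> rdist p (Exp p v t) = t.
Proof.
move=> v1 /andP[t0 tr]; have [cg e0 _] := ExpP mc p v.
have b1 := rdist_Exp mc p v (- r) 0; have b2 := rdist_Exp mc p v 0 t; have b3 := rdist_Exp mc p v t r.
have t1 := rdist_triangle (Exp p v (- r)) (Exp p v 0) (Exp p v r).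
have t2 := rdist_triangle (Exp p v 0) (Exp p v t) (Exp p v r).
rewrite v1 !mul1r e0 sub0r opprK (gtr0_norm r0) in b1; rewrite v1 mul1r subr0 e0 (ger0_norm t0) in b2.
rewrite v1 mul1r ger0_norm ?subr_ge0 // in b3; rewrite (opp v1) e0 in t1; rewrite e0 in t2.
by apply/eqP; rewrite eq_le b2 /=; exact: (radial_arith b1 b3 t1 t2).
Qed.

(** Equal images give equal norms [l], as the norm is the distance to [p]. Following one radius up
    to [l] and the other from [l] to [r] is minimizing, so it has no corner and both radii coincide;
    this requires [l < r]. *)
Lemma opposite_exp_injective u u' : pnorm p u < r -> pnorm p u' < r -> Exp p u 1 = Exp p u' 1 -> u = u'.
Proof.
have radial x : pnorm p x < r -> rdist p (Exp p x 1) = pnorm p x.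
  move=> xr; have x0 : 0 <= pnorm p x by exact: nrm_ge0.
  case: (eqVneq (pnorm p x) 0) => [e|xn]; first by rewrite e (pnorm_eq0 e) Exp0 rdistxx.
  have h1 : pnorm p ((pnorm p x)^-1 *: x) = 1 by rewrite pnormZ ger0_norm ?invr_ge0 // mulVf.
  have h2 : Exp p x 1 = Exp p ((pnorm p x)^-1 *: x) (pnorm p x) by rewrite Exp_scale mulVf.
  by rewrite h2 opposite_radial // x0 ltW.
move=> ur ur' e; have en : pnorm p u' = pnorm p u by rewrite -(radial _ ur) -(radial _ ur') e.
case: (eqVneq (pnorm p u) 0) => [z|un].
  by rewrite (pnorm_eq0 z); apply/esym/(@pnorm_eq0 _ _ p); rewrite en.
set l := pnorm p u in en un; have l0 : 0 < l by rewrite lt_neqAle eq_sym un; exact: nrm_ge0.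
have [g1 z1 v1] := ExpP mc p (l^-1 *: u'); have [g2 z2 v2] := ExpP mc p (l^-1 *: u).
have n1 : pnorm p (l^-1 *: u') = 1 by rewrite pnormZ en ger0_norm ?invr_ge0 ?(ltW l0) // mulVf.
have n2 : pnorm p (l^-1 *: u) = 1 by rewrite pnormZ ger0_norm ?invr_ge0 ?(ltW l0) // mulVf.
have meet : Exp p (l^-1 *: u') l = Exp p (l^-1 *: u) l by rewrite !Exp_scale mulVf // e.
have s1 : speed (Exp p (l^-1 *: u')) l = 1 by rewrite Exp_speed.
have s2 : speed (Exp p (l^-1 *: u)) l = 1 by rewrite Exp_speed.
have rl : 0 < r - l by rewrite subr_gt0.
have far : l + (r - l) <= rdist (Exp p (l^-1 *: u') (l - l)) (Exp p (l^-1 *: u) (l + (r - l))).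
  by rewrite subrr z1 addrC subrK opposite_radial // (ltW r0) lexx.
have H := no_corner g1 g2 meet s1 s2 l0 rl far.
have ce : Exp p (l^-1 *: u') = Exp p (l^-1 *: u).
  by apply/funext => s; have := H (s - l); rewrite addrC subrK.
have := v1; rewrite ce v2 => /(congr1 (fun x => l *: x)); rewrite !scalerA mulfV // !scale1r.
by move.
Qed.

Theorem injectivity_radius_ge : (r%:E <= injectivity_radius p)%E.
Proof.
apply: ereal_sup_ubound; exists r => //; split=> //.
have -> : exp_map p = (fun u => Exp p u 1) by apply/funext => u; exact: exp_mapE.
exact: exp_diffeo opposite_exp_injective.
Qed.
End OppositePoints.
End FlowDerivative.

(** * Lengths of arcs and a sweepout *)

Lemma fine_le_fin (R : realType) (x : \bar R) (r : R) : (0%:E <= x)%E -> (x <= r%:E)%E -> fine x <= r.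
Proof. by case: x => [x| |] //=; rewrite ?lee_fin. Qed.

Lemma constant_sign (R : realType) (J : R -> R) : (forall t : R, {for t, continuous J}) ->
  (forall t : R, 0 <= t <= 1 -> J t != 0) -> exists sg : R, (sg = 1 \/ sg = -1) /\ forall t : R, 0 <= t <= 1 -> `|J t| = sg * J t.
Proof.
move=> cJ nz; have z01 : 0 <= (0 : R) <= 1 by rewrite lexx ler01.
case: (ltP 0 (J 0)) => J0.
  exists 1; split=> [|t t01]; first by left.
  rewrite mul1r ger0_norm //; rewrite leNgt; apply/negP => Jt; have /andP[t0 t1] := t01.
  have [|y /andP[y0 yt] Jy] := @real_ivt R J 0 t 0 t0 (fun y _ => cJ y); first by rewrite (ltW Jt) (ltW J0) orbT.
  by have := nz y; rewrite y0 (le_trans yt t1) Jy eqxx => /(_ isT).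
exists (-1); split=> [|t t01]; first by right.
rewrite mulN1r ler0_norm //; rewrite leNgt; apply/negP => Jt; have /andP[t0 t1] := t01.
have [|y /andP[y0 yt] Jy] := @real_ivt R J 0 t 0 t0 (fun y _ => cJ y); first by rewrite J0 (ltW Jt).
by have := nz y; rewrite y0 (le_trans yt t1) Jy eqxx => /(_ isT).
Qed.

Lemma double_half (R : realType) (x : R) : 2^-1 <= x -> 1 <= 2 * x.
Proof. by move=> h; lra. Qed.

Lemma int01 (m : int) : 0 <= m -> m <= 1 -> m = 0 \/ m = 1.
Proof. by move=> m0 m1; lia. Qed.

Lemma int_le1 (R : realType) (k : int) : 0 <= (k%:~R : R) -> (k = 0 \/ k = 1) \/ 1 < (k%:~R : R).
Proof.
rewrite ler0z => k0; case: (ltP 1 k) => k1; first by right; rewrite -[1]/(1%:~R) ltr_int.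
by left; lia.
Qed.

(** * Arbitrary parametrizations of the boundary circle *)

Section CircleLift.
Variables (R : realType) (M : riemannian_surface R).
Variables (Om : set M) (U : set 'rV[R]_2) (f : 'rV[R]_2 -> M) (h : M -> 'rV[R]_2).
Hypothesis dc : disc_chart Om U f h.
Notation mu := (@lebesgue_measure R).
Notation c0 := (c0 f).

Section Lift.
Variable c : R -> M.
Hypothesis cc : circle_param (bdry Om) c.

Let cS : smooth_to ([set: R] : set R^o) c. Proof. by case: cc. Qed.
Let cb t : bdry Om (c t). Proof. by case: cc => _ _ _ <-; exists t. Qed.
Let w t := h (c t).
Let dw t : 'rV[R]_2 := 'D_1 (w : R^o -> 'rV[R]_2) t.

Let wS t : exists N : set R^o, [/\ open N, N t & smooth N (w : R^o -> 'rV[R]_2)].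
Proof.
apply: (h_curve_smooth dc cS); have [h1 Uh fh] := disc_inv dc (bdry_Om dc (cb t)).
by exists (h (c t)).
Qed.

Let d_w (t : R) : is_derive t (1 : R) w (dw t).
Proof.
have [N [oN Nt wN]] := wS t; apply: DeriveDef => //.
by have := smooth_differentiable wN Nt => /derivable1_diffP.
Qed.

Let c_dw (t : R) : {for t, continuous dw}.
Proof. by have [N [oN Nt wN]] := wS t; exact: (wN 1%N).2 1 t Nt. Qed.

(** The time interval exceeds [[0, 1]] on both sides, so that on [[0, 1]] the relation with [c0]
    holds in a neighbourhood and can be differentiated. *)
Lemma circle_param_lift : exists phi J : R -> R, (forall t, {for t, continuous J}) /\
  forall t : R, -1 <= t <= 2 -> is_derive t (1 : R) phi (J t) /\ c t = c0 (phi t).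
Proof.
have p0 : 0 < 2 * pi :> R by rewrite mulr_gt0 // pi_gt0.
have comp (k : 'I_2) (t : R) : is_derive t (1 : R) (fun t => w (1 * t + -1) 0 k) (dw (1 * t + -1) 0 k).
  have d := is_derive_affine (d_w (1 * t + -1)); rewrite scale1r in d.
  by move/is_derive_mxP: d => /(_ 0 k).
have ccomp (k : 'I_2) (t : R) : {for t, continuous (fun t : R => dw (1 * t + -1) 0 k : R^o)}.
  have ca : {for t, continuous (fun t : R => 1 * t + -1 : R)}.
    apply: (@continuousD _ R^o); last exact: cst_continuous.
    by apply: (@continuousM R _); [exact: cst_continuous|exact: id].
  have c1 := continuous_comp ca (@c_dw (1 * t + -1)).
  exact: (continuous_comp c1 (@coord_continuous _ _ _ 0 k _)).
have w1 t : (w (1 * t + -1) 0 0) ^+ 2 + (w (1 * t + -1) 0 1) ^+ 2 = 1.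
  exact: (bdry_esq dc (bdry_Om dc (cb _))).1.
have T3 : 0 <= 3 :> R by [].
(* [circle_lift] works on an interval starting at 0; the shift of time by -1 and the length 3 yield
   the interval from -1 to 2. *)
have [th H] := circle_lift T3 (comp 0) (comp 1) (ccomp 0) (ccomp 1) w1.
pose J t := (2 * pi)^-1 * (w t 0 0 * dw t 0 1 - w t 0 1 * dw t 0 0).
exists (fun t => (2 * pi)^-1 * th (1 * t + 1)), J; split=> t.
  have cw k : {for t, continuous (fun t : R => w t 0 k : R^o)}.
    exact: (continuous_comp (is_derive_continuous (d_w t)) (@coord_continuous _ _ _ 0 k _)).
  have cdw k : {for t, continuous (fun t : R => dw t 0 k : R^o)}.
    exact: (continuous_comp (@c_dw t) (@coord_continuous _ _ _ 0 k _)).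
  apply: (@continuousM R _); first exact: cst_continuous.
  by apply: (@continuousB _ R^o); apply: (@continuousM R _).
move=> /andP[t1 t2]; have t3 : 0 <= 1 * t + 1 <= 3 by apply/andP; split; lra.
have e : 1 * (1 * t + 1) + -1 = t by ring.
have [d ec es] := H _ t3; rewrite e in d ec es; split.
  have d1 := is_derive_affine d; rewrite scale1r in d1.
  have d2 := is_deriveZ (2 * pi)^-1 d1.
  by apply: (is_derive_congr d2).
have [_ _ <-] := disc_inv dc (bdry_Om dc (cb t)); congr f; rewrite -/(w t).
have eT : 2 * pi * ((2 * pi)^-1 * th (1 * t + 1)) = th (1 * t + 1) by rewrite mulrA mulfV ?gt_eqF // [LHS]mul1r.
apply/rowP => k; have [->|->] : k = 0 \/ k = 1 by case: k => [[|[|//]] ?]; [left|right]; exact/val_inj.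
  by rewrite mxE eT /= -ec.
by rewrite mxE eT /= -es.
Qed.

Section Speed.
Variables (phi J : R -> R).
Hypothesis cJ : forall t, {for t, continuous J}.
Hypothesis lift : forall t : R, -1 <= t <= 2 -> is_derive t (1 : R) phi (J t) /\ c t = c0 (phi t).

Lemma in_lift (t : R) : 0 <= t <= 1 -> -1 <= t <= 2.
Proof. by move=> /andP[t0 t1]; apply/andP; split; lra. Qed.

Lemma lift_speed t : 0 <= t <= 1 -> speed c t = `|J t| * speed c0 (phi t).
Proof.
move=> t01; have [dp ce] := lift (in_lift t01).
have rc := smooth_to_regular cS (I : [set: R] t).
have r0 := smooth_to_regular (c0_smooth dc) (I : [set: R] (phi t)).
set i := chart_at (c t); have ic : dom i (c t) := chart_atP _.
have ic0 : dom i (c0 (phi t)) by rewrite -ce.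
have dF : differentiable (chart i \o c0) (phi t).
  by apply/derivable1_diffP; have := regular_derive r0 ic0; case.
have d := is_derive_comp dp dF.
have nE : \forall s \near t, ((chart i \o c0) \o phi) s = (chart i \o c) s.
  apply: (near_realP' ltr01) => s; rewrite ltr_norml => /andP[s1 s2].
  have sI : -1 <= s <= 2 by case/andP: t01 => t0 t1; apply/andP; split; lra.
  by have [_ e] := lift sI; rewrite /= e.
have v1 := is_derive_unique (regular_derive rc ic) (is_derive_near nE d).
have v2 : 'D_(J t) (chart i \o c0) (phi t) = J t *: vel i c0 (phi t).
  have e1 : J t *: (1 : R^o) = J t by rewrite /GRing.scale /= mulr1.
  have [_ e2] := regular_derive r0 ic0.
  have e3 : 'D_(J t *: (1 : R^o)) (chart i \o c0) (phi t) = J t *: 'D_1 (chart i \o c0) (phi t) := derive_dirZ (J t) (1 : R^o) dF.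
  by rewrite e2 e1 in e3.
rewrite (speedE rc ic) (speedE r0 ic0) v1 v2 -ce; exact: nrmZ.
Qed.

Lemma lift_slope_neq0 t : 0 <= t <= 1 -> J t != 0.
Proof.
move=> t01; case: cc => _ /(_ t) s0 _ _; move: s0; rewrite lift_speed //.
by apply: contraNneq => ->; rewrite normr0 mul0r.
Qed.

(** Over one period the lift advances by an integer in the direction of its sign [sg], and by at
    most one turn because [c] is injective modulo its period. Zero turns are allowed for by
    [0 <= b]. *)
Lemma lift_jump sg (B : R -> R) (b : R) : (forall t : R, 0 <= t <= 1 -> `|J t| = sg * J t) -> (sg = 1 \/ sg = -1) ->
  (forall x : R, (x = phi 0 \/ x = phi 1) -> B (x + 1) - B x <= b) -> 0 <= b -> sg * (B (phi 1) - B (phi 0)) <= b.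
Proof.
move=> Jp sgE HB b0.
have cph (t : R) : 0 <= t <= 1 -> {for t, continuous phi}.
  by move=> t01; have [d _] := lift (in_lift t01); exact: is_derive_continuous d.
have z0 : 0 <= (0 : R) <= 1 by rewrite lexx ler01.
have z1 : 0 <= (1 : R) <= 1 by rewrite lexx ler01.
have [_ e0] := lift (in_lift z0); have [_ e1] := lift (in_lift z1).
case: (cc) => _ _ inj _; case: (c0_circle dc) => _ _ inj0 _.
have ec : c 1 = c 0 by apply/inj; exists 1; rewrite subr0.
have [k kE] := (inj0 (phi 1) (phi 0)).1 (etrans (esym e1) (etrans ec e0)).
have inc : 0 <= sg * (phi 1 - phi 0).
  have dsp (t : R) : 0 <= t <= 1 -> is_derive t (1 : R) (fun t => sg *: (phi t : R^o)) (sg *: (J t : R^o)).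
    by move=> t01; have [d _] := lift (in_lift t01); exact: is_deriveZ.
  have := @derive_le R (cst 0) (cst 0) (fun t => sg *: (phi t : R^o)) (fun t => sg *: (J t : R^o)) 0 1 ler01
    (fun t _ => is_derive_cst _ _ _) dsp.
  rewrite /cst subrr /GRing.scale /= -mulrBr; apply=> t /andP[t0 t1].
  by rewrite -Jp ?normr_ge0 // (ltW t0) (ltW t1).
(* A lift going strictly beyond one turn would bring [c] back to [c 0] at a time strictly between 0
   and 1. *)
have noint (v : R) : `|v - phi 0| = 1 -> (phi 0 < v < phi 1) || (phi 1 < v < phi 0) -> False.
  move=> v1 vb; have [|t /andP[t0 t1] tv] := @real_ivt R phi 0 1 v ler01 cph.
    by case/orP: vb => /andP[/ltW -> /ltW ->]; rewrite ?orbT.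
  have t01 : 0 <= t <= 1 by rewrite t0.
  have [_ et] := lift (in_lift t01).
  have [n nE] : exists n : int, v - phi 0 = n%:~R.
    have [hv|hv] : v - phi 0 = 1 \/ v - phi 0 = -1.
      by move: v1; case: (ltP 0 (v - phi 0)) => hv; [rewrite gtr0_norm //|rewrite ler0_norm //] => e; [left|right; lra].
      by exists 1.
    by exists (-1); rewrite hv.
  have ct : c t = c 0 by rewrite et e0 tv; apply/inj0; exists n.
  have [m mE] := (inj t 0).1 ct; rewrite subr0 in mE.
  have m01 : (m = 0 \/ m = 1) by move: t0 t1; rewrite mE ler0z -[1]/(1%:~R) ler_int; exact: int01.
  case: m01 => m0.
    have tz : t = 0 by rewrite mE m0.
    by move: vb; rewrite -tv tz ltxx /= andbF.
  have tz : t = 1 by rewrite mE m0.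
  by move: vb; rewrite -tv tz ltxx /= andbF.
case: sgE => sgE; rewrite sgE in inc; rewrite sgE.
  rewrite mul1r kE in inc; rewrite mul1r.
  case: (int_le1 inc) => [[k0|k1]|k1].
  - have e : phi 1 = phi 0 by apply/eqP; rewrite -subr_eq0 kE k0.
    by rewrite e subrr.
  - have -> : phi 1 = phi 0 + 1 by rewrite -(subrK (phi 0) (phi 1)) kE k1 addrC.
    by apply: HB; left.
  exfalso; apply: (noint (phi 0 + 1)); first by rewrite addrC addKr normr1.
  by apply/orP; left; rewrite -kE in k1; apply/andP; split; lra.
have kE' : phi 0 - phi 1 = (- k)%:~R by rewrite intrN -kE opprB.
rewrite mulN1r opprB kE' in inc; rewrite mulN1r opprB.
case: (int_le1 inc) => [[k0|k1]|k1].
- have e : phi 0 = phi 1 by apply/eqP; rewrite -subr_eq0 kE' k0.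
  by rewrite e subrr.
- have -> : phi 0 = phi 1 + 1 by rewrite -(subrK (phi 1) (phi 0)) kE' k1 addrC.
  by apply: HB; right.
exfalso; apply: (noint (phi 0 - 1)); first by rewrite addrC addKr normrN normr1.
by apply/orP; right; rewrite -kE' in k1; apply/andP; split; lra.
Qed.

Variables (m de K : R).
Hypothesis de0 : 0 < de.
Hypothesis de1 : de < 2^-1.
Hypothesis K0 : 0 < K.
Hypothesis sK : forall t, speed c0 t <= K.
Variable A : set M.
Hypothesis mA : measurable (c @^-1` A).
Hypothesis bA : forall t : R, A (c0 t) -> (2^-1 <= bump m de t :> R)%R.

(* On the arc the bump is at least 1/2, so the length is bounded by a multiple of the integral of the bump along the
   lifted angle, whatever the parametrization. *)
Lemma lift_length : (\int[mu]_(t in `[0%R, 1%R[ `&` c @^-1` A) speed c t)%R <= 4 * K * de.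
Proof.
have [sg [sgE Jp]] := constant_sign cJ lift_slope_neq0.
have cph (t : R) : -1 <= t <= 2 -> {for t, continuous phi}.
  by move=> tI; have [d _] := lift tI; exact: is_derive_continuous d.
(* The primitive of the bump is needed on a window containing the lift, one further period on each
   side, and the periods around [m] used in [bump_period]. *)
have [N mN phN] : exists2 N : R, `|m| + 3 <= N & forall t : R, 0 <= t <= 1 -> `|phi t| + 1 < N.
  have ca (t : R) : 0 <= t <= 1 -> {for t, continuous (fun t => `|phi t|)}.
    by move=> t01; apply: (continuous_comp (cph t (in_lift t01))); exact: norm_continuous.
  have [t1 _ H] := EVT_max ler01 (within_continuous ca).
  exists (`|m| + 3 + `|phi t1|) => [|t t01]; first by rewrite lerDl.
  have h1 : `|phi t| <= `|phi t1| by apply: H; rewrite in_itv.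
  have := normr_ge0 m; lra.
have N0 : 0 < N by have := normr_ge0 m; lra.
have NN : - N - 1 < N + 1 by lra.
have [B dB'] := primitive_exists NN (fun t _ => @bump_continuous R m de t).
have dB (t : R) : - N < t < N -> is_derive t (1 : R) B (bump m de t).
  by move=> /andP[t1 t2]; apply: dB'; apply/andP; split; lra.
have J1 : sg * (B (phi 1) - B (phi 0)) <= 2 * de.
  apply: (@lift_jump sg B (2 * de) Jp sgE); last by rewrite mulr_ge0 // ltW.
  move=> x xE; have xN : `|x| + 1 < N by case: xE => ->; apply: phN; rewrite lexx ler01.
  have n1 := ler_norm x; have n2 := ler_norm (- x); rewrite normrN in n2.
  by apply: (bump_period de0 de1 mN dB); lra.
pose G t := (2 * K * sg) *: (B (phi t) : R^o).
pose g t := 2 * K * (sg * J t) * bump m de (phi t).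
have phI (t : R) : 0 <= t <= 1 -> - N < phi t < N.
  by move=> t01; have := phN t t01; move=> hN; rewrite -ltr_norml; lra.
have dG (t : R) : 0 <= t <= 1 -> is_derive t (1 : R) G (g t).
  move=> t01; have [dp _] := lift (in_lift t01).
  have d1 := @is_derive1_comp R B phi t _ _ (dB _ (phI t t01)) dp.
  have d2 := is_deriveZ (2 * K * sg) d1.
  by apply: (is_derive_congr d2) => //; rewrite /g /GRing.scale /=; ring.
have g0 (t : R) : 0 <= t <= 1 -> 0 <= g t.
  by move=> t01; rewrite /g -Jp // mulr_ge0 ?bump_ge0 // mulr_ge0 // mulr_ge0 // ltW.
have cg (t : R) : 0 <= t <= 1 -> {for t, continuous g}.
  move=> t01; have cb' := continuous_comp (cph t (in_lift t01)) (@bump_continuous R m de (phi t)).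
  apply: (@continuousM R _) cb'; apply: (@continuousM R _); first exact: cst_continuous.
  by apply: (@continuousM R _); [exact: cst_continuous|exact: cJ].
have wg := within_continuous cg.
set D := `[0%R, 1%R[ `&` c @^-1` A.
have mD : measurable D by apply: measurableI.
have mI : measurable (`[0%R, 1%R] : set R) by [].
have DI : D `<=` `[0%R, 1%R] by move=> t [/=]; rewrite !in_itv /= => /andP[-> /ltW ->].
have mg : measurable_fun (`[0%R, 1%R] : set R) (EFin \o g).
  by apply/measurable_EFinP; apply: subspace_continuous_measurable_fun.
have ms : measurable_fun [set: R] (EFin \o speed c).
  apply/measurable_EFinP; apply: continuous_measurable_fun => t.
  exact: (speed_continuous openT cS I).
have gI : (\int[mu]_(t in `[0%R, 1%R]) (g t)%:E = (G 1)%:E - (G 0)%:E)%E.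
  apply: continuous_FTC2 => //.
    split=> [t|/=|/=].
    - rewrite in_itv /= => /andP[t0 t1]; have [|+ _] := dG t; first by rewrite (ltW t0) (ltW t1).
      by [].
    - by apply: cvg_at_right_filter; apply: (is_derive_continuous (dG 0 _)); rewrite lexx ler01.
    by apply: cvg_at_left_filter; apply: (is_derive_continuous (dG 1 _)); rewrite lexx ler01.
  move=> t; rewrite in_itv /= => /andP[t0 t1]; rewrite derive1E.
  by have [|_ ->] := dG t; first by rewrite (ltW t0) (ltW t1).
have le1 : (\int[mu]_(t in D) (speed c t)%:E <= \int[mu]_(t in D) (g t)%:E)%E.
  apply: ge0_le_integral => //.
  - by move=> t _; rewrite lee_fin speed_ge0.
  - exact: measurable_funTS.
  - exact: measurable_funS mI DI mg.
  move=> t Dt; have := DI t Dt; rewrite /= in_itv /= => t01; case: Dt => _ At.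
  have [_ ce] := lift (in_lift t01); rewrite /= ce in At.
  rewrite lee_fin lift_speed // Jp // /g.
  have b1 := bA At; have s1 := sK (phi t); have j1 : 0 <= sg * J t by rewrite -Jp.
  have h1 : (sg * J t) * speed c0 (phi t) <= (sg * J t) * K by rewrite ler_wpM2l.
  have h2 : (sg * J t * K) * 1 <= (sg * J t * K) * (2 * bump m de (phi t)).
    by apply: ler_wpM2l; [exact: mulr_ge0 j1 (ltW K0)|exact: double_half b1].
  have -> : 2 * K * (sg * J t) * bump m de (phi t) = (sg * J t * K) * (2 * bump m de (phi t)) by ring.
  by rewrite mulr1 in h2; exact: le_trans h1 h2.
have le2 : (\int[mu]_(t in D) (g t)%:E <= \int[mu]_(t in `[0%R, 1%R]) (g t)%:E)%E.
  by apply: ge0_subset_integral => // t; rewrite /= in_itv /= => t01; rewrite lee_fin g0.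
rewrite /Rintegral; apply: fine_le_fin.
  by apply: integral_ge0 => t _; rewrite lee_fin speed_ge0.
apply: le_trans le1 _; apply: le_trans le2 _; rewrite gI -EFinB lee_fin /G /GRing.scale /=.
have -> : 2 * K * sg * B (phi 1) - 2 * K * sg * B (phi 0) = 2 * K * (sg * (B (phi 1) - B (phi 0))) by ring.
have -> : 4 * K * de = 2 * K * (2 * de) by ring.
by apply: ler_wpM2l; [rewrite mulr_ge0 // ltW|exact: J1].
Qed.
End Speed.
End Lift.

Lemma circle_arc_measurable c a b : circle_param (bdry Om) c -> measurable (c @^-1` (c0 @` `[a, b])).
Proof.
case=> cS _ _ _; apply: closed_measurable; apply: closed_comp; first by move=> t _; exact: cS.1.
apply: compact_closed; first exact: surface_hausdorff.
apply: continuous_compact; last exact: segment_compact.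
by apply: within_continuous => t _; exact: (c0_smooth dc).1.
Qed.

(** [length_in] picks an unspecified parametrization, so the bound is proved for every one of them.
    The width [d] is independent of the centre [m]. *)
Lemma short_arcs (e : R) : 0 < e -> exists2 d : R, 0 < d & forall m A,
  (forall c, circle_param (bdry Om) c -> measurable (c @^-1` A)) -> A `<=` c0 @` `[m - d, m + d] ->
  length_in (bdry Om) A < e.
Proof.
move=> e0; have [K K0 sK] := speed_c0_bounded dc.
(* [1 / 4] keeps the bump within half a period; the other term makes the bound [4 * K * de] of
   [lift_length] at most [e / 2]. *)
pose de := Num.min (1 / 4) (e / (8 * K)).
have de0 : 0 < de by rewrite lt_min !divr_gt0 // mulr_gt0.
have de1 : de < 2^-1 by apply: (@le_lt_trans _ _ (1 / 4)); [rewrite ge_min lexx|lra].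
have deK : 4 * K * de < e.
  have h1 : de * (8 * K) <= e by rewrite -ler_pdivlMr ?mulr_gt0 // ge_min lexx orbT.
  have := mulr_gt0 de0 K0; nra.
have [d d0 hd] := bump_half de0 de1; exists d => // m A mA AI.
apply: le_lt_trans deK; rewrite /length_in.
set P := [set l | _]; have [c cc ->] : P (get P).
  by apply: getPex; exists (\int[mu]_(t in `[0%R, 1%R[ `&` c0 @^-1` A) speed c0 t)%R; exists c0 => //; exact: (c0_circle dc).
have [phi [J [cJ lift]]] := circle_param_lift cc.
apply: (lift_length cc cJ lift de0 de1 K0 sK (mA c cc) (m := m)) => t At.
have [x xI xE] := AI _ At; case: (c0_circle dc) => _ _ inj0 _.
have [k kE] := (inj0 t x).1 (esym xE).
have -> : t = x + k%:~R by rewrite -kE addrC subrK.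
rewrite bump_int; apply: hd; move: xI; rewrite /= in_itv /= => /andP[x1 x2].
by rewrite ler_norml; apply/andP; split; lra.
Qed.

Section Sweep.
Variable ta : R.

Lemma arc_difference_small (t e : R) : 0 < e -> exists2 d : R, 0 < d & forall s : R, `|s - t| < d ->
  length_in (bdry Om) ((c0 @` `[ta, ta + s] `\` c0 @` `[ta, ta + t]) `|` (c0 @` `[ta, ta + t] `\` c0 @` `[ta, ta + s])) < e.
Proof.
move=> /short_arcs [d d0 hd]; exists d => // s; rewrite ltr_norml => /andP[s1 s2].
apply: (hd (ta + t)).
  by move=> c cc; apply: measurableU; apply: measurableD; exact: circle_arc_measurable.
move=> _ [[[u uI <-] nI]|[[u uI <-] nI]]; exists u => //; move: uI; rewrite /= !in_itv /= => /andP[u1 u2].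
  have h1 : ta + t < u by rewrite ltNge; apply/negP => u3; apply: nI; exists u => //; rewrite /= in_itv /= u1.
  by apply/andP; split; lra.
have h1 : ta + s < u by rewrite ltNge; apply/negP => u3; apply: nI; exists u => //; rewrite /= in_itv /= u1.
by apply/andP; split; lra.
Qed.

(** One end point rests at the base point while the other makes a full turn; the arcs are nested,
    and two of them differ by a short arc. *)
Lemma base_point_sweepout : sweepout (bdry Om) (fun _ => c0 ta) (fun t => c0 (ta + t)).
Proof.
have c1 : c0 (ta + 1) = c0 ta by exact: (c0_int f ta 1).
have cq (t : R) : {for t, continuous (fun t => c0 (ta + t))}.
  have ca : {for t, continuous (fun t : R => ta + t : R)}.
    by apply: (@continuousD _ R^o); [exact: cst_continuous|exact: id].
  exact: (continuous_comp ca ((c0_smooth dc).1 (ta + t) I)).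
split; first by rewrite addr0 c1.
- by apply: within_continuous => t _; exact: cst_continuous.
- by apply: within_continuous => t _; exact: cq.
exists (fun t => c0 @` `[ta, ta + t]); split.
- move=> t /andP[t0 t1]; exists c0, ta, (ta + t); split=> //; first exact: (c0_circle dc).
  by rewrite lerDl t0 lerD2l.
- move=> t _ e e0; have [d d0 hd] := arc_difference_small t e0; exists d => // s _; exact: hd.
- by rewrite addr0 set_itv1 image_set1.
apply/seteqP; split=> [_ [u _ <-]|x /(bdry_c0 dc) [u ->]]; first exact: (c0_bdry dc).
have /andP[n1 n2] := floor_itv (u - ta); set n := Num.floor _ in n1 n2.
exists (u - n%:~R); last by have := c0_int f (u - n%:~R) n; rewrite subrK => ->.
rewrite intrD in n2; rewrite /= in_itv /=; apply/andP; split; lra.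
Qed.
End Sweep.

Theorem far_point x : bdry Om x -> exists2 y, bdry Om y & width (bdry Om) <= rdist x y.
Proof.
move=> /(bdry_c0 dc) [ta ->].
have cd (t : R) : {for t, continuous (fun t => rdist (c0 ta) (c0 (ta + t)))}.
  have ca : {for t, continuous (fun t : R => ta + t : R)}.
    by apply: (@continuousD _ R^o); [exact: cst_continuous|exact: id].
  have c1 := continuous_comp ca ((c0_smooth dc).1 (ta + t) I).
  exact: (continuous_comp c1 (@rdist_continuous _ _ (c0 ta) _)).
have [t1 _ H] := EVT_max (ler01 : 0 <= 1 :> R) (within_continuous (fun t _ => cd t)).
exists (c0 (ta + t1)); first exact: (c0_bdry dc).
apply: (@le_trans _ _ (sup [set rdist (c0 ta) (c0 (ta + t)) | t in `[0, 1]])).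
  apply: ge_inf; last by exists (fun _ => c0 ta), (fun t => c0 (ta + t)); split=> //; exact: base_point_sweepout.
  (* The infimum defining [width] must be over a set bounded below. When [E] has no supremum the
     value of [sup] is 0, which is also admissible. *)
  exists 0 => _ [p [q [_ ->]]]; set E := [set _ | _ in _].
  case: (pselect (has_sup E)) => [hE|/sup_out -> //].
  apply: (@le_trans _ _ (rdist (p 0) (q 0))); first exact: rdist_ge0.
  by apply: ub_le_sup; [exact: hE.2|exists 0 => //; rewrite /= in_itv /= lexx ler01].
apply: ge_sup; first by exists (rdist (c0 ta) (c0 (ta + 0))); exists 0 => //; rewrite /= in_itv /= lexx ler01.
by move=> _ [t tI <-]; exact: H.
Qed.
End CircleLift.

(** * The ball *)

Lemma esq_convex (R : realType) (a b : 'rV[R]_2) (t : R) : esq a < 1 -> esq b < 1 -> 0 <= t <= 1 ->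
  esq (t *: (b - a) + a) < 1.
Proof.
rewrite /esq !mxE; move: (a 0 0) (a 0 1) (b 0 0) (b 0 1) => a0 a1 b0 b1 ha hb /andP[t0 t1].
have E : (t * (b0 - a0) + a0) ^+ 2 + (t * (b1 - a1) + a1) ^+ 2 = t * (b0 ^+ 2 + b1 ^+ 2) + (1 - t) * (a0 ^+ 2 + a1 ^+ 2)
   - t * (1 - t) * ((b0 - a0) ^+ 2 + (b1 - a1) ^+ 2) by ring.
rewrite E; have h1 : 0 <= t * (1 - t) * ((b0 - a0) ^+ 2 + (b1 - a1) ^+ 2).
  by rewrite mulr_ge0 ?mulr_ge0 ?subr_ge0 // addr_ge0 // sqr_ge0.
move: (b0 ^+ 2 + b1 ^+ 2) (a0 ^+ 2 + a1 ^+ 2) hb ha h1 => B A hB hA h1.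
have h2 : t * B + (1 - t) * A < 1.
  case: (eqVneq t 0) => [->|tn]; first by rewrite mul0r add0r subr0 mul1r.
  have tp : 0 < t by rewrite lt_neqAle eq_sym tn.
  have h3 : t * B < t * 1 by rewrite ltr_pM2l.
  have h4 : (1 - t) * A <= (1 - t) * 1 by rewrite ler_wpM2l ?subr_ge0 // ltW.
  lra.
lra.
Qed.

Lemma width_squeeze (R : realType) (L d lx ly : R) : L <= d -> d <= lx / 2 + ly / 2 -> lx <= L -> ly <= L -> lx = L.
Proof. by move=> h1 h2 h3 h4; lra. Qed.

Lemma shrink_contradiction (R : realType) (L r D a b : R) : 0 < D -> r = L / 2 -> a <= r - D -> b = a -> L <= a + b -> False.
Proof. by move=> h1 h2 h3 h4 h5; lra. Qed.

Section Ball.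
Variables (R : realType) (M : riemannian_surface R).
Hypothesis mc : complete_surface M.
Variables (Om : set M) (U : set 'rV[R]_2) (f : 'rV[R]_2 -> M) (h : M -> 'rV[R]_2) (s : M -> M).
Hypothesis dc : disc_chart Om U f h.
Hypothesis si : isometric_involution Om s.
Hypothesis tc : totally_convex Om.
Hypothesis ug : forall x y : M, bdry Om x -> bdry Om y -> x <> y -> joined_by_unique_geodesic x y.
Hypothesis sb : forall x : M, bdry Om x -> s x <> x.
Hypothesis wd : width (bdry Om) = diam (bdry Om).
Notation Exp := (Exp mc).
Notation c0 := (c0 f).
Notation chord := (chord mc Om s).

Variable x0 : M.
Hypothesis Ox0 : Om x0.
Hypothesis sx0 : s x0 = x0.
Hypothesis nb0 : ~ bdry Om x0.
Hypothesis midE : forall x, bdry Om x -> mid mc Om s x = x0.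
Let L := width (bdry Om).
Let rho := L / 2.

Let ss x : Om x -> s (s x) = x. Proof. by case: si => _ + _; exact. Qed.
Let sd x y : Om x -> Om y -> rdist (s x) (s y) = rdist x y. Proof. exact: (s_dist mc si tc). Qed.
Let sbd x : bdry Om x -> bdry Om (s x). Proof. exact: (s_bdry dc si). Qed.

Lemma center_dist_half x : bdry Om x -> rdist x x0 = rdist x (s x) / 2.
Proof. by move=> bx; have [_ _ <- _] := midP mc dc si tc ug sb bx; rewrite midE. Qed.

(** Ensures that the supremum in [diam] is a genuine upper bound and not a default value. *)
Lemma bdry_dist_bounded : exists K : R, forall x, bdry Om x -> rdist x0 x <= K.
Proof.
have cd (t : R) : {for t, continuous (fun t => rdist x0 (c0 t))}.
  exact: (continuous_comp ((c0_smooth dc).1 t I) (@rdist_continuous _ _ x0 _)).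
have [t1 _ H] := EVT_max (ler01 : 0 <= 1 :> R) (within_continuous (fun t _ => cd t)).
exists (rdist x0 (c0 t1)) => x /(bdry_c0 dc) [t ->].
have /andP[n1 n2] := floor_itv t; set n := Num.floor t in n1 n2.
have e : c0 t = c0 (t - n%:~R) by have := c0_int f (t - n%:~R) n; rewrite subrK.
rewrite e; apply: H; rewrite in_itv /= subr_ge0 n1 lerBlDl /=; rewrite intrD in n2; exact: ltW.
Qed.

Lemma bdry_dist_le x y : bdry Om x -> bdry Om y -> rdist x y <= L.
Proof.
move=> bx by_; rewrite /L wd; apply: ub_le_sup; last by exists x, y.
have [K HK] := bdry_dist_bounded; exists (K + K) => _ [a [b [ba bb ->]]].
apply: le_trans (rdist_triangle a x0 b) _; rewrite rdist_sym; apply: lerD; exact: HK.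
Qed.

Lemma chord_length x : bdry Om x -> rdist x (s x) = L.
Proof.
move=> bx; have [y by_ Ly] := far_point dc bx.
have t1 := rdist_triangle x x0 y; rewrite (rdist_sym x0 y) !center_dist_half // in t1.
exact: width_squeeze Ly t1 (bdry_dist_le bx (sbd bx)) (bdry_dist_le by_ (sbd by_)).
Qed.

Lemma bdry_c0_0 : bdry Om (c0 0). Proof. exact: (c0_bdry dc). Qed.

Lemma width_gt0 : 0 < L.
Proof. by rewrite -(chord_length bdry_c0_0); exact: (len_gt0 mc sb bdry_c0_0). Qed.

Lemma radius_gt0 : 0 < rho. Proof. by rewrite divr_gt0 // width_gt0. Qed.

Lemma double_radius : rho + rho = L. Proof. by rewrite /rho -splitr. Qed.

Lemma center_dist x : bdry Om x -> rdist x0 x = rho.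
Proof. by move=> bx; rewrite rdist_sym center_dist_half // chord_length. Qed.

Let u x := velocity (chord x) rho.

Lemma chord_from_center x : bdry Om x -> [/\ pnorm x0 (u x) = 1, forall t, chord x (t + rho) = Exp x0 (u x) t,
  Exp x0 (u x) (- rho) = x & Exp x0 (u x) rho = s x].
Proof.
move=> bx; have [p1 e1 _ _] := chordP mc dc si tc ug sb bx.
set w := xget _ _ in p1; have [cg z0 v0] := ExpP mc x w.
have ce : chord x rho = x0 by have := midE bx; rewrite /mid chord_length.
have E t : chord x (t + rho) = Exp x0 (u x) t.
  by have := geodesic_ExpE mc rho t cg; rewrite -/(chord x) ce.
split=> //.
- rewrite -(Exp_speed mc x0 (u x) 0); have <- : chord x \o (fun t => 1 * t + rho) = Exp x0 (u x).
    by apply/funext => t; rewrite /= mul1r E.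
  have rc : curve_regular (chord x) (1 * 0 + rho) by exact: geodesic_regular.
  by have := speed_affine rc; rewrite normr1 mul1r => ->; rewrite Exp_speed.
- by rewrite -E addNr; exact: z0.
by rewrite -E double_radius -(chord_length bx).
Qed.

(** The point on the right has the distances to [s x] and [x] required by the metric uniqueness of
    the chord of [s x]. *)
Lemma chord_opposite x t : bdry Om x -> 0 <= t <= L -> chord (s x) t = chord x (L - t).
Proof.
move=> bx /andP[t0 tL]; have bsx := sbd bx; have Ox := bdry_Om dc bx.
have [_ _ uq _] := chordP mc dc si tc ug sb bsx; have [_ _ _ H] := chordP mc dc si tc ug sb bx.
have tI : 0 <= L - t <= rdist x (s x) by rewrite chord_length // subr_ge0 tL gerBl t0.
have [_ d1 d2'] := H _ tI.
have d2 : rdist (chord x (L - t)) (s x) = t by rewrite d2' chord_length // opprB addrC subrK.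
have d3 : rdist (s x) (chord x (L - t)) = t by rewrite rdist_sym.
have d4 : rdist (chord x (L - t)) (s (s x)) = L - t by rewrite ss // rdist_sym.
have := uq (chord x (L - t)); rewrite d3 d4 (chord_length bsx) => E.
have e : t + (L - t) = L by rewrite addrC subrK.
exact: esym (E e).
Qed.

(** The determinant of the direction [u] against [v], as a function on the boundary circle, takes
    opposite values at a point and its image under [s]; at a zero [u] is parallel to [v], and both
    are unit vectors. *)
Lemma direction_exists v : pnorm x0 v = 1 -> exists x, bdry Om x /\ (u x = v \/ u x = - v).
Proof.
move=> v1; have [r [g nr]] := normal_radius_exists mc x0.
have r0 : 0 < r by case: nr.
set i := chart_at x0; have gE w : pnorm x0 w < r -> dom i (Exp x0 w 1) /\ g (chart i (Exp x0 w 1)) = w.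
  by case: nr => _ + _ _ _; exact.
have gS : smooth ((fun w => chart i (Exp x0 w 1)) @` [set w | pnorm x0 w < r]) g by case: nr => _ _ [].
have rho0 := radius_gt0; have L0 := width_gt0.
(* The continuity known for chords concerns their points, not their velocities. The direction is
   therefore read off from the point at distance [de] past the centre, inside a normal ball. *)
pose de := Num.min (r / 2) rho.
have de0 : 0 < de by rewrite lt_min rho0 divr_gt0.
have der : de < r by apply: (@le_lt_trans _ _ (r / 2)); [rewrite ge_min lexx|rewrite ltr_pdivrMr // ltr_pMr // ltr1n].
have deL : de <= rho by rewrite ge_min lexx orbT.
(* All chords have length [L], so this fraction marks the point at distance [de] past the centre on
   each of them. *)
pose ta := (rho + de) / L.
have taL : ta * L = rho + de by rewrite /ta divfK // gt_eqF.
have ta01 : 0 <= ta <= 1.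
  by rewrite divr_ge0 ?(ltW L0) ?addr_ge0 ?(ltW rho0) ?(ltW de0) //= ler_pdivrMr // mul1r -double_radius lerD2l.
pose Q t := chord (c0 t) (rho + de).
have small (a : R) w : `|a| = de -> pnorm x0 w = 1 -> pnorm x0 (a *: w) < r by move=> ad w1; rewrite pnormZ ad w1 mulr1.
have QE t : Q t = Exp x0 (de *: u (c0 t)) 1.
  have [_ E _ _] := chord_from_center (c0_bdry dc t).
  by rewrite /Q addrC E Exp_scale mulr1.
have Qs t : pnorm x0 (de *: u (c0 t)) < r.
  by apply: small; [rewrite gtr0_norm|have [] := chord_from_center (c0_bdry dc t)].
have cQ t : {for t, continuous Q}.
  move=> A /= nA; have [e e0 He] := rdist_nbhs mc nA.
  have [d d0 Hd] := chord_continuous mc dc si tc ug sb (c0_bdry dc t) ta01 e0.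
  have cd : {for t, continuous (fun t' => rdist (c0 t) (c0 t'))}.
    exact: (continuous_comp ((c0_smooth dc).1 t I) (@rdist_continuous _ _ (c0 t) _)).
  have d2 : 0 < d / 2 by rewrite divr_gt0.
  have n : \forall t' \near t, `|rdist (c0 t) (c0 t') - rdist (c0 t) (c0 t)| <= d / 2 by exact: continuous_near_le cd d2.
  apply: filterS n => t'; rewrite rdistxx subr0 => h1; apply: He.
  have := Hd (c0 t') (c0_bdry dc t'); rewrite (chord_length (c0_bdry dc t)) (chord_length (c0_bdry dc t')) taL.
  apply; apply: le_lt_trans (ler_norm _) _; apply: le_lt_trans h1 _.
  by rewrite ltr_pdivrMr // ltr_pMr // ltr1n.
pose F t := cross (g (chart i (Q t))) v.
have cF t : {for t, continuous F}.
  have [iQ gQ] := gE _ (Qs t); rewrite -QE in iQ.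
  have cc : {for chart i (Q t), continuous g}.
    by apply: (smooth_continuous gS); exists (de *: u (c0 t)); [exact: Qs|rewrite QE].
  have c1 := continuous_comp (continuous_comp (@cQ t) (@chart_continuous _ M i _ iQ)) cc.
  have ck (k : 'I_2) : {for t, continuous (fun t => g (chart i (Q t)) 0 k : R^o)}.
    exact: (continuous_comp c1 (@coord_continuous _ _ _ 0 k _)).
  by apply: (@continuousB _ R^o); apply: (@continuousM R _); [exact: ck|exact: cst_continuous|exact: ck|exact: cst_continuous].
have FE t : F t = de * cross (u (c0 t)) v.
  by rewrite /F QE (gE _ (Qs t)).2 /cross !mxE; ring.
have [t1 t1E] := bdry_c0 dc (sbd bdry_c0_0).
(* [t1] is a parameter of the image under [s] of the base point; its chord is the same segment run
   backwards. *)
have odd : F t1 = - F 0.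
  have [p1 E _ _] := chord_from_center bdry_c0_0.
  have ns : `|- de| = de by rewrite normrN gtr0_norm.
  have Q1 : Q t1 = Exp x0 (- de *: u (c0 0)) 1.
    have dI : 0 <= rho + de <= L by rewrite addr_ge0 ?(ltW rho0) ?(ltW de0) //= -double_radius lerD2l.
    rewrite /Q -t1E (chord_opposite bdry_c0_0 dI).
    rewrite Exp_scale mulr1 -E; congr (chord _ _); rewrite -double_radius; ring.
  rewrite (FE 0) /F Q1 (gE _ (small _ _ ns p1)).2 /cross !mxE; ring.
have [t Ft] : exists t, F t = 0.
  case: (leP 0 t1) => t10.
    have [|t _ Ft] := @real_ivt R F 0 t1 0 t10 (fun t _ => @cF t); last by exists t.
    by rewrite odd; case: (leP (F 0) 0) => h0; rewrite ?oppr_ge0 ?oppr_le0 ?h0 ?(ltW h0) ?orbT.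
  have [|t _ Ft] := @real_ivt R F t1 0 0 (ltW t10) (fun t _ => @cF t); last by exists t.
  by rewrite odd; case: (leP (F 0) 0) => h0; rewrite ?oppr_ge0 ?oppr_le0 ?h0 ?(ltW h0) ?orbT.
have bt := c0_bdry dc t; exists (c0 t); split=> //.
have v0 : v != 0.
  by apply/eqP => e; have := pnormZ x0 0 v; rewrite scale0r normr0 mul0r -{1}e v1 => /eqP; rewrite oner_eq0.
move: Ft; rewrite FE => /eqP; rewrite mulf_eq0 (gt_eqF de0) /= => /eqP /(cross_eq0 v0) [l ul].
have [p1 _ _ _] := chord_from_center bt; move: p1; rewrite ul pnormZ v1 mulr1.
by case: (ger0P l) => _ e; [left; rewrite e scale1r|right; rewrite -(opprK l) e scaleN1r].
Qed.

Lemma diameters v : pnorm x0 v = 1 -> [/\ bdry Om (Exp x0 v rho), s (Exp x0 v rho) = Exp x0 v (- rho) &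
  rdist (Exp x0 v (- rho)) (Exp x0 v rho) = 2 * rho].
Proof.
move=> /direction_exists [x [bx uv]]; have [_ _ e1 e2] := chord_from_center bx.
have Ox := bdry_Om dc bx; have l2 : 2 * rho = L by rewrite mulr2n mulrDl mul1r double_radius.
case: uv => uv; rewrite uv in e1 e2.
  by rewrite e1 e2 ss // chord_length // l2; split=> //; exact: sbd.
have neg t : Exp x0 (- v) t = Exp x0 v (- t) by rewrite -scaleN1r Exp_scale mulN1r.
rewrite neg opprK in e1; rewrite neg in e2.
by rewrite e1 e2 rdist_sym chord_length // l2.
Qed.

Lemma radial_direction v : v != 0 -> exists2 w, pnorm x0 w = 1 & forall t, Exp x0 v t = Exp x0 w (pnorm x0 v * t).
Proof.
move=> v0; have n0 : pnorm x0 v != 0 by apply: contraNneq v0 => /pnorm_eq0 ->.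
have p0 : 0 <= pnorm x0 v by exact: nrm_ge0.
exists ((pnorm x0 v)^-1 *: v) => [|t]; first by rewrite pnormZ ger0_norm ?invr_ge0 // mulVf.
by rewrite Exp_scale mulrA mulVf // mul1r.
Qed.

(** Every point at distance exactly [rho] from the centre is a boundary point. An interior point
    farther away could be joined to the centre by a segment of disc coordinates inside the open
    disc, which would meet that distance. *)
Lemma Om_radius q : Om q -> rdist x0 q <= rho.
Proof.
move=> Oq; case: (pselect (bdry Om q)) => [bq|nbq]; first by rewrite center_dist.
have [e1 U1 f1] := disc_inv dc Oq; have [e0 U0 f0] := disc_inv dc Ox0.
have lt1 y : Om y -> ~ bdry Om y -> esq (h y) <= 1 -> esq (h y) < 1.
  by move=> Oy nb le; rewrite lt_neqAle le andbT; apply/eqP => e; apply/nb/(bdry_esq dc Oy).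
have h1 := lt1 q Oq nbq e1; have h0 := lt1 x0 Ox0 nb0 e0.
rewrite leNgt; apply/negP => far.
pose seg (t : R) := t *: (h q - h x0) + h x0.
have segE (t : R) : 0 <= t <= 1 -> esq (seg t) < 1 by exact: esq_convex.
have DU := let: And4 _ _ DU _ := dc in DU.
have hf := let: And4 _ hf _ _ := dc in hf.
have cD (t : R) : 0 <= t <= 1 -> {for t, continuous (fun t => rdist x0 (f (seg t)))}.
  move=> t01; have cs : {for t, continuous seg}.
    have d := is_deriveD (is_derive_scalel (h q - h x0) t) (is_derive_cst (h x0) t (1 : R)).
    exact: is_derive_continuous d.
  have Ut : U (seg t) by apply: DU; exact: ltW (segE t t01).
  exact: (continuous_comp (continuous_comp cs (disc_continuous dc Ut)) (@rdist_continuous _ _ x0 _)).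
have [|t t01 Dt] := @real_ivt R (fun t => rdist x0 (f (seg t))) 0 1 rho ler01 cD.
  by rewrite /seg scale0r add0r scale1r subrK f0 f1 rdistxx (ltW radius_gt0) (ltW far).
have [v [vn vE]] := minimizing_geodesic mc x0 (f (seg t)); rewrite Dt in vn.
have v0 : v != 0.
  apply/eqP => e; have := pnormZ x0 0 v; rewrite scale0r normr0 mul0r -{1}e vn => e'.
  by have := radius_gt0; rewrite e' ltxx.
have [w w1 wE] := radial_direction v0; have [bw _ _] := diameters w1.
move: vE; rewrite wE vn mulr1 => fE; rewrite fE in bw.
have := (bdry_esq dc (bdry_Om dc bw)).1 bw; rewrite hf; last by apply: DU; exact: ltW (segE t t01).
by move=> e; have := segE t t01; rewrite e ltxx.
Qed.

(** One inclusion is [Om_radius] with a minimizing geodesic; the other is total convexity applied to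
    radii, whose outer ends are boundary points. *)
Lemma Om_ball : Om = geodesic_ball x0 rho.
Proof.
apply/seteqP; split=> [q Oq|_ [v vr <-]].
  have [v [vn vE]] := minimizing_geodesic mc x0 q; exists v; last by rewrite (exp_mapE mc).
  have : pnorm x0 v <= rho by rewrite vn; exact: Om_radius.
  exact.
have vr' : pnorm x0 v <= rho := vr.
rewrite (exp_mapE mc); case: (eqVneq v 0) => [->|v0]; first by rewrite Exp0.
have [w w1 wE] := radial_direction v0; have [bw _ _] := diameters w1; rewrite wE mulr1.
have [cg z0 _] := ExpP mc x0 (rho *: w).
have end1 : Exp x0 (rho *: w) 1 = Exp x0 w rho by rewrite Exp_scale mulr1.
have rho0 := radius_gt0; have p0 : 0 <= pnorm x0 v by exact: nrm_ge0.
have tI : 0 <= pnorm x0 v / rho <= 1 by rewrite divr_ge0 ?(ltW rho0) //= ler_pdivrMr // mul1r.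
have := Om_geodesic tc Ox0 (bdry_Om dc bw) cg z0 end1 tI.
by rewrite Exp_scale mulrC divfK // gt_eqF.
Qed.

(** A fixed point is equidistant from the two ends of the diameter through it, which [s] exchanges.
    Off the centre it would be closer than [rho] to one end, hence to both, and the diameter would
    not be minimizing. *)
Lemma fixed_point_unique y : Om y -> s y = y -> y = x0.
Proof.
move=> Oy sy; apply: contrapT => yx; have D0 : 0 < rdist x0 y.
  rewrite lt_neqAle rdist_ge0 andbT eq_sym; apply/eqP => /(rdist_eq0 mc) e; exact: yx (esym e).
have xy : x0 <> y by move=> e; exact: yx (esym e).
have [w w1 wy] := unit_minimizer mc xy; have [bw sw dw] := diameters w1.
have Ow := bdry_Om dc bw.
have d1 := rdist_Exp mc x0 w (rdist x0 y) rho; rewrite w1 mul1r wy ger0_norm ?subr_ge0 ?Om_radius // in d1.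
have d2 := sd Oy Ow; rewrite sy sw in d2.
have d3 := rdist_triangle (Exp x0 w (- rho)) y (Exp x0 w rho); rewrite dw (rdist_sym _ y) addrC in d3.
by apply: (shrink_contradiction D0 (erefl rho) d1 d2); rewrite -double_radius -mulr2n mulr_natl in d3 *.
Qed.

Lemma radius_le_injectivity : (rho%:E <= injectivity_radius x0)%E.
Proof. by apply: (@injectivity_radius_ge _ _ mc x0 rho radius_gt0) => v /diameters []. Qed.
End Ball.

Theorem theoremF (R : realType) (M : riemannian_surface R)
    (Omega : set M) (s : M -> M)
    (M_complete : complete_surface M)
    (Omega_disc : smooth_disc Omega)
    (Omega_convex : totally_convex Omega)
    (unique_geodesics : forall x y : M, bdry Omega x -> bdry Omega y ->
       x <> y -> joined_by_unique_geodesic x y)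
    (s_involution : isometric_involution Omega s)
    (s_boundary : forall x : M, bdry Omega x -> s x <> x)
    (width_diam : width (bdry Omega) = diam (bdry Omega)) :
  exists x0 : M,
    [/\ Omega x0 /\ s x0 = x0,
        forall y : M, Omega y -> s y = y -> y = x0,
        ((width (bdry Omega) / 2)%:E <= injectivity_radius x0)%E &
        Omega = geodesic_ball x0 (width (bdry Omega) / 2)].
Proof.
have [U [f [h dc]]] := smooth_disc_chart Omega_disc.
have [x0 [Ox0 sx0 nb0 midE]] := center_exists M_complete dc s_involution Omega_convex unique_geodesics s_boundary.
exists x0; split=> //.
- by move=> y Oy sy; eapply fixed_point_unique; eassumption.
- by eapply radius_le_injectivity; eassumption.
by eapply Om_ball; eassumption.
Qed.
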